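(* Let $\pi$, $(d_n)$ and $M$ be as in the context. Let $r\ge1$ be an integer and $p\in\mathcal I_{\pi,r}(M)$, and let $\mu(p)\in\mathcal I_\pi(M)$ be the unique $r$-Markov process whose marginal on $S_r$ is $p$. If for all couplings $q\in\mathcal I_{\pi,r}(M^2)$ of $p$ and $p$ we have $\Sigma(q)\le2\Sigma(p)$, then $$\underline h(\mu(p))=\bar h(\mu(p))=\Sigma(p)$$ and $\mu(p)$ is strongly typical.
   Context: **Random labeling and topology.** $M$ is a finite set. Let $\mathbb N=\{1,2,\dots\}$ and $\mathbb N^f=\bigcup_{k\ge0}\mathbb N^k$ with $\mathbb N^0=\{o\}$. A rooted $M$-colored graph $(G,f,v)$ is a connected graph $G$ with a map $f$ from its vertices to $M$ and a distinguished vertex $v$. If $G$ is locally finite, its randomly labeled version is the isomorphic random rooted colored graph on a subset of $\mathbb N^f$ given by the breadth-first search from the root with ties broken uniformly at random: the root gets label $o$, and the $j$-th offspring of the vertex labeled $(i_1,\dots,i_{k-1})$ gets label $(i_1,\dots,i_{k-1},j)$. A random rooted colored graph on a subset of $\mathbb N^f$ is called randomly labeled if its law equals that of its randomly labeled version. $\mathcal G^\bullet_M$ is the set of rooted colored graphs arising as such labelings, with metric $\sum_{r\ge0}2^{-r}\mathbf 1_{g_r\ne g'_r}$, where $g_r$ is the restriction of $g$ to vertices at distance at most $r$ from the root. Fix a distance $\mathrm d$ on $\mathcal P(\mathcal G^\bullet_M)$ (probability measures) generating the weak topology (e.g. Lévy–Prohorov). For $\nu\in\mathcal P(\mathcal G^\bullet_M)$,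 $\nu_r$ is the law of the restriction to vertices at distance at most $r$ from the root. For a finite graph $G$ with vertex set $V$ and $f:V\to M$, $\mathrm{distr}_G(f)=\frac1{|V|}\sum_{v\in V}\mathrm{distr}_{G,v}(f)$, where $\mathrm{distr}_{G,v}(f)$ is the law of the randomly labeled version of the connected component of $v$ in $(G,f)$, rooted at $v$. **Trees and invariant processes.** $\pi$ is a probability measure on the non-negative integers with mean $d=\sum_k k\pi(k)\in(0,\infty)$, and $\hat\pi(k)=(k+1)\pi(k+1)/d$. $\mathrm{UGW}(\pi)$ is the law of the Galton–Watson tree $(T,o)$ (on a subset of $\mathbb N^f$) in which the root $o$ has a number of offspring of law $\pi$ and all other vertices have independent numbers of offspring of law $\hat\pi$. A random rooted colored graph $(G,f,o)$ is unimodular if $\mathbb E\sum_vF(G,f,o,v)=\mathbb E\sum_vF(G,f,v,o)$ for all non-negative isomorphism-invariant functions $F$ of colored graphs with two ordered distinguished vertices. $\mathcal I_\pi(M)$ is the set of laws of randomly labeled rooted colored trees $(T,X)$ with $T\sim\mathrm{UGW}(\pi)$, $X$ a random coloring of the vertices of $T$ by $M$, and $(T,X,o)$ unimodular. **Edge-biased law and Markov processes.** $B_r(S)$ is the set of vertices at distance at most $r$ from $S$ in the tree; $S_r=B_r(o)$ and, if $\deg(o)\ge1$, $E_r=B_{r-1}(\{o,1\})$ ($r\ge1$). For a law $\mu$ of a randomly labeled rooted colored tree $(T,X)$ with $\mathbb E\deg(o)=d$, let $\vec\mu(\cdot)=\frac1d\mathbb E[\deg(o)\mathbf 1((T,X,(o,1))\in\cdot)]$,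 a law on colored trees rooted at the directed edge $(o,1)$; $(\vec T,\vec X)$ denotes a random variable with law $\vec\mu$. $X_{S_r}$ denotes the colored tree $(T,X)$ restricted to $S_r$, and $\vec X_{E_r}$ the colored tree $(\vec T,\vec X)$ restricted to $E_r$. A random coloring $(T,X)$ of a random tree (or its law) is $r$-Markov if, conditioned on $T$ restricted to $B_{r-1}(e)$ and on the colors at $B_{r-1}(e)$, for $e$ an edge, the processes (colored trees) on the left and right subtrees of $e$ are independent. $\mathcal I_{\pi,r}(M)$ is the set of laws $p$ of randomly labeled colored trees $(T',X')$ with colors in $M$ such that $T'$ has law $\mathrm{UGW}(\pi)_r$ (the law of $T\sim\mathrm{UGW}(\pi)$ restricted to $S_r$) and such that the restriction to $E_r$ of the edge-biased law $\vec p$ is invariant by switching the two sides of the oriented root edge. A coupling $q\in\mathcal I_{\pi,r}(M^2)$ of $p$ and $p$ is the law of a colored tree $(T',(Y_1,Y_2))$ with $(T',Y_1)\sim p$ and $(T',Y_2)\sim p$. **Annealed entropy.** $H$ is Shannon entropy (natural logarithm) of a discrete random variable or law. For $p\in\mathcal I_{\pi,r}(M)$, $\Sigma(p)=\Sigma_r(\mu(p))=H(X_{S_r})-\frac d2H(\vec X_{E_r})-H(\pi)$, where $X_{S_r}\sim p$ and $\vec X_{E_r}$ has law the restriction of $\vec p$ to $E_r$ (this depends only on $p$; same formula with color set $M^2$ for $q$). **Sofic entropies and typicality.** $n$ runs along an infinite subset of $\mathbb N$; $d_n=(d_n(1),\dots,d_n(n))$ are sequences of non-negative integers with even sum such that $\frac1n\sum_{v=1}^n\delta_{d_n(v)}$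 converges weakly to $\pi$ and $\sup_n\max_vd_n(v)\le\Delta$ for some real $\Delta$. $\mathcal G_n(d_n)$ is the set of simple graphs on $\{1,\dots,n\}$ in which each $v$ has degree $d_n(v)$ (non-empty for $n$ large), and $G_n$ is uniform on it. For $\mu\in\mathcal I_\pi(M)$, $\epsilon>0$, $t\ge0$, set $\mathcal F_G(\mu,t,\epsilon)=\{f\in M^n:\mathrm d(\mathrm{distr}_G(f)_t,\mu_t)\le\epsilon\}$ and $H_G(\mu,t,\epsilon)=\frac1n\log|\mathcal F_G(\mu,t,\epsilon)|\in\{-\infty\}\cup[0,\infty)$. For $0<\alpha<1$, let $h_n(\mu,t,\epsilon,\alpha)=\sup\{h\in\{-\infty\}\cup[0,\infty):\mathbb P(H_{G_n}(\mu,t,\epsilon)\ge h)\ge\alpha\}$, $\bar h(\mu,t,\alpha)=\lim_{\epsilon\to0}\limsup_nh_n(\mu,t,\epsilon,\alpha)$, $\underline h(\mu,t,\alpha)=\lim_{\epsilon\to0}\liminf_nh_n(\mu,t,\epsilon,\alpha)$. These do not depend on $\alpha\in(0,1)$; the common values are $\bar h(\mu,t)$, $\underline h(\mu,t)$, and $\bar h(\mu)=\lim_{t\to\infty}\bar h(\mu,t)$, $\underline h(\mu)=\lim_{t\to\infty}\underline h(\mu,t)$. $\mu$ is strongly typical if $\lim_{\epsilon\to0}\lim_{n\to\infty}\mathbb P(\exists f\in M^n:\mathrm d(\mathrm{distr}_{G_n}(f),\mu)\le\epsilon)=1$. *)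

(* Defs.v *)
From HB Require Import structures.
From mathcomp Require Import all_boot all_order all_algebra finmap.
From mathcomp Require Import all_classical all_reals all_analysis measurable_realfun giry.
From mathcomp Require Import zify lra.
Import Order.TTheory GRing.Theory Num.Theory.
Import numFieldNormedType.Exports.

Set Implicit Arguments.
Unset Strict Implicit.
Unset Printing Implicit Defensive.

Local Open Scope classical_set_scope.
Local Open Scope ring_scope.

(* Nonempty finite types: measurable spaces of the library are pointed, and a
   rooted colored graph exists only if there is at least one color. *)
#[short(type="pFinType")]
HB.structure Definition PointedFinite := {M of Finite M & isPointed M}.
HB.saturate unit.
HB.saturate prod.


(* A simple graph on a subset of [T] with vertices colored by [M]: [col v = None]
   means that [v] is not a vertex. *)
Record cgraph (T : eqType) (M : Type) := CGraph {
  col : T -> option M;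
  adj : rel T;
  adj_sym : symmetric adj;
  adj_irr : irreflexive adj;
  adj_col : forall u v, adj u v -> col u }.

HB.instance Definition _ T M := gen_eqMixin (cgraph T M).
HB.instance Definition _ T M := gen_choiceMixin (cgraph T M).

Section cgraph_theory.
Context {T : eqType} {M : Type}.
Implicit Types g : cgraph T M.

Definition verts g : set T := [set v | col g v].

Lemma cgraph_eq g g' : col g =1 col g' -> adj g =2 adj g' -> g = g'.
Proof.
case: g g' => c a s i p [c' a' s' i' p'] /= /funext cc /funeq2P aa.
have {}aa : a = a' by apply/funext => x; apply/funext => y; rewrite aa.
by subst; congr CGraph; exact: Prop_irrelevance.
Qed.

Fact restrict_sym g (S : set T) :
  symmetric (fun u v => [&& adj g u v, u \in S & v \in S]).
Proof. by move=> u v; rewrite adj_sym [(u \in S) && _]andbC. Qed.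

Fact restrict_irr g (S : set T) :
  irreflexive (fun u v => [&& adj g u v, u \in S & v \in S]).
Proof. by move=> u; rewrite adj_irr. Qed.

Fact restrict_col g (S : set T) u v :
  [&& adj g u v, u \in S & v \in S] -> (if u \in S then col g u else None).
Proof. by case/and3P => /adj_col ? -> _. Qed.

Definition restrict g (S : set T) : cgraph T M :=
  CGraph (restrict_sym g S) (restrict_irr g S) (@restrict_col g S).

(* B_k(S) for the graph distance *)
Definition gball g (k : nat) (S : set T) : set T :=
  [set w | exists u p, [/\ S u, path (adj g) u p, last u p = w & (size p <= k)%N]].

End cgraph_theory.


(* The set N^f of finite sequences, with N shifted to start at 0: the root o is
   [::] and the j-th offspring (j >= 1) of v is [rcons v j.-1]. In particular the
   vertex labeled 1 is [:: 0]. *)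
Notation label := (seq nat).

Definition shortlex (u v : label) : bool :=
  (size u < size v)%N ||
  (size u == size v) && ((u : seqlexi nat) <= v)%O.

(* The locally finite graphs that arise as breadth-first labelings. The search
   visits vertices in shortlex order of the labels, so the parent of a non-root
   vertex is its shortlex-least neighbor, and offspring are numbered without
   gaps. Connectedness follows, every vertex being joined to its parent. *)
Definition bfs_labeled (M : Type) (g : cgraph label M) : Prop :=
  [/\ verts g [::],
      forall v j, verts g (rcons v j) ->
        adj g v (rcons v j) /\ (forall i, (i < j)%N -> verts g (rcons v i)),
      forall v j u, adj g u (rcons v j) -> shortlex v u &
      forall v, finite_set [set u | adj g v u]].

(* The space of labeled rooted colored graphs. [R] is a phantom parameter: it is
   the type of the values of the distance of the metric structure below. *)
Record lgraph (R : realType) (M : pFinType) := RGraph {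
  lgraph_val :> cgraph label M;
  lgraphP : bfs_labeled lgraph_val }.

Section lgraph_theory.
Context {R : realType} {M : pFinType}.
Implicit Types g : lgraph R M.

Lemma lgraph_eq g g' : g = g' :> cgraph label M -> g = g'.
Proof.
case: g g' => g pg [g' pg'] /= e; subst; congr RGraph; exact: Prop_irrelevance.
Qed.

Lemma vert_root g : verts g [::].
Proof. by case: (lgraphP g). Qed.

Lemma parent_adj g v j : verts g (rcons v j) -> adj g v (rcons v j).
Proof. by case: (lgraphP g) => _ h _ _ /h[]. Qed.

Lemma parent_vert g v j : verts g (rcons v j) -> verts g v.
Proof. by move/parent_adj/adj_col. Qed.

Lemma adj_size g u w : adj g u w -> (size w <= (size u).+1)%N.
Proof.
case/lastP: w => // v j /(let: And4 _ _ h _ := lgraphP g in h v j u).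
by rewrite size_rcons ltnS => /orP[/ltnW //|/andP[/eqP ->]].
Qed.

(* In a BFS labeling, the length of a label is the distance to the root *)
Lemma gball_root g k w : verts g w -> gball g k [set [::]] w <-> (size w <= k)%N.
Proof.
move=> gw; split.
  case=> u [p [/= -> + <-]].
  suff h : forall q x, path (adj g) x q -> (size (last x q) <= size x + size q)%N.
    by move=> /h /=; exact: leq_trans.
  elim=> [|y q ih] x /=; first by rewrite addn0.
  move=> /andP[/adj_size xy /ih h]; apply: leq_trans h _.
  by rewrite addnS -addSn leq_add2r.
elim/last_ind: w k gw => [|w j ih] k gw.
  by exists [::], [::].
rewrite size_rcons; case: k => // k; rewrite ltnS => wk.
have [u [p [u0 up lp sp]]] := ih k (parent_vert gw) wk.
exists u, (rcons p (rcons w j)); split => //.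
- by rewrite rcons_path up lp parent_adj.
- by rewrite last_rcons.
- by rewrite size_rcons.
Qed.

Fact restr_subproof (r : nat) g :
  bfs_labeled (restrict g (gball g r [set [::]])).
Proof.
set S := gball _ _ _.
have S0 : S [::] by exists [::], [::].
have vE v : verts (restrict g S) v <-> verts g v /\ (size v <= r)%N.
  rewrite /verts/=; case: ifPn => [/set_mem vS|/negP vS].
    split=> [gv|[]//]; split=> //.
    exact/(gball_root _ gv).
  by split=> // -[gv sv]; case: vS; rewrite inE; apply/gball_root.
split.
- by apply/vE; split=> //; exact: vert_root.
- move=> v j /vE[gvj svj]; rewrite size_rcons in svj.
  have [gv0 gv1] : adj g v (rcons v j) /\ forall i, (i < j)%N -> verts g (rcons v i).
    by case: (lgraphP g) => _ h _ _; exact: h.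
  split.
    rewrite /= gv0 /=; apply/andP; split; rewrite inE.
      by apply/gball_root; [exact: parent_vert gvj|lia].
    by apply/gball_root; rewrite ?size_rcons.
  by move=> i ij; apply/vE; rewrite size_rcons; split=> //; exact: gv1.
- by move=> v j u /and3P[h _ _]; case: (lgraphP g) => _ _ + _; apply; exact: h.
- move=> v; case: (lgraphP g) => _ _ _ /(_ v); apply: sub_finite_set.
  by move=> u /= /and3P[].
Qed.

Definition restr (r : nat) g : lgraph R M := @RGraph R M _ (restr_subproof r g).

Lemma restr_col r g v : col (restr r g) v = if (size v <= r)%N then col g v else None.
Proof.
rewrite /=; case E : (col g v) => [c|]; last by case: ifP; case: ifP.
have gv : verts g v by rewrite /verts/= E.
case: ifPn => [/set_mem/(gball_root _ gv) ->//|/negP vS].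
by case: ifPn => // vr; case: vS; rewrite inE; apply/gball_root.
Qed.

Lemma restr_adj r g u v :
  adj (restr r g) u v = [&& adj g u v, (size u <= r)%N & (size v <= r)%N].
Proof.
rewrite /=; case E : (adj g u v) => //=.
have gu : verts g u by exact: adj_col E.
have gv : verts g v by apply: (@adj_col _ _ g v u); rewrite adj_sym E.
by congr andb; apply/idP/idP; rewrite inE => /gball_root; exact.
Qed.

Lemma restr_inj g g' : (forall r, restr r g = restr r g') -> g = g'.
Proof.
move=> gg'; apply/lgraph_eq/cgraph_eq => [v|u v].
  by have := restr_col (size v) g v; rewrite gg' restr_col leqnn.
have := restr_adj (maxn (size u) (size v)) g u v.
by rewrite gg' restr_adj leq_maxl leq_maxr !andbT.
Qed.

End lgraph_theory.

HB.instance Definition _ R M := gen_eqMixin (lgraph R M).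
HB.instance Definition _ R M := gen_choiceMixin (lgraph R M).

Section lgraph_point.
Context {R : realType} {M : pFinType}.

Fact point_col (u v : label) :
  (fun _ _ : label => false) u v -> (if u is [::] then Some (point : M) else None).
Proof. by []. Qed.

Definition cpoint : cgraph label M :=
  @CGraph label M _ (fun _ _ => false) (fun _ _ => erefl) (fun _ => erefl) point_col.

Fact cpointP : bfs_labeled cpoint.
Proof.
split=> //.
- by move=> v j; rewrite /verts/=; case: v.
- move=> v; rewrite (_ : [set _ | _] = set0)//.
  by apply/seteqP; split.
Qed.

HB.instance Definition _ := isPointed.Build (lgraph R M) (@RGraph R M _ cpointP).

End lgraph_point.

Section lgraph_metric.
Context {R : realType} {M : pFinType}.
Implicit Types g : lgraph R M.

Definition gterm g g' (r : nat) : R := (restr r g != restr r g')%:R / 2 ^+ r.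

Definition gdist g g' : R := limn (series (gterm g g')).

Lemma gterm_ge0 g g' r : 0 <= gterm g g' r.
Proof. by rewrite /gterm divr_ge0// exprn_ge0. Qed.

Lemma is_cvg_gdist g g' : cvgn (series (gterm g g')).
Proof.
apply: (@series_le_cvg R _ (geometric 1 2^-1)).
- exact: gterm_ge0.
- by move=> n; rewrite /= mulr_ge0// exprn_ge0// invr_ge0.
- move=> n; rewrite /gterm /= exprVn mul1r ler_piMl ?invr_ge0 ?exprn_ge0//.
  by case: (_ != _); rewrite ?ler01 ?lexx.
- by apply: is_cvg_geometric_series; rewrite ger0_norm ?invr_ge0// invf_lt1 ?ltr1n.
Qed.

Lemma gterm_le_gdist g g' r : gterm g g' r <= gdist g g'.
Proof.
have h : nondecreasing_seq (series (gterm g g')).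
  by apply: nondecreasing_series => n _ _; exact: gterm_ge0.
rewrite /gdist.
apply: le_trans (nondecreasing_cvgn_le h (@is_cvg_gdist g g') r.+1).
by rewrite seriesSr lerDr sumr_ge0// => i _; exact: gterm_ge0.
Qed.

Fact gdistxx g : gdist g g = 0.
Proof.
rewrite /gdist (_ : series _ = fun=> 0) ?lim_cst//.
by apply/funext => n; rewrite /series/= big1// => i _; rewrite /gterm eqxx mul0r.
Qed.

Lemma gdist_lt_restr g g' r : gdist g g' < (2 ^+ r)^-1 -> restr r g = restr r g'.
Proof.
move=> /(le_lt_trans (gterm_le_gdist g g' r)); rewrite /gterm.
by case: eqP => // _; rewrite mul1r ltxx.
Qed.

Fact gdist_eq0 g g' : gdist g g' = 0 -> g = g'.
Proof.
by move=> d0; apply: restr_inj => r; apply: gdist_lt_restr; rewrite d0 invr_gt0 exprn_gt0.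
Qed.

Fact gdist_sym g g' : gdist g g' = gdist g' g.
Proof.
rewrite /gdist; congr (limn (series _)); apply/funext => r.
by rewrite /gterm eq_sym.
Qed.

Fact gdist_triangle g' g g'' : gdist g g'' <= gdist g g' + gdist g' g''.
Proof.
rewrite /gdist -lim_seriesD; [|exact: is_cvg_gdist..].
apply: lim_series_le; first exact: is_cvg_gdist.
  by apply: is_cvg_seriesD; exact: is_cvg_gdist.
move=> r; rewrite -[leRHS]/(gterm g g' r + gterm g' g'' r) /gterm -mulrDl.
rewrite ler_wpM2r ?invr_ge0 ?exprn_ge0//.
have : (restr r g != restr r g'') ==> (restr r g != restr r g') || (restr r g' != restr r g'').
  by apply/implyP; apply: contraNT; rewrite negb_or !negbK => /andP[/eqP -> /eqP ->].
by move: (restr r g != restr r g'') (restr r g != restr r g') (restr r g' != restr r g'') => [] [] [] //= _; rewrite ?addr0 ?add0r ?lerDl ?addr_ge0.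
Qed.

HB.instance Definition _ := @isMetric.Build R (lgraph R M) gdist
  gdistxx gdist_eq0 gdist_sym gdist_triangle.

(* Borel sigma-algebra *)
Definition lgraph_open : set (set (lgraph R M)) := open.

HB.instance Definition _ :=
  @isMeasurable.Build (sigma_display lgraph_open) (lgraph R M) <<s lgraph_open >>
  (@sigma_algebra0 _ setT _) (@sigma_algebraC _ _) (@sigma_algebra_bigcup _ setT _).

End lgraph_metric.

Lemma lgraph_measurable (R : realType) (M M' : pFinType)
    (f : lgraph R M -> lgraph R M') :
  (forall r g g', restr r g = restr r g' -> restr r (f g) = restr r (f g')) ->
  measurable_fun setT f.
Proof.
move=> hf; apply: (@measurability _ _ _ _ _ _ lgraph_open) => //.
move=> _ [U oU <-]; rewrite setTI; apply: sub_sigma_algebra.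
have le_gdist g g' : gdist (f g) (f g') <= gdist g g'.
  apply: lim_series_le; [exact: is_cvg_gdist..|move=> r].
  rewrite /gterm ler_wpM2r ?invr_ge0 ?exprn_ge0// ler_nat.
  case: (eqVneq (restr r (f g)) _) => // ne; case: eqVneq => // /hf e.
  by rewrite e eqxx in ne.
rewrite /lgraph_open /= openE => g /= Ufg.
move: oU; rewrite /lgraph_open openE => /(_ _ Ufg).
rewrite /interior -!nbhs_ballE => -[e /= e0 eU].
exists e => // g'; rewrite ballEmdist /= => gg'.
by apply: eU; rewrite ballEmdist /=; exact: le_lt_trans (le_gdist g g') gg'.
Qed.

Section lgraph_restr.
Context {R : realType} {M : pFinType} (s : nat).

Fact measurable_restr : measurable_fun setT (@restr R M s).
Proof.
apply: lgraph_measurable => r g g' gg'; apply/lgraph_eq/cgraph_eq => [v|u v].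
  by have := restr_col r g v; rewrite gg' !restr_col; case: ifP => // _ ->.
have := restr_adj r g u v; rewrite gg' !restr_adj.
by case: (_ <= r)%N; rewrite ?andbF//; case: (_ <= r)%N; rewrite ?andbF ?andbT// => ->.
Qed.

HB.instance Definition _ :=
  isMeasurableFun.Build _ _ _ _ (@restr R M s) measurable_restr.

End lgraph_restr.

Section recolor.
Context {M M' : Type} (h : M -> M').

Fact crecolor_col (T : eqType) (g : cgraph T M) u v :
  adj g u v -> omap h (col g u).
Proof. by move/adj_col; case: (col g u). Qed.

Definition crecolor (T : eqType) (g : cgraph T M) : cgraph T M' :=
  CGraph (@adj_sym _ _ g) (@adj_irr _ _ g) (@crecolor_col _ g).

Fact crecolor_subproof (g : cgraph label M) :
  bfs_labeled g -> bfs_labeled (crecolor g).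
Proof.
have vE v : verts (crecolor g) v = verts g v.
  by rewrite /verts/=; case: (col g v).
case=> g0 g1 g2 g3; split=> //.
- by rewrite vE.
- by move=> v j; rewrite vE => /g1[? h1]; split=> // i /h1; rewrite vE.
Qed.

End recolor.

Section lgraph_recolor.
Context {R : realType} {M M' : pFinType} (h : M -> M').

Definition recolor (g : lgraph R M) : lgraph R M' :=
  @RGraph R M' _ (crecolor_subproof h (lgraphP g)).

Fact measurable_recolor : measurable_fun setT recolor.
Proof.
apply: lgraph_measurable => r g g' gg'; apply/lgraph_eq/cgraph_eq => [v|u v].
  have := restr_col r g v; rewrite gg' !restr_col /=.
  by case: ifP => // _ ->.
by have := restr_adj r g u v; rewrite gg' !restr_adj.
Qed.

HB.instance Definition _ :=
  isMeasurableFun.Build _ _ _ _ recolor measurable_recolor.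

End lgraph_recolor.

Section bfs.
Context {T : eqType} {M : Type}.
Variables (g : cgraph T M) (s : seq T).
Implicit Types (don queue : seq (label * T)) (lx : label * T).

(* Breadth-first search of [g] in which ties are broken by the order of the list
   [s] of vertices. When [s] is uniform among the orderings of the vertices, the
   successive sets of offspring are in independent uniform orders. *)
Definition offspring (seen : seq T) (x : T) : seq T :=
  undup [seq y <- s | adj g x y & y \notin seen].

Definition labeled_offspring (seen : seq T) lx : seq (label * T) :=
  let ys := offspring seen lx.2 in
  zip [seq rcons lx.1 j | j <- iota 0 (size ys)] ys.

Fixpoint bfs_run (fuel : nat) don queue : seq (label * T) :=
  match fuel, queue with
  | k.+1, lx :: queue' =>
      bfs_run k (rcons don lx)
        (queue' ++ labeled_offspring [seq z.2 | z <- don ++ queue] lx)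
  | _, _ => don ++ queue
  end.

Definition bfs_trace (v : T) : seq (label * T) :=
  bfs_run (size s).+1 [::] [:: ([::], v)].

Definition lookup (d : seq (label * T)) (l : label) : option T :=
  ohead [seq z.2 | z <- d & z.1 == l].

(* The graph induced by [g] on the labels attributed by the search [d] *)
Definition pull_col d l := obind (col g) (lookup d l).
Definition pull_adj d : rel label := fun l l' =>
  if (lookup d l, lookup d l') is (Some x, Some y) then adj g x y else false.

Fact pull_sym d : symmetric (pull_adj d).
Proof.
move=> l l'; rewrite /pull_adj.
by case: (lookup d l) (lookup d l') => [x|] [y|] //; rewrite adj_sym.
Qed.

Fact pull_irr d : irreflexive (pull_adj d).
Proof. by move=> l; rewrite /pull_adj; case: (lookup d l) => // x; rewrite adj_irr. Qed.

Fact pull_adj_col d l l' : pull_adj d l l' -> pull_col d l.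
Proof.
rewrite /pull_adj /pull_col.
by case: (lookup d l) (lookup d l') => [x|] [y|] //= /adj_col.
Qed.

Definition pull d : cgraph label M :=
  CGraph (@pull_sym d) (@pull_irr d) (@pull_adj_col d).

Let slt (u v : label) : bool :=
  (size u < size v)%N || (size u == size v) && ((u : seqlexi nat) < v)%O.

Let slt_rcons u v i j : slt u v -> slt (rcons u i) (rcons v j).
Proof.
rewrite /slt !size_rcons ltnS eqSS => /orP[->//|/andP[/eqP uv ltuv]].
apply/orP; right; rewrite uv eqxx /=.
elim: u v uv ltuv => [|x u ih] [|y v]//= [uv].
rewrite !Order.SeqLexiOrder.ltxi_cons => /andP[-> /=].
by move/implyP => h; apply/implyP => /h; exact: ih.
Qed.

Let slt_rcons2 l (i j : nat) : (i < j)%N -> slt (rcons l i) (rcons l j).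
Proof.
move=> ij; rewrite /slt !size_rcons eqxx ltnn /=.
elim: l => [|x l ih] /=; rewrite Order.SeqLexiOrder.ltxi_cons.
  by rewrite leEnat ltnW //= leqNgt ij.
by rewrite lexx.
Qed.

Let sltW u v : slt u v -> shortlex u v.
Proof. by rewrite /slt /shortlex => /orP[->//|/andP[-> /ltW ->]]; rewrite orbT. Qed.

Let shortlexxx u : shortlex u u.
Proof. by rewrite /shortlex eqxx lexx orbT. Qed.

Let sltxx u : slt u u = false.
Proof. by rewrite /slt ltnn ltxx andbF. Qed.

Let slt_rconsr l j : slt l (rcons l j).
Proof. by rewrite /slt size_rcons ltnSn. Qed.

Let slt0 l j : slt [::] (rcons l j).
Proof. by rewrite /slt size_rcons. Qed.

Let slt_trans : transitive slt.
Proof.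
move=> v u w; rewrite /slt.
case/orP => [uv|/andP[/eqP uv luv]]; case/orP => [vw|/andP[/eqP vw lvw]].
- by rewrite (ltn_trans uv vw).
- by rewrite -vw uv.
- by rewrite uv vw.
- by rewrite uv vw eqxx (lt_trans luv lvw) orbT.
Qed.

Let parent_spec (v : T) don d (z : label * T) : Prop :=
  z = ([::], v) \/
  exists l j x, [/\ z.1 = rcons l j, (l, x) \in don, adj g x z.2,
    (forall l' x', (l', x') \in d -> adj g x' z.2 -> shortlex l l') &
    (forall i, (i < j)%N -> rcons l i \in map fst d)].

Let inv v don queue : Prop :=
  let d := don ++ queue in
  [/\ pairwise slt (map fst d),
      ([::], v) \in d,
      {in d, forall z, parent_spec v don d z} &
      forall l x y, (l, x) \in don -> y \in s -> adj g x y -> y \in map snd d].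

Let inv_step v don lx q : inv v don (lx :: q) ->
  inv v (rcons don lx) (q ++ labeled_offspring (map snd (don ++ lx :: q)) lx).
Proof.
case: lx => li xi; set d := don ++ _; set new := labeled_offspring _ _.
have d'E : rcons don (li, xi) ++ q ++ new = d ++ new by rewrite cat_rcons /d -catA.
rewrite /inv d'E -/d; case=> d1 d2 d3 d4.
set ys := offspring (map snd d) xi.
have newE : new = zip [seq rcons li j | j <- iota 0 (size ys)] ys by [].
have new1 : map fst new = [seq rcons li j | j <- iota 0 (size ys)].
  by rewrite newE -/unzip1 unzip1_zip// size_map size_iota.
have new2 : map snd new = ys.
  by rewrite newE -/unzip2 unzip2_zip// size_map size_iota.
have newP z : z \in new -> exists2 j, z.1 = rcons li j & z.2 \in ys /\
     (forall i, (i < j)%N -> rcons li i \in map fst new).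
  move=> zn; have : z.1 \in map fst new by exact: map_f.
  rewrite new1 => /mapP[j]; rewrite mem_iota add0n => /= jy zj.
  exists j => //; split; first by rewrite -new2; exact: map_f.
  by move=> i ij; apply: map_f; rewrite mem_iota add0n (leq_trans ij) // ltnW.
have dlt : forall l x, (l, x) \in don -> slt l li.
  move=> l x lx; move: d1; rewrite /d map_cat pairwise_cat => /and3P[/allrelP h _ _].
  by apply: h; [exact: (map_f fst lx)|rewrite /= mem_head].
have qgt : forall l x, (l, x) \in q -> slt li l.
  move=> l x lx; move: d1; rewrite /d map_cat pairwise_cat /= => /and4P[_ _ /allP h _].
  by apply: h; exact: (map_f fst lx).
have dnew : forall z z', z \in d -> z' \in new -> slt z.1 z'.1.
  move=> z z' zd /newP[j -> _]; case: (d3 _ zd) => [->//|[l [k [x [-> lx _ _ _]]]]].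
  exact/slt_rcons/dlt/lx.
split.
- rewrite map_cat pairwise_cat d1 /=; apply/andP; split.
    by apply/allrelP => _ _ /mapP[z zd ->] /mapP[z' zn ->]; exact: dnew.
  rewrite new1 pairwise_map.
  have : pairwise ltn (iota 0 (size ys)).
    by rewrite -sorted_pairwise ?iota_ltn_sorted//; exact: ltn_trans.
  by apply: sub_pairwise => i j; exact: slt_rcons2.
- by rewrite mem_cat d2.
- move=> z; rewrite mem_cat => /orP[zd|zn].
    case: (d3 _ zd) => [->|[l [k [x [zl lx xz h1 h2]]]]]; first by left.
    right; exists l, k, x; split => //.
    + by rewrite mem_rcons inE lx orbT.
    + move=> l' x'; rewrite mem_cat => /orP[|l'n _]; first exact: h1.
      by apply: sltW; apply: (dnew (l, x) (l', x')); rewrite // /d mem_cat lx.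
    + by move=> i /h2 hi; rewrite map_cat mem_cat hi.
  case: (newP _ zn) => j zj [zy hj]; right; exists li, j, xi.
  move: zy; rewrite mem_undup mem_filter => /andP[/andP[xz zd] zs].
  split => //.
  + by rewrite mem_rcons mem_head.
  + move=> l' x'; rewrite mem_cat /d mem_cat inE => /orP[/orP[l'd|]|].
    * move=> x'z; move: zd; rewrite -/d => /negP[].
      exact: d4 l'd zs x'z.
    * by case/orP => [/eqP[-> _]//|/qgt/sltW].
    * by move=> /newP[k /= -> _] _; exact/sltW/slt_rconsr.
  + by move=> i /hj hi; rewrite map_cat mem_cat hi orbT.
- move=> l x y; rewrite mem_rcons inE map_cat mem_cat => /orP[/eqP[_ ->]|lx] ys' xy.
    case: (boolP (y \in map snd d)) => //= yd.
    by rewrite new2 mem_undup mem_filter xy yd.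
  by rewrite (d4 _ _ _ lx ys' xy).
Qed.

Let inv_run v k don queue : inv v don queue ->
  exists don' queue', bfs_run k don queue = don' ++ queue' /\ inv v don' queue'.
Proof.
elim: k don queue => [|k ih] don [|lx q] //= h; try by exists don; eexists; split; [|exact: h].
exact/ih/inv_step.
Qed.

Fact bfs_subproof v : verts g v -> bfs_labeled (pull (bfs_trace v)).
Proof.
move=> gv; rewrite /bfs_trace.
have : inv v [::] [:: ([::], v)].
  by split=> //; rewrite ?mem_head // => z; rewrite inE => /eqP ->; left.
case/(inv_run (size s).+1) => don [queue [-> ]]; rewrite /inv.
set d := don ++ queue; case=> d1 d2 d3 _.
have lk l x : (l, x) \in d -> lookup d l = Some x.
  move: d1; rewrite /lookup; elim: (d) => [|[l1 x1] d' ih]//= /andP[/allP h hd'].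
  rewrite inE => /orP[/eqP[-> ->]|lxd]; first by rewrite eqxx.
  case: eqP => [e|_]; last exact: ih.
  by have := h _ (map_f fst lxd); rewrite e sltxx.
have lk' l x : lookup d l = Some x -> (l, x) \in d.
  rewrite /lookup; elim: (d) => [|[l1 x1] d' ih]//=; rewrite inE.
  case: eqP => [<- [->]|_ /ih ->]; by rewrite ?eqxx ?orbT.
have lkv l x : (l, x) \in d -> verts g x.
  move/d3 => [[_ ->]//|[l' [j [x' [_ _ + _ _]]]]].
  by rewrite adj_sym => /adj_col.
have vP l : verts (pull d) l <-> exists x, (l, x) \in d.
  rewrite /verts/= /pull_col; split => [|[x lx]].
    by case e : (lookup d l) => [x|]//= _; exists x; exact: lk'.
  by rewrite (lk _ _ lx)/=; exact: lkv lx.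
have vm l : l \in map fst d -> verts (pull d) l.
  by move=> /mapP[[l' x] lx ->]; apply/vP; exists x.
have ddon z : z \in don -> z \in d by rewrite /d mem_cat => ->.
split.
- by apply/vP; exists v.
- move=> l j /vP[y ljy]; case: (d3 _ ljy) => [[]|[l' [j' [x [/= e lx xy _ h]]]]].
    by move/(congr1 size); rewrite size_rcons.
  case: (rcons_inj e) => el ej; subst l' j'.
  split; last by move=> i /h/vm.
  by rewrite /= /pull_adj (lk _ _ (ddon _ lx)) (lk _ _ ljy).
- move=> l j u; rewrite /= /pull_adj.
  case e1 : (lookup d u) => [x'|]//; case e2 : (lookup d _) => [y|]// x'y.
  case: (d3 _ (lk' _ _ e2)) => [[]|[l' [j' [x [/= e _ _ h _]]]]].
    by move/(congr1 size); rewrite size_rcons.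
  by case: (rcons_inj e) => -> _; exact: h (lk' _ _ e1) x'y.
- move=> l; apply: (@sub_finite_set _ _ [set` map fst d]); last exact: finite_seq.
  move=> u /=; rewrite /pull_adj; case: (lookup d l) => [x|]//.
  case e : (lookup d u) => [y|]// _; exact: (map_f fst (lk' _ _ e)).
Qed.
End bfs.

Definition bfs (R : realType) (T : eqType) (M : pFinType) (g : cgraph T M)
    (s : seq T) (v : T) (gv : verts g v) : lgraph R M :=
  @RGraph R M _ (bfs_subproof s gv).

(* The uniform law on the entries of a nonempty list *)
Definition empirical (R : realType) d (X : measurableType d) (xs : seq X) :
    probability X R :=
  mnormalize
    (msum (fun k => \d_(nth point xs k) : {measure set X -> \bar R}) (size xs))
    (\d_point).

(* Law of the randomly labeled version of the restriction of [g] to distance [r]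
   from the root, equivalently of the restriction to distance [r] of the randomly
   labeled version of [g]. *)
Definition relabeled (R : realType) (M : pFinType) (g : lgraph R M) (r : nat) :
    probability (lgraph R M) R :=
  empirical R [seq bfs R s (vert_root (restr r g))
              | s : seq label <- permutations (fset_set (verts (restr r g)))].

Definition randomly_labeled (R : realType) (M : pFinType)
    (mu : probability (lgraph R M) R) : Prop :=
  forall (r : nat) (h : lgraph R M),
    mu [set g | restr r g = h] = (\int[mu]_g relabeled g r [set h])%E.

Section finite_graphs.
Context (R : realType) (M : pFinType) (n : nat).

(* A simple graph on ['I_n] is a set [E] of pairs of vertices. *)
Definition edge (E : {set {set 'I_n}}) : rel 'I_n :=
  fun u v => (u != v) && ([set u; v]%SET \in E).

Fact edge_sym E : symmetric (edge E).
Proof. by move=> u v; rewrite /edge eq_sym finset.setUC. Qed.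

Fact edge_irr E : irreflexive (edge E).
Proof. by move=> u; rewrite /edge eqxx. Qed.

Definition cfinite (E : {set {set 'I_n}}) (f : 'I_n -> M) : cgraph 'I_n M :=
  @CGraph _ _ (fun v => Some (f v)) (edge E) (edge_sym E) (edge_irr E)
    (fun _ _ _ => isT).

(* All vertices have as many search orders as each other, so that the uniform law
   on (vertex, order) is the average over vertices. *)
Definition distr (E : {set {set 'I_n}}) (f : 'I_n -> M) : probability (lgraph R M) R :=
  empirical R [seq bfs R s (isT : verts (cfinite E f) v)
              | v <- enum 'I_n, s <- permutations (enum 'I_n)].

Definition graphs_of_degrees (deg : 'I_n -> nat) : {set {set {set 'I_n}}} :=
  [set E : {set {set 'I_n}} |
    [forall e in E, #|e| == 2] && [forall v, #|[set u | edge E v u]%SET| == deg v]]%SET.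

End finite_graphs.

Section galton_watson.

(* [gw_tree R N] is the tree in which the vertex [v] has [N v] offspring. *)
Fixpoint gw_from (N : label -> nat) (u v : label) : bool :=
  if v is j :: v' then (j < N u)%N && gw_from N (rcons u j) v' else true.

Definition gw_vert N v := gw_from N [::] v.

Definition parent (v : label) : label := take (size v).-1 v.

Definition child (u v : label) : bool := (v != [::]) && (parent v == u).

Definition gw_adj N : rel label := fun u v =>
  [&& gw_vert N u, gw_vert N v & child u v || child v u].

Lemma parent_rcons v j : parent (rcons v j) = v.
Proof. by rewrite /parent size_rcons /= -cats1 take_size_cat. Qed.

Lemma gw_vert_rcons N v j : gw_vert N (rcons v j) = gw_vert N v && (j < N v)%N.
Proof.
rewrite /gw_vert -[in N v](cat0s v); elim: v [::] => [|i v ih] u /=.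
  by rewrite cats0 andbT.
by rewrite ih cat_rcons andbA.
Qed.

Fact gw_sym N : symmetric (gw_adj N).
Proof. by move=> u v; rewrite /gw_adj andbCA orbC. Qed.

Fact gw_irr N : irreflexive (gw_adj N).
Proof.
move=> u; rewrite /gw_adj orbb /child; case/lastP: u => [|v j].
  by rewrite !andbF.
rewrite parent_rcons; apply/negP => /and4P[_ _ _ /eqP/(congr1 size)].
by rewrite size_rcons => /n_Sn.
Qed.

Fact gw_col N u v : gw_adj N u v -> (if gw_vert N u then Some tt else None).
Proof. by case/and3P => ->. Qed.

Definition cgw N : cgraph label unit :=
  CGraph (@gw_sym N) (@gw_irr N) (@gw_col N).

Fact gw_subproof N : bfs_labeled (cgw N).
Proof.
have vE v : verts (cgw N) v = gw_vert N v.
  by rewrite /verts/=; case: (gw_vert N v).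
split.
- by rewrite vE.
- move=> v j; rewrite vE => vj; have := vj; rewrite gw_vert_rcons => /andP[gv jv].
  split; last by move=> i ij; rewrite vE gw_vert_rcons gv (ltn_trans ij).
  rewrite /= /gw_adj gv vj /child parent_rcons eqxx andbT.
  by case: (v).
- move=> v j u /and3P[_ _ /orP[/andP[_]|/andP[u0 /eqP pu]]].
    by rewrite parent_rcons => /eqP ->; rewrite /shortlex eqxx lexx orbT.
  case/lastP: u u0 pu => // u k _; rewrite parent_rcons => ->.
  by rewrite /shortlex !size_rcons ltnS leqnSn.
- move=> v; apply: (@sub_finite_set _ _
    [set` parent v :: [seq rcons v j | j <- iota 0 (N v)]]); last exact: finite_seq.
  move=> u /= /and3P[_ gu /orP[|/andP[_ /eqP ->]]]; last by rewrite mem_head.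
  case/lastP: u gu => // u k; rewrite gw_vert_rcons => /andP[_ kN].
  case/andP => _; rewrite parent_rcons => /eqP <-; rewrite inE; apply/orP; right.
  by rewrite map_f// mem_iota add0n.
Qed.

Definition gw_tree (R : realType) N : lgraph R unit := @RGraph R unit _ (gw_subproof N).

End galton_watson.

Section pi_laws.
Context {R : realType} (pi : probability nat R).

Definition pmass (k : nat) : R := fine (pi [set k]).

Definition mean : \bar R := (\int[pi]_k (k%:R : R)%:E)%E.

Definition hat_pmass (k : nat) : R := k.+1%:R * pmass k.+1 / fine mean.

(* The second clause gives both the laws of the numbers of offspring and their
   independence. *)
Definition UGW (nu : probability (lgraph R unit) R) : Prop :=
  exists d (Omega : measurableType d) (P : probability Omega R)
         (N : label -> Omega -> nat),
    [/\ forall v k, measurable (N v @^-1` [set k]),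
        forall (vs : seq label) (k : label -> nat), uniq vs ->
          P [set w | forall v, v \in vs -> N v w = k v] =
          (\prod_(v <- vs) (if v is [::] then pmass (k v) else hat_pmass (k v)))%:E &
        forall A, measurable A -> nu A = P [set w | A (gw_tree R (N ^~ w))]].

End pi_laws.

Section processes.
Context {R : realType} {M : pFinType}.
Implicit Types (mu p : probability (lgraph R M) R) (g : lgraph R M).

Definition cgiso g g' (phi : label -> label) : Prop :=
  [/\ set_bij (verts g) (verts g') phi,
      forall u, verts g u -> col g' (phi u) = col g u &
      forall u v, verts g u -> verts g v -> adj g' (phi u) (phi v) = adj g u v].

(* Every connected locally finite colored graph is isomorphic to an [lgraph], so
   [F] is an isomorphism-invariant function of doubly rooted colored graphs. *)
Definition unimodular mu : Prop :=
  forall F : lgraph R M -> label -> label -> \bar R,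
    (forall g u v, 0 <= F g u v)%E ->
    (forall g g' phi u v, cgiso g g' phi -> verts g u -> verts g v ->
       F g' (phi u) (phi v) = F g u v) ->
    (forall v : label, measurable_fun [set g : lgraph R M | verts g v] (fun g => F g [::] v)) ->
    (forall v : label, measurable_fun [set g : lgraph R M | verts g v] (fun g => F g v [::])) ->
    (\int[mu]_g (\esum_(v in verts g) F g [::] v) =
     \int[mu]_g (\esum_(v in verts g) F g v [::]))%E.

Definition invariant_process (pi : probability nat R) mu : Prop :=
  [/\ randomly_labeled mu,
      exists2 nu, UGW pi nu & measure_eq (distribution mu (recolor (fun=> tt))) nu &
      unimodular mu].

Definition root_deg g : nat := #|` fset_set [set u | adj g [::] u]|.

Definition edge_biased (d : R) mu (A : set (lgraph R M)) : \bar R :=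
  (d^-1%:E * \int[mu]_(g in A) (root_deg g)%:R%:E)%E.

Definition edge_ball (r : nat) g : cgraph label M :=
  restrict g (gball g r.-1 [set [::]; [:: 0%N]]).

(* Atoms of the law of the edge-biased tree restricted to E_r *)
Definition edge_mass (d : R) (r : nat) p (h : cgraph label M) : R :=
  fine (edge_biased d p [set g : lgraph R M | edge_ball r g = h]).

(* Relabeling that exchanges the roles of the root and of its offspring [:: 0] in
   a tree; the other neighbors keep their relative order. *)
Definition switch (v : label) : label :=
  match v with
  | [::] => [:: 0]
  | [:: 0] => [::]
  | 0 :: j :: v' => j.+1 :: v'
  | i.+1 :: v' => 0 :: i :: v'
  end%N.

Lemma switchK : involutive switch.
Proof. by case=> [|[|i] [|j v]]. Qed.

Definition cswitch (h : cgraph label M) : cgraph label M :=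
  @CGraph _ _ (col h \o switch) (fun u v => adj h (switch u) (switch v))
    (fun u v => adj_sym h (switch u) (switch v))
    (fun u => adj_irr h (switch u)) (fun u v => @adj_col _ _ h (switch u) (switch v)).

(* The set I_{pi,r}(M) *)
Definition local_process (pi : probability nat R) (r : nat) p : Prop :=
  [/\ randomly_labeled p,
      exists2 nu, UGW pi nu &
        measure_eq (distribution p (recolor (fun=> tt))) (distribution nu (restr r)) &
      forall h, edge_mass (fine (mean pi)) r p (cswitch h) =
                edge_mass (fine (mean pi)) r p h].

(* The edge is e = (parent v, v). The restriction to B_{r-1}(e) takes countably
   many values [c], so conditioning on it is conditioning on each event [C]. The
   right subtree consists of the labels with prefix [v]. *)
Definition r_markov (r : nat) mu : Prop :=
  forall (v : label) (c : cgraph label M) (A B : set (cgraph label M)),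
    v != [::] -> verts c v ->
    let C := [set g : lgraph R M | restrict g (gball g r.-1 [set parent v; v]) = c] in
    let lft := fun g : lgraph R M => restrict g [set w | ~~ prefix v w] in
    let rgt := fun g : lgraph R M => restrict g [set w | prefix v w] in
    measurable (lft @^-1` A) -> measurable (rgt @^-1` B) ->
    (mu C * mu (C `&` (lft @^-1` A `&` rgt @^-1` B)) =
     mu (C `&` lft @^-1` A) * mu (C `&` rgt @^-1` B))%E.

Definition shannon (T : choiceType) (m : T -> R) : \bar R :=
  (\esum_(x in [set: T]) (- (m x * ln (m x)))%:E)%E.

Definition Sigma (pi : probability nat R) (r : nat) p : \bar R :=
  (shannon (fun g => fine (p [set g]))
   - (fine (mean pi) / 2)%:E * shannon (edge_mass (fine (mean pi)) r p)
   - shannon (pmass pi))%E.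

End processes.

Section couplings.
Context {R : realType} {M : pFinType} (pi : probability nat R) (r : nat).

Definition self_coupling (p : probability (lgraph R M) R)
    (q : probability (lgraph R (M * M)%type) R) : Prop :=
  [/\ local_process pi r q,
      measure_eq (distribution q (recolor fst)) p &
      measure_eq (distribution q (recolor snd)) p].

End couplings.

Section distances.
Context {R : realType} {M : pFinType}.

Definition distance_on_laws (D : probability (lgraph R M) R -> probability (lgraph R M) R -> R) :
    Prop :=
  [/\ forall mu nu, D mu nu = 0 <-> measure_eq mu nu,
      forall mu nu, D mu nu = D nu mu &
      forall mu nu rho, D mu rho <= D mu nu + D nu rho].

Definition generates_weak_topology
    (D : probability (lgraph R M) R -> probability (lgraph R M) R -> R) : Prop :=
  forall mu (U : set (probability (lgraph R M) R)),
    (exists2 e, 0 < e & [set nu | D mu nu < e] `<=` U) <->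
    (exists k (phi : 'I_k -> lgraph R M -> R) e,
      [/\ forall i, continuous (phi i), forall i, exists K, forall g, `|phi i g| <= K, 0 < e &
        [set nu : probability (lgraph R M) R |
          forall i, `|\int[nu]_g phi i g - \int[mu]_g phi i g| < e] `<=` U]).

End distances.

Section sofic.
Context {R : realType} {M : pFinType}.
Variables (dist : probability (lgraph R M) R -> probability (lgraph R M) R -> R).
Variables (idx : set nat) (deg : forall n, 'I_n -> nat).
Implicit Type mu : probability (lgraph R M) R.

(* The third clause is weak convergence of the empirical degree law. *)
Definition degree_sequence (pi : probability nat R) : Prop :=
  [/\ infinite_set idx,
      forall n, idx n -> ~~ odd (\sum_(v < n) deg v),
      forall phi : nat -> R, (exists K, forall k, `|phi k| <= K) ->
        (n%:R^-1 * \sum_(v < n) phi (deg v)) @[n --> within idx \oo]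
          --> (\int[pi]_k phi k : R) &
      exists Delta : R, forall n (v : 'I_n), idx n -> (deg v)%:R <= Delta].

(* Probability for the uniform graph with degrees [deg] *)
Definition prob n (A : {set {set 'I_n}} -> bool) : R :=
  #|[set E in graphs_of_degrees (@deg n) | A E]%SET|%:R / #|graphs_of_degrees (@deg n)|%:R.

Definition typical_colorings n (E : {set {set 'I_n}}) mu (t : nat) (eps : R) :
    {set {ffun 'I_n -> M}} :=
  [set f : {ffun 'I_n -> M} |
    dist (distribution (distr R E f) (restr t)) (distribution mu (restr t)) <= eps]%SET.

Definition entropy_of n (E : {set {set 'I_n}}) mu t eps : \bar R :=
  let F := typical_colorings E mu t eps in
  if F == finset.set0 then -oo%E else (n%:R^-1 * ln #|F|%:R)%:E.

Definition h_n mu t eps (alpha : R) (n : nat) : \bar R :=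
  ereal_sup [set h | (h = -oo \/ 0 <= h < +oo)%E /\
    alpha <= @prob n (fun E => (h <= entropy_of E mu t eps)%E)].

Definition h_upper_at mu t alpha : \bar R :=
  lim (limf_esup (h_n mu t eps alpha) (within idx \oo) @[eps --> (0:R)^'+]).

Definition h_lower_at mu t alpha : \bar R :=
  lim (limf_einf (h_n mu t eps alpha) (within idx \oo) @[eps --> (0:R)^'+]).

Definition h_upper mu alpha : \bar R := lim (h_upper_at mu t alpha @[t --> \oo]).

Definition h_lower mu alpha : \bar R := lim (h_lower_at mu t alpha @[t --> \oo]).

Definition strongly_typical mu : Prop :=
  exists2 L : R -> R,
    forall eps, 0 < eps ->
      @prob n (fun E => [exists f : {ffun 'I_n -> M}, dist (distr R E f) mu <= eps])
        @[n --> within idx \oo] --> L eps &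
    L eps @[eps --> 0^'+] --> (1 : R).

End sofic.

(* Main.v *)
(* A uniform graph with given degrees is a uniform pairing of half-edges conditioned on
   having no loop and no multiple edge, which has subexponential cost. The type of a
   coloring at depth h is the empirical law of the depth h unfoldings of the colored
   graph at its vertices. Counting pairings and colorings jointly, there are about
   exp(n Sigma(q)) colorings per pairing with a type close to q. So by Markov's
   inequality at most exp(n (Sigma(p) + o(1))) colorings are typical for p. For the
   lower bound, take the law of mu on the balls of radius h >= r: since mu is r-Markov,
   its Sigma is at least Sigma(p), which gives the first moment of the number of typical
   colorings at depth h. A pair of those has for type at depth r a coupling of p and p,
   so by hypothesis the second moment is at most exp(2n (Sigma(p) + o(1))), and there
   are exp(n (Sigma(p) - o(1))) typical colorings with probability at least exp(-o(n)).
   A switching of two pairs of half-edges changes types by O(1/n); a martingale bound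
   then makes the exceptional set exponentially small after a small change of the
   tolerance. Finally few vertices lie near a cycle, and at the others the unfolding,
   made symmetric under the reorderings of siblings, is the randomly labeled ball. *)
Require Import Defs.
From mathcomp Require Import all_boot all_order all_algebra fingroup perm finmap.
From mathcomp Require Import all_classical all_reals all_analysis measurable_realfun giry.
From mathcomp Require Import zify lra.
Import Order.TTheory GRing.Theory Num.Theory.
Import numFieldNormedType.Exports.

Set Implicit Arguments.
Unset Strict Implicit.
Unset Printing Implicit Defensive.

Local Open Scope classical_set_scope.
Local Open Scope ring_scope.

(** Pairings act on labeled half-edges, so types are ordered trees, whereas [Sigma] concerns laws
    that are invariant under the reordering of siblings. An empirical law of types is not invariant,
    and its entropy has to be compared with that of its symmetrization [Sym]; [star] and
    [Sig_star_le] make this comparison. In the converse direction a given law seldom has integral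
    and symmetric edge counts at size n: a vanishing proportion of half-edges is left uncolored and
    paired among themselves, which spoils few types ([unf_lip]). The hypothesis concerns exact
    couplings, while a pair of colorings only has approximate marginals; compactness of the set of
    laws and continuity of [Sig] bridge the gap ([near_optimal]). The number of typical colorings is
    not a Lipschitz function of the pairing, so concentration is applied to the Hamming distance to
    the set of good pairings instead ([blowup]). Exceptional sets must be exponentially small
    ([rare]), not merely negligible, because conditioning on simple pairings divides by a proportion
    that is only bounded below by a power of 1/n. *)

Local Notation inS := finset.in_set.

Lemma card_incl (T : finType) (A B : {pred T}) : {subset A <= B} -> (#|A| <= #|B|)%N.
Proof. by move=> h; apply/subset_leq_card/fintype.subsetP. Qed.

(** * Entropy, Gibbs' inequality and Stirling bounds *)

Section entropy.
Context {R : realType}.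

Definition eta (x : R) : R := - (x * ln x).

Definition shan (T : finType) (w : T -> R) : R := \sum_x eta (w x).

Lemma eta0 : eta 0 = 0. Proof. by rewrite /eta mul0r oppr0. Qed.

Lemma eta_le0 (x : R) : x <= 0 -> eta x = 0.
Proof. by move=> x0; rewrite /eta ln0// mulr0 oppr0. Qed.

Lemma eta_ge0 (x : R) : x <= 1 -> 0 <= eta x.
Proof.
move=> x1; case: (lerP x 0) => x0; first by rewrite eta_le0.
by rewrite /eta oppr_ge0 mulr_ge0_le0 ?ln_le0// ltW.
Qed.

(** With s the square root of [x], [eta x] is 2 s^2 ln (1/s), and ln y < y at y = 1/s. This gives
    the continuity of [eta] at 0, where [ln] is not continuous. *)
Lemma eta_sqrt (x : R) : `|x| <= 1 -> `|eta x| <= 2 * Num.sqrt `|x|.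
Proof.
move=> x1; case: (lerP x 0) => x0; first by rewrite eta_le0 ?normr0 ?mulr_ge0 ?sqrtr_ge0.
move: x1; rewrite gtr0_norm// => x1.
rewrite ger0_norm ?eta_ge0//.
have s0 : 0 < Num.sqrt x by rewrite sqrtr_gt0.
have xE : x = Num.sqrt x ^+ 2 by rewrite sqr_sqrtr ?ltW.
rewrite /eta {1 2}xE; move: (Num.sqrt x) s0 => s s0.
rewrite lnXn// -[X in X *+ 2]opprK -lnV ?posrE//.
have := ln_sublinear (_ : 0 < s^-1); rewrite invr_gt0 => /(_ s0) h.
rewrite mulNrn mulrN opprK -mulr_natl expr2.
have : s * ln s^-1 <= 1 by rewrite -(divff (lt0r_neq0 s0)) ler_pM2l// ltW.
by move=> h1; nra.
Qed.

Lemma continuous_eta : continuous (eta : R -> R).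
Proof.
move=> x; case: (ltrgtP x 0) => x0.
- have nx : \forall y \near x, eta x = eta y.
    near=> y; rewrite !eta_le0// ?ltW//.
    by near: y; exact: lt_nbhsl.
  by apply: cvg_trans (near_eq_cvg nx) _; exact: cvg_cst.
- by apply: cvgN; apply: cvgM; [exact: cvg_id|exact: continuous_ln x0].
- rewrite x0 /continuous_at eta0; apply/cvgrPdist_le => e e0.
  near=> y; rewrite sub0r normrN.
  have y1 : `|y| <= 1.
    near: y; apply/nbhs_ballP; exists 1 => //= z; rewrite /ball/= sub0r normrN.
    exact: ltW.
  apply: le_trans (eta_sqrt y1) _.
  have : `|y| <= (e / 2) ^+ 2.
    near: y; apply/nbhs_ballP; exists ((e / 2) ^+ 2); first by rewrite /= exprn_gt0 ?divr_gt0.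
    by move=> z; rewrite /ball/= sub0r normrN; exact: ltW.
  move=> /ler_wsqrtr; rewrite sqrtr_sqr (@ger0_norm _ (e / 2)); last by apply: divr_ge0 => //; exact: ltW.
  move=> h; lra.
Unshelve. all: end_near. Qed.

(** Sum of ln y <= y - 1 at y = w/p. The weight [w] only has to be dominated in total mass, so that
    it can be built by hand without being normalized; [Sig_star_le] and [shan_submod] rest on the
    choice of such a [w]. *)
Lemma gibbs (T : finType) (p w : T -> R) :
  (forall x, 0 <= p x) -> (forall x, 0 <= w x) -> (forall x, 0 < p x -> 0 < w x) ->
  \sum_x w x <= \sum_x p x ->
  shan p <= - \sum_x p x * ln (w x).
Proof.
move=> p0 w0 pw sw; rewrite -subr_le0 opprK /shan -big_split/=.
have : \sum_x (eta (p x) + p x * ln (w x)) <= \sum_x (w x - p x).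
  apply: ler_sum => x _; have := p0 x; rewrite le_eqVlt => /orP[/eqP <-|px].
    by rewrite eta0 mul0r addr0 subr0.
  have wx := pw _ px.
  rewrite /eta addrC -mulrN -mulrDr -ln_div ?posrE//.
  have h : ln (w x / p x) <= w x / p x - 1.
    rewrite -[in leLHS](subrK 1 (w x / p x)) addrC.
    by apply: le_ln1Dx; rewrite ltrDr divr_gt0.
  apply: le_trans (ler_wpM2l (ltW px) h) _.
  by rewrite mulrBr mulr1 mulrCA divff ?mulr1// lt0r_neq0.
by move=> /le_trans; apply; rewrite sumrB subr_le0.
Qed.

Definition lfact (m : nat) : R := ln (m`!%:R).

Lemma lfactS m : lfact m.+1 = lfact m + ln m.+1%:R.
Proof. by rewrite /lfact factS natrM lnM ?posrE ?ltr0n ?fact_gt0// addrC. Qed.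

Definition xlnx (m : nat) : R := m%:R * ln m%:R.

Lemma lfact_ge m : xlnx m - m%:R <= lfact m.
Proof.
elim: m => [|m ih]; first by rewrite /xlnx mul0r subr0 /lfact fact0 ln1.
rewrite lfactS; apply: le_trans (lerD ih (lexx _)).
rewrite /xlnx -natr1 mulrDl mul1r.
suff : m%:R * ln (m%:R + 1) - 1 <= m%:R * ln m%:R :> R by lra.
case: m {ih} => [|m]; first by rewrite !mul0r sub0r oppr_le0.
have m0 : 0 < m.+1%:R :> R by rewrite ltr0n.
have : ln (1 + m.+1%:R^-1) <= m.+1%:R^-1 :> R.
  by apply: le_ln1Dx; rewrite (lt_trans _ (_ : 0 < _))// ?invr_gt0// ltrN10.
have -> : 1 + m.+1%:R^-1 = (m.+1%:R + 1) / m.+1%:R :> R.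
  by rewrite mulrDl divff ?lt0r_neq0// mul1r.
rewrite ln_div ?posrE ?addr_gt0// => h.
have := ler_wpM2l (ltW m0) h; rewrite mulrBr divff ?lt0r_neq0//; lra.
Qed.

Lemma lfact_le m : lfact m <= xlnx m - m%:R + (1 + ln m.+1%:R).
Proof.
case: m => [|m]; first by rewrite /xlnx mul0r /lfact fact0 ln1 sub0r oppr0 add0r addr0.
have : lfact m.+1 <= xlnx m.+1 - m.+1%:R + (1 + ln m.+1%:R).
  elim: m => [|m ih]; first by rewrite /xlnx /lfact factS fact0 ln1; lra.
  rewrite lfactS; apply: le_trans (lerD ih (lexx _)) _.
  rewrite /xlnx -[m.+2%:R]natr1.
  have m0 : 0 < m.+1%:R :> R by rewrite ltr0n.
  move: m0; set x := m.+1%:R : R => x0.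
  suff : 1 + (x + 1) * ln x <= (x + 1) * ln (x + 1).
    by rewrite !mulrDl !mul1r; lra.
  have : ln (1 + (- (x + 1)^-1)) <= - (x + 1)^-1.
    apply: le_ln1Dx; rewrite ltrNl opprK invf_lt1 ?ltrDr// addr_gt0//.
  have -> : 1 + - (x + 1)^-1 = x / (x + 1).
    by rewrite -[X in X / _](addrK 1 x) mulrBl divff ?mul1r// lt0r_neq0// addr_gt0.
  rewrite ln_div ?posrE ?addr_gt0// => h.
  have x1 : 0 <= x + 1 by rewrite addr_ge0// ltW.
  have := ler_wpM2l x1 h; rewrite mulrN divff ?lt0r_neq0 ?addr_gt0// mulrBr; lra.
move=> /le_trans; apply; rewrite lerD2l lerD2l ler_ln ?posrE ?ltr0n// ler_nat//.
Qed.

(** Stirling's formula up to a logarithm. This is precise enough, as only exponential rates in the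
    number of vertices matter; these errors add up to [err]. *)
Lemma lfact_bound m : `|lfact m - (xlnx m - m%:R)| <= 1 + ln m.+1%:R.
Proof.
rewrite ger0_norm ?subr_ge0 ?lfact_ge//.
by have := lfact_le m; lra.
Qed.

Lemma expR_lfact m : expR (lfact m) = m`!%:R.
Proof. by rewrite lnK// posrE ltr0n fact_gt0. Qed.

Lemma xlnx_eta (N m : nat) : (0 < N)%N ->
  xlnx m = m%:R * ln N%:R - N%:R * eta (m%:R / N%:R).
Proof.
move=> N0; rewrite /xlnx /eta; case: m => [|m]; first by rewrite !mul0r oppr0 mulr0 subr0.
have N0' : 0 < N%:R :> R by rewrite ltr0n.
rewrite ln_div ?posrE// mulrN opprK mulrA [N%:R * _]mulrC divfK ?lt0r_neq0//.
by rewrite mulrBr addrC subrK.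
Qed.

(** From exp (-x) >= 1 - x, hence exp x <= 1/(1 - x). It bounds one increment of the martingale in
    [conc]. *)
Lemma expR_quad (x : R) : `|x| <= 2^-1 -> expR x <= 1 + x + 2 * x ^+ 2.
Proof.
rewrite ler_norml => /andP[h1 h2].
have h3 : 0 < 1 - x by lra.
have := expR_ge1Dx (- x); rewrite expRN => h4.
have e0 := expR_gt0 x.
have : (1 - x) * expR x <= 1.
  by rewrite -[leRHS](mulVf (lt0r_neq0 e0)) ler_pM2r.
move=> h5; rewrite -(ler_pM2l h3); apply: le_trans h5 _.
have -> : (1 - x) * (1 + x + 2 * x ^+ 2) = 1 + x ^+ 2 * (1 - 2 * x) by lra.
rewrite lerDl mulr_ge0 ?sqr_ge0//; lra.
Qed.

End entropy.

(** * Finite trees and their laws *)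

Section seq_perm.
Context {T : eqType}.

(** Adjacent transpositions generate all permutations, here in the form of an induction principle.
    The prefix [u] in the proof is the part already in place. *)
Lemma swap_perm_ind (Q : seq T -> Prop) :
  (forall s1 x y s2, Q (s1 ++ x :: y :: s2) -> Q (s1 ++ y :: x :: s2)) ->
  forall s t, perm_eq s t -> Q s -> Q t.
Proof.
move=> hQ s t; suff : forall u, perm_eq s t -> Q (u ++ s) -> Q (u ++ t) by move=> /(_ [::]).
elim: s t => [|a s ih] t u st.
  by have /perm_size/esym/size0nil -> := st.
have at' : a \in t by rewrite -(perm_mem st) mem_head.
case/splitPr: at' st => t1 t2 st.
move=> h; have {}h : Q (u ++ a :: (t1 ++ t2)).
  rewrite -cat_rcons; apply: ih; last by rewrite cat_rcons.
  by move: st; rewrite perm_sym -cat1s perm_catCA /= perm_cons perm_sym.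
elim: t1 u h {ih st} => [|b t1 iht] u //= h.
by rewrite -cat_rcons; apply: iht; rewrite cat_rcons; exact: hQ h.
Qed.

Fixpoint picks (s : seq T) : seq (T * seq T) :=
  if s is a :: s' then (a, s') :: [seq (b.1, a :: b.2) | b <- picks s'] else [::].

Lemma size_picks s : size (picks s) = size s.
Proof. by elim: s => //= a s ih; rewrite size_map ih. Qed.

Definition rem_at j (s : seq T) := take j s ++ drop j.+1 s.

Lemma size_rem_at j s : (j < size s)%N -> size (rem_at j s) = (size s).-1.
Proof. by move=> js; rewrite /rem_at size_cat size_take size_drop js; lia. Qed.

Lemma picksE x0 s : picks s = [seq (nth x0 s j, rem_at j s) | j <- iota 0 (size s)].
Proof.
elim: s => //= a s ->; rewrite /rem_at /= drop0 -map_comp; congr cons.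
by rewrite (iotaDl 1 0) -map_comp; apply: eq_map => j.
Qed.

Lemma perm_picks (T' : eqType) (G : T -> seq T -> T') s t :
  (forall a r r', perm_eq r r' -> G a r = G a r') ->
  perm_eq s t ->
  perm_eq [seq G b.1 b.2 | b <- picks s] [seq G b.1 b.2 | b <- picks t].
Proof.
move=> hG st.
apply: (swap_perm_ind (Q := fun t => perm_eq _ [seq G b.1 b.2 | b <- picks t]) _ st) => //.
move=> s1 x y s2 /perm_trans; apply.
elim: s1 G hG => [|a s1 ih] G hG /=.
  rewrite -!map_comp -cat1s -[X in perm_eq _ X]cat1s -[X in _ ++ X]cat1s -[X in perm_eq _ (_ ++ X)]cat1s.
  rewrite perm_catCA perm_cat2l perm_cat2l.
  rewrite (eq_map (_ : _ =1 (fun b => G b.1 [:: y, x & b.2])))// => b /=; apply: hG.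
  by rewrite -(cat1s x) -(cat1s y) -[in X in perm_eq _ X](cat1s y) -[in X in perm_eq _ X](cat1s x) perm_catCA.
rewrite (hG a _ (s1 ++ y :: x :: s2)) ?perm_cons.
  by rewrite -!map_comp; apply: (ih (fun b r => G b (a :: r))) => b r r' rr'; apply: hG; rewrite perm_cons.
by rewrite perm_cat2l -(cat1s x) -(cat1s y) -[in X in perm_eq _ X](cat1s y) -[in X in perm_eq _ X](cat1s x) perm_catCA.
Qed.

(** The identity when [i] is out of range, so that it is an involution without side condition; [upd]
    follows the same convention. *)
Fixpoint swl (i : nat) (s : seq T) : seq T :=
  match i, s with
  | 0, a :: b :: s' => b :: a :: s'
  | i'.+1, a :: s' => a :: swl i' s'
  | _, _ => s
  end.

Lemma size_swl i s : size (swl i s) = size s.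
Proof. by elim: i s => [|i ih] [|a s] //=; [case: s|rewrite ih]. Qed.

Lemma swlK i : involutive (swl i).
Proof. by elim: i => [|i ih] [|a s] //=; [case: s|rewrite ih]. Qed.

Lemma perm_swl i s : perm_eq (swl i s) s.
Proof.
elim: i s => [|i ih] [|a s] //=; last by rewrite perm_cons.
by case: s => // b s; rewrite -(cat1s b) -(cat1s a) -[in X in perm_eq _ X](cat1s a) -[in X in perm_eq _ X](cat1s b) perm_catCA.
Qed.

Lemma swl_cat s1 x y s2 : swl (size s1) (s1 ++ x :: y :: s2) = s1 ++ y :: x :: s2.
Proof. by elim: s1 => //= a s1 ->. Qed.

Fixpoint upd (j : nat) (f : T -> T) (s : seq T) : seq T :=
  match j, s with
  | 0, a :: s' => f a :: s'
  | j'.+1, a :: s' => a :: upd j' f s'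
  | _, _ => s
  end.

Lemma size_upd j f s : size (upd j f s) = size s.
Proof. by elim: j s => [|j ih] [|a s] //=; rewrite ih. Qed.

Lemma upd_cat f s1 x s2 : upd (size s1) f (s1 ++ x :: s2) = s1 ++ f x :: s2.
Proof. by elim: s1 => //= a s1 ->. Qed.

Lemma updK j f : involutive f -> involutive (upd j f).
Proof. by move=> fK; elim: j => [|j ih] [|a s] //=; rewrite ?fK ?ih. Qed.
End seq_perm.

Lemma map_swl (T T' : eqType) (f : T -> T') i s : map f (swl i s) = swl i (map f s).
Proof. by elim: i s => [|i ih] [|a s] //=; [case: s|rewrite ih]. Qed.

Lemma map_upd (T T' : eqType) (f : T -> T') g g' j s :
  (forall x, f (g x) = g' (f x)) -> map f (upd j g s) = upd j g' (map f s).
Proof. by move=> h; elim: j s => [|j ih] [|a s] //=; rewrite ?h ?ih. Qed.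

Lemma map_upd_id (T T' : eqType) (f : T -> T') g j s :
  (forall x, f (g x) = f x) -> map f (upd j g s) = map f s.
Proof. by move=> h; elim: j s => [|j ih] [|a s] //=; rewrite ?h ?ih. Qed.

Section mkb.
Context {Dl : nat} {T : Type}.

Fact mkb_subproof (s : seq T) : (size (take Dl s) <= Dl)%N.
Proof. by rewrite size_take_min geq_minl. Qed.

(** A total constructor: longer lists are truncated. Every list that matters has length at most
    [Dl], whence the size conditions in the lemmas. *)
Definition mkb (s : seq T) : {bseq Dl of T} := Bseq (mkb_subproof s).

Lemma mkbK (s : seq T) : (size s <= Dl)%N -> mkb s = s :> seq T.
Proof. by move=> h /=; rewrite take_oversize. Qed.

Lemma mkb_val (s : {bseq Dl of T}) : mkb s = s.
Proof. by apply: val_inj; rewrite /= take_oversize// size_bseq. Qed.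
End mkb.

(* Trees of depth at most [k] colored by [M]: the color of the root and its subtrees,
   in order and at most [Dl] in number *)
Fixpoint B (M : finType) (Dl k : nat) : finType :=
  if k is k'.+1 then (M * {bseq Dl of B M Dl k'})%type : finType else M.

Section trees.
Context {M : finType} {Dl : nat}.
Local Notation B := (B M Dl).

Definition nd k (m : M) (s : seq (B k)) : B k.+1 := (m, mkb s).

Definition kids k (x : B k.+1) : seq (B k) := x.2.

Lemma nd_kids k (x : B k.+1) : nd x.1 (kids x) = x.
Proof. by case: x => m s; rewrite /nd /kids/= mkb_val. Qed.

Lemma size_kids k (x : B k.+1) : (size (kids x) <= Dl)%N.
Proof. exact: size_bseq. Qed.

Lemma kids_nd k m (s : seq (B k)) : (size s <= Dl)%N -> kids (nd m s) = s.
Proof. exact: mkbK. Qed.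

Definition root k : B k -> M :=
  match k with 0 => fun x => x | k'.+1 => fun x => x.1 end.

Lemma B_eq k (x y : B k.+1) : x.1 = y.1 -> kids x = kids y -> x = y.
Proof. by move: x y => [m s] [m' s']; rewrite /kids /= => -> /val_inj ->. Qed.

Fixpoint lf k (m : M) : B k := match k with 0 => m | k'.+1 => nd m [::] end.

Definition leB k : rel (B k) := fun x y => (enum_rank x <= enum_rank y)%N.

Lemma leB_total k : total (@leB k). Proof. by move=> x y; exact: leq_total. Qed.
Lemma leB_trans k : transitive (@leB k). Proof. by move=> y x z; exact: leq_trans. Qed.
Lemma leB_anti k : antisymmetric (@leB k).
Proof. by move=> x y /anti_leq h; exact/enum_rank_inj/val_inj. Qed.

(** Representative of a tree up to the reordering of siblings at all vertices, obtained by sorting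
    for the arbitrary order [leB]. Equality of [canon] is the equivalence of trees used
    throughout. *)
Fixpoint canon k : B k -> B k :=
  match k with
  | 0 => id
  | k'.+1 => fun x => nd x.1 (sort (@leB k') (map (@canon k') (kids x)))
  end.

Lemma canonS k (x : B k.+1) : canon x = nd x.1 (sort (@leB k) (map (@canon k) (kids x))).
Proof. by []. Qed.

Lemma kids_canon k (x : B k.+1) : kids (canon x) = sort (@leB k) (map (@canon k) (kids x)).
Proof. by rewrite canonS kids_nd// size_sort size_map size_kids. Qed.

Lemma canonP k (x y : B k.+1) :
  canon x = canon y <-> x.1 = y.1 /\ perm_eq (map (@canon k) (kids x)) (map (@canon k) (kids y)).
Proof.
split=> [e|[e1 e2]].
  split; first exact: (congr1 (fun z : B k.+1 => z.1) e).
  by apply/(perm_sortP (@leB_total k) (@leB_trans k) (@leB_anti k)); rewrite -!kids_canon e.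
apply: B_eq => //; rewrite !kids_canon.
exact/(perm_sortP (@leB_total k) (@leB_trans k) (@leB_anti k)).
Qed.

Lemma canonK k (x : B k) : canon (canon x) = canon x.
Proof.
elim: k x => // k ih x; apply/canonP; split=> //.
rewrite kids_canon (perm_trans (perm_map _ (permEl (perm_sort _ _))))// -map_comp.
by rewrite (eq_map (ih : _ \o _ =1 _)).
Qed.

Lemma perm_kids_canon k (x y : B k.+1) : canon x = canon y ->
  perm_eq (map (@canon k) (kids x)) (map (@canon k) (kids y)).
Proof. by move/canonP => []. Qed.

Lemma size_canon k (x y : B k.+1) : canon x = canon y -> size (kids x) = size (kids y).
Proof. by move/perm_kids_canon/perm_size; rewrite !size_map. Qed.

Fixpoint tr k : B k.+1 -> B k :=
  match k with
  | 0 => fun x => x.1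
  | k'.+1 => fun x => nd x.1 (map (@tr k') (kids x))
  end.

Lemma trS k (x : B k.+2) : tr x = nd x.1 (map (@tr k) (kids x)).
Proof. by []. Qed.

Lemma kids_tr k (x : B k.+2) : kids (tr x) = map (@tr k) (kids x).
Proof. by rewrite trS kids_nd// size_map size_kids. Qed.

Lemma root_tr k (x : B k.+1) : root (tr x) = x.1.
Proof. by case: k x. Qed.

(* Exchanges the subtrees [i] and [i + 1] at the vertex [l]. *)
Fixpoint sw (l : seq nat) (i : nat) k {struct k} : B k -> B k :=
  match k with
  | 0 => id
  | k'.+1 => fun x =>
      if l is j :: l' then nd x.1 (upd j (@sw l' i k') (kids x))
      else nd x.1 (swl i (kids x))
  end.

Lemma kids_sw l i k (x : B k.+1) :
  kids (sw l i x) = if l is j :: l' then upd j (@sw l' i k) (kids x) else swl i (kids x).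
Proof. by case: l => [|j l] /=; rewrite kids_nd ?size_swl ?size_upd ?size_kids. Qed.

Lemma sw1 l i k (x : B k.+1) : (sw l i x).1 = x.1.
Proof. by case: l. Qed.

Lemma swK l i k : involutive (@sw l i k).
Proof.
elim: k l => [|k ih] l x //; apply: B_eq; first by rewrite !sw1.
by rewrite !kids_sw; case: l => [|j l]; rewrite ?swlK ?updK.
Qed.

Lemma canon_sw l i k (x : B k) : canon (sw l i x) = canon x.
Proof.
elim: k l x => // k ih l x; apply/canonP; split; first by rewrite sw1.
rewrite kids_sw; case: l => [|j l]; first by rewrite perm_map// perm_swl.
by rewrite map_upd_id.
Qed.

Lemma tr_sw l i k (x : B k.+1) : tr (sw l i x) = sw l i (tr x).
Proof.
elim: k l x => [|k ih] l x; first by rewrite /= ; case: l.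
apply: B_eq; first by rewrite sw1; exact: (sw1 l i x).
rewrite kids_tr !kids_sw !kids_tr; case: l => [|j l]; first by rewrite map_swl.
by rewrite (map_upd (g' := @sw l i k)).
Qed.

(** The exchanges [sw] generate the reorderings of siblings: the subtrees of the root are permuted
    by adjacent exchanges, then put in canonical form one at a time by induction. Invariance can
    thus be checked on one involution, which also serves as a change of variables in sums. *)
Lemma sw_inv k (X : Type) (F : B k -> X) :
  (forall l i x, F (sw l i x) = F x) -> forall x y, canon x = canon y -> F x = F y.
Proof.
elim: k X F => [|k ih] X F hF x y; first by move=> /= ->.
have hp m s t : (size s <= Dl)%N -> perm_eq s t -> F (nd m s) = F (nd m t).
  move=> sD' st.
  have sD : (size t <= Dl)%N by rewrite -(perm_size st).
  move: sD; apply: (swap_perm_ind (Q := fun t => (size t <= Dl)%N -> F (nd m s) = F (nd m t)) _ st) => //.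
  move=> s1 a b s2 h sD; rewrite h; last by move: sD; rewrite !size_cat.
  rewrite -(hF [::] (size s1) (nd m (s1 ++ b :: a :: s2))) /=.
  have -> : kids (nd m (s1 ++ b :: a :: s2)) = s1 ++ b :: a :: s2 by rewrite kids_nd.
  by rewrite swl_cat.
have hc m s1 c s2 : (size (s1 ++ c :: s2) <= Dl)%N -> F (nd m (s1 ++ c :: s2)) = F (nd m (s1 ++ canon c :: s2)).
  move=> sD; pose F' z := if (size (s1 ++ z :: s2) <= Dl)%N then F (nd m (s1 ++ z :: s2)) else F (nd m [::]).
  have szE z : size (s1 ++ z :: s2) = size (s1 ++ c :: s2) by rewrite !size_cat.
  have := ih _ F' _ c (canon c).
  rewrite canonK /F' !szE sD; apply => //.
  move=> l i z; rewrite !szE sD.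
  rewrite -(hF (size s1 :: l) i (nd m (s1 ++ z :: s2))) /=.
  by rewrite kids_nd ?upd_cat// szE.
have hm m s1 s2 : (size (s1 ++ s2) <= Dl)%N -> F (nd m (s1 ++ s2)) = F (nd m (s1 ++ map (@canon k) s2)).
  elim: s2 s1 => [|c s2 ihs] s1 sD //.
  rewrite hc// -cat_rcons ihs; last by rewrite cat_rcons; move: sD; rewrite !size_cat.
  by rewrite cat_rcons.
have hn z : F z = F (canon z).
  rewrite -[in LHS](nd_kids z) (hm _ [::]) ?size_kids// canonS; apply: hp.
    by rewrite size_map size_kids.
  by rewrite perm_sym perm_sort.
by move=> e; rewrite hn e -hn.
Qed.

Lemma canon_tr k (x y : B k.+1) : canon x = canon y -> canon (tr x) = canon (tr y).
Proof. by apply: (sw_inv (F := fun x => canon (tr x))) => l i z; rewrite tr_sw canon_sw. Qed.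

Definition kap k (x : B k.+1) (b : B k * seq (B k)) : B k * B k := (b.1, tr (nd x.1 b.2)).

(* For each offspring of the root: the branch through it, and the rest of the tree
   truncated to the same depth. *)
Definition kaps k (x : B k.+1) : seq (B k * B k) :=
  [seq kap x b | b <- picks (kids x)].

Definition canon2 k (ab : B k * B k) := (canon ab.1, canon ab.2).

Lemma size_kaps k (x : B k.+1) : size (kaps x) = size (kids x).
Proof. by rewrite size_map size_picks. Qed.

Lemma map_picks (T T' : eqType) (f : T -> T') s :
  picks (map f s) = [seq (f b.1, map f b.2) | b <- picks s].
Proof. by elim: s => //= a s ->; rewrite -!map_comp. Qed.

Lemma size_picks_le (T : eqType) (s : seq T) b : b \in picks s -> (size b.2).+1 = size s.
Proof.
elim: s b => //= a s ih b; rewrite inE => /orP[/eqP -> //|/mapP[c /ih cs ->]] /=.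
by rewrite cs.
Qed.

Lemma perm_kaps k (x y : B k.+1) : canon x = canon y ->
  perm_eq (map (@canon2 k) (kaps x)) (map (@canon2 k) (kaps y)).
Proof.
move=> /canonP[e p].
(* [nd] truncates lists that are too long, which would break the invariance under permutation
   required by [perm_picks]; [None] stands for these lists, which do not occur among the picks. *)
pose G (z : M) (a : B k) (r : seq (B k)) := if (size r <= Dl)%N then (a, Some (canon (tr (nd z r)))) else (a, None).
have h (z : B k.+1) : map (fun ab => (ab.1, Some ab.2)) (map (@canon2 k) (kaps z)) =
    [seq G z.1 b.1 b.2 | b <- picks (map (@canon k) (kids z))].
  rewrite map_picks /kaps -!map_comp; apply/eq_in_map => b bz /=.
  have sb := size_picks_le bz.
  have b2 : (size b.2 <= Dl)%N by apply: leq_trans (size_kids z); rewrite -sb.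
  rewrite /canon2 /G size_map b2 /=; congr (_, Some _); apply: canon_tr; apply/canonP; split=> //.
  rewrite !kids_nd ?size_map// -map_comp.
  by rewrite (eq_map (fun c => canonK c : (_ \o _) c = _)).
have inj : injective (fun ab : B k * B k => (ab.1, Some ab.2)) by move=> [a b] [c d] [-> ->].
apply: (perm_map_inj inj); rewrite !h e; apply: (perm_picks (G := G y.1)) p => a r r' rr'.
rewrite /G (perm_size rr'); case: ifP => // rD; congr (_, Some _); apply: canon_tr.
by apply/canonP; split=> //; rewrite !kids_nd ?(perm_size rr')// perm_map.
Qed.

Lemma count_kaps_canon k (x y : B k.+1) (A : pred (B k * B k)) : canon x = canon y ->
  count (A \o @canon2 k) (kaps x) = count (A \o @canon2 k) (kaps y).
Proof. by move=> /perm_kaps/seq.permP/(_ A); rewrite !count_map. Qed.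
End trees.

Section recolor_trees.
Context {M M' : finType} {Dl : nat} (h : M -> M').

Fixpoint mapB k : B M Dl k -> B M' Dl k :=
  match k with
  | 0 => h
  | k'.+1 => fun x => nd (h x.1) (map (@mapB k') (kids x))
  end.

Lemma kids_mapB k (x : B M Dl k.+1) : kids (mapB x) = map (@mapB k) (kids x).
Proof. by rewrite /= kids_nd// size_map size_kids. Qed.

Lemma mapB_sw l i k (x : B M Dl k) : mapB (sw l i x) = sw l i (mapB x).
Proof.
elim: k l x => // k ih l x; apply: B_eq; first by rewrite sw1 /= sw1.
rewrite kids_mapB !kids_sw kids_mapB; case: l => [|j l]; first by rewrite map_swl.
by rewrite (map_upd (g' := @sw M' Dl l i k)).
Qed.

End recolor_trees.

Section unfolding.
Context {M : finType} {Dl : nat} {W : Type} (nx : W -> seq W) (c : W -> M).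

(** The tree unfolded from the state [w], where [nx] lists the next states. States will be
    half-edges, pairs (previous vertex, vertex) or labels; unfoldings of different kinds are
    compared by [canon_unf] and [unf_lip]. *)
Fixpoint unf k (w : W) : B M Dl k :=
  match k with
  | 0 => c w
  | k'.+1 => nd (c w) (map (unf k') (nx w))
  end.

Hypothesis nxD : forall w, (size (nx w) <= Dl)%N.

Lemma kids_unf k w : kids (unf k.+1 w) = map (unf k) (nx w).
Proof. by rewrite kids_nd// size_map. Qed.

Lemma tr_unf k w : tr (unf k.+1 w) = unf k w.
Proof.
elim: k w => // k ih w; apply: B_eq => //.
by rewrite kids_tr !kids_unf -map_comp; apply: eq_map.
Qed.
End unfolding.

(** What the unfolding meets, in preorder. When [c] gives the vertex of a state, the absence of
    repetition says that the unfolding closes up nowhere, that is, that the ball is a tree. *)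
Fixpoint flat (W T : Type) (nx : W -> seq W) (c : W -> T) (k : nat) (w : W) : seq T :=
  c w :: (if k is k'.+1 then flatten (map (flat nx c k') (nx w)) else [::]).

Arguments B : simpl never.
Arguments sw : simpl never.
Arguments canon : simpl never.
Arguments tr : simpl never.
Arguments nd : simpl never.
Arguments mapB : simpl never.
Arguments unf : simpl never.
Arguments Finite.sort : simpl never.
Arguments eq_op : simpl never.

(** * Push-forward, symmetrization, edge marginals and the entropy [Sig] *)

Section laws.
Context {R : realType}.

Definition push (T U : finType) (phi : T -> U) (P : T -> R) (u : U) : R :=
  \sum_(x | phi x == u) P x.

Lemma sum_push (T U : finType) (phi : T -> U) (P : T -> R) (g : U -> R) :
  \sum_u push phi P u * g u = \sum_x P x * g (phi x).
Proof.
rewrite [RHS](partition_big phi predT)//=; apply: eq_bigr => u _.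
by rewrite /push mulr_suml; apply: eq_bigr => x /eqP ->.
Qed.

Lemma push_sum1 (T U : finType) (phi : T -> U) (P : T -> R) :
  \sum_u push phi P u = \sum_x P x.
Proof.
have := sum_push phi P (fun=> 1).
by under eq_bigr do rewrite mulr1; move=> ->; apply: eq_bigr => x _; rewrite mulr1.
Qed.

Lemma push_ge0 (T U : finType) (phi : T -> U) (P : T -> R) :
  (forall x, 0 <= P x) -> forall u, 0 <= push phi P u.
Proof. by move=> P0 u; exact: sumr_ge0. Qed.

Lemma push_ge (T U : finType) (phi : T -> U) (P : T -> R) x :
  (forall x, 0 <= P x) -> P x <= push phi P (phi x).
Proof. by move=> P0; rewrite /push (bigD1 x)//= lerDl sumr_ge0. Qed.

Lemma push_comp (T U X : finType) (phi : T -> U) (psi : U -> X) (P : T -> R) z :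
  push psi (push phi P) z = push (psi \o phi) P z.
Proof.
rewrite /push (partition_big phi (fun u => psi u == z))//=.
apply: eq_bigr => u /eqP <-; apply: eq_bigl => x.
by case: eqP => [->|]; rewrite ?eqxx ?andbF.
Qed.

Lemma eq_push (T U : finType) (phi psi : T -> U) (P : T -> R) : phi =1 psi -> push phi P =1 push psi P.
Proof. by move=> h u; apply: eq_bigl => x; rewrite h. Qed.

Section canonical.
Context {M : finType} {Dl : nat}.
Local Notation B := (B M Dl).

Definition inv k (P : B k -> R) := forall x y, canon x = canon y -> P x = P y.

Lemma invP k (P : B k -> R) : (forall l i x, P (sw l i x) = P x) <-> inv P.
Proof.
split=> [h x y|h l i x]; first exact: (sw_inv h).
by apply: h; rewrite canon_sw.
Qed.

Definition ocl k (x : B k) : nat := #|[pred y | canon y == canon x]|.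

Lemma ocl_gt0 k (x : B k) : (0 < ocl x)%N.
Proof. by apply/card_gt0P; exists x; rewrite inE. Qed.

Lemma ocl_gt0R k (x : B k) : 0 < (ocl x)%:R :> R.
Proof. by rewrite ltr0n ocl_gt0. Qed.

Lemma ocl_eq k (x y : B k) : canon x = canon y -> ocl x = ocl y.
Proof. by move=> e; apply: eq_card => z; rewrite !inE e. Qed.

Lemma ocl_canon k (x : B k) : ocl (canon x) = ocl x.
Proof. by apply: ocl_eq; rewrite canonK. Qed.

(* Average over the reorderings of siblings *)
Definition Sym k (P : B k -> R) (x : B k) : R := push (@canon _ _ k) P (canon x) / (ocl x)%:R.

Lemma Sym_inv k (P : B k -> R) : inv (Sym P).
Proof. by move=> x y e; rewrite /Sym e (ocl_eq e). Qed.

Lemma push_canon_inv k (P : B k -> R) x : inv P ->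
  push (@canon _ _ k) P (canon x) = P x * (ocl x)%:R.
Proof.
move=> iP; rewrite /push (eq_bigr (fun=> P x)); last by move=> y /eqP /iP.
by rewrite sumr_const mulr_natr.
Qed.

Lemma Sym_id k (P : B k -> R) : inv P -> Sym P =1 P.
Proof.
by move=> iP x; rewrite /Sym push_canon_inv// mulfK// lt0r_neq0// ocl_gt0R.
Qed.

Lemma push_canon_im k (P : B k -> R) u : canon u <> u -> push (@canon _ _ k) P u = 0.
Proof.
move=> h; rewrite /push big_pred0// => x; apply/eqP => e; apply: h.
by rewrite -e canonK.
Qed.

Lemma push_canon_Sym k (P : B k -> R) : push (@canon _ _ k) (Sym P) =1 push (@canon _ _ k) P.
Proof.
move=> u; have [e|/eqP h] := eqVneq (canon u) u; last by rewrite !push_canon_im.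
rewrite -e push_canon_inv; last exact: Sym_inv.
by rewrite /Sym divfK// lt0r_neq0// ocl_gt0R.
Qed.

Lemma eq_Sym k (P Q : B k -> R) :
  push (@canon _ _ k) P =1 push (@canon _ _ k) Q -> Sym P =1 Sym Q.
Proof. by move=> e x; rewrite /Sym e. Qed.

Lemma Sym_ge0 k (P : B k -> R) : (forall x, 0 <= P x) -> forall x, 0 <= Sym P x.
Proof. by move=> P0 x; rewrite divr_ge0// push_ge0. Qed.

(** Both sides are sums over classes. Together with [push_canon_Sym], it allows a law to be replaced
    by its symmetrization in any expression that ignores the order of siblings. *)
Lemma sum_class k (P Q : B k -> R) (g : B k -> R) :
  push (@canon _ _ k) P =1 push (@canon _ _ k) Q ->
  (forall x y, canon x = canon y -> g x = g y) ->
  \sum_x P x * g x = \sum_x Q x * g x.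
Proof.
move=> PQ hg.
have h (P' : B k -> R) : \sum_x P' x * g x = \sum_u push (@canon _ _ k) P' u * g u.
  by rewrite sum_push; apply: eq_bigr => x _; congr (_ * _); apply: hg; rewrite canonK.
by rewrite (h P) (h Q); apply: eq_bigr => u _; rewrite PQ.
Qed.

Lemma sum_Sym k (P : B k -> R) : \sum_x Sym P x = \sum_x P x.
Proof.
have := @sum_class k (Sym P) P (fun=> 1) (@push_canon_Sym k P) (fun _ _ _ => erefl).
by under eq_bigr do rewrite mulr1; under [RHS]eq_bigr do rewrite mulr1.
Qed.

(* The edge-biased law restricted to E_(k+1), multiplied by the mean degree [mdeg] *)
Definition Ek k (P : B k.+1 -> R) (ab : B k * B k) : R :=
  \sum_x P x * (count_mem ab (kaps x))%:R.

Lemma sum_Ek k (P : B k.+1 -> R) (g : B k * B k -> R) :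
  \sum_ab Ek P ab * g ab = \sum_x P x * \sum_(ab <- kaps x) g ab.
Proof.
rewrite /Ek; under eq_bigr do rewrite mulr_suml.
rewrite exchange_big /=; apply: eq_bigr => x _.
under eq_bigr do rewrite -mulrA; rewrite -mulr_sumr; congr (_ * _).
elim: (kaps x) => [|ab s ih]; first by rewrite big_nil big1// => ab _; rewrite mul0r.
rewrite big_cons -ih /= (bigD1 ab)//= [in RHS](bigD1 ab)//= eqxx natrD mulrDl mul1r addrA.
congr (_ + _); apply: eq_bigr => cd; rewrite eq_sym => /negbTE ->.
by rewrite add0n.
Qed.

Definition mdeg k (P : B k.+1 -> R) : R := \sum_x P x * (size (kids x))%:R.

Lemma sum_Ek1 k (P : B k.+1 -> R) : \sum_ab Ek P ab = mdeg P.
Proof.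
have := sum_Ek P (fun=> 1).
under eq_bigr do rewrite mulr1; move=> ->; apply: eq_bigr => x _.
by rewrite big_const_seq count_predT size_kaps iter_addr_0.
Qed.

Lemma Ek_ge0 k (P : B k.+1 -> R) : (forall x, 0 <= P x) -> forall ab, 0 <= Ek P ab.
Proof. by move=> P0 ab; apply: sumr_ge0 => x _; rewrite mulr_ge0. Qed.

Definition degB k (x : B k.+1) : 'I_Dl.+1 := Ordinal (size_kids x : (size (kids x) < Dl.+1)%N).

(** [Sigma] for a law on finite trees (see [Sigma_Sig]). Divided by the mean degree, [Ek] is the
    edge-biased law. *)
Definition Sig k (P : B k.+1 -> R) : R :=
  shan P - mdeg P / 2 * shan (fun ab => Ek P ab / mdeg P) - shan (push (@degB k) P).

Definition edge_symm k (E : B k * B k -> R) := forall a b, E (a, b) = E (b, a).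

Lemma push_canon2_Ek k (P Q : B k.+1 -> R) :
  push (@canon _ _ k.+1) P =1 push (@canon _ _ k.+1) Q ->
  push (@canon2 _ _ k) (Ek P) =1 push (@canon2 _ _ k) (Ek Q).
Proof.
move=> PQ u.
have h (P' : B k.+1 -> R) : push (@canon2 _ _ k) (Ek P') u =
    \sum_x P' x * (count (pred1 u \o @canon2 _ _ k) (kaps x))%:R.
  rewrite /push /Ek exchange_big /=; apply: eq_bigr => x _.
  rewrite -mulr_sumr -natr_sum; congr (_ * _%:R).
  elim: (kaps x) => [|c s ih] /=; first by rewrite big1.
  rewrite big_split /= ih; congr (_ + _)%N.
  case: (boolP (canon2 c == u)) => cu.
    by rewrite (bigD1 c)//= eqxx big1// => d /andP[_]; rewrite eq_sym => /negbTE ->.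
  by rewrite big1// => d /eqP du; case: eqP => // cd; rewrite cd du eqxx in cu.
rewrite !h; apply: sum_class => // x y e; congr (_%:R).
exact: count_kaps_canon.
Qed.

End canonical.
End laws.

Section push_inv.
Context {R : realType} {M M' : finType} {Dl : nat}.

Lemma inv_push k k' (phi : B M Dl k -> B M' Dl k') (P : B M Dl k -> R) :
  (forall l i x, phi (sw l i x) = sw l i (phi x)) -> inv P -> inv (push phi P).
Proof.
move=> hphi iP; apply/invP => l i y; rewrite /push.
rewrite (reindex_inj (inv_inj (@swK _ _ l i k)))/=.
apply: eq_big => [x|x _]; first by rewrite hphi (inj_eq (inv_inj (@swK _ _ l i k'))).
by apply: iP; rewrite canon_sw.
Qed.

(** A map that commutes with the exchanges maps classes into classes, so both sides are invariant
    laws with the same law of the class. *)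
Lemma Sym_push k k' (phi : B M Dl k -> B M' Dl k') (P : B M Dl k -> R) :
  (forall l i x, phi (sw l i x) = sw l i (phi x)) ->
  push phi (Sym P) =1 Sym (push phi P).
Proof.
move=> hphi x; rewrite -(Sym_id (inv_push hphi (@Sym_inv _ _ _ _ P))).
apply: eq_Sym => u; rewrite !push_comp.
have hc y : canon (phi y) = canon (phi (canon y)).
  apply: (sw_inv (F := fun y => canon (phi y))); last by rewrite canonK.
  by move=> l i z; rewrite hphi canon_sw.
have h (Q : B M Dl k -> R) : push (@canon _ _ k' \o phi) Q u =
    push ((@canon _ _ k' \o phi) \o @canon _ _ k) Q u.
  by apply: eq_push => y /=; rewrite hc.
rewrite (h (Sym P)) (h P) -[LHS]push_comp -[RHS]push_comp; apply: eq_bigr => y _.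
exact: push_canon_Sym.
Qed.
End push_inv.

Section edge_inv.
Context {R : realType} {M : finType} {Dl : nat}.
Local Notation B := (B M Dl).

Definition kapj k (x : B k.+1) (j : nat) : B k * B k :=
  (nth (lf k x.1) (kids x) j, tr (nd x.1 (rem_at j (kids x)))).

Lemma kapsE k (x : B k.+1) : kaps x = [seq kapj x j | j <- iota 0 (size (kids x))].
Proof. by rewrite /kaps (picksE (lf k x.1)) -map_comp. Qed.

(** Splitting the count by the position [j] of the offspring lets changes of variables act at a
    fixed position. *)
Lemma EkE k (P : B k.+1 -> R) ab :
  Ek P ab = \sum_(j < Dl) \sum_(x | (j < size (kids x))%N && (kapj x j == ab)) P x.
Proof.
rewrite /Ek; under [RHS]eq_bigr do rewrite big_mkcond.
rewrite exchange_big; apply: eq_bigr => x _ /=.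
rewrite -big_mkcond /= sumr_const mulr_natr; congr (_ *+ _).
rewrite kapsE count_map -sum1_card -sum1_count big_mkcond [RHS]big_mkcond /=.
rewrite -[X in iota 0 X]subn0 -[iota 0 _]/(index_iota 0 (size (kids x))).
rewrite [LHS](big_nat_widen _ _ Dl) ?size_kids// big_mkord.
rewrite [LHS]big_mkcond.
by apply: eq_bigr => j _; rewrite unfold_in; case: ltnP; case: eqP.
Qed.

Lemma size_remS (T : eqType) j (s : seq T) : (j < size s)%N -> (size (rem_at j s)).+1 = size s.
Proof. by move=> js; rewrite size_rem_at// prednK//; apply: leq_trans js. Qed.

Definition ins_at (T : eqType) j (c : T) (s : seq T) := take j s ++ c :: drop j s.

Lemma ins_rem (T : eqType) x0 j (s : seq T) : (j < size s)%N ->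
  ins_at j (nth x0 s j) (rem_at j s) = s.
Proof.
move=> js; rewrite /ins_at /rem_at take_size_cat ?size_takel ?(ltnW js)//.
by rewrite drop_size_cat ?size_takel ?(ltnW js)// -drop_nth// cat_take_drop.
Qed.

Lemma rem_ins (T : eqType) j (c : T) s : (j <= size s)%N -> rem_at j (ins_at j c s) = s.
Proof.
move=> js; rewrite /ins_at /rem_at take_size_cat ?size_takel//.
by rewrite -cat_rcons drop_size_cat ?size_rcons ?size_takel// cat_take_drop.
Qed.

Lemma nth_ins (T : eqType) x0 j (c : T) s : (j <= size s)%N -> nth x0 (ins_at j c s) j = c.
Proof. by move=> js; rewrite /ins_at nth_cat size_takel// ltnn subnn. Qed.

Lemma size_ins (T : eqType) j (c : T) s : size (ins_at j c s) = (size s).+1.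
Proof. by rewrite /ins_at size_cat /= addnS -size_cat cat_take_drop. Qed.

Lemma perm_ins (T : eqType) j (c : T) s : perm_eq (ins_at j c s) (c :: s).
Proof. by rewrite /ins_at -cat1s perm_catCA cat_take_drop. Qed.

(** An exchange in the tree deprived of its branch [j], which is then put back in its place. On
    [kapj x j] it acts on the second component alone, just as an exchange inside the branch [j] acts
    on the first alone. *)
Let op k j l i (x : B k.+1) : B k.+1 :=
  if (j < size (kids x))%N then
    nd x.1 (ins_at j (nth (lf k x.1) (kids x) j)
                     (kids (sw l i (nd x.1 (rem_at j (kids x))))))
  else x.

Let size_rem k j (x : B k.+1) : (j < size (kids x))%N -> (size (rem_at j (kids x)) <= Dl)%N.
Proof. by move=> js; apply: ltnW; rewrite (size_remS js) size_kids. Qed.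

Let size_sw l i k (x : B k.+1) : size (kids (sw l i x)) = size (kids x).
Proof. by rewrite kids_sw; case: l => [|j l]; rewrite ?size_swl ?size_upd. Qed.

Let kids_op k j l i (x : B k.+1) : (j < size (kids x))%N ->
  kids (op j l i x) = ins_at j (nth (lf k x.1) (kids x) j)
                     (kids (sw l i (nd x.1 (rem_at j (kids x))))).
Proof.
move=> js; rewrite /op js kids_nd// size_ins size_sw kids_nd ?size_rem//.
by rewrite (size_remS js) size_kids.
Qed.

Let le_j k j l i (x : B k.+1) : (j < size (kids x))%N ->
  (j <= size (kids (sw l i (nd x.1 (rem_at j (kids x))))))%N.
Proof. by move=> js; rewrite size_sw kids_nd ?size_rem// -ltnS (size_remS js). Qed.

Let size_op k j l i (x : B k.+1) : size (kids (op j l i x)) = size (kids x).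
Proof.
case js : (j < size (kids x))%N; last by rewrite /op js.
by rewrite kids_op// size_ins size_sw kids_nd ?size_rem// (size_remS js).
Qed.

Let opK k j l i : involutive (@op k j l i).
Proof.
move=> x; case js : (j < size (kids x))%N; last by rewrite {2}/op js /op js.
have e1 : (op j l i x).1 = x.1 by rewrite /op js.
apply: B_eq; first by rewrite {1}/op size_op js /= e1.
rewrite kids_op ?size_op// e1 kids_op// nth_ins ?le_j// rem_ins ?le_j//.
have := nd_kids (sw l i (nd x.1 (rem_at j (kids x)))); rewrite sw1 /= => ->.
by rewrite swK kids_nd ?size_rem// ins_rem.
Qed.

Let canon_op k j l i (x : B k.+1) : canon (op j l i x) = canon x.
Proof.
case js : (j < size (kids x))%N; last by rewrite /op js.
apply/canonP; split; first by rewrite /op js.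
rewrite kids_op//; apply: (perm_trans (perm_map _ (perm_ins _ _ _))).
rewrite -[in X in perm_eq _ (map _ X)](ins_rem (lf k x.1) js).
rewrite perm_sym; apply: (perm_trans (perm_map _ (perm_ins _ _ _))).
rewrite /= perm_cons -[in X in perm_eq (map _ X)](@kids_nd _ _ _ x.1 (rem_at j (kids x))) ?size_rem//.
by rewrite perm_sym; apply: perm_kids_canon; exact: canon_sw.
Qed.

Let kapj_op k j l i (x : B k.+1) : (j < size (kids x))%N ->
  kapj (op j l i x) j = ((kapj x j).1, sw l i (kapj x j).2).
Proof.
move=> js; have e1 : (op j l i x).1 = x.1 by rewrite /op js.
rewrite /kapj e1 kids_op// nth_ins ?le_j// rem_ins ?le_j//.
have := nd_kids (sw l i (nd x.1 (rem_at j (kids x)))); rewrite sw1 /= => ->.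
by rewrite tr_sw.
Qed.

Lemma nth_upd (T : eqType) (x0 : T) f j s : (j < size s)%N -> nth x0 (upd j f s) j = f (nth x0 s j).
Proof. by elim: j s => [|j ih] [|a s] //=; exact: ih. Qed.

Lemma rem_upd (T : eqType) (f : T -> T) j s : rem_at j (upd j f s) = rem_at j s.
Proof. by rewrite /rem_at; elim: j s => [|j ih] [|a s] //=; rewrite ih. Qed.

(** A reordering of [x] may move both components of [kapj x j]. The changes of variables
    [sw (j :: l) i] and [op j l i] move one component each and preserve [P]. *)
Lemma Ek_inv k (P : B k.+1 -> R) a b a' b' : inv P ->
  canon a = canon a' -> canon b = canon b' -> Ek P (a, b) = Ek P (a', b').
Proof.
move=> iP aa bb; transitivity (Ek P (a', b)).
  move: a a' aa; apply: (sw_inv (F := fun a => Ek P (a, b))) => l i a.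
  rewrite !EkE; apply: eq_bigr => j _.
  rewrite (reindex_inj (inv_inj (@swK _ _ (val j :: l) i k.+1)))/=.
  apply: eq_big => [x|x _]; last by apply: iP; exact: (canon_sw (_ :: _)).
  rewrite kids_sw size_upd.
  case: ltnP => //= jx; rewrite /kapj kids_sw sw1 rem_upd nth_upd// !xpair_eqE.
  by rewrite (inj_eq (inv_inj (@swK _ _ l i k))).
move: b b' bb; apply: (sw_inv (F := fun b => Ek P (a', b))) => l i b.
rewrite !EkE; apply: eq_bigr => j _.
rewrite (reindex_inj (inv_inj (@opK k (val j) l i)))/=.
apply: eq_big => [x|x _]; last by apply: iP; exact: canon_op.
rewrite size_op; case: ltnP => //= jx; rewrite kapj_op// !xpair_eqE/=.
by rewrite (inj_eq (inv_inj (@swK _ _ l i k))).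
Qed.

Lemma Ek_inv_canon2 k (P : B k.+1 -> R) ab : inv P ->
  Ek P ab = push (@canon2 _ _ k) (Ek P) (canon2 ab) / ((ocl ab.1)%:R * (ocl ab.2)%:R).
Proof.
move=> iP; rewrite /push (eq_bigr (fun=> Ek P ab)); last first.
  by move=> [c d] /eqP[e1 e2]; case: ab e1 e2 => a b /= ? ?; exact: Ek_inv.
rewrite sumr_const -[X in _ *+ X]/(#|_|).
have -> : #|[pred c : B k * B k | canon2 c == canon2 ab]| = (ocl ab.1 * ocl ab.2)%N.
  rewrite -cardX; apply: eq_card => -[c d]; rewrite !inE /= /canon2 xpair_eqE.
  by [].
rewrite -(mulr_natr (Ek P ab)) natrM mulfK// mulf_neq0// lt0r_neq0// ocl_gt0R//.
Qed.

Lemma edge_symm_inv k (P : B k.+1 -> R) : inv P ->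
  edge_symm (push (@canon2 _ _ k) (Ek P)) -> edge_symm (Ek P).
Proof.
move=> iP h a b; rewrite (Ek_inv_canon2 (a, b))// (Ek_inv_canon2 (b, a))//.
by rewrite /canon2 /= h [X in _ / X]mulrC.
Qed.
End edge_inv.

Lemma sum_picks (R : realType) (T : eqType) (f : T -> R) (s : seq T) :
  \sum_(b <- picks s) f b.1 = \sum_(c <- s) f c.
Proof.
elim: s => [|a s ih]; first by rewrite !big_nil.
by rewrite /= !big_cons big_map /= ih.
Qed.

(** * Entropy of a law of types against that of its symmetrization *)

Section star.
Context {R : realType} {M : finType} {Dl : nat}.
Local Notation B := (B M Dl).

(** The order at the root is kept, because the half-edges at a vertex are labeled. It is forgotten
    below, so that half-edges are matched according to the classes of their branches. *)
Definition star k (x : B k.+1) : B k.+1 := nd x.1 (map (@canon _ _ k) (kids x)).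

Lemma kids_star k (x : B k.+1) : kids (star x) = map (@canon _ _ k) (kids x).
Proof. by rewrite kids_nd// size_map size_kids. Qed.

Lemma star_canon k (x : B k.+1) : canon (star x) = canon x.
Proof.
apply/canonP; split=> //; rewrite kids_star -map_comp.
by rewrite (eq_map (fun c => canonK c : (_ \o _) c = _)).
Qed.

Lemma star_star k (x : B k.+1) : star (star x) = star x.
Proof.
apply: B_eq => //; rewrite !kids_star -map_comp.
by rewrite (eq_map (fun c => canonK c : (_ \o _) c = _)).
Qed.

(** The branches at the root can be replaced independently by members of their classes. *)
Lemma star_fiber k (x : B k.+1) :
  (\prod_(c <- kids x) ocl c <= #|[pred y | star y == star x]|)%N.
Proof.
set n := size (kids x); pose x0 : B k := lf k x.1.
pose F (i : 'I_n) : pred (B k) := [pred y | canon y == canon (nth x0 (kids x) i)].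
have -> : (\prod_(c <- kids x) ocl c = #|family F|)%N.
  rewrite card_family (big_nth x0) big_mkord -/n.
  rewrite foldrE big_map big_enum /=; apply: eq_bigr => i _.
  exact: eq_card.
pose h (g : {ffun 'I_n -> B k}) : B k.+1 := nd x.1 [seq g i | i <- enum 'I_n].
have szh (g : {ffun 'I_n -> B k}) : size [seq g i | i <- enum 'I_n] = n.
  by rewrite size_map size_enum_ord.
have kh (g : {ffun 'I_n -> B k}) : kids (h g) = [seq g i | i <- enum 'I_n].
  by rewrite kids_nd// szh size_kids.
have hinj : injective h.
  have hk g (i : 'I_n) : nth x0 (kids (h g)) i = g i.
    by rewrite kh (nth_map i) ?size_enum_ord// nth_ord_enum.
  by move=> g g' e; apply/ffunP => i; rewrite -!hk e.
rewrite -(fintype.card_image hinj); apply/fintype.subset_leq_card/fintype.subsetP => y /fintype.imageP[g gF ->].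
rewrite inE; apply/eqP/B_eq => //; rewrite !kids_star kh.
have szg : size [seq (g : {ffun 'I_n -> B k}) i | i <- enum 'I_n] = n by rewrite size_map size_enum_ord.
apply: (@eq_from_nth _ x0); first by rewrite [LHS]size_map [RHS]size_map.
move=> i; rewrite [size _]size_map szg => ni.
rewrite [LHS](nth_map x0) ?szg// [RHS](nth_map x0)//.
rewrite (nth_map (Ordinal ni)) ?size_enum_ord//.
move/familyP: gF => /(_ (nth (Ordinal ni) (enum 'I_n) i)); rewrite inE => /eqP ->.
by rewrite nth_enum_ord.
Qed.

(** Let [lo x] be the sum of the logarithms of the class sizes of the branches at the root. Passing
    from [star] to ordered trees, the entropy of the tree gains at least the mean of [lo] ([H1]).
    The edge entropy gains the mean logarithm of the class sizes at both ends, which by edge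
    symmetry is 2/d times the mean of [lo], with d the mean degree ([H2]). The factor d/2 makes the
    gains cancel. *)
Lemma Sig_star_le k (P L : B k.+1 -> R) :
  inv P -> (forall x, 0 <= L x) -> 0 < mdeg L ->
  push (@canon _ _ k.+1) P =1 push (@canon _ _ k.+1) L ->
  edge_symm (push (@canon2 _ _ k) (Ek L)) ->
  shan (push (@star k) L) - mdeg L / 2 * shan (fun ab => push (@canon2 _ _ k) (Ek L) ab / mdeg L)
    - shan (push (@degB _ _ k) L) <= Sig P.
Proof.
move=> iP L0 d0 PL symE.
have P0 x : 0 <= P x.
  rewrite -(Sym_id iP) /Sym divr_ge0// PL; exact: push_ge0.
have dPL : mdeg P = mdeg L.
  by apply: sum_class => // x y /size_canon ->.
have degPL : shan (push (@degB _ _ k) P) = shan (push (@degB _ _ k) L).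
  apply: eq_bigr => j _; congr eta.
  have h (Q : B k.+1 -> R) : push (@degB _ _ k) Q j = \sum_x Q x * (degB x == j)%:R.
    by rewrite /push big_mkcond; apply: eq_bigr => x _; case: (_ == _); rewrite ?mulr1 ?mulr0.
  rewrite !h; apply: sum_class => // x y /size_canon e; congr (_%:R).
  by congr (nat_of_bool (_ == _)); apply/val_inj; exact: e.
set lo := fun x : B k.+1 => \sum_(c <- kids x) ln (ocl c)%:R : R.
have lo_class x y : canon x = canon y -> lo x = lo y.
  move=> /perm_kids_canon p.
  have h z : lo z = \sum_(c <- map (@canon _ _ k) (kids z)) ln (ocl c)%:R.
    by rewrite big_map; apply: eq_bigr => c _; rewrite ocl_canon.
  by rewrite h [RHS]h; exact: perm_big.
have expro x : expR (lo x) = (\prod_(c <- kids x) ocl c)%N%:R.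
  by rewrite expR_sum natr_prod; apply: eq_bigr => c _; rewrite lnK// posrE ocl_gt0R.
have H1 : shan (push (@star k) L) + \sum_x L x * lo x <= shan P.
  (* By [star_fiber] this is at most the mass that [P] gives to the fiber of [s], so the total mass
     is controlled; and the logarithm of [w (star x)] is that of [P x] plus [lo x], which is the
     gain sought. *)
  pose w s := if star s == s then P s * expR (lo s) else 0.
  have wE x : w (star x) = P x * expR (lo x).
    rewrite /w star_star eqxx (iP _ _ (star_canon x)).
    by rewrite (lo_class _ _ (star_canon x)).
  have Lpos x : 0 < L x -> 0 < P x.
    move=> Lx; rewrite -(Sym_id iP) /Sym divr_gt0 ?ocl_gt0R// PL.
    by apply: lt_le_trans Lx _; exact: push_ge.
  have h : shan (push (@star k) L) <= - \sum_s push (@star k) L s * ln (w s).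
    apply: gibbs.
    - exact: push_ge0.
    - by move=> s; rewrite /w; case: ifP => // _; rewrite mulr_ge0// expR_ge0.
    - move=> s Ls; have [x /eqP xs Lx] : exists2 x, star x == s & 0 < L x.
        apply: contrapT => hn; move: Ls; rewrite /push big1 ?ltxx// => x xs.
        apply/eqP/negPn/negP => Lx; apply: hn; exists x => //.
        by rewrite lt_neqAle eq_sym Lx L0.
      by rewrite -xs wE mulr_gt0 ?expR_gt0// Lpos.
    - rewrite push_sum1.
      have -> : \sum_x L x = \sum_x P x.
        have := @sum_class _ _ _ _ P L (fun=> 1) PL (fun _ _ _ => erefl).
        by under eq_bigr do rewrite mulr1; under [RHS]eq_bigr do rewrite mulr1.
      rewrite -(push_sum1 (@star k) P); apply: ler_sum => s _; rewrite /w.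
      case: eqP => [e|_]; last exact: push_ge0.
      rewrite /push (eq_bigr (fun=> P s)); last first.
        by move=> x /eqP xs; apply: iP; rewrite -[RHS]star_canon e -xs star_canon.
      rewrite sumr_const -[P s *+ _]mulr_natr expro; apply: ler_wpM2l => //.
      by rewrite ler_nat; have := star_fiber s; rewrite e.
  have -> : shan P = - \sum_x L x * ln (P x).
    rewrite /shan /eta sumrN; congr (- _).
    by apply: sum_class => // x y /iP ->.
  rewrite sum_push in h; rewrite -lerBrDr; apply: le_trans h _.
  rewrite -opprD lerN2 -big_split/=.
  apply: ler_sum => x _; rewrite -mulrDr wE.
  have := L0 x; rewrite le_eqVlt => /orP[/eqP <-|Lx]; first by rewrite !mul0r.
  by rewrite lnM ?posrE ?expR_gt0 ?Lpos// expRK.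
have EPL := push_canon2_Ek PL.
set E := push (@canon2 _ _ k) (Ek L) in symE *.
have E0 ab : 0 <= E ab by apply: push_ge0; exact: Ek_ge0.
have sE : \sum_ab E ab = mdeg L by rewrite push_sum1 sum_Ek1.
have H2 : shan (fun ab => Ek P ab / mdeg P) <=
    shan (fun ab => E ab / mdeg L) + 2 / mdeg L * \sum_x L x * lo x.
  rewrite dPL.
  pose v ab := Ek P ab / mdeg L.
  have vE ab : v ab = E (canon2 ab) / mdeg L / ((ocl ab.1)%:R * (ocl ab.2)%:R).
    by rewrite /v Ek_inv_canon2// EPL mulrAC.
  have -> : shan (fun ab => Ek P ab / mdeg L) =
      - \sum_ab v ab * ln (E (canon2 ab) / mdeg L)
      + \sum_ab v ab * (ln (ocl ab.1)%:R + ln (ocl ab.2)%:R).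
    rewrite -sumrN -big_split/=; apply: eq_bigr => ab _; rewrite /eta -/(v ab).
    have : 0 <= v ab by rewrite divr_ge0 ?(ltW d0)//; exact: Ek_ge0.
    rewrite le_eqVlt => /orP[/eqP <-|va]; first by rewrite !mul0r oppr0 addr0.
    have o12 : 0 < (ocl ab.1)%:R * (ocl ab.2)%:R :> R by rewrite mulr_gt0// ocl_gt0R.
    have E1 : 0 < E (canon2 ab) / mdeg L.
      by move: va; rewrite vE pmulr_lgt0 ?invr_gt0.
    have -> : ln (ocl ab.1)%:R + ln (ocl ab.2)%:R = ln ((ocl ab.1)%:R * (ocl ab.2)%:R) :> R.
      by rewrite lnM ?posrE ?ocl_gt0R.
    by rewrite {2}vE ln_div ?posrE// mulrBr opprB addrC.
  apply: lerD.
    rewrite /v; under eq_bigr do rewrite mulrAC -mulrA.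
    have := sum_push (@canon2 _ _ k) (Ek P) (fun ab => (mdeg L)^-1 * ln (E ab / mdeg L)).
    under [X in X = _ -> _]eq_bigr do rewrite EPL -/E mulrA.
    under [X in _ = X -> _]eq_bigr do rewrite [_^-1 * _]mulrC.
    move=> <-; rewrite -sumrN le_eqVlt; apply/orP; left; apply/eqP.
    by apply: eq_bigr => ab _.
  rewrite le_eqVlt; apply/orP; left; apply/eqP.
  have -> : \sum_ab v ab * (ln (ocl ab.1)%:R + ln (ocl ab.2)%:R) =
     (mdeg L)^-1 * \sum_ab E ab * (ln (ocl ab.1)%:R + ln (ocl ab.2)%:R).
    rewrite sum_push mulr_sumr.
    have := sum_push (@canon2 _ _ k) (Ek P) (fun ab => ln (ocl ab.1)%:R + ln (ocl ab.2)%:R : R).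
    under [X in X = _ -> _]eq_bigr do rewrite EPL.
    rewrite sum_push => h; rewrite -mulr_sumr h mulr_sumr; apply: eq_bigr => ab _.
    by rewrite /v /= !ocl_canon mulrA [_^-1 * _]mulrC.
  under eq_bigr do rewrite mulrDr.
  rewrite big_split/=.
  (* Edge symmetry enters here: both ends contribute equally. *)
  have -> : \sum_ab E ab * ln (ocl ab.2)%:R = \sum_ab E ab * ln (ocl ab.1)%:R.
    rewrite (reindex_inj (h := fun ab => (ab.2, ab.1))); last by move=> [a b] [c d] [-> ->].
    by apply: eq_bigr => -[a b] _ /=; rewrite symE.
  have -> : \sum_ab E ab * ln (ocl ab.1)%:R = \sum_x L x * lo x.
    rewrite sum_push; under eq_bigr do rewrite ocl_canon.
    rewrite (sum_Ek L (fun ab => ln (ocl ab.1)%:R)); apply: eq_bigr => x _; congr (_ * _).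
    by rewrite /kaps big_map /lo (sum_picks (fun c => ln (ocl c)%:R)).
  by lra.
rewrite /Sig degPL dPL; rewrite dPL in H2.
have := ler_wpM2l (ltW (divr_gt0 d0 (ltr0Sn R 1))) H2.
rewrite mulrDr mulrA.
have -> : mdeg L / 2 * (2 / mdeg L) = 1.
  by rewrite mulrA -(mulrA (mdeg L)) mulVf ?mulr1 ?divff ?lt0r_neq0.
by rewrite mul1r => h; lra.
Qed.
End star.

(** * Conditional independence and the entropy of Markov laws *)

Section submodularity.
Context {R : realType} {U V : finType} (f : U -> V).

(** Strong subadditivity of the entropy. The weight [w] makes the two coordinates independent given
    their images by [f], and Gibbs' inequality compares [e] with it. *)
Lemma shan_submod (e : U * U -> R) : (forall x, 0 <= e x) ->
  shan e + shan (push (fun xy => (f xy.1, f xy.2)) e) <=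
  shan (push (fun xy => (xy.1, f xy.2)) e) + shan (push (fun xy => (f xy.1, xy.2)) e).
Proof.
move=> e0; set e12 := push (fun xy => (f xy.1, f xy.2)) e.
set e1 := push (fun xy => (xy.1, f xy.2)) e; set e2 := push (fun xy => (f xy.1, xy.2)) e.
have g12 z : 0 <= e12 z by exact: push_ge0.
have g1 z : 0 <= e1 z by exact: push_ge0.
have g2 z : 0 <= e2 z by exact: push_ge0.
pose w xy := e1 (xy.1, f xy.2) * e2 (f xy.1, xy.2) / e12 (f xy.1, f xy.2).
have pos x : 0 < e x -> [/\ 0 < e1 (x.1, f x.2), 0 < e2 (f x.1, x.2) & 0 < e12 (f x.1, f x.2)].
  move=> ex; split; apply: lt_le_trans ex _.
  - exact: (push_ge (fun xy => (xy.1, f xy.2)) x e0).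
  - exact: (push_ge (fun xy => (f xy.1, xy.2)) x e0).
  - exact: (push_ge (fun xy => (f xy.1, f xy.2)) x e0).
have sm1 z z' : \sum_(x | f x == z) e1 (x, z') = e12 (z, z').
  rewrite /e1 /push (exchange_big_dep (fun xy => (f xy.1 == z) && (f xy.2 == z')))/=; last first.
    by move=> x [a b] /eqP <- /eqP[-> ->]; rewrite !eqxx.
  rewrite /e12 /push; apply: eq_big => [[a b]|[a b] /= /andP[/eqP az /eqP bz]]; first by rewrite xpair_eqE.
  rewrite (big_pred1 a)// => x; rewrite !xpair_eqE /= bz eqxx andbT [a == x]eq_sym.
  by case: (x =P a) => [->|]; rewrite ?az ?eqxx ?andbF.
have sm2 z z' : \sum_(y | f y == z') e2 (z, y) = e12 (z, z').
  rewrite /e2 /push (exchange_big_dep (fun xy => (f xy.1 == z) && (f xy.2 == z')))/=; last first.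
    by move=> x [a b] /eqP <- /eqP[-> ->]; rewrite !eqxx.
  rewrite /e12 /push; apply: eq_big => [[a b]|[a b] /= /andP[/eqP az /eqP bz]]; first by rewrite xpair_eqE.
  rewrite (big_pred1 b)// => x; rewrite !xpair_eqE /= az eqxx /= [b == x]eq_sym.
  by case: (x =P b) => [->|]; rewrite ?bz ?eqxx ?andbF.
have sw' : \sum_xy w xy <= \sum_xy e xy.
  rewrite -(push_sum1 (fun xy => (f xy.1, f xy.2)) e) -/e12.
  rewrite (partition_big (fun xy => (f xy.1, f xy.2)) predT)//=.
  apply: ler_sum => -[z z'] _.
  rewrite (eq_bigr (fun xy => e1 (xy.1, z') * e2 (z, xy.2) / e12 (z, z'))); last first.
    by move=> [x y] /eqP[<- <-].
  rewrite -mulr_suml (eq_bigl (fun xy : U * U => (f xy.1 == z) && (f xy.2 == z'))); last first.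
    by move=> [x y]; rewrite xpair_eqE.
  rewrite -(pair_big (fun x => f x == z) (fun y => f y == z') (fun x y => e1 (x, z') * e2 (z, y)))/=.
  under eq_bigr do rewrite -mulr_sumr sm2.
  rewrite -mulr_suml sm1; have := g12 (z, z'); rewrite le_eqVlt => /orP[/eqP <-|h].
    by rewrite !mul0r.
  by rewrite mulfK// lt0r_neq0.
have := gibbs e0 _ _ sw'; rewrite -lerBrDr; move=> h; apply: le_trans (h _ _) _.
- by move=> x; rewrite divr_ge0// mulr_ge0.
- by move=> x /pos[p1 p2 p3]; rewrite divr_gt0// mulr_gt0.
have s1 : shan e1 = - \sum_x e x * ln (e1 (x.1, f x.2)).
  by rewrite /shan /eta sumrN (sum_push _ _ (fun u => ln (e1 u))).
have s2 : shan e2 = - \sum_x e x * ln (e2 (f x.1, x.2)).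
  by rewrite /shan /eta sumrN (sum_push _ _ (fun u => ln (e2 u))).
have s12 : shan e12 = - \sum_x e x * ln (e12 (f x.1, f x.2)).
  by rewrite /shan /eta sumrN (sum_push _ _ (fun u => ln (e12 u))).
have -> : \sum_x e x * ln (w x) = \sum_x e x * ln (e1 (x.1, f x.2)) +
    \sum_x e x * ln (e2 (f x.1, x.2)) - \sum_x e x * ln (e12 (f x.1, f x.2)).
  rewrite -big_split -sumrB; apply: eq_bigr => x _ /=.
  have := e0 x; rewrite le_eqVlt => /orP[/eqP <-|/pos[p1 p2 p3]]; first by rewrite !mul0r; lra.
  rewrite /w ln_div ?posrE ?mulr_gt0// lnM ?posrE//; lra.
by rewrite s1 s2 s12; lra.
Qed.
End submodularity.

Section markov.
Context {R : realType} {M : finType} {Dl k : nat}.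
Local Notation B := (B M Dl).
Variable P : B k.+2 -> R.
Hypothesis P0 : forall x, 0 <= P x.
Hypothesis iP : inv P.
Hypothesis mkP : forall m m' (b b' : B k.+1) (s s' : seq (B k.+1)),
  (size s < Dl)%N -> (size s' < Dl)%N ->
  tr b = tr b' -> tr (tr (nd m s : B k.+2)) = tr (tr (nd m' s' : B k.+2)) ->
  P (nd m (b :: s)) * P (nd m' (b' :: s')) = P (nd m (b' :: s)) * P (nd m' (b :: s')).

Let Eh := push (fun ab : B k.+1 * B k.+1 => (ab.1, tr ab.2)) (Ek P).
Let Et := push (fun ab : B k.+1 * B k.+1 => (tr ab.1, tr ab.2)) (Ek P).
(** Conditional law of a branch given its truncation and the truncated rest of the tree; it is 0
    where the denominator vanishes. *)
Let K (b : B k.+1) (z : B k) := Eh (b, z) / Et (tr b, z).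
Let zz (m : M) (s : seq (B k.+1)) : B k := tr (tr (nd m s : B k.+2)).

Let EpE (T : finType) (g : B k.+1 * B k.+1 -> T) c :
  push g (Ek P) c = \sum_(j < Dl) \sum_(x | (j < size (kids x))%N && (g (kapj x j) == c)) P x.
Proof.
rewrite /push; under eq_bigr do rewrite EkE.
rewrite exchange_big /=; apply: eq_bigr => j _.
rewrite (exchange_big_dep (fun x => (j < size (kids x))%N && (g (kapj x j) == c)))/=; last first.
  by move=> ab x /eqP <- /andP[-> /eqP ->] /=.
apply: eq_bigr => x /andP[jx /eqP gx].
rewrite (big_pred1 (kapj x j))// => ab; rewrite jx /= [kapj x j == ab]eq_sym.
by case: (ab =P kapj x j) => [->|_]; rewrite ?gx ?eqxx ?andbF.
Qed.

Let front (x : B k.+2) j : (j < size (kids x))%N ->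
  P x = P (nd x.1 (nth (lf k.+1 x.1) (kids x) j :: rem_at j (kids x))).
Proof.
move=> jx; apply: iP; apply/canonP; split=> //.
rewrite kids_nd /=; last by rewrite (size_remS jx) size_kids.
rewrite -[in X in perm_eq X](ins_rem (lf k.+1 x.1) jx).
exact: (perm_map _ (perm_ins _ _ _)).
Qed.

Let size_rem (x : B k.+2) j : (j < size (kids x))%N -> (size (rem_at j (kids x)) < Dl)%N.
Proof. by move=> jx; rewrite (size_remS jx) size_kids. Qed.

Let swap_child (G : M -> seq (B k.+1) -> R) (b b' : B k.+1) j (A : M -> seq (B k.+1) -> bool) :
  \sum_(x : B k.+2 | [&& (j < size (kids x))%N, nth (lf k.+1 x.1) (kids x) j == b' & A x.1 (rem_at j (kids x))])
     G x.1 (rem_at j (kids x)) =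
  \sum_(x : B k.+2 | [&& (j < size (kids x))%N, nth (lf k.+1 x.1) (kids x) j == b & A x.1 (rem_at j (kids x))])
     G x.1 (rem_at j (kids x)).
Proof.
pose h (x : B k.+2) : B k.+2 := nd x.1 (upd j (tperm b b') (kids x)).
have kh x : kids (h x) = upd j (tperm b b') (kids x) by rewrite kids_nd// size_upd size_kids.
have hK : involutive h.
  move=> x; apply: B_eq => //; rewrite !kh; apply: updK; exact: tpermK.
rewrite (reindex_inj (inv_inj hK))/=; apply: eq_big => [x|x _]; last by rewrite kh rem_upd.
rewrite kh size_upd rem_upd; case: ltnP => //= jx.
by rewrite nth_upd// -[X in _ == X](tpermL b b') (inj_eq perm_inj).
Qed.

(** The exchange identity [mkP] summed over all trees with a distinguished branch, whose masses add
    up to the edge marginals. [swap_child] is the bijection that replaces the distinguished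
    branch. *)
Let exch (m : M) (b : B k.+1) s : (size s < Dl)%N ->
  P (nd m (b :: s)) * Et (tr b, zz m s) =
  (\sum_(b' | tr b' == tr b) P (nd m (b' :: s))) * Eh (b, zz m s).
Proof.
move=> sD; rewrite /Et /Eh !EpE !mulr_sumr; apply: eq_bigr => j _ /=.
rewrite mulr_sumr (partition_big (fun x : B k.+2 => nth (lf k.+1 x.1) (kids x) j) (fun b' => tr b' == tr b))/=; last first.
  by move=> x /andP[_ /eqP[-> _]].
rewrite mulr_suml; apply: eq_bigr => b' /eqP bb'.
transitivity (\sum_(x : B k.+2 | [&& (j < size (kids x))%N, nth (lf k.+1 x.1) (kids x) j == b' & zz x.1 (rem_at j (kids x)) == zz m s])
     P (nd m (b' :: s)) * P (nd x.1 (b :: rem_at j (kids x)))).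
  apply: eq_big => [x|x /andP[/andP[jx /eqP[_ e2]] /eqP e1]].
    rewrite (@xpair_eqE (B k) (B k)); case: ltnP => //= jx.
    by case: (nth (nd x.1 [::]) (kids x) j =P b') => [->|_]; rewrite ?bb' ?eqxx ?andbT ?andbF.
  by rewrite (front jx) e1; apply: mkP => //; exact: size_rem.
rewrite -mulr_sumr; congr (_ * _).
rewrite (swap_child (fun m s => P (nd m (b :: s))) b b' j (fun m' s' => zz m' s' == zz m s)).
apply: eq_big => [x|x /and3P[jx /eqP e1 _]]; first by rewrite (@xpair_eqE (B k.+1) (B k)).
by rewrite (front jx) e1.
Qed.

Let le_Et (x : B k.+2) j : (j < size (kids x))%N ->
  P x <= Et (tr (nth (lf k.+1 x.1) (kids x) j), zz x.1 (rem_at j (kids x))).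
Proof.
move=> jx; rewrite /Et EpE.
have jD : (j < Dl)%N by apply: leq_trans jx (size_kids x).
rewrite (bigD1 (Ordinal jD))//= (bigD1 x) /=; last by rewrite jx /kapj /zz /= eqxx.
by rewrite -addrA lerDl addr_ge0// sumr_ge0// => i _; rewrite sumr_ge0.
Qed.

Let step m (b : B k.+1) s : (size s < Dl)%N ->
  P (nd m (b :: s)) = K b (zz m s) * \sum_(b' | tr b' == tr b) P (nd m (b' :: s)).
Proof.
move=> sD; have ex := exch m b sD.
have : 0 <= Et (tr b, zz m s).
  by apply: push_ge0; exact: Ek_ge0.
rewrite /K le_eqVlt => /orP[/eqP e0|e0]; last first.
  by apply: (mulIf (lt0r_neq0 e0)); rewrite ex mulrAC divfK ?lt0r_neq0// mulrC.
(* Here [K] is 0 by convention, and [le_Et] bounds the left-hand side by [Et], which vanishes. *)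
rewrite -e0 invr0 mulr0 mul0r; apply/eqP; rewrite eq_le P0 andbT.
have k1 : kids (nd m (b :: s) : B k.+2) = b :: s by rewrite kids_nd.
have := @le_Et (nd m (b :: s)) 0; rewrite k1 => /(_ isT) /=.
by rewrite /rem_at /= drop0 -e0.
Qed.

Let stepm m pre (b : B k.+1) s : (size (pre ++ b :: s) <= Dl)%N ->
  P (nd m (pre ++ b :: s)) = K b (zz m (pre ++ s)) * \sum_(b' | tr b' == tr b) P (nd m (pre ++ b' :: s)).
Proof.
move=> sD; have sD' : (size (pre ++ s) < Dl)%N by move: sD; rewrite !size_cat /= addnS.
have h b' : P (nd m (pre ++ b' :: s)) = P (nd m (b' :: (pre ++ s))).
  apply: iP; apply/canonP; split=> //; rewrite !kids_nd//; last by move: sD; rewrite !size_cat.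
  by rewrite -cat1s perm_map// perm_catCA.
by rewrite h step//; congr (_ * _); apply: eq_bigr => b' _; rewrite h.
Qed.

Let zz_tr m (s s' : seq (B k.+1)) : (size s <= Dl)%N -> (size s' <= Dl)%N ->
  map (@tr _ _ k) s = map (@tr _ _ k) s' -> zz m s = zz m s'.
Proof. by move=> sD sD' e; rewrite /zz [X in tr X]trS [X in _ = tr X]trS !kids_nd// e. Qed.

(** Mass of the trees whose first branches are [pre] and whose other branches are known through
    their truncations only. [Kp] is the product of the kernels that restore these branches one by
    one. *)
Let Fixpoint sv m (pre s : seq (B k.+1)) : R :=
  if s is c :: s' then \sum_(c' | tr c' == tr c) sv m (rcons pre c') s' else P (nd m pre).

Let Fixpoint Kp m (pre s : seq (B k.+1)) : R :=
  if s is c :: s' then K c (zz m (pre ++ s')) * Kp m (rcons pre c) s' else 1.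

Let Kp_tr m pre pre' s : (size (pre ++ s) <= Dl)%N -> map (@tr _ _ k) pre = map (@tr _ _ k) pre' ->
  Kp m pre s = Kp m pre' s.
Proof.
elim: s pre pre' => [|c s ih] pre pre' sD e //=.
have sz : size pre' = size pre by rewrite -(size_map (@tr _ _ k)) -e size_map.
congr (_ * _).
  congr (K _ _); apply: zz_tr; rewrite ?map_cat ?e//; move: sD; rewrite !size_cat /= addnS ?sz; exact: ltnW.
by apply: ih; rewrite ?cat_rcons// !map_rcons e.
Qed.

Let sv_Kp m pre s : (size (pre ++ s) <= Dl)%N -> P (nd m (pre ++ s)) = Kp m pre s * sv m pre s.
Proof.
elim: s pre => [|c s ih] pre sD /=; first by rewrite cats0 mul1r.
rewrite stepm// -mulrA; congr (_ * _); rewrite mulr_sumr; apply: eq_bigr => c' /eqP cc'.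
rewrite -cat_rcons ih; last by rewrite cat_rcons; move: sD; rewrite !size_cat.
congr (_ * _); apply: Kp_tr; last by rewrite !map_rcons cc'.
by rewrite cat_rcons; move: sD; rewrite !size_cat.
Qed.

Let sv_le m pre s : (size (pre ++ s) <= Dl)%N ->
  sv m pre s <= \sum_(y | (tr y == tr (nd m (pre ++ s) : B k.+2)) && (take (size pre) (kids y) == pre)) P y.
Proof.
elim: s pre => [|c s ih] pre sD /=.
  rewrite cats0 in sD *.
  by rewrite (bigD1 (nd m pre)) /= ?kids_nd ?take_size ?eqxx// lerDl sumr_ge0.
rewrite [leRHS](partition_big (fun y => nth c (kids y) (size pre)) (fun c' => tr c' == tr c))/=; last first.
  move=> y /andP[/eqP ey _].
  have : kids (tr y) = kids (tr (nd m (pre ++ c :: s) : B k.+2)) by rewrite ey.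
  rewrite !kids_tr kids_nd// => e.
  have sy : size (kids y) = size (pre ++ c :: s) by rewrite -(size_map (@tr _ _ k)) e size_map.
  have := congr1 (fun u => nth (tr c) u (size pre)) e.
  rewrite !(nth_map c) ?sy ?size_cat /= ?addnS ?ltnS ?leq_addr// nth_cat ltnn subnn /= => ->.
  by [].
apply: ler_sum => c' /eqP cc'.
have sD' : (size (rcons pre c' ++ s) <= Dl)%N by rewrite cat_rcons; move: sD; rewrite !size_cat.
apply: le_trans (ih _ sD') _; rewrite le_eqVlt; apply/orP; left; apply/eqP.
apply: eq_bigl => y.
have -> : tr (nd m (rcons pre c' ++ s) : B k.+2) = tr (nd m (pre ++ c :: s) : B k.+2).
  by rewrite cat_rcons !trS !kids_nd// ?map_cat /= ?cc'//; move: sD; rewrite !size_cat.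
case: (tr y =P tr (nd m (pre ++ c :: s))) => [ey|//]; rewrite /= size_rcons.
have : kids (tr y) = kids (tr (nd m (pre ++ c :: s) : B k.+2)) by rewrite ey.
rewrite !kids_tr kids_nd// => e.
have sy : size (kids y) = size (pre ++ c :: s) by rewrite -(size_map (@tr _ _ k)) e size_map.
rewrite (take_nth c) ?eqseq_rcons// sy size_cat /= addnS ltnS leq_addr//.
Qed.

Let KpE m pre s : Kp m pre s = \prod_(b <- picks s) K b.1 (zz m (pre ++ b.2)).
Proof.
elim: s pre => [|c s ih] pre /=; first by rewrite big_nil.
rewrite big_cons big_map ih /=; congr (_ * _); apply: eq_bigr => b _.
by rewrite cat_rcons.
Qed.

(** Given the truncated tree, the branches are independent with kernel [K]: [step] is iterated over
    the offspring of the root. In this direction the inequality bounds the entropy of [P] from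
    below. *)
Lemma markov_le (x : B k.+2) :
  P x <= push (@tr _ _ k.+1) P (tr x) * \prod_(b <- picks (kids x)) K b.1 (zz x.1 b.2).
Proof.
have := @sv_Kp x.1 [::] (kids x) (size_kids x).
rewrite cat0s nd_kids => ->; rewrite KpE mulrC.
apply: ler_wpM2r.
  apply: prodr_ge0 => b _; rewrite divr_ge0//; apply: push_ge0; exact: Ek_ge0.
have := @sv_le x.1 [::] (kids x) (size_kids x).
by move=> /le_trans; apply; rewrite cat0s nd_kids /push big_mkcondr /=; apply: ler_sum => y _; case: ifP.
Qed.

Lemma kaps_tr (x : B k.+2) : kaps (tr x) = [seq (tr ab.1, tr ab.2) | ab <- kaps x].
Proof.
rewrite /kaps kids_tr map_picks -!map_comp; apply/eq_in_map => b bx /=.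
have sb := size_picks_le bx.
have b2 : (size b.2 <= Dl)%N by apply: ltnW; rewrite sb size_kids.
by rewrite /kap /= trS !kids_nd.
Qed.

Lemma Ek_tr : Ek (push (@tr _ _ k.+1) P) =1 Et.
Proof.
move=> ab; rewrite /Ek sum_push /Et.
transitivity (\sum_cd Ek P cd * ((tr cd.1, tr cd.2) == ab)%:R).
  rewrite sum_Ek; apply: eq_bigr => x _; congr (_ * _).
  by rewrite kaps_tr count_map -sum1_count natr_sum big_mkcond; apply: eq_bigr => c _ /=; case: eqP.
by rewrite /push [RHS]big_mkcond; apply: eq_bigr => cd _; case: eqP; rewrite ?mulr1 ?mulr0.
Qed.

Lemma shan_scale (T : finType) (d : R) (e : T -> R) : 0 < d -> (forall x, 0 <= e x) ->
  shan (fun x => e x / d) = shan e / d + (\sum_x e x) / d * ln d.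
Proof.
move=> d0 e0; rewrite /shan !mulr_suml -big_split/=; apply: eq_bigr => x _; rewrite /eta.
have := e0 x; rewrite le_eqVlt => /orP[/eqP <-|ex]; first by rewrite !mul0r oppr0 mul0r addr0.
rewrite ln_div ?posrE//; lra.
Qed.

(** By [markov_le] the entropy of [P] exceeds that of its truncation by at least H(Eh) - H(Et).
    Submodularity gives H(Ek P) + H(Et) <= 2 H(Eh), the two mixed marginals being equal by symmetry,
    so half the increase of the edge entropy is at most the same amount. Normalizations and degree
    entropies are common to both sides. *)
Lemma markov_Sig : 0 < mdeg P -> edge_symm (Ek P) -> Sig (push (@tr _ _ k.+1) P) <= Sig P.
Proof.
move=> d0 sE; have E0 := Ek_ge0 P0.
have dT : mdeg (push (@tr _ _ k.+1) P) = mdeg P.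
  by rewrite -sum_Ek1 -(sum_Ek1 P); under eq_bigr do rewrite Ek_tr; rewrite push_sum1.
have degT : shan (push (@degB _ _ k) (push (@tr _ _ k.+1) P)) = shan (push (@degB _ _ k.+1) P).
  apply: eq_bigr => j _; rewrite push_comp; congr eta; apply: eq_push => x.
  by apply/val_inj; rewrite /= kids_tr size_map.
have h1 : shan (push (@tr _ _ k.+1) P) + shan Eh - shan Et <= shan P.
  have -> : shan (push (@tr _ _ k.+1) P) + shan Eh - shan Et =
    - \sum_x P x * (ln (push (@tr _ _ k.+1) P (tr x)) + \sum_(ab <- kaps x) (ln (Eh (ab.1, tr ab.2)) - ln (Et (tr ab.1, tr ab.2)))).
    under [in RHS]eq_bigr do rewrite mulrDr; rewrite big_split/= -sum_Ek.
    under [X in _ = - (_ + X)]eq_bigr do rewrite mulrBr; rewrite sumrB.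
    rewrite {1 2 3}/shan /eta !sumrN.
    by rewrite (sum_push _ _ (fun u => ln (push _ P u))) (sum_push _ _ (fun u => ln (Eh u))) (sum_push _ _ (fun u => ln (Et u))); lra.
  rewrite /shan /eta sumrN lerN2; apply: ler_sum => x _.
  have := P0 x; rewrite le_eqVlt => /orP[/eqP <-|Px]; first by rewrite !mul0r.
  apply: ler_wpM2l => //; have := markov_le x.
  have Ptx : 0 < push (@tr _ _ k.+1) P (tr x) by apply: lt_le_trans Px _; exact: push_ge.
  have prodx : 0 < \prod_(b <- picks (kids x)) K b.1 (zz x.1 b.2).
    by rewrite -(pmulr_rgt0 _ Ptx); apply: lt_le_trans Px (markov_le x).
  rewrite -ler_ln ?posrE ?mulr_gt0// lnM ?posrE// => /le_trans; apply.
  rewrite lerD2l /kaps big_map.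
  have pos b : b \in kaps x -> 0 < Eh (b.1, tr b.2) /\ 0 < Et (tr b.1, tr b.2).
    move=> bx; have : 0 < Ek P b.
      apply: lt_le_trans (_ : P x * (count_mem b (kaps x))%:R <= _).
        by rewrite mulr_gt0// ltr0n -has_count has_pred1.
      by rewrite /Ek (bigD1 x)//= lerDl sumr_ge0// => y _; rewrite mulr_ge0.
    move=> h; split; apply: lt_le_trans h _.
      exact: (push_ge (fun ab => (ab.1, tr ab.2)) b E0).
    exact: (push_ge (fun ab => (tr ab.1, tr ab.2)) b E0).
  elim: (picks (kids x)) (fun b (bx : b \in picks (kids x)) => pos _ (map_f (kap x) bx)) => [|b s ih] hs.
    by rewrite !big_nil ln1.
  have [p1 p2] := hs b (mem_head _ _).
  have ps : 0 < \prod_(j <- s) K j.1 (zz x.1 j.2).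
    rewrite big_seq; apply: prodr_gt0 => c cs.
    by have [q1 q2] := hs c (@mem_behead _ (b :: s) _ cs); rewrite divr_gt0.
  rewrite !big_cons lnM ?posrE ?divr_gt0// ln_div ?posrE//.
  by apply: lerD => //; apply: ih => c cs; apply: hs; rewrite inE cs orbT.
have h2 : shan (Ek P) + shan Et <= 2 * shan Eh.
  apply: le_trans (shan_submod (@tr _ _ k) E0) _.
  rewrite -/Eh mulr2n mulrDl mul1r lerD2l le_eqVlt; apply/orP; left; apply/eqP.
  rewrite /shan (reindex (fun ab : B k.+1 * B k => (ab.2, ab.1))); last by exists (fun ab => (ab.2, ab.1)) => -[].
  apply: eq_bigr => -[a b] _ /=; congr eta; rewrite /Eh /push.
  rewrite (reindex_inj (h := fun ab : B k.+1 * B k.+1 => (ab.2, ab.1))); last by move=> [a' b'] [c d] [-> ->].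
  by apply: eq_big => [[c d]|[c d] _] /=; rewrite ?xpair_eqE 1?andbC// sE.
rewrite /Sig degT dT; under eq_fun do rewrite Ek_tr.
have sEt : \sum_x Et x = mdeg P by rewrite push_sum1 sum_Ek1.
have Et0 x : 0 <= Et x by exact: push_ge0.
rewrite !shan_scale// sEt sum_Ek1.
rewrite lerD2r !mulrDr !opprD.
have e1 s : mdeg P / 2 * (s / mdeg P) = s / 2 by rewrite mulrAC mulrCA divff ?mulr1// lt0r_neq0.
rewrite !e1; lra.
Qed.
End markov.

Lemma count_enumE (V : finType) (p : pred V) : count p (enum V) = #|[set v | p v]%SET|.
Proof.
by rewrite -sum1_count big_enum_cond /= -sum1_card; apply: eq_bigl => v; rewrite inE.
Qed.

(** * Counting sequences with a given empirical law *)

Section class_size.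
Context {T L : finType} (g : T -> L).

(** Number of ways to choose an element in each class listed by [ds] so that each [a] is chosen
    [n a] times (see [count_sqs]). *)
Fixpoint wcls (ds : seq L) (n : T -> nat) : nat :=
  if ds is d :: ds' then
    \sum_(a | (g a == d) && (0 < n a)%N) wcls ds' (fun b => n b - (b == a))%N
  else [forall a, n a == 0%N].

(** A product of multinomial coefficients over the classes, written without division. Choosing the
    first element [a] lowers [n a] by one, and the factors [n a] thus released add up to the size of
    the class. *)
Lemma wcls_fact ds n : (forall l, \sum_(a | g a == l) n a = count_mem l ds)%N ->
  (wcls ds n * \prod_a (n a)`! = \prod_l (count_mem l ds)`!)%N.
Proof.
elim: ds n => [|d ds ih] n h.
  have n0 a : n a = 0%N.
    by apply/eqP; rewrite -leqn0 -[X in (_ <= X)%N](h (g a)) (bigD1 a)//= leq_addr.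
  rewrite /= (_ : [forall a, n a == 0%N]); last by apply/forallP => a; rewrite n0.
  by rewrite mul1n !big1// => a _; rewrite n0.
rewrite /= big_distrl /=.
transitivity (\sum_(a | (g a == d) && (0 < n a)%N) n a * \prod_l (count_mem l ds)`!)%N.
  apply: eq_bigr => a /andP[/eqP ga na].
  rewrite -(ih (fun b => n b - (b == a))%N) => [|l]; last first.
    have := h l; case: (eqVneq d l) => [<-|dl] /=.
      rewrite eqxx (bigD1 a) ?ga//= [in X in _ -> X](bigD1 a) ?ga//= eqxx => e.
      rewrite (eq_bigr n) => [|b /andP[_ /negbTE ->]]; last by rewrite subn0.
      by case: (n a) na e => // p _; rewrite subn1 /= !addSn add0n => -[].
    rewrite (negbTE dl) add0n => <-; apply: eq_bigr => b /eqP gb.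
    by rewrite (_ : b == a = false) ?subn0//; apply/eqP => ba; rewrite -ga -ba gb eqxx in dl.
  rewrite mulnCA; congr (_ * _)%N.
  rewrite (bigD1 a)//= [in RHS](bigD1 a)//= eqxx mulnA; congr (_ * _)%N.
    by case: (n a) na => // m _; rewrite factS subn1.
  by apply: eq_bigr => b /negbTE ->; rewrite subn0.
rewrite -big_distrl /=.
have -> : (\sum_(a | (g a == d) && (0 < n a)) n a = count_mem d (d :: ds))%N.
  rewrite -h big_mkcondr /=; apply: eq_bigr => a _; by case: (n a).
rewrite (bigD1 d)//= [in RHS](bigD1 d)//= eqxx mulnA; congr (_ * _)%N.
by apply: eq_bigr => l; rewrite eq_sym => /negbTE ->.
Qed.

Fixpoint sqs (ds : seq L) : seq (seq T) :=
  if ds is d :: ds' then [seq a :: t | a <- [seq a <- enum T | g a == d], t <- sqs ds']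
  else [:: [::]].

Lemma sqs_uniq ds : uniq (sqs ds).
Proof.
elim: ds => //= d ds ih; apply: allpairs_uniq => //.
  by rewrite filter_uniq// enum_uniq.
by move=> [a t] [b u] _ _ /= [-> ->].
Qed.

Lemma mem_sqs ds t : (t \in sqs ds) = (map g t == ds).
Proof.
elim: ds t => [|d ds ih] [|a t] //=.
- by apply/negbTE/negP => /allpairsP[[b u]] [].
- apply/allpairsP/eqP => [[[b u]] /= [+ + [-> ->]]|[<- e]].
    by rewrite mem_filter ih => /andP[/eqP -> _] /eqP ->.
  by exists (a, t); rewrite /= mem_filter eqxx mem_enum ih e eqxx.
Qed.

Lemma count_sqs ds n :
  count (fun t => [forall a, count_mem a t == n a]) (sqs ds) = wcls ds n.
Proof.
elim: ds n => [|d ds ih] n /=.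
  by rewrite addn0; congr (nat_of_bool _); apply: eq_forallb => a; rewrite eq_sym.
rewrite count_flatten -map_comp sumnE big_map big_filter big_enum_cond /=.
rewrite big_mkcondr /=; apply: eq_bigr => a _.
rewrite count_map; case: posnP => na.
  apply/eqP; rewrite -leqn0 leqNgt -has_count; apply/hasP => -[t _ /forallP/(_ a)] /=.
  by rewrite eqxx na.
rewrite -ih; apply: eq_count => t /=; apply: eq_forallb => b.
rewrite eq_sym; case: (eqVneq b a) => [->|ba]; last by rewrite subn0 add0n eq_sym.
by rewrite add1n; case: (n a) na => // m _; rewrite eqSS subn1 /= eq_sym.
Qed.

Lemma card_cls (V : finType) (d : V -> L) (n : T -> nat) :
  #|[set X : {ffun V -> T} | [forall v, g (X v) == d v] &
      [forall a, #|[set v | X v == a]%SET| == n a]]%SET| = wcls (map d (enum V)) n.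
Proof.
set A := finset.finset _; pose f (X : {ffun V -> T}) := [seq X v | v <- enum V].
have finj : injective f.
  move=> X Y /eq_in_map e; apply/ffunP => v; apply: e; by rewrite mem_enum.
rewrite -count_sqs -size_filter cardE -(size_map f); apply/perm_size/uniq_perm.
- by rewrite map_inj_uniq// enum_uniq.
- by rewrite filter_uniq// sqs_uniq.
have cntE (X : {ffun V -> T}) a : count_mem a (f X) = #|[set v | X v == a]%SET|.
  by rewrite count_map count_enumE.
move=> t; rewrite mem_filter mem_sqs; apply/mapP/andP => [[X]|[/forallP h /eqP e]].
  rewrite mem_enum inE => /andP[/forallP h1 /forallP h2] ->; split.
    by apply/forallP => a; rewrite cntE.
  by apply/eqP; rewrite /f -map_comp; apply: eq_map => v /=; exact/eqP.
have [t0|t0] := posnP (size t).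
  have V0 : enum V = [::] by apply/eqP; rewrite -size_eq0 -(size_map d) -e size_map t0.
  have te : t = [::] by apply/eqP; rewrite -size_eq0 t0.
  have hV (v : V) : False by have := mem_enum V v; rewrite V0.
  exists [ffun v => match hV v with end]; last by rewrite /f V0.
  rewrite mem_enum inE; apply/andP; split; apply/forallP => a; first by have := hV a.
  by rewrite -cntE /f V0 /= -(eqP (h a)) te.
case: t t0 h e => // a0 t _ h e.
have st : size (a0 :: t) = size (enum V) by rewrite -(size_map g) e size_map.
pose X := [ffun v => nth a0 (a0 :: t) (index v (enum V))].
have fX : f X = a0 :: t.
  apply: (@eq_from_nth _ a0); first by rewrite size_map st.
  move=> i; rewrite size_map => iV; rewrite (nth_map (enum_val (Ordinal (eq_ind _ (fun m => (i < m)%N) iV _ (esym (cardE V)))))) //.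
  by rewrite ffunE index_uniq ?enum_uniq.
exists X => //; rewrite mem_enum inE; apply/andP; split; apply/forallP => a.
  have : map g (f X) = map d (enum V) by rewrite fX.
  by rewrite /f -map_comp => /eq_in_map/(_ a); rewrite mem_enum => /(_ isT) /= ->.
by rewrite -cntE fX.
Qed.
End class_size.

Section class_entropy.
Context {R : realType}.

(** The logarithm of (e (N + 1))^k, a polynomial factor. *)
Definition err (k N : nat) : R := k%:R * (1 + ln N.+1%:R).

Lemma sum_lfact (T : finType) (n : T -> nat) (N : nat) :
  (\sum_a n a = N)%N -> (0 < N)%N ->
  `|\sum_a lfact (n a) - (N%:R * ln N%:R - N%:R - N%:R * shan (fun a => (n a)%:R / N%:R))| <= err #|T| N :> R.
Proof.
move=> sN N0.
have -> : N%:R * ln N%:R - N%:R - N%:R * shan (fun a => (n a)%:R / N%:R) =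
    \sum_a (xlnx (n a) - (n a)%:R) :> R.
  under [RHS]eq_bigr do rewrite (xlnx_eta _ N0).
  rewrite sumrB sumrB -mulr_suml -natr_sum sN /shan mulr_sumr; lra.
rewrite -sumrB; apply: le_trans (ler_norm_sum _ _ _) _.
rewrite /err mulr_natl -sumr_const; apply: ler_sum => a _.
apply: le_trans (lfact_bound _) _; rewrite lerD2l ler_ln ?posrE ?ltr0n//.
by rewrite ler_nat ltnS -sN (bigD1 a)//= leq_addr.
Qed.

Lemma sum_lfact_eq (T : finType) (n : T -> nat) :
  expR (\sum_a lfact (n a)) = (\prod_a (n a)`!)%:R :> R.
Proof. by rewrite expR_sum natr_prod; apply: eq_bigr => a _; rewrite expR_lfact. Qed.

(** The exponential rate is the entropy of a letter given its class, as the sequence [d] of classes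
    is fixed. *)
Lemma cls_entropy (T L V : finType) (g : T -> L) (d : V -> L) (n : T -> nat) :
  (forall l, \sum_(a | g a == l) n a = #|[set v | d v == l]%SET|)%N -> (0 < #|V|)%N ->
  let A := [set X : {ffun V -> T} | [forall v, g (X v) == d v] &
      [forall a, #|[set v | X v == a]%SET| == n a]]%SET in
  (0 < #|A|)%N /\
  `|ln #|A|%:R - #|V|%:R * (shan (fun a => (n a)%:R / #|V|%:R) -
     shan (fun l => #|[set v | d v == l]%SET|%:R / #|V|%:R))| <= err (#|T| + #|L|) #|V| :> R.
Proof.
move=> h V0 A; set N := #|V| in V0 *.
have cE l : count_mem l (map d (enum V)) = #|[set v | d v == l]%SET|.
  by rewrite count_map count_enumE.
have := @wcls_fact _ _ g (map d (enum V)) n; rewrite -card_cls -/A.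
move=> /(_ _)/wrap[l|e]; first by rewrite h cE.
have sl : (\sum_l #|[set v | d v == l]%SET| = N)%N.
  rewrite -[RHS]sum1_card (partition_big d predT)//=.
  by apply: eq_bigr => l _; rewrite -sum1_card; apply: eq_bigl => v; rewrite inE.
have sn : (\sum_a n a = N)%N.
  by rewrite (partition_big g predT)//= -[RHS]sl; apply: eq_bigr => l _; rewrite h.
have A0 : (0 < #|A|)%N.
  rewrite lt0n; apply/eqP => A0; move: e; rewrite A0 mul0n => /eqP.
  by rewrite eq_sym -leqn0 leqNgt prodn_gt0// => l; exact: fact_gt0.
split=> //.
have e' : ln #|A|%:R + \sum_a lfact (n a) = \sum_l lfact #|[set v | d v == l]%SET| :> R.
  apply: expR_inj; rewrite expRD lnK ?posrE ?ltr0n// !sum_lfact_eq -natrM e.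
  by congr (_%:R); apply: eq_bigr => l _; rewrite cE.
have h1 := sum_lfact sn V0; have h2 := sum_lfact sl V0.
have eD : err (#|T| + #|L|) N = err #|T| N + err #|L| N by rewrite /err natrD mulrDl.
rewrite eD; move: h1 h2 e'; rewrite !ler_norml.
set a := \sum_a _; set b := \sum_l _; move=> /andP[h1 h2] /andP[h3 h4] e'.
apply/andP; split; rewrite !mulrBr; lra.
Qed.
End class_entropy.

(** * Pairings of half-edges *)

Section pairings.
Context {D : finType}.
Implicit Types (s : {perm D}) (P : seq (D * D)).

(* The pairings of the set [D] of half-edges are the fixed-point free involutions. *)
Definition fpi s : bool := [forall x, (s (s x) == x) && (s x != x)].

Lemma fpiP s : reflect (forall x, s (s x) = x /\ s x <> x) (fpi s).
Proof.
apply: (iffP forallP) => h x; first by have /andP[/eqP -> /eqP] := h x.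
by have [-> /eqP ->] := h x; rewrite eqxx.
Qed.

Definition dP P := map fst P ++ map snd P.

Definition U P : {set D} := [set x | x \notin dP P]%SET.

(* The pairings that extend the partial pairing [P] *)
Definition I P : {set {perm D}} :=
  [set s | fpi s & all (fun xy => s xy.1 == xy.2) P]%SET.

Lemma dP_cons y a P : perm_eq (dP ((y, a) :: P)) [:: y, a & dP P].
Proof. by rewrite /dP /= perm_cons -cat1s perm_catCA. Qed.

Lemma in_U P x : (x \in U P) = (x \notin dP P). Proof. by rewrite inE. Qed.

Lemma U_cons y a P : U ((y, a) :: P) = (U P :\ y :\ a)%SET.
Proof.
apply/setP => x; rewrite !in_setD1 !in_U (perm_mem (dP_cons _ _ _)) !inE !negb_or.
by rewrite andbCA.
Qed.

Lemma I_nil s : (s \in I [::]) = fpi s.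
Proof. by rewrite inE andbT. Qed.

Lemma I_sub P s : s \in I P -> fpi s.
Proof. by rewrite inE => /andP[]. Qed.

Lemma U_img P s x : s \in I P -> x \in U P -> s x \in U P.
Proof.
rewrite !inE => /andP[/fpiP f /allP h]; apply: contra; rewrite /dP !mem_cat.
case/orP => /mapP[[u v] uv /= e].
  have /eqP /= suv := h _ uv; have [e2 _] := f x.
  by apply/orP; right; apply/mapP; exists (u, v) => //=; rewrite -suv -e e2.
have /eqP /= suv := h _ uv.
have : s x = s u by rewrite suv.
by move/perm_inj => ->; apply/orP; left; apply/mapP; exists (u, v).
Qed.

Lemma I_cons y a P s : (s \in I ((y, a) :: P)) = (s \in I P) && (s y == a).
Proof. by rewrite !inE /= andbA andbAC. Qed.

Lemma sum_I (V : nmodType) (F : {perm D} -> V) P y : y \in U P ->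
  \sum_(s in I P) F s = \sum_(a in (U P :\ y)%SET) \sum_(s in I ((y, a) :: P)) F s.
Proof.
move=> yU; rewrite (partition_big (fun s => s y) (mem (U P :\ y)%SET)) /=; last first.
  by move=> s sI; rewrite in_setD1 (U_img sI)// andbT; have /fpiP/(_ y)[_ /eqP] := I_sub sI.
by apply: eq_bigr => a _; apply: eq_bigl => s; rewrite I_cons.
Qed.

Lemma conj_tperm s a b x : (s ^ tperm a b)%g x = tperm a b (s (tperm a b x)).
Proof. by rewrite -{1}(tpermK a b x) permJ. Qed.

Lemma fpi_conj s a b : fpi (s ^ tperm a b)%g = fpi s.
Proof.
suff h t : fpi t -> fpi (t ^ tperm a b)%g.
  apply/idP/idP => [/h|/h//]; rewrite -conjgM.
  by rewrite (_ : tperm a b * tperm a b = 1)%g ?conjg1//; apply: tperm2.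
move=> /fpiP f; apply/fpiP => x; rewrite !conj_tperm tpermK; have [e n] := f (tperm a b x).
rewrite e tpermK; split=> // h; apply: n.
by rewrite -[LHS](tpermK a b) h.
Qed.

(** Conjugation by the transposition of [a] and [b] exchanges their partners, so it maps the
    pairings in which [y] is paired with [a] onto those in which it is paired with [b]. This is the
    switching used in all that follows. *)
Lemma conj_I y a b P s : a \in (U P :\ y)%SET -> b \in (U P :\ y)%SET -> y \in U P ->
  (s \in I ((y, a) :: P)) = ((s ^ tperm a b)%g \in I ((y, b) :: P)).
Proof.
suff h (a' b' : D) t : a' \in (U P :\ y)%SET -> b' \in (U P :\ y)%SET -> y \in U P ->
    t \in I ((y, a') :: P) -> (t ^ tperm a' b')%g \in I ((y, b') :: P).
  move=> ha hb yU; apply/idP/idP => [sI|sI]; first exact: h sI.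
  have := h b a _ hb ha yU sI.
  by rewrite tpermC -conjgM tperm2 conjg1.
rewrite !in_setD1 !in_U => /andP[ya aU] /andP[yb bU] yU.
rewrite inE => /andP[f /= /andP[/eqP sy /allP h]].
rewrite inE fpi_conj f /=; apply/andP; split.
  by rewrite conj_tperm [tperm a' b' y]tpermD// sy tpermL.
apply/allP => -[u v] uv /=; have /eqP /= e := h _ uv.
have uP : u \in dP P by rewrite mem_cat (map_f fst uv).
have vP : v \in dP P by rewrite mem_cat (map_f snd uv) orbT.
have ne (z w : D) : z \notin dP P -> w \in dP P -> z != w.
  by move=> zP wP; apply: contraNneq zP => ->.
by rewrite conj_tperm [tperm _ _ u]tpermD ?ne// e tpermD ?ne.
Qed.

Lemma sum_I_conj (V : nmodType) (F : {perm D} -> V) P y a b :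
  y \in U P -> a \in (U P :\ y)%SET -> b \in (U P :\ y)%SET ->
  \sum_(s in I ((y, b) :: P)) F s = \sum_(s in I ((y, a) :: P)) F (s ^ tperm a b)%g.
Proof.
move=> yU aU bU; rewrite (reindex_inj (@conjg_inj _ (tperm a b))) /=.
by apply: eq_bigl => s; rewrite -conj_I.
Qed.

Lemma card_I_conj P y a b :
  y \in U P -> a \in (U P :\ y)%SET -> b \in (U P :\ y)%SET ->
  #|I ((y, b) :: P)| = #|I ((y, a) :: P)|.
Proof.
move=> yU aU bU; rewrite -!sum1_card.
exact: (sum_I_conj (fun=> 1%N) yU aU bU).
Qed.

Lemma card_I_cons P y a : y \in U P -> a \in (U P :\ y)%SET ->
  (#|I P| = #|U P|.-1 * #|I ((y, a) :: P)|)%N.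
Proof.
move=> yU aU; rewrite -sum1_card (sum_I (fun=> 1%N) yU).
under eq_bigr do rewrite sum1_card.
rewrite (eq_bigr (fun=> #|I ((y, a) :: P)|)) => [|b bU]; last exact: card_I_conj.
by rewrite sum_nat_const [#|U P|](cardsD1 y) yU.
Qed.

Lemma card_U_cons P y a : y \in U P -> a \in (U P :\ y)%SET ->
  #|U P| = #|U ((y, a) :: P)|.+2.
Proof. by move=> yU aU; rewrite (cardsD1 y) yU (cardsD1 a) aU U_cons. Qed.

(** The number of pairings of [n] points: the double factorial of n - 1 when [n] is even, and 0 when
    [n] is odd. *)
Fixpoint ndf n : nat := match n with 0 => 1 | 1 => 0 | n'.+2 => n'.+1 * ndf n' end.

Section coloured.
Context {K : finType} (iota : K -> K) (iotaK : involutive iota) (c : D -> K).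

Definition compat P : {set {perm D}} :=
  [set s in I P | [forall x in U P, c (s x) == iota (c x)]]%SET.

Definition cnt P k := #|[set x in U P | c x == k]%SET|.

(** Factors of the square of the number of compatible pairings. The square avoids choosing one color
    in each pair {k, iota k}: such a pair allows n! matchings and appears twice in the product. *)
Definition gfac k n := if iota k == k then (ndf n ^ 2)%N else n`!.

Lemma compat_balanced P s k : s \in compat P -> cnt P k = cnt P (iota k).
Proof.
rewrite inE => /andP[sI /forall_inP h].
rewrite /cnt -(card_imset _ (@perm_inj _ s)); apply: eq_card => x.
rewrite !inE; apply/imsetP/andP => [[y]|[xU /eqP cx]].
  rewrite inE => /andP[yU /eqP <-] ->; split; first by have := U_img sI yU; rewrite inE.
  exact: h.
have sxU : s x \in U P by apply: (U_img sI); rewrite inE.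
have /fpiP/(_ x)[sx _] := I_sub sI.
exists (s x); rewrite ?sx// inE sxU /= (eqP (h x _)) ?inE// cx iotaK//.
Qed.

Lemma compat_cons P y a : y \in U P -> a \in (U P :\ y)%SET -> c a = iota (c y) ->
  compat ((y, a) :: P) = [set s in compat P | s y == a]%SET.
Proof.
move=> yU aU ca; apply/setP => s; rewrite !inE /=.
case: (boolP (fpi s)) => //= f; case: (boolP (s y == a)) => //= sy; last by rewrite andbF.
rewrite andbT; congr andb; apply/forall_inP/forall_inP => h x.
  rewrite inE => xP; case: (eqVneq x y) => [->|xy]; first by rewrite (eqP sy) ca.
  case: (eqVneq x a) => [->|xa].
    by move/fpiP: f => /(_ y)[e _]; rewrite -(eqP sy) e (eqP sy) ca iotaK.
  by apply: h; rewrite U_cons !inE xa xy.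
by rewrite U_cons => /setD1P[_ /setD1P[_]]; exact: h.
Qed.

Lemma uniq_cons P y a : y \in U P -> a \in (U P :\ y)%SET -> uniq (dP P) -> uniq (dP ((y, a) :: P)).
Proof.
rewrite in_setD1 !in_U => yP /andP[ay aP] uP; rewrite (perm_uniq (dP_cons _ _ _)) /= uP aP /=.
by rewrite inE negb_or eq_sym ay yP.
Qed.

Lemma cnt_cons P y a k : y \in U P -> a \in (U P :\ y)%SET ->
  cnt P k = ((c y == k) + (c a == k) + cnt ((y, a) :: P) k)%N.
Proof.
move=> yU aU; rewrite /cnt U_cons (cardsD1 y) (cardsD1 a) addnA; congr (_ + _ + _)%N.
- by rewrite inS yU.
- by move: aU; rewrite !in_setD1 inS => /andP[-> ->].
- by apply: eq_card => x; rewrite !(in_setD1, inS); case: (x == a); case: (x == y); rewrite ?andbF.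
Qed.

Let Ifull P : U P = finset.set0 -> uniq (dP P) -> #|I P| = 1%N.
Proof.
move=> U0 uP; pose s0 := (\prod_(xy <- P) tperm xy.1 xy.2)%g.
have Pin x : x \in dP P by have := finset.in_set0 x; rewrite -U0 inE => /negbFE.
have hs0 (Q : seq (D * D)) : uniq (dP Q) ->
    (forall x, x \notin dP Q -> (\prod_(xy <- Q) tperm xy.1 xy.2)%g x = x) /\
    (forall xy, xy \in Q -> (\prod_(xy <- Q) tperm xy.1 xy.2)%g xy.1 = xy.2 /\
                            (\prod_(xy <- Q) tperm xy.1 xy.2)%g xy.2 = xy.1).
  elim: Q => [|[u v] Q ih]; first by split=> // x _; rewrite big_nil perm1.
  rewrite (perm_uniq (dP_cons _ _ _)) /= inE negb_or -!andbA => /and4P[uv uQ vQ /ih[h1 h2]].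
  split=> [x|xy].
    rewrite (perm_mem (dP_cons _ _ _)) !inE !negb_or => /and3P[xu xv xQ].
    by rewrite big_cons permM /= tpermD 1?eq_sym// h1.
  rewrite inE => /orP[/eqP ->|xyQ]; rewrite big_cons !permM /=.
    by rewrite tpermL tpermR !h1.
  have x1 : xy.1 \in dP Q by rewrite mem_cat map_f.
  have x2 : xy.2 \in dP Q by rewrite mem_cat map_f ?orbT.
  have ne z w : z \notin dP Q -> w \in dP Q -> z != w by move=> zP wP; apply: contraNneq zP => ->.
  by rewrite !tpermD ?ne//; exact: h2.
have [_ h2] := hs0 P uP.
have s0I : s0 \in I P.
  rewrite inE; apply/andP; split; last by apply/allP => xy /h2[-> _].
  apply/fpiP => x; have := Pin x; rewrite mem_cat => /orP[] /mapP[xy xyP ->]; have [e1 e2] := h2 _ xyP.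
    rewrite e1 e2; split=> // e; move: uP; rewrite /dP cat_uniq => /and3P[_ /hasPn/(_ xy.2)].
    by rewrite map_f// => /(_ isT)/=; rewrite e map_f.
  rewrite e2 e1; split=> // e; move: uP; rewrite /dP cat_uniq => /and3P[_ /hasPn/(_ xy.2)].
  by rewrite map_f// => /(_ isT)/=; rewrite -e map_f.
apply/eqP/cards1P; exists s0; apply/setP => s; rewrite inE; apply/idP/eqP => [sI|-> //].
apply/permP => x; move: (sI); rewrite inE => /andP[/fpiP f /allP h].
have := Pin x; rewrite mem_cat => /orP[] /mapP[xy xyP ->]; have [e1 e2] := h2 _ xyP.
  by rewrite (eqP (h _ xyP)) e1.
by have [e _] := f xy.1; rewrite -[in LHS](eqP (h _ xyP)) e e2.
Qed.

(** Induction on the number of free half-edges. The partner of [y] is one of the free half-edges of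
    color [iota (c y)], and the number of completions does not depend on which one. *)
Lemma card_compat P : (forall k, cnt P k = cnt P (iota k)) -> uniq (dP P) ->
  (#|compat P| ^ 2 = \prod_k gfac k (cnt P k))%N.
Proof.
move: {2}(#|U P|) (leqnn #|U P|) => m.
elim: m P => [|m ih] P Um bal uP.
  have U0 : U P = finset.set0 by apply/eqP; rewrite -cards_eq0 -leqn0.
  have -> : compat P = I P.
    by apply/setP => s; rewrite inS; case: (s \in I P) => //=; apply/forall_inP => x; rewrite U0 inE.
  rewrite Ifull// big1// => k _.
  have -> : cnt P k = 0%N.
    by apply/eqP; rewrite /cnt cards_eq0; apply/eqP/setP => x; rewrite U0 !inE.
  by rewrite /gfac; case: ifP.
have [U0|[y yU]] := set_0Vmem (U P).
  by apply: ih => //; rewrite U0 cards0.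
set k0 := c y; pose S := [set a in (U P :\ y)%SET | c a == iota k0]%SET.
have cardS : (cnt P (iota k0) = (k0 == iota k0) + #|S|)%N.
  rewrite /cnt (cardsD1 y) inS yU /=; congr (_ + _)%N.
  by apply: eq_card => x; rewrite !(in_setD1, inS); case: (x == y) => //=; rewrite andbF.
have IHa a : a \in S -> (#|compat ((y, a) :: P)| ^ 2 = \prod_k gfac k (cnt P k - (k0 == k) - (iota k0 == k)))%N.
  rewrite inE => /andP[aU /eqP ca].
  have cE k : cnt ((y, a) :: P) k = (cnt P k - (k0 == k) - (iota k0 == k))%N.
    by rewrite (cnt_cons k yU aU) ca -/k0; lia.
  rewrite ih; first by apply: eq_bigr => k _; rewrite cE.
  - by move: Um; rewrite (card_U_cons yU aU); lia.
  - move=> k; rewrite !cE -bal -!subnDA; congr (_ - _)%N.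
    rewrite (inj_eq (inv_inj iotaK)) addnC; congr (_ + nat_of_bool _)%N.
    by rewrite -(inj_eq (inv_inj iotaK)) iotaK.
  - exact: uniq_cons.
have step : (#|compat P| = \sum_(a in S) #|compat ((y, a) :: P)|)%N.
  rewrite -sum1_card (partition_big (fun s => s y) (mem S)) /=; last first.
    move=> s; rewrite inE => /andP[sI /forall_inP h]; rewrite [_ \in S]inS (eqP (h y yU)) eqxx andbT.
    rewrite in_setD1 (U_img sI yU) andbT.
    by have /fpiP/(_ y)[_ /eqP] := I_sub sI.
  apply: eq_bigr => a; rewrite inE => /andP[aU /eqP ca].
  by rewrite compat_cons// -sum1_card; apply: eq_bigl => s; rewrite inE.
(* Without any candidate, balance forces [iota k0 = k0] with [y] alone in its color, and the factor
   [ndf 1] is 0. *)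
have [S0|[a aS]] := set_0Vmem S.
  rewrite step S0 big_set0 exp0n//.
  have := cardS; rewrite S0 cards0 addn0 => c1.
  have c0 : (0 < cnt P k0)%N by apply/card_gt0P; exists y; rewrite inS yU /=.
  have e : iota k0 = k0 by move: c0; rewrite bal c1; case: eqP.
  by rewrite (bigD1 k0)//= /gfac e eqxx (_ : cnt P k0 = 1%N)// bal c1 e eqxx.
have step2 : (#|compat P| = #|S| * #|compat ((y, a) :: P)|)%N.
  rewrite step (eq_bigr (fun=> #|compat ((y, a) :: P)|)) ?sum_nat_const//.
  by move=> b bS; apply/eqP; rewrite -(eqn_exp2r _ _ (ltn0Sn 1)) !IHa.
have S0 : (0 < #|S|)%N by apply/card_gt0P; exists a.
rewrite step2 expnMn IHa//.
case: (eqVneq (iota k0) k0) => e.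
  rewrite (bigD1 k0)//= [in RHS](bigD1 k0)//= mulnA; congr (_ * _)%N.
    have cS : cnt P k0 = #|S|.+1 by rewrite -{1}e cardS e eqxx.
    rewrite /gfac e !eqxx cS; case: #|S| S0 => // q _.
    by rewrite !subSS !subn0 /= expnMn.
  apply: eq_bigr => k kk; rewrite e [k0 == k]eq_sym (negbTE kk) !subn0 //.
have cS : cnt P (iota k0) = #|S| by rewrite cardS [_ == iota _]eq_sym (negbTE e).
rewrite (bigD1 k0)//= [in RHS](bigD1 k0)//= (bigD1 (iota k0))//= [in RHS](bigD1 (iota k0))//=.
rewrite /gfac iotaK [_ == k0](negbTE e) [k0 == iota k0]eq_sym (negbTE e) !eqxx cS bal cS.
rewrite !subn0 !mulnA; congr (_ * _)%N.
  case: #|S| S0 => // q _; rewrite !subSS !subn0 factS; lia.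
by apply: eq_bigr => k /andP[k1 k2]; rewrite [k0 == k]eq_sym (negbTE k1) [iota k0 == k]eq_sym (negbTE k2) !subn0.
Qed.

End coloured.

Lemma card_I P : uniq (dP P) -> #|I P| = ndf #|U P|.
Proof.
move=> uP; have := @card_compat unit id (fun _ => erefl) (fun=> tt) P (fun _ => erefl) uP.
have -> : compat id (fun=> tt) P = I P.
  by apply/setP => s; rewrite inS; case: (s \in I P) => //=; apply/forall_inP.
rewrite (big_pred1 tt) ?/gfac ?eqxx; last by case.
have -> : cnt (fun=> tt) P tt = #|U P| by apply: eq_card => x; rewrite !inE andbT.
by move/eqP; rewrite eqn_exp2r// => /eqP.
Qed.
End pairings.

Section ndf_bounds.
Context {R : realType}.

Lemma ndf_le n : (ndf n ^ 2 <= n`!)%N.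
Proof.
elim/ltn_ind: n => -[|[|n]] ih //=.
rewrite expnMn !factS mulnA; apply: leq_mul; last exact: ih.
by rewrite -mulnn leq_mul.
Qed.

Lemma ndf_ge n : ~~ odd n -> (n`! <= n.+1 * ndf n ^ 2)%N.
Proof.
elim/ltn_ind: n => -[|[|n]] ih //=; rewrite negbK => on.
have := ih n (leqnSn _) on => h.
rewrite expnMn !factS.
apply: (@leq_trans (n.+2 * (n.+1 * (n.+1 * ndf n ^ 2)))%N); first by rewrite !leq_mul.
by nia.
Qed.
End ndf_bounds.

(** * Concentration for uniform pairings *)

Section concentration.
Context {R : realType} {D : finType}.
Implicit Types (s t u : {perm D}) (P : seq (D * D)).

(** Exponential moment of the martingale that reveals one pair at a time. The bijection of
    [sum_I_conj] between two choices of the partner of [y] changes [F] by at most [c], so the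
    conditional means [Av] differ by at most [c]. By [expR_quad] a revelation costs a factor of at
    most exp (2 (lam c)^2), the linear term having mean 0. *)
Lemma conc (F : {perm D} -> R) (c lam : R) :
  0 <= lam -> lam * c <= 2^-1 -> 0 <= c ->
  (forall s a b, fpi s -> `|F (s ^ tperm a b)%g - F s| <= c) ->
  forall P, uniq (dP P) -> (0 < #|I P|)%N ->
  \sum_(s in I P) expR (lam * (F s - (\sum_(t in I P) F t) / #|I P|%:R)) <=
  #|I P|%:R * expR (2 * (lam * c) ^+ 2 * #|U P|%:R).
Proof.
move=> lam0 lc c0 lipF P; move: {2}(#|U P|) (leqnn #|U P|) => m.
elim: m P => [|m ih] P Um uP I0.
  have U0 : #|U P| = 0%N by apply/eqP; rewrite -leqn0.
  have /cards1P[s0 ->] : #|I P| == 1%N by rewrite card_I// U0.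
  rewrite big_set1 cards1 big_set1 U0 mulr0 expR0 !mulr1 divr1 subrr mulr0 expR0//.
have [U0|[y yU]] := set_0Vmem (U P); first by apply: ih => //; rewrite U0 cards0.
have [s0 s0I] := card_gt0P I0.
set S := (U P :\ y)%SET.
have a0S : s0 y \in S by rewrite in_setD1 (U_img s0I yU) andbT; have /fpiP/(_ y)[_ /eqP] := I_sub s0I.
set a0 := s0 y in a0S; set q := #|I ((y, a0) :: P)|.
have Iq a : a \in S -> #|I ((y, a) :: P)| = q by exact: card_I_conj.
have Icard : (#|I P| = #|S| * q)%N by rewrite (card_I_cons yU a0S) (cardsD1 y (U P)) yU.
have [S0 q0] : (0 < #|S|)%N /\ (0 < q)%N by apply/andP; rewrite -muln_gt0 -Icard.
set A := (\sum_(t in I P) F t) / #|I P|%:R.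
pose Av a := (\sum_(t in I ((y, a) :: P)) F t) / q%:R.
have qR : 0 < q%:R :> R by rewrite ltr0n.
have SR : 0 < #|S|%:R :> R by rewrite ltr0n.
have AE : A = (\sum_(a in S) Av a) / #|S|%:R.
  by rewrite /A (sum_I F yU) Icard natrM invfM mulrA mulrAC -mulr_suml.
have dA a b : a \in S -> b \in S -> `|Av a - Av b| <= c.
  move=> aS bS; rewrite /Av (sum_I_conj F yU bS aS) -mulrBl -sumrB normrM.
  rewrite [X in _ * X]gtr0_norm ?invr_gt0// ler_pdivrMr//.
  apply: le_trans (ler_norm_sum _ _ _) _; rewrite -(Iq b bS) mulr_natr -sumr_const.
  by apply: ler_sum => t tI; apply: lipF; exact: I_sub tI.
have dAA a : a \in S -> `|Av a - A| <= c.
  move=> aS; have -> : Av a - A = (\sum_(b in S) (Av a - Av b)) / #|S|%:R.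
    by rewrite sumrB sumr_const mulrBl -[Av a *+ _]mulr_natr mulfK ?lt0r_neq0// -AE.
  rewrite normrM [X in _ * X]gtr0_norm ?invr_gt0// ler_pdivrMr//.
  apply: le_trans (ler_norm_sum _ _ _) _; rewrite mulr_natr -sumr_const.
  by apply: ler_sum => b bS; exact: dA.
have sA0 : \sum_(a in S) (Av a - A) = 0.
  by rewrite sumrB sumr_const -[A *+ _]mulr_natr AE divfK ?lt0r_neq0// subrr.
rewrite (sum_I _ yU) -/S.
set E' := expR (2 * (lam * c) ^+ 2 * (#|U P|.-2)%:R).
apply: (@le_trans _ _ (\sum_(a in S) q%:R * E' * expR (lam * (Av a - A)))).
  apply: ler_sum => a aS.
  under eq_bigr do rewrite -(subrK (Av a) (F _)) -addrA mulrDr expRD.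
  rewrite -mulr_suml ler_wpM2r ?expR_ge0//.
  have aU' := uniq_cons yU aS uP.
  have := ih ((y, a) :: P) _ aU'; rewrite (Iq a aS) => h.
  have cU := card_U_cons yU aS.
  by rewrite /E' cU /=; apply: h => //; rewrite -ltnS ltnW// -cU.
rewrite -mulr_sumr.
have hS : \sum_(a in S) expR (lam * (Av a - A)) <= #|S|%:R * expR (2 * (lam * c) ^+ 2).
  apply: (@le_trans _ _ (\sum_(a in S) (1 + lam * (Av a - A) + 2 * (lam * c) ^+ 2))).
    apply: ler_sum => a aS.
    have h : `|lam * (Av a - A)| <= lam * c by rewrite normrM ger0_norm// ler_wpM2l// dAA.
    apply: le_trans (expR_quad (le_trans h lc)) _.
    rewrite lerD2l ler_wpM2l// -real_normK ?num_real//.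
    by rewrite lerXn2r ?nnegrE// mulr_ge0.
  rewrite big_split/= big_split/= -mulr_sumr sA0 mulr0 addr0 !sumr_const -mulrnDl -[_ *+ #|S|]mulr_natl.
  by rewrite ler_wpM2l// expR_ge1Dx.
apply: le_trans (ler_wpM2l _ hS) _; first by rewrite mulr_ge0// expR_ge0.
have hE : E' * expR (2 * (lam * c) ^+ 2) <= expR (2 * (lam * c) ^+ 2 * #|U P|%:R).
  rewrite /E' -expRD ler_expR -[X in _ + X]mulr1 -mulrDr ler_wpM2l ?mulr_ge0 ?sqr_ge0//.
  by rewrite natr1 ler_nat (card_U_cons yU a0S) /=.
rewrite Icard natrM; set e2 := expR _ in hE *.
have -> : q%:R * E' * (#|S|%:R * e2) = #|S|%:R * q%:R * (E' * e2) by lra.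
by rewrite ler_wpM2l// mulr_ge0.
Qed.

Definition hd s t : nat := #|[set x | s x != t x]%SET|.

(** Only [a], [b] and their partners get new partners. A function that is 1-Lipschitz for [hd]
    therefore satisfies the hypothesis of [conc] with constant 4. *)
Lemma hd_conj s a b : fpi s -> (hd (s ^ tperm a b)%g s <= 4)%N.
Proof.
move=> /fpiP f; apply: leq_trans (_ : #|[set a; b; s a; s b]%SET| <= 4)%N; last first.
  by rewrite -!finset.setUA !cardsU1 cards1; do !case: (_ \notin _).
apply: card_incl => x; rewrite !inE; apply: contraNT.
rewrite !negb_or -!andbA => /and4P[xa xb xsa xsb].
have sx z : x != s z -> s x != z by apply: contraNneq => <-; have [-> _] := f x.
by rewrite conj_tperm [tperm _ _ x]tpermD 1?eq_sym// tpermD 1?eq_sym ?sx.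
Qed.

Lemma conc_tail (F : {perm D} -> R) (beta : R) :
  0 < beta -> beta <= 1 ->
  (forall s t, fpi s -> fpi t -> `|F s - F t| <= (hd s t)%:R) ->
  (0 < #|I (D := D) [::]|)%N ->
  \sum_(s in I [::]) F s <= beta * #|D|%:R * #|I (D := D) [::]|%:R ->
  #|[set s in I [::] | 2 * beta * #|D|%:R <= F s]%SET|%:R <=
    expR (- (beta ^+ 2 / 128) * #|D|%:R) * #|I (D := D) [::]|%:R.
Proof.
move=> b0 b1 lipF I0 EF; set N := #|D|%:R : R.
have lip4 s a b : fpi s -> `|F (s ^ tperm a b)%g - F s| <= 4.
  move=> fs; apply: le_trans (lipF _ _ _ fs) _; first by rewrite fpi_conj.
  by rewrite ler_nat hd_conj.
have l0 : 0 <= beta / 64 by rewrite divr_ge0// ltW.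
have lc : beta / 64 * 4 <= 2^-1 by lra.
(* With parameter beta/64 and constant 4, the excess beta N over the mean gains beta^2 N/64 in the
   exponent, while [conc] costs 2 (beta/16)^2 N = beta^2 N/128. *)
have := conc l0 lc (ler0n _ _) lip4 (isT : uniq (dP [::])) I0.
have -> : #|U (D := D) [::]| = #|D| by apply: eq_card => x; rewrite !inE.
set avg := (\sum_(t in I [::]) F t) / _; set q := #|I _|%:R in EF avg *.
have q0 : 0 < q by rewrite ltr0n.
have avg_le : avg <= beta * N by rewrite ler_pdivrMr.
move=> h; set T := finset.finset _.
have : #|T|%:R * expR (beta / 64 * (beta * N)) <= q * expR (2 * (beta / 64 * 4) ^+ 2 * N).
  apply: le_trans h; rewrite mulr_natl -sumr_const.
  apply: (@le_trans _ _ (\sum_(s in T) expR (beta / 64 * (F s - avg)))).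
    apply: ler_sum => s; rewrite inE => /andP[_ hs].
    rewrite ler_expR ler_wpM2l//; move: hs avg_le; lra.
  rewrite [leRHS](bigID (mem T)) /= -[leLHS]addr0 lerD//.
    rewrite le_eqVlt; apply/orP; left; apply/eqP; apply: eq_bigl => s.
    by apply/idP/andP => [sT|[]//]; split=> //; move: sT; rewrite inS => /andP[].
  by apply: sumr_ge0 => s _; exact: expR_ge0.
rewrite -ler_pdivlMr ?expR_gt0// => /le_trans; apply.
rewrite -expRN -[leLHS]mulrA -expRD [leRHS]mulrC; apply: ler_wpM2l; first exact: ltW.
rewrite ler_expR.
have N0 : 0 <= N by rewrite ler0n.
have b2 : 0 <= beta ^+ 2 * N by rewrite mulr_ge0// sqr_ge0.
rewrite !expr2 in b2 *; nra.
Qed.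

Lemma hd_sym s t : hd s t = hd t s.
Proof. by apply: eq_card => x; rewrite !inE eq_sym. Qed.

Lemma hd_tri t s u : (hd s u <= hd s t + hd t u)%N.
Proof.
apply: leq_trans (leq_card_setU _ _); apply: card_incl => x.
by rewrite !inE; case: (eqVneq (s x) (t x)) => //= ->.
Qed.

Lemma hdxx s : hd s s = 0%N.
Proof. by apply/eqP; rewrite cards_eq0; apply/eqP/setP => x; rewrite !inE eqxx. Qed.

(** [F] is the Hamming distance to [A]. It vanishes on [A], whose proportion is at least exp
    (-beta^2 N/128), so [conc] applied to [-F] forces its mean to be at most beta N; [conc_tail]
    then bounds the upper tail. A set of exponentially small proportion thus has a neighborhood of
    almost full proportion. *)
Lemma blowup (A : {set {perm D}}) (beta : R) :
  0 < beta -> beta <= 1 -> (0 < #|A|)%N -> A \subset I [::] ->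
  expR (- (beta ^+ 2 / 128) * #|D|%:R) * #|I (D := D) [::]|%:R <= #|A|%:R ->
  #|[set s in I [::] | [forall t in A, 2 * beta * #|D|%:R <= (hd s t)%:R]]%SET|%:R <=
    expR (- (beta ^+ 2 / 128) * #|D|%:R) * #|I (D := D) [::]|%:R.
Proof.
move=> b0 b1 A0 AI hA; have [t0 t0A] := card_gt0P A0.
pose f s : nat := hd s [arg min_(t < t0 in A) hd s t].
have fP s : (exists2 t, t \in A & f s = hd s t) /\ (forall t, t \in A -> (f s <= hd s t)%N).
  by rewrite /f; case: arg_minnP => // t tA ht; split=> //; exists t.
have lipn s u : (f s <= f u + hd s u)%N.
  have [[t tA ->] _] := fP u; have [_ h] := fP s.
  by apply: leq_trans (h _ tA) _; rewrite addnC hd_tri.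
pose F s : R := (f s)%:R.
have lipF s u : `|F s - F u| <= (hd s u)%:R.
  move: (lipn s u) (lipn u s); rewrite (hd_sym u s) -!(ler_nat R) !natrD ler_norml /F => h1 h2.
  by apply/andP; split; lra.
have I0 : (0 < #|I (D := D) [::]|)%N by apply: leq_trans A0 (subset_leq_card AI).
set N := #|D|%:R : R; set q := #|I _|%:R in hA *.
have q0 : 0 < q by rewrite ltr0n.
have EF : \sum_(s in I [::]) F s <= beta * N * q.
  have lip4 s a b : fpi s -> `|(- F (s ^ tperm a b)%g) - (- F s)| <= 4.
    move=> fs; rewrite -opprD normrN; apply: le_trans (lipF _ _) _.
    by rewrite ler_nat hd_conj.
  have l0 : 0 <= beta / 64 by rewrite divr_ge0// ltW.
  have lc : beta / 64 * 4 <= 2^-1 by lra.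
  have := conc l0 lc (ler0n _ _) lip4 (isT : uniq (dP [::])) I0.
  have -> : #|U (D := D) [::]| = #|D| by apply: eq_card => x; rewrite !inE.
  rewrite -/q sumrN mulNr; set S := \sum_(s in _) F s => h.
  have {}h : #|A|%:R * expR (beta / 64 * (S / q)) <= q * expR (2 * (beta / 64 * 4) ^+ 2 * N).
    apply: le_trans h; rewrite mulr_natl -sumr_const.
    apply: (@le_trans _ _ (\sum_(s in A) expR (beta / 64 * (- F s - - (S / q))))).
      apply: ler_sum => s sA; have [_ /(_ s sA)] := fP s.
      by rewrite hdxx leqn0 => /eqP fs; rewrite /F fs oppr0 sub0r opprK.
    rewrite [leRHS](bigID (mem A)) /= -[leLHS]addr0 lerD//.
      rewrite le_eqVlt; apply/orP; left; apply/eqP; apply: eq_bigl => s.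
      by case sA : (s \in A); rewrite ?andbF// (fintype.subsetP AI).
    by apply: sumr_ge0 => s _; exact: expR_ge0.
  have := le_trans (ler_wpM2r (expR_ge0 _) hA) h.
  rewrite mulrAC [X in _ <= X]mulrC ler_pM2r// -expRD ler_expR.
  have N0 : 0 <= N by rewrite ler0n.
  move=> h2; rewrite -ler_pdivrMr//; move: h2; set z := S / q => h2.
  have : beta / 64 * z <= beta / 64 * (beta * N) by rewrite !expr2 in h2 *; lra.
  by rewrite ler_pM2l// divr_gt0.
have := conc_tail b0 b1 (fun s t _ _ => lipF s t) I0 EF.
apply: le_trans; rewrite ler_nat; apply: card_incl => s.
move=> /setIdP[sI /forall_inP h]; apply/setIdP; split=> //.
by have [[t tA e] _] := fP s; rewrite /F e; exact: h.
Qed.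
End concentration.

(** * Short cycles, by exploration of a uniform pairing *)

Section exploration.
Context {D V : finType} (vtx : D -> V) (Dl : nat).
Definition dl v : seq D := [seq x <- enum D | vtx x == v].
Hypothesis dlD : forall v, (size (dl v) <= Dl)%N.
Implicit Types (s t u : {perm D}) (P : seq (D * D)).

Lemma mem_dl v x : (x \in dl v) = (vtx x == v).
Proof. by rewrite mem_filter mem_enum andbT. Qed.

Lemma dl_uniq v : uniq (dl v). Proof. by rewrite filter_uniq// enum_uniq. Qed.

(** Continuation without backtracking: at the far end of [x], the partner of [x] is excluded. *)
Definition nxd s x : seq D := [seq z <- dl (vtx (s x)) | z != s x].

Definition fld s k x : seq V := flat (nxd s) (fun x => vtx (s x)) k x.

(* [v] lies on a cycle, or can be reached in two ways, within distance [k + 1] *)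
Definition ntree s k v : bool := ~~ uniq (v :: flatten [seq fld s k x | x <- dl v]).

(** Bound on the number of half-edges explored in a branch of depth [k]. It also bounds the
    propagation of a defect in [unf_lip]. *)
Fixpoint wt k : nat := if k is k'.+1 then (1 + Dl * wt k')%N else 1%N.

Definition WL s (L : seq (nat * D)) : seq V := flatten [seq fld s ky.1 ky.2 | ky <- L].

Definition ch k a : seq (nat * D) :=
  if k is k'.+1 then [seq (k', z) | z <- [seq z <- dl (vtx a) | z != a]] else [::].

Lemma WL_cons s k y L : WL s ((k, y) :: L) = vtx (s y) :: WL s (ch k (s y) ++ L).
Proof.
rewrite /WL map_cat flatten_cat /= -cat_cons; congr (_ ++ _).
by case: k => [|k] //=; rewrite /fld /= -map_comp.
Qed.

(** [L] lists the branches to be explored with their depths, [m] bounds the remaining work and [vis]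
    lists the visited vertices. The partner of [y] is at a visited vertex in at most [b] of the
    [#|U P| - 1] cases; otherwise its vertex is visited and the branches beyond it join the list. A
    union bound over [m] revelations, each with at least [N0] choices, gives a proportion of at most
    m b/N0. *)
Lemma explore m b N0 P vis (L : seq (nat * D)) : uniq (dP P) ->
  (\sum_(ky <- L) wt ky.1 <= m)%N -> uniq (map snd L) ->
  {in L, forall ky, ky.2 \in U P} -> {in L, forall ky, vtx ky.2 \in vis} ->
  (forall z, vtx z \notin vis -> z \in U P) -> uniq vis ->
  (Dl * (size vis + m) <= b)%N -> (N0 + 2 * m <= #|U P|)%N ->
  (#|[set s in I P | ~~ uniq (vis ++ WL s L)]%SET| * N0 <= m * b * #|I P|)%N.
Proof.
elim: m P vis L => [|m ih] P vis L uP wL uL LU Lvis hU uvis hb hN.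
  case: L wL uL LU Lvis => [|[k y] L]; last by rewrite big_cons; case: k.
  move=> _ _ _ _; rewrite (_ : [set s in I P | _]%SET = finset.set0) ?cards0//.
  by apply/setP => s; rewrite inS finset.in_set0 cats0 uvis andbF.
case: L wL uL LU Lvis => [|[k y] L] wL uL LU Lvis.
  rewrite (_ : [set s in I P | _]%SET = finset.set0) ?cards0//.
  by apply/setP => s; rewrite inS finset.in_set0 cats0 uvis andbF.
have yU : y \in U P by exact: (LU _ (mem_head _ _)).
have yvis : vtx y \in vis by exact: (Lvis _ (mem_head _ _)).
set A := finset.finset _.
have step : (#|A| = \sum_(a in (U P :\ y)%SET) #|[set s in I ((y, a) :: P) | s \in A]%SET|)%N.
  have cnt (B C : {set {perm D}}) : (\sum_(s in B) (s \in C) = #|[set s in B | s \in C]%SET|)%N.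
    rewrite -[RHS]sum1_card [RHS](eq_bigl (fun s => (s \in B) && (s \in C))) => [|s]; last by rewrite inS.
    by rewrite [RHS]big_mkcondr; apply: eq_bigr => s _; case: (s \in C).
  have AE : A = [set s in I P | s \in A]%SET.
    by apply/setP => s; apply/idP/setIdP => [sA|[]//]; split=> //; case/setIdP: sA.
  by rewrite {1}AE -cnt (sum_I _ yU); apply: eq_bigr => a _; rewrite cnt.
have [S0|[a0 a0S]] := set_0Vmem (U P :\ y)%SET; first by rewrite step S0 big_set0.
set q := #|I ((y, a0) :: P)|.
have Iq a : a \in (U P :\ y)%SET -> #|I ((y, a) :: P)| = q by move=> aS; exact: card_I_conj.
have cI := card_I_cons yU a0S; rewrite -/q in cI.
have bad a : a \in (U P :\ y)%SET -> vtx a \in vis ->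
    (#|[set s in I ((y, a) :: P) | s \in A]%SET| <= q)%N.
  move=> aS _; rewrite -(Iq a aS); apply: card_incl => s.
  by rewrite inS => /andP[].
have good a : a \in (U P :\ y)%SET -> vtx a \notin vis ->
    (#|[set s in I ((y, a) :: P) | s \in A]%SET| * N0 <= m * b * q)%N.
  move=> aS avis; have aU : a \in U P by case/setD1P: aS.
  have ya : y != a by case/setD1P: aS; rewrite eq_sym.
  rewrite -(Iq a aS).
  have chP ky : ky \in ch k a -> [/\ vtx ky.2 = vtx a & ky.2 != a].
    case: (k) => //= k' /mapP[z]; rewrite mem_filter mem_dl => /andP[za /eqP va] ->.
    by split.
  have := ih ((y, a) :: P) (rcons vis (vtx a)) (ch k a ++ L).
  move=> /(_ _)/wrap[]; first exact: uniq_cons.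
  move=> /(_ _)/wrap[].
    move: wL; rewrite big_cons big_cat /= => wL.
    suff h : (\sum_(i <- ch k a) wt i.1 < wt k)%N.
      by rewrite -ltnS; apply: leq_trans wL; rewrite -addSn leq_add2r.
    case: (k) => [|k'] /=; first by rewrite big_nil.
    rewrite add1n ltnS big_map big_const_seq iter_addn_0 mulnC leq_mul2r count_predT.
    by apply/orP; right; rewrite size_filter (leq_trans (count_size _ _)).
  move=> /(_ _)/wrap[].
    rewrite map_cat cat_uniq; move: uL => /= /andP[_ ->]; rewrite andbT; apply/andP; split.
      case: (k) => //= k'; rewrite -map_comp map_id; apply: filter_uniq; exact: dl_uniq.
    apply/hasPn => z /mapP[ky kyL ->]; apply/mapP => -[kz /chP[e _] ez].
    by move: avis; rewrite -e -ez (Lvis ky)// inE kyL orbT.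
  move=> /(_ _)/wrap[].
    move=> ky; rewrite mem_cat U_cons => /orP[/chP[va kya]|kyL].
      rewrite !in_setD1 kya hU ?va// andbT.
      by apply: contraNneq avis => e; rewrite -va e.
    have kyU := LU ky (mem_behead (s := (k, y) :: L) kyL).
    have kyvis := Lvis ky (mem_behead (s := (k, y) :: L) kyL).
    rewrite !in_setD1 kyU andbT; apply/andP; split.
      by apply: contraNneq avis => <-.
    by apply: contraTneq uL => /= <-; rewrite (map_f snd kyL).
  move=> /(_ _)/wrap[].
    move=> ky; rewrite mem_cat mem_rcons inE => /orP[/chP[-> _]|kyL]; first by rewrite eqxx.
    by rewrite (Lvis ky (mem_behead (s := (k, y) :: L) kyL)) orbT.
  move=> /(_ _)/wrap[].
    move=> z; rewrite mem_rcons inE negb_or U_cons => /andP[za zvis].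
    rewrite !in_setD1 hU// andbT; apply/andP; split.
      by apply: contraNneq za => ->.
    by apply: contraNneq zvis => ->.
  move=> /(_ _)/wrap[]; first by rewrite rcons_uniq avis.
  move=> /(_ _)/wrap[]; first by rewrite size_rcons addSnnS.
  move=> /(_ _)/wrap[]; first by move: hN; rewrite (card_U_cons yU aS); clear; lia.
  apply: leq_trans; rewrite leq_mul2r; apply/orP; right.
  apply: card_incl => s /setIdP[sI /setIdP[_ sA]]; apply/setIdP; split=> //.
  move: sA; rewrite WL_cons; have -> : s y = a by move: sI; rewrite I_cons => /andP[_ /eqP].
  by rewrite cat_rcons.
(* The partners at visited vertices contribute at most [b * q]; the others are bounded by induction,
   with [m] in place of [m.+1]. *)
rewrite step (bigID (fun a => vtx a \in vis)) /= mulnDl mulSnr mulnDl addnC.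
apply: leq_add.
  rewrite big_distrl /=; apply: leq_trans (_ : \sum_(a in (U P :\ y)%SET) m * b * q <= _)%N.
    rewrite big_mkcondr /=; apply: leq_sum => a aS; case: ifP => // avis; exact: good.
  by rewrite sum_nat_const cI (cardsD1 y (U P)) yU /= mulnCA mulnA.
apply: leq_trans (_ : (b * q) * N0 <= _)%N.
  rewrite leq_mul2r; apply/orP; right.
  apply: leq_trans (_ : \sum_(a in D | vtx a \in vis) q <= _)%N.
    rewrite big_mkcond [leqRHS]big_mkcond /=; apply: leq_sum => a _.
    by case: ifP => // /andP[aS avis]; rewrite avis; exact: bad.
  rewrite sum_nat_const leq_mul2r; apply/orP; right.
  apply: leq_trans hb; apply: leq_trans (_ : Dl * size vis <= _)%N; last by rewrite leq_mul2l leq_addr orbT.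
  apply: leq_trans (_ : size (flatten [seq dl v | v <- vis]) <= _)%N.
    apply: leq_trans (card_size _); apply: card_incl => x xv.
    by apply/flattenP; exists (dl (vtx x)); [exact: map_f|rewrite mem_dl].
  rewrite size_flatten sumnE !big_map mulnC.
  apply: leq_trans (_ : \sum_(v <- vis) Dl <= _)%N; first by apply: leq_sum => v _; exact: dlD.
  by rewrite big_const_seq iter_addn_0 mulnC.
rewrite -mulnA leq_mul2l; apply/orP; right.
rewrite cI mulnC leq_mul2r; apply/orP; right.
by move: hN (card_U_cons yU a0S); clear; lia.
Qed.

Lemma card_ntree k v N0 (m := (Dl * wt k)%N) : (N0 + 2 * m <= #|D|)%N ->
  (#|[set s in I [::] | ntree s k v]%SET| * N0 <= m * (Dl * m.+1) * #|I (D := D) [::]|)%N.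
Proof.
move=> hN.
have cU : #|U (D := D) [::]| = #|D| by apply: eq_card => x; rewrite !inE.
have := @explore m (Dl * m.+1)%N N0 [::] [:: v] [seq (k, x) | x <- dl v].
move=> /(_ isT)/(_ _)/wrap[].
  rewrite big_map big_const_seq iter_addn_0 count_predT mulnC leq_mul2r.
  by rewrite (dlD v) orbT.
move=> /(_ _)/wrap[]; first by rewrite -map_comp map_id dl_uniq.
move=> /(_ _)/wrap[]; first by move=> ky _; rewrite inE.
move=> /(_ _)/wrap[]; first by move=> ky /mapP[x]; rewrite mem_dl inE => ? ->.
move=> /(_ _)/wrap[]; first by move=> ky _; rewrite inE.
move=> /(_ isT) /(_ (leqnn _)); rewrite cU => /(_ hN).
apply: leq_trans; rewrite leq_mul2r; apply/orP; right.
apply: card_incl => s; rewrite !inS => /andP[-> /=].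
by rewrite /ntree /WL -map_comp.
Qed.
End exploration.

Lemma uniq_map_inj_in (T T' : eqType) (f : T -> T') (l : seq T) : uniq (map f l) ->
  {in l &, injective f}.
Proof.
elim: l => //= a l ih /andP[al ul] x y; rewrite !inE => /orP[/eqP->|xl] /orP[/eqP->|yl] // e.
- by case/negP: al; rewrite e map_f.
- by case/negP: al; rewrite -e map_f.
- exact: ih.
Qed.

(** * The proportion of simple pairings is at least polynomially small *)

Section simple_pairings.
Context {D V : finType} (vtx : D -> V) (Dl : nat).
Local Notation dl := (dl vtx).
Hypothesis dlD : forall v, (size (dl v) <= Dl)%N.
Implicit Types (s : {perm D}).

(* [x] is a loop or has a parallel *)
Definition bad s x : bool := (vtx (s x) == vtx x) ||
  [exists y, [&& y != x, vtx y == vtx x & vtx (s y) == vtx (s x)]].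

Lemma badP s x : reflect (vtx (s x) = vtx x \/ exists y, [/\ y <> x, vtx y = vtx x & vtx (s y) = vtx (s x)])
  (bad s x).
Proof.
apply: (iffP orP) => -[h|h]; [left; exact/eqP| |left; exact/eqP|].
  by right; case/existsP: h => y /and3P[/eqP ? /eqP ? /eqP ?]; exists y.
by right; apply/existsP; case: h => y [/eqP ? /eqP ? /eqP ?]; exists y; apply/and3P.
Qed.

Definition nbad s := #|[set x | bad s x]%SET|.

Definition simple s := fpi s && (nbad s == 0)%N.

Lemma nbadP s : reflect (forall x, ~~ bad s x) (nbad s == 0)%N.
Proof.
rewrite /nbad cards_eq0; apply: (iffP eqP) => [h x|h].
  by move/setP/(_ x): h; rewrite inS finset.in_set0 => ->.
by apply/setP => x; rewrite inS finset.in_set0 (negbTE (h x)).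
Qed.

Lemma bad_ntree s x : bad s x -> ntree vtx s 0 (vtx x).
Proof.
rewrite /ntree /fld /flat /= => /badP h; apply/negP.
rewrite (_ : flatten _ = map (vtx \o s) (dl (vtx x))); last first.
  by elim: (dl _) => //= a l ->.
case/andP => xm; have xd : x \in dl (vtx x) by rewrite mem_dl.
case: h => [e|[y [yx e1 e2]]].
  by move=> _; case/negP: xm; apply/mapP; exists x.
have yd : y \in dl (vtx x) by rewrite mem_dl e1.
by move=> /uniq_map_inj_in/(_ _ _ yd xd e2).
Qed.

Lemma size_flatten_dl (l : seq V) : (size (flatten [seq dl v | v <- l]) <= size l * Dl)%N.
Proof. by elim: l => //= a l ih; rewrite size_cat mulSn leq_add. Qed.

(** The half-edges at [v] and at its neighbors; a switching with a half-edge taken outside creates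
    neither a loop nor a multiple edge at [v]. *)
Let near s v : seq D := flatten [seq dl w | w <- v :: map (vtx \o s) (dl v)].

Let size_near s v : (size (near s v) <= Dl.+1 * Dl)%N.
Proof.
by apply: leq_trans (size_flatten_dl _) _; rewrite leq_mul2r /= size_map ltnS dlD orbT.
Qed.

Let near_self s v y : y \notin near s v -> vtx y <> v.
Proof.
move=> /negP h e; apply: h; apply/flattenP; exists (dl v); last by rewrite mem_dl e.
by rewrite /= inE eqxx.
Qed.

Let near_nb s v y z : y \notin near s v -> vtx z = v -> vtx (s z) <> vtx y.
Proof.
move=> /negP h zv e; apply: h; apply/flattenP; exists (dl (vtx y)); last by rewrite mem_dl.
by rewrite /= inE -e; apply/orP; right; apply/map_f/mapP; exists z => //; rewrite mem_dl zv.
Qed.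

(** The pairs {x, s x} and {y, s y} are replaced by {x, y} and {s x, s y}. When [y] is not bad, [y]
    is away from the vertex of [x] and [s y] away from that of [s x], the four half-edges become
    good and no other becomes bad. The size condition leaves room for such a [y]. *)
Lemma fixone s : fpi s -> (0 < nbad s)%N -> (2 * (Dl.+1 * Dl) + nbad s < #|D|)%N ->
  exists ab : D * D, (nbad (s ^ tperm ab.1 ab.2)%g < nbad s)%N.
Proof.
move=> /fpiP fs nb hN; case/card_gt0P: (nb) => x; rewrite inS => bx.
have ss z : s (s z) = z by case: (fs z).
have [y hy] : exists y, y \notin near s (vtx x) ++ map s (near s (vtx (s x))) ++ enum [set x | bad s x]%SET.
  apply/existsP; apply/contraLR: hN => /existsPn h; rewrite -leqNgt.
  apply: leq_trans (_ : size (near s (vtx x) ++ map s (near s (vtx (s x))) ++ enum [set x | bad s x]%SET) <= _)%N.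
    apply: leq_trans (card_size _); apply: card_incl => y _.
    exact/negPn/h.
  rewrite size_cat size_cat size_map -cardE mul2n -addnn -addnA.
  exact: leq_add (size_near _ _) (leq_add (size_near _ _) (leqnn _)).
move: hy; rewrite (mem_cat y (near s (vtx x))) (mem_cat y (map s _)) !negb_or => /and3P[y1 y2 y3].
have {}y2 : s y \notin near s (vtx (s x)).
  by apply: contra y2 => h; rewrite -(ss y) map_f.
have yl : vtx (s y) <> vtx y.
  move=> e; case/negP: y3; rewrite mem_enum inS; apply/badP; left; exact: e.
have yx : vtx y <> vtx x := near_self y1.
have sysx : vtx (s y) <> vtx (s x) := near_self y2.
have n1 z : vtx z = vtx x -> vtx (s z) <> vtx y := near_nb y1.
have n2 z : vtx z = vtx (s x) -> vtx (s z) <> vtx (s y) := near_nb y2.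
exists (s x, y); rewrite /nbad /=; set s' := (s ^ _)%g.
have e0 : y != s x by apply/eqP => e; apply: (n1 x) => //; rewrite e.
have e1 : x != y by apply/eqP => e; apply: yx; rewrite e.
have e2 : s y != y by apply/eqP => e; apply: yl; rewrite e.
have e3 : s x != x by case: (fs x) => _ /eqP.
have e4 : s y != s x by apply/eqP => e; apply: sysx; rewrite e.
have e5 : x != s y by apply: contraNneq e0 => ->; rewrite ss.
have s'x : s' x = y.
  by rewrite /s' conj_tperm [tperm _ _ x]tpermD ?tpermL// eq_sym.
have s'y : s' y = x.
  by rewrite /s' conj_tperm tpermR ss tpermD// eq_sym.
have s'sx : s' (s x) = s y.
  by rewrite /s' conj_tperm tpermL tpermD// eq_sym.
have s'sy : s' (s y) = s x.
  rewrite /s' conj_tperm [tperm _ _ (s y)]tpermD// ?ss ?tpermR// eq_sym//.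
have s'z z : z != x -> z != y -> z != s x -> z != s y -> s' z = s z.
  move=> zx zy zsx zsy; rewrite /s' conj_tperm [tperm _ _ z]tpermD 1?eq_sym// tpermD//.
    by apply: contraNneq zx => /perm_inj ->.
  by apply: contraNneq zsy => ->; rewrite ss.
have dich z : [\/ z = x, z = y, z = s x | z = s y] \/ s' z = s z.
  case: (z =P x) => [->|/eqP zx]; first by left; constructor 1.
  case: (z =P y) => [->|/eqP zy]; first by left; constructor 2.
  case: (z =P s x) => [->|/eqP zsx]; first by left; constructor 3.
  case: (z =P s y) => [->|/eqP zsy]; first by left; constructor 4.
  by right; apply: s'z.
have n1' z : vtx z = vtx y -> vtx (s z) <> vtx x.
  by move=> zy e; apply: (n1 (s z)) => //; rewrite ss.
have n2' z : vtx z = vtx (s y) -> vtx (s z) <> vtx (s x).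
  by move=> zy e; apply: (n2 (s z)) => //; rewrite ss.
have m1 : vtx (s x) <> vtx y by exact: n1.
have m2 : vtx (s y) <> vtx x by exact: n1'.
have good z : [\/ z = x, z = y, z = s x | z = s y] -> ~ bad s' z.
  move=> hz; case/badP => [|[w []]]; first by case: hz => ->; rewrite ?(s'x, s'y, s'sx, s'sy); congruence.
  move=> wz; case: (dich w) => [hw|->].
    by case: hw wz => ->; case: hz => ->; rewrite ?(s'x, s'y, s'sx, s'sy); congruence.
  case: hz => ->; rewrite ?(s'x, s'y, s'sx, s'sy);
    [exact: n1|exact: n1'|exact: n2|exact: n2'].
apply: proper_card; apply/properP; split; last first.
  by exists x; rewrite inS//; apply/negP/good; constructor 1.
apply/fintype.subsetP => z; rewrite !inS => bz.
case: (dich z) => [/good//|ez]; have zn : ~ [\/ z = x, z = y, z = s x | z = s y] by move/good.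
move: bz => /badP; rewrite ez; case=> [h|[w [wz e6 e7]]]; first by apply/badP; left.
have [hw|ew] := dich w; last by apply/badP; right; exists w; rewrite -ew.
exfalso; move: (n1 z) (n1' z) (n2 z) (n2' z) e6 e7.
by case: hw => ->; rewrite ?(s'x, s'y, s'sx, s'sy) => a1 a2 a3 a4 e6 e7;
  [apply: a1|apply: a2|apply: a3|apply: a4]; congruence.
Qed.

(** The transposition and the switched pairing determine [s], so that removing one bad half-edge
    loses a factor of at most [#|D|^2 + 1]. *)
Lemma card_fixone j : (2 * (Dl.+1 * Dl) + j.+1 < #|D|)%N ->
  (#|[set s | fpi s & (nbad s <= j.+1)%N]%SET| <=
   (#|D| ^ 2).+1 * #|[set s | fpi s & (nbad s <= j)%N]%SET|)%N.
Proof.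
move=> hN; set A := finset _; set A' := (X in (_ * #|pred_of_set X|)%N).
pose g s : option (D * D) := if (nbad s <= j)%N then None else
  [pick ab : D * D | (nbad (s ^ tperm ab.1 ab.2)%g <= j)%N].
pose h s := if g s is Some ab then (s ^ tperm ab.1 ab.2)%g else s.
rewrite -[_.+1](_ : #|{: option (D * D)}| = _); last by rewrite card_option card_prod.
have inj : {in A &, injective (fun s => (g s, h s))}.
  move=> s t _ _ [e]; rewrite /h e; case: (g t) => // ab.
  by move/conjg_inj.
rewrite -(card_in_imset inj) -[#|{: option _}|]cardsT -cardsX.
apply: card_incl => _ /imsetP[s /setIdP[fs hs] ->].
rewrite inE finset.in_setT /=; apply/setIdP; rewrite /h /g; case: ifP => [//|hj].
case: pickP => [ab hab|hn]; first by rewrite fpi_conj.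
have [||ab] := @fixone s fs; first by apply: leq_trans (_ : j.+1 <= _)%N; rewrite // ltnNge hj.
  by apply: leq_ltn_trans hN; rewrite leq_add2l.
by move/leq_trans => /(_ _ hs); rewrite ltnS hn.
Qed.

Lemma card_simple j m : (2 * (Dl.+1 * Dl) + j + m < #|D|)%N ->
  (#|[set s | fpi s & (nbad s <= j + m)%N]%SET| <=
   (#|D| ^ 2).+1 ^ m * #|[set s | fpi s & (nbad s <= j)%N]%SET|)%N.
Proof.
elim: m => [|m ih]; first by rewrite !addn0 expn0 mul1n.
rewrite addnS => hN; rewrite addnS; apply: leq_trans (card_fixone _) _; first by rewrite addnS addnA.
rewrite [(_ ^ m.+1)%N]expnS -mulnA leq_mul2l; apply/orP; right; apply: ih; exact: ltnW.
Qed.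

Definition nsimple := #|[set s | simple s]%SET|.

(** By [bad_ntree] and [card_ntree] the mean of [nbad] is at most C/2, so by Markov's inequality at
    least half of the pairings have [nbad] at most [C]. Then [C] switchings lead to simple pairings
    at a polynomial cost. *)
Lemma simple_many (C := (4 * (Dl ^ 2 * Dl.+1))%N) :
  (2 * (Dl.+1 * Dl) + C + 4 * Dl < #|D|)%N ->
  (#|I (D := D) [::]| <= 2 * ((#|D| ^ 2).+1 ^ C * nsimple))%N.
Proof.
move=> hN.
have e1 : (\sum_(s in I (D := D) [::]) nbad s * (#|D| - 2 * Dl) <= #|D| * (Dl ^ 2 * Dl.+1) * #|I (D := D) [::]|)%N.
  apply: leq_trans (_ : \sum_x #|[set s in I [::] | ntree vtx s 0 (vtx x)]%SET| * (#|D| - 2 * Dl) <= _)%N.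
    rewrite -!big_distrl /= leq_mul2r; apply/orP; right.
    under [leqRHS]eq_bigr => x _ do rewrite -sum1_card.
    under [leqLHS]eq_bigr => s _ do rewrite /nbad -sum1_card.
    rewrite (exchange_big_dep predT) //=; apply: leq_sum => x _.
    rewrite big_mkcond [leqRHS]big_mkcond; apply: leq_sum => s _ /=.
    case: ifP => // /andP[sI]; rewrite inS => /bad_ntree h.
    by rewrite ifT//; apply/setIdP.
  rewrite -mulnA -sum_nat_const; apply: leq_sum => x _.
  have := @card_ntree _ _ vtx _ dlD 0 (vtx x) (#|D| - 2 * Dl).
  rewrite /= muln1 => /(_ _)/wrap[]; last first.
    by move/leq_trans; apply; rewrite mulnA expnS expn1.
  have : (4 * Dl < #|D|)%N by apply: leq_ltn_trans hN; rewrite leq_addl.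
  by move=> /ltnW h; rewrite subnK//; apply: leq_trans h; rewrite leq_mul2r orbT.
have e2 : (\sum_(s in I (D := D) [::]) nbad s * 2 <= C * #|I (D := D) [::]|)%N.
  move: e1; rewrite -!big_distrl /=.
  have : (4 * Dl < #|D|)%N by apply: leq_ltn_trans hN; rewrite leq_addl.
  rewrite /C; move: (\sum_(_ in _) _)%N (Dl ^ 2 * Dl.+1)%N #|I _| => S q i; clear => h e1.
  have D0 : (0 < #|D|)%N by apply: leq_ltn_trans h.
  rewrite -(leq_pmul2r D0); apply: leq_trans (_ : 4 * (S * (#|D| - 2 * Dl)) <= _)%N.
    rewrite -mulnA [leqRHS]mulnCA leq_mul2l; apply/orP; right; move: h; clear; lia.
  apply: leq_trans (_ : 4 * (#|D| * q * i) <= _)%N; first by rewrite leq_mul2l.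
  by rewrite -!mulnA leq_mul2l /= mulnC mulnA.
have e3 : (#|I (D := D) [::]| <= 2 * #|[set s | fpi s & (nbad s <= C)%N]%SET|)%N.
  rewrite -(cardsID [set s | (nbad s <= C)%N]%SET (I (D := D) [::])) mul2n -addnn.
  have cI : #|(I [::] :&: [set s | (nbad s <= C)%N])%SET| = #|[set s | fpi s & (nbad s <= C)%N]%SET|.
    by apply: eq_card => s; rewrite finset.in_setI I_nil !inS.
  rewrite cI leq_add2l -cI.
  set A := (_ :&: _)%SET; set A' := (_ :\: _)%SET.
  have cAA : (#|I (D := D) [::]| = #|A| + #|A'|)%N by rewrite cardsID.
  have : (C.+1 * 2 * #|A'| <= C * #|I (D := D) [::]|)%N.
    apply: leq_trans e2; rewrite mulnC -sum_nat_const [leqRHS](bigID (mem A')) /=.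
    apply: leq_trans (leq_addr _ _).
    rewrite [leqRHS](eq_bigl (fun s => s \in A')) => [|s]; last first.
      by rewrite /= finset.in_setD; case: (_ \in I _); rewrite ?andbF.
    apply: leq_sum => s; rewrite finset.in_setD inS -ltnNge => /andP[h _].
    by rewrite leq_mul2r /=.
  by rewrite cAA; move: #|A| #|A'| => a a'; clear; move: C => c; nia.
apply: leq_trans e3 _.
rewrite leq_mul2l /=; apply: leq_trans (@card_simple 0%N C _) _.
  by move: hN; clear; lia.
rewrite leq_mul2l; apply/orP; right; apply: card_incl => s.
by rewrite !inS leqn0.
Qed.

End simple_pairings.

(** * From simple pairings to graphs with given degrees *)

Section graphs.
Context {n : nat} {D : finType} (vtx : D -> 'I_n) (deg : 'I_n -> nat).
Local Notation dl := (dl vtx).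
Hypothesis size_dl : forall v, size (dl v) = deg v.
Implicit Types (s : {perm D}) (E : {set {set 'I_n}}).

Definition Gr s : {set {set 'I_n}} := [set [set vtx x; vtx (s x)]%SET | x : D]%SET.

Lemma simple_inj s x y : simple vtx s -> vtx x = vtx y -> vtx (s x) = vtx (s y) -> x = y.
Proof.
case/andP => _ /nbadP/(_ x) h e1 e2; apply/eqP; rewrite eq_sym; apply: contraNT h => xy.
by apply/badP; right; exists y; split=> //; exact/eqP.
Qed.

Lemma simple_loop s x : simple vtx s -> vtx (s x) <> vtx x.
Proof. by case/andP => _ /nbadP/(_ x) h e; move/badP: h; apply; left. Qed.

Lemma edge_Gr s u v : simple vtx s ->
  edge (Gr s) u v = (v \in map (fun x => vtx (s x)) (dl u)).
Proof.
move=> ss; have fs := andP ss; case: fs => /fpiP fs _; rewrite /edge; apply/andP/mapP.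
  case=> uv /imsetP[x _ e].
  have : u \in [set vtx x; vtx (s x)]%SET by rewrite -e finset.in_set2 eqxx.
  have : v \in [set vtx x; vtx (s x)]%SET by rewrite -e finset.in_set2 eqxx orbT.
  rewrite !finset.in_set2 => /orP[/eqP ev|/eqP ev] /orP[/eqP eu|/eqP eu]; subst.
  - by rewrite eqxx in uv.
  - by exists (s x); rewrite ?mem_dl//; case: (fs x) => ->.
  - by exists x; rewrite ?mem_dl.
  - by rewrite eqxx in uv.
case=> x; rewrite mem_dl => /eqP <- ->; split; first by apply/eqP => /esym; exact: simple_loop.
by apply/imsetP; exists x.
Qed.

Lemma Gr_degrees s : simple vtx s -> Gr s \in graphs_of_degrees deg.
Proof.
move=> ss; rewrite inS; apply/andP; split.
  apply/forallP => e; apply/implyP => /imsetP[x _ ->]; rewrite cards2.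
  by case: (vtx x =P _) => // /esym/(simple_loop ss).
apply/forallP => v; rewrite -size_dl -(size_map (fun x => vtx (s x))).
rewrite (_ : finset _ = [set:: map (fun x => vtx (s x)) (dl v)]%SET); last first.
  by apply/setP => w; rewrite !inS edge_Gr.
rewrite cardsE; apply/eqP/card_uniqP; rewrite map_inj_in_uniq ?dl_uniq// => x y.
by rewrite !mem_dl => /eqP xv /eqP yv e; apply: (simple_inj ss) => //; rewrite xv yv.
Qed.

(** One-to-one assignments of the neighbors of each vertex in [E] to its half-edges. A simple
    pairing with graph [E] amounts to such an assignment ([card_fiber]), and the number of these
    depends on the degrees alone ([card_Phi]). *)
Definition Phi E : {set {ffun D -> 'I_n}} :=
  [set phi : {ffun D -> 'I_n} | [forall x, edge E (vtx x) (phi x)] &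
     [forall x, forall y, (vtx x == vtx y) && (phi x == phi y) ==> (x == y)]]%SET.

Lemma PhiP E (phi : {ffun D -> 'I_n}) : reflect ((forall x, edge E (vtx x) (phi x)) /\
   (forall x y, vtx x = vtx y -> phi x = phi y -> x = y)) (phi \in Phi E).
Proof.
apply: (iffP setIdP) => -[/forallP h1 h2]; split=> //.
  by move=> x y e1 e2; move: h2 => /forallP/(_ x)/forallP/(_ y); rewrite e1 e2 !eqxx => /eqP.
apply/forallP => x; apply/forallP => y; apply/implyP => /andP[/eqP e1 /eqP e2].
by apply/eqP; apply: h2.
Qed.

Section fixed_graph.
Variables (E : {set {set 'I_n}}) (hE : E \in graphs_of_degrees deg).

Definition nb v : seq 'I_n := enum [set u | edge E v u]%SET.

Lemma size_nb v : size (nb v) = deg v.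
Proof.
by move: hE; rewrite inS => /andP[_ /forallP/(_ v)/eqP]; rewrite cardE.
Qed.

Lemma mem_nb u v : (v \in nb u) = edge E u v.
Proof. by rewrite mem_enum inS. Qed.

Lemma Phi_onto phi u v : phi \in Phi E -> edge E u v -> exists2 x, vtx x = u & phi x = v.
Proof.
move=> /PhiP[h1 h2] uv.
have sub : {subset map phi (dl u) <= nb u}.
  by move=> w /mapP[x]; rewrite mem_dl mem_nb => /eqP <- ->.
have un : uniq (map phi (dl u)).
  rewrite map_inj_in_uniq ?dl_uniq// => x y.
  by rewrite !mem_dl => /eqP xv /eqP yv; apply: h2; rewrite xv yv.
have [|_ eqm] := uniq_min_size un sub; first by rewrite size_nb size_map size_dl.
have : v \in nb u by rewrite mem_nb.
by rewrite -eqm => /mapP[x]; rewrite mem_dl => /eqP xu ->; exists x.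
Qed.

Lemma card_fiber : #|[set s | simple vtx s & Gr s == E]%SET| = #|Phi E|.
Proof.
pose F (s : {perm D}) : {ffun D -> 'I_n} := [ffun x => vtx (s x)].
rewrite -(card_in_imset (f := F)); last first.
  move=> s t /setIdP[ss _] /setIdP[st /eqP Et] /ffunP e; apply/permP => x.
  have e' z : vtx (s z) = vtx (t z) by move: (e z); rewrite !ffunE.
  have [/fpiP fs _] := andP ss; have [/fpiP ft _] := andP st.
  apply: (simple_inj ss) => //; rewrite (fs x).1 e'.
  by rewrite (ft x).1.
apply: eq_card => phi; apply/imsetP/idP => [[s /setIdP[ss /eqP Es] ->]|hp].
  apply/PhiP; split=> [x|x y]; rewrite !ffunE.
    by rewrite -Es edge_Gr//; apply/mapP; exists x; rewrite ?mem_dl.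
  exact: simple_inj ss.
have /PhiP[h1 h2] := hp.
(* The partner of [x] is the half-edge at the vertex [phi x] to which the vertex of [x] is
   assigned. *)
have hx x : exists y, (vtx y == phi x) && (phi y == vtx x).
  have [y yx xy] := Phi_onto hp (etrans (edge_sym E _ _) (h1 x)).
  by exists y; rewrite yx xy !eqxx.
pose g x := xchoose (hx x).
have g1 x : vtx (g x) = phi x by have /andP[/eqP] := xchooseP (hx x).
have g2 x : phi (g x) = vtx x by have /andP[_ /eqP] := xchooseP (hx x).
have gK : involutive g by move=> x; apply: h2; rewrite ?g1 ?g2.
have fg : fpi (perm (inv_inj gK)).
  apply/fpiP => x; rewrite !permE; split=> // e.
  by move: (h1 x); rewrite -g1 e edge_irr.
have sg : simple vtx (perm (inv_inj gK)).
  apply/andP; split=> //; apply/nbadP => x; apply/badP; rewrite permE g1.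
  case=> [e|[y [yx e]]]; first by move: (h1 x); rewrite e edge_irr.
  by rewrite permE g1 => e'; apply: yx; apply: h2.
exists (perm (inv_inj gK)); last by apply/ffunP => x; rewrite ffunE permE g1.
apply/setIdP; split=> //; apply/eqP/setP => e.
have [eE|eE] := boolP (e \in E).
  have /cards2P[u [v [uv ee]]] : #|e| == 2.
    by move: hE; rewrite inS => /andP[/forallP/(_ e)/implyP/(_ eE)].
  have [|x xu xv] := @Phi_onto _ u v hp; first by rewrite /edge uv -ee.
  by apply/imsetP; exists x; rewrite // permE g1 xu xv.
apply/negP => /imsetP[x _ ee]; case/negP: eE; rewrite ee permE g1.
by move: (h1 x) => /andP[].
Qed.

Lemma Phi_n0 : (0 < #|Phi E|)%N.
Proof.
apply/card_gt0P; exists [ffun x => nth (vtx x) (nb (vtx x)) (index x (dl (vtx x)))].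
have lt x : (index x (dl (vtx x)) < size (nb (vtx x)))%N.
  by rewrite size_nb -size_dl index_mem mem_dl.
apply/PhiP; split=> [x|x y e]; rewrite !ffunE; first by rewrite -mem_nb mem_nth.
have ltx : (index x (dl (vtx y)) < size (nb (vtx y)))%N by rewrite -e.
rewrite e => /eqP; rewrite nth_uniq ?enum_uniq// => /eqP h.
have xm : x \in dl (vtx y) by rewrite mem_dl e.
by rewrite -(nth_index x xm) h nth_index// mem_dl.
Qed.

End fixed_graph.

(** The neighbor lists of a vertex in [E] and [E'] have the same length and are matched index by
    index. *)
Lemma card_Phi E E' : E \in graphs_of_degrees deg -> E' \in graphs_of_degrees deg ->
  (#|Phi E| <= #|Phi E'|)%N.
Proof.
move=> hE hE'.
pose F (phi : {ffun D -> 'I_n}) : {ffun D -> 'I_n} :=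
  [ffun x => nth (vtx x) (nb E' (vtx x)) (index (phi x) (nb E (vtx x)))].
have lt (phi : {ffun D -> 'I_n}) x : phi \in Phi E -> (index (phi x) (nb E (vtx x)) < size (nb E' (vtx x)))%N.
  by case/PhiP => h _; rewrite size_nb// -(size_nb hE) index_mem mem_nb.
have im x (phi : {ffun D -> 'I_n}) : phi \in Phi E -> phi x \in nb E (vtx x).
  by case/PhiP => h _; rewrite mem_nb.
rewrite -(card_in_imset (f := F)); last first.
  move=> phi psi hp hq /ffunP e; apply/ffunP => x; move: (e x); rewrite !ffunE.
  move/eqP; rewrite nth_uniq ?enum_uniq ?lt// => /eqP e'.
  by rewrite -(nth_index (vtx x) (im x _ hp)) e' nth_index ?im.
apply: card_incl => _ /imsetP[phi hp ->].
apply/PhiP; split=> [x|x y e]; rewrite !ffunE; first by rewrite -mem_nb mem_nth ?lt.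
have ltx : (index (phi x) (nb E (vtx y)) < size (nb E' (vtx y)))%N by rewrite -e lt.
have imx : phi x \in nb E (vtx y) by rewrite -e im.
rewrite e => /eqP; rewrite nth_uniq ?enum_uniq// ?lt// => /eqP e'.
case/PhiP: (hp) => _; apply => //.
by rewrite -(nth_index (vtx y) imx) e' nth_index// im.
Qed.

(* The uniform graph is the graph of a uniform simple pairing, as all graphs come
   from equally many pairings. *)
Lemma card_graphs (A : {set {set 'I_n}} -> bool) (R : realType) :
  (0 < nsimple vtx)%N ->
  #|[set E in graphs_of_degrees deg | A E]%SET|%:R / #|graphs_of_degrees deg|%:R =
  #|[set s | simple vtx s & A (Gr s)]%SET|%:R / (nsimple vtx)%:R :> R.
Proof.
case/card_gt0P => s0; rewrite inS => hs0.
have h0 := Gr_degrees hs0.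
have key B : #|[set s | simple vtx s & B (Gr s)]%SET| =
    (#|[set E in graphs_of_degrees deg | B E]%SET| * #|Phi (Gr s0)|)%N.
  rewrite -sum1_card (partition_big Gr (mem [set E in graphs_of_degrees deg | B E]%SET)) /=; last first.
    by move=> s /setIdP[ss hB]; apply/setIdP; split=> //; exact: Gr_degrees.
  rewrite -sum_nat_const; apply: eq_bigr => E /setIdP[hE hB].
  rewrite sum1_card (_ : #|Phi (Gr s0)| = #|Phi E|); last first.
    by apply/eqP; rewrite eqn_leq !card_Phi.
  rewrite -card_fiber//; apply: eq_card => s; rewrite unfold_in 2!inS.
  by case: (simple vtx s); case: (Gr s =P E) => [->|]; rewrite ?hB ?andbF.
have P0 : #|Phi (Gr s0)|%:R != 0 :> R by rewrite pnatr_eq0 -lt0n Phi_n0.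
have -> : nsimple vtx = (#|graphs_of_degrees deg| * #|Phi (Gr s0)|)%N.
  have -> : #|graphs_of_degrees deg| = #|[set E in graphs_of_degrees deg | xpredT E]%SET|.
    by apply: eq_card => E; rewrite [in RHS]inS andbT.
  by rewrite -key; apply: eq_card => s; rewrite !inS andbT.
rewrite key !natrM invfM mulrACA divff// mulr1.
by [].
Qed.
End graphs.

(** * Empirical laws and types of a colored pairing *)

Section empirical_laws.
Context {R : realType} {V : finType}.

Definition emp (T : finType) (X : V -> T) (a : T) : R := #|[set v | X v == a]%SET|%:R / #|V|%:R.

Lemma emp_ge0 (T : finType) (X : V -> T) a : 0 <= emp X a.
Proof. by rewrite divr_ge0. Qed.

Lemma empE (T : finType) (X : V -> T) a : emp X a = (\sum_v (X v == a)%:R) / #|V|%:R.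
Proof.
congr (_ / _); rewrite -sum1_card natr_sum big_mkcond /=.
by apply: eq_bigr => v _; rewrite inS; case: ifP.
Qed.

Lemma sum_emp (T : finType) (X : V -> T) (g : T -> R) :
  \sum_a emp X a * g a = (\sum_v g (X v)) / #|V|%:R.
Proof.
under eq_bigr => a _ do rewrite empE mulrAC mulr_suml.
rewrite -mulr_suml exchange_big /=; congr (_ / _); apply: eq_bigr => v _.
rewrite (bigD1 (X v)) //= eqxx mul1r big1 ?addr0// => a; rewrite eq_sym => /negbTE ->.
by rewrite mul0r.
Qed.

Lemma sum_emp1 (T : finType) (X : V -> T) : (0 < #|V|)%N -> \sum_a emp X a = 1.
Proof.
move=> V0; under eq_bigr => a _ do rewrite -[emp _ _]mulr1.
by rewrite sum_emp sumr_const mulfV// pnatr_eq0 -lt0n.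
Qed.

Lemma push_emp (T U : finType) (phi : T -> U) (X : V -> T) : push phi (emp X) =1 emp (phi \o X).
Proof.
move=> u; transitivity (\sum_a emp X a * (phi a == u)%:R); last by rewrite sum_emp empE.
rewrite /push big_mkcond /=; apply: eq_bigr => a _.
by case: (phi a == u); rewrite ?mulr1 ?mulr0.
Qed.

Lemma emp_dist (T : finType) (X Y : V -> T) a :
  `|emp X a - emp Y a| <= #|[set v | X v != Y v]%SET|%:R / #|V|%:R.
Proof.
rewrite !empE -mulrBl -sumrB normrM [X in _ * X]ger0_norm ?invr_ge0//.
rewrite ler_wpM2r ?invr_ge0//; apply: le_trans (ler_norm_sum _ _ _) _.
rewrite -sum1_card natr_sum big_mkcond [leRHS]big_mkcond /=; apply: ler_sum => v _.
rewrite inS; case: (X v =P Y v) => [->|_] /=; first by rewrite subrr normr0.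
by case: (X v == a); case: (Y v == a); rewrite ?subrr ?subr0 ?sub0r ?normrN ?normr0 ?normr1.
Qed.
End empirical_laws.

Lemma picks_uniq (T : eqType) (s : seq T) : uniq s ->
  picks s = [seq (x, [seq z <- s | z != x]) | x <- s].
Proof.
elim: s => //= a s ih /andP[as_ us]; rewrite eqxx /= ih//.
congr ((_, _) :: _).
  by rewrite -[LHS]filter_predT; apply: eq_in_filter => z zs; apply/esym/eqP => e; rewrite -e zs in as_.
rewrite -map_comp; apply/eq_in_map => x xs /=.
by rewrite ifT//; apply: contraNneq as_ => ->.
Qed.

Section types.
Context {D V : finType} (vtx : D -> V) (Dl : nat).
Local Notation dl := (dl vtx).
Hypothesis dlD : forall v, (size (dl v) <= Dl)%N.
Implicit Types (s t : {perm D}).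

Lemma nxdD s x : (size (nxd vtx s x) <= Dl)%N.
Proof. by apply: leq_trans (dlD (vtx (s x))); rewrite size_filter count_size. Qed.

(** Outside [Inc] the family [b] obeys the recursion that defines the unfolding. A defect at a
    half-edge is seen one level higher by at most [Dl] others, whence the growth by [wt]. This
    compares the types of two pairings ([typ_lip]), and also prescribed types with the actual types
    of a pairing that respects most of them ([near_X]). *)
Lemma unf_lip (M : finType) s (c : D -> M) (b : forall j, D -> B M Dl j) (Inc : {set D}) k :
  (forall x, x \notin Inc -> b 0%N x = c x) ->
  (forall j x, (j < k)%N -> x \notin Inc -> b j.+1 x = nd (c x) (map (b j) (nxd vtx s x))) ->
  (#|[set x | b k x != unf (nxd vtx s) c k x]%SET| <= wt Dl k * #|Inc|)%N.
Proof.
move=> h0; elim: k => [|k ih] hS.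
  rewrite mul1n; apply: card_incl => x; rewrite inS.
  by apply: contraNT => /h0 ->.
set Bk := [set x | b k x != unf (nxd vtx s) c k x]%SET.
have {}ih : (#|Bk| <= wt Dl k * #|Inc|)%N by apply: ih => j x jk; apply: hS; exact: ltnW.
pose pre := [set x | has (mem Bk) (nxd vtx s x)]%SET.
have cpre : (#|pre| <= Dl * #|Bk|)%N.
  apply: leq_trans (_ : \sum_(z in Bk) #|[set x | z \in nxd vtx s x]%SET| <= _)%N.
    apply: leq_trans (_ : #|\bigcup_(z in Bk) [set x | z \in nxd vtx s x]%SET|%SET <= _)%N.
      apply: card_incl => x; rewrite inS => /hasP[z zx zB].
      by apply/bigcupP; exists z => //; rewrite inS.
    apply: (big_ind2 (fun (A : {set D}) m => #|A| <= m)%N); rewrite ?cards0// => A m A' m' h h'.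
    by apply: leq_trans (leq_add h h'); rewrite cardsU leq_subr.
  rewrite mulnC -sum_nat_const; apply: leq_sum => z _; apply: leq_trans (dlD (vtx z)).
  rewrite -(card_imset _ (@perm_inj _ s)); apply: leq_trans (card_size _).
  apply: card_incl => _ /imsetP[x + ->].
  by rewrite inS /nxd mem_filter => /andP[_]; rewrite !mem_dl eq_sym.
rewrite /= mulnDl mul1n -mulnA; apply: leq_trans (leq_add (leqnn _) (leq_trans cpre _)); last first.
  by rewrite leq_mul2l ih orbT.
apply: leq_trans (_ : #|(Inc :|: pre)%SET| <= _)%N; last by rewrite cardsU leq_subr.
apply: card_incl => x; rewrite inS finset.in_setU.
apply: contraNT; rewrite negb_or => /andP[xI]; rewrite inS -all_predC => /allP hx.
rewrite hS// /unf; apply/eqP; congr nd; apply/eq_in_map => z /hx /=.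
by rewrite inS negbK => /eqP.
Qed.

Section coloring.
Context {M : finType} (f : V -> M).

(* The branch through the half-edge [x] in the universal cover of the paired graph *)
Definition br s k x : B M Dl k := unf (nxd vtx s) (fun x => f (vtx (s x))) k x.

Lemma brS s k x : br s k.+1 x = nd (f (vtx (s x))) (map (br s k) (nxd vtx s x)).
Proof. by []. Qed.

Definition typ s k v : B M Dl k.+1 := nd (f v) (map (br s k) (dl v)).

Lemma kids_typ s k v : kids (typ s k v) = map (br s k) (dl v).
Proof. by rewrite kids_nd// size_map. Qed.

Lemma tr_typ s k v : tr (typ s k.+1 v) = typ s k v.
Proof.
rewrite trS kids_typ -map_comp; congr nd; apply: eq_map => x /=.
by apply: tr_unf => y; exact: nxdD.
Qed.

(** Once the branch through [x] is removed, the truncated tree at [v] is the branch through the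
    partner of [x], which leads back to [v]. This is why every colored pairing has a symmetric edge
    law ([edge_symm_typ]). *)
Lemma kaps_typ s k v : fpi s -> kaps (typ s k v) = [seq (br s k x, br s k (s x)) | x <- dl v].
Proof.
move=> /fpiP fs; rewrite /kaps kids_typ map_picks picks_uniq ?dl_uniq// -!map_comp.
apply/eq_in_map => x; rewrite mem_dl => /eqP xv; rewrite /kap /=; congr pair.
have sz : (size [seq z <- dl v | z != x] <= Dl)%N.
  by apply: leq_trans (dlD v); rewrite size_filter count_size.
case: k => [|k]; first by rewrite /tr /br /unf /= (fs x).1 xv.
rewrite trS kids_nd ?size_map// -map_comp brS /nxd (fs x).1 xv.
by congr nd; apply: eq_map => z /=; apply: tr_unf => y; exact: nxdD.
Qed.

Lemma typ_lip s t k :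
  (#|[set v | typ s k v != typ t k v]%SET| <= wt Dl k * hd s t)%N.
Proof.
apply: leq_trans (_ : #|[set x | br t k x != br s k x]%SET| <= _)%N; last first.
  have := @unf_lip M s (fun x => f (vtx (s x))) (br t) [set x | s x != t x]%SET k; apply.
    by move=> x; rewrite inS negbK /br /unf => /eqP ->.
  by move=> j x _; rewrite inS negbK /br /unf -/unf /nxd => /eqP ->.
apply: leq_trans (_ : #|vtx @: [set x | br t k x != br s k x]|%SET <= _)%N; last exact: leq_imset_card.
apply: card_incl => v; rewrite inS => h.
suff /hasP[x xv hx] : has (fun x => br t k x != br s k x) (dl v).
  by apply/imsetP; exists x; rewrite ?inS//; apply/esym/eqP; rewrite -mem_dl.
apply: contraNT h; rewrite -all_predC => /allP hx; apply/eqP; congr nd.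
by apply/eq_in_map => x /hx /=; rewrite negbK => /eqP.
Qed.

End coloring.

Fixpoint flatB (T : finType) k : B T Dl k -> seq T :=
  match k with
  | 0 => fun x => [:: x]
  | k'.+1 => fun x => x.1 :: flatten (map (@flatB T k') (kids x))
  end.

Lemma flatB_unf (W : Type) (T : finType) (nx : W -> seq W) (c : W -> T) k w :
  (forall w, size (nx w) <= Dl)%N -> flatB (unf nx c k w) = flat nx c k w.
Proof.
move=> h; elim: k w => // k ih w; rewrite [LHS]/= kids_unf// -map_comp /=.
by congr (_ :: flatten _); apply: eq_map => y; exact: ih.
Qed.

(** Coloring each vertex by itself makes [ntree] a function of the type, so that [typ_lip] yields
    [ntree_lip]. *)
Lemma ntree_typ s k v : ntree vtx s k v = ~~ uniq (flatB (typ id s k v)).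
Proof.
rewrite /ntree [flatB _]/= kids_typ -map_comp; congr (~~ uniq (_ :: flatten _)).
by apply: eq_map => x; rewrite /fld -flatB_unf// => w; exact: nxdD.
Qed.

Lemma ntree_lip s t k : (#|[set v | ntree vtx s k v]%SET| <=
  #|[set v | ntree vtx t k v]%SET| + wt Dl k * hd s t)%N.
Proof.
apply: leq_trans (leq_add (leqnn _) (typ_lip id s t k)).
apply: leq_trans (_ : #|[set v | ntree vtx t k v] :|: [set v | typ id s k v != typ id t k v]|%SET <= _)%N.
  apply: card_incl => v; rewrite !inE !ntree_typ.
  by case: eqP => [->|_]; rewrite ?orbT ?orbF.
by rewrite cardsU leq_subr.
Qed.

Lemma size_kids_typ (M : finType) (f : V -> M) s k v : size (kids (typ f s k v)) = size (dl v).
Proof. by rewrite kids_typ size_map. Qed.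

Lemma sum_dl (T : nmodType) (g : D -> T) : \sum_v \sum_(x <- dl v) g x = \sum_x g x.
Proof.
rewrite [RHS](partition_big vtx predT)//=; apply: eq_bigr => v _.
by rewrite /dl big_filter big_enum_cond.
Qed.

Lemma sum_size_dl : (\sum_v size (dl v) = #|D|)%N.
Proof.
transitivity (\sum_v \sum_(x <- dl v) 1)%N; first by apply: eq_bigr => v _; rewrite sum1_size.
by rewrite (sum_dl (T := nat)) sum1_card.
Qed.

Section law.
Context {R : realType} {M : finType} (f : V -> M) (s : {perm D}) (fs : fpi s) (k : nat).
Local Notation L := (@emp R V _ (typ f s k)).

Lemma mdeg_emp (X : V -> B M Dl k.+1) : (forall v, size (kids (X v)) = size (dl v)) ->
  mdeg (@emp R V _ X) = #|D|%:R / #|V|%:R.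
Proof.
move=> h; rewrite /mdeg sum_emp -sum_size_dl natr_sum; congr (_ / _).
by apply: eq_bigr => v _; rewrite h.
Qed.

Lemma push2_Ek_typ ab : push (@canon2 _ _ k) (Ek L) ab =
  (\sum_x (canon (br f s k x) == ab.1)%:R * (canon (br f s k (s x)) == ab.2)%:R) / #|V|%:R.
Proof.
transitivity (\sum_cd Ek L cd * (canon2 cd == ab)%:R).
  rewrite /push big_mkcond; apply: eq_bigr => cd _; case: (_ == ab); rewrite ?mulr1 ?mulr0//.
rewrite sum_Ek sum_emp; congr (_ / _); rewrite -sum_dl.
apply: eq_bigr => v _; rewrite kaps_typ// big_map; apply: eq_bigr => x _.
case: ab => a b; rewrite /canon2 /= (@xpair_eqE (B M Dl k) (B M Dl k)).
by case: (_ == a); case: (_ == b); rewrite ?mulr1 ?mulr0.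
Qed.

Lemma edge_symm_typ : edge_symm (push (@canon2 _ _ k) (Ek L)).
Proof.
move=> a b; rewrite !push2_Ek_typ; congr (_ / _).
rewrite (reindex_inj (@perm_inj _ s)) /=; apply: eq_bigr => x _.
by case/fpiP/(_ x): fs => -> _; rewrite mulrC.
Qed.

Lemma push_deg_typ : push (@degB _ _ k) L =1 emp (fun v => degB (typ f s k v)).
Proof. by move=> d; rewrite push_emp. Qed.
End law.
End types.

Lemma canon2_star (M : finType) (Dl k : nat) (x : B M Dl k.+1) :
  map (@canon2 _ _ k) (kaps (star x)) = map (@canon2 _ _ k) (kaps x).
Proof.
rewrite /kaps kids_star map_picks -!map_comp; apply/eq_in_map => b /size_picks_le hb.
have sb : (size b.2 <= Dl)%N by apply: leq_trans (size_kids x); rewrite -hb.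
rewrite /canon2 /kap /= canonK; congr pair; apply: canon_tr; apply/canonP; split=> //.
rewrite !kids_nd ?size_map// -map_comp (eq_map (g := @canon _ _ k)) ?perm_refl// => y /=.
by rewrite canonK.
Qed.

Section err.
Context {R : realType}.
Lemma err_ge0 C N : 0 <= err C N :> R.
Proof. by rewrite mulr_ge0// addr_ge0// ln_ge0// ler1n. Qed.

Lemma err_le C C' N N' : (C <= C')%N -> (N <= N')%N -> err C N <= err C' N' :> R.
Proof.
move=> CC NN; rewrite ler_pM ?ler_nat ?addr_ge0 ?ln_ge0 ?ler1n// lerD2l.
by rewrite ler_ln ?posrE// ler_nat ltnS.
Qed.

Lemma errD C C' N : err (C + C') N = err C N + err C' N :> R.
Proof. by rewrite /err natrD mulrDl. Qed.
End err.

(** * Pairings compatible with a coloring of the half-edges *)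

Section compat_bound.
Context {R : realType} {D : finType} {K : finType} (iota : K -> K) (iotaK : involutive iota) (c : D -> K).
Hypotheses (D0 : (0 < #|D|)%N) (eD : ~~ odd #|D|).

Local Notation N := (#|D|%:R : R).
Local Notation e k := (#|[set x | c x == k]%SET|%:R / N : R).

Lemma card_U_nil : #|U (D := D) [::]| = #|D|.
Proof. by apply: eq_card => x; rewrite !inE. Qed.

Let cntE k : cnt c [::] k = #|[set x | c x == k]%SET|.
Proof. by apply: eq_card => x; rewrite !inE. Qed.

Let sumc : (\sum_k cnt c [::] k = #|D|)%N.
Proof.
rewrite -sum1_card (partition_big c predT)//=; apply: eq_bigr => k _.
by rewrite cntE -sum1_card; apply: eq_bigl => x; rewrite inS.
Qed.

Lemma lnI : `|ln (#|I (D := D) [::]|%:R) - 2^-1 * (N * ln N - N)| <= err 1 #|D| :> R.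
Proof.
rewrite card_I// card_U_nil.
have ge := ndf_ge eD; have le := ndf_le #|D|.
have n0 : (0 < ndf #|D|)%N.
  rewrite lt0n; apply: contraTneq ge => ->.
  by rewrite exp0n// muln0 -ltnNge fact_gt0.
have n0R : 0 < (ndf #|D|)%:R :> R by rewrite ltr0n.
have N1 : 0 < #|D|.+1%:R :> R by rewrite ltr0n.
have l1 := lfact_ge (R := R) #|D|; have l2 := lfact_le (R := R) #|D|.
have l3 : 2 * ln (ndf #|D|)%:R <= lfact #|D| :> R.
  by rewrite mulr_natl -lnXn// -natrX ler_ln ?posrE ?ler_nat// ltr0n ?expn_gt0 ?n0 ?fact_gt0.
have l4 : lfact #|D| <= ln #|D|.+1%:R + 2 * ln (ndf #|D|)%:R :> R.
  rewrite mulr_natl -lnXn// -lnM ?posrE ?exprn_gt0// -natrX -natrM.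
  by rewrite ler_ln ?posrE ?ler_nat// ltr0n ?muln_gt0 ?expn_gt0 ?n0 ?fact_gt0.
have l5 : 0 <= ln #|D|.+1%:R :> R by rewrite ln_ge0// ler1n.
move: l1 l2; rewrite /err /xlnx => l1 l2.
by rewrite ler_norml; apply/andP; split; lra.
Qed.

Lemma I_gt0 : (0 < #|I (D := D) [::]|)%N.
Proof.
rewrite card_I// card_U_nil lt0n; apply: contraTneq (ndf_ge eD) => ->.
by rewrite exp0n// muln0 -ltnNge fact_gt0.
Qed.

Let lfactc : `|\sum_k lfact (cnt c [::] k) - (N * ln N - N - N * shan (fun k => e k))| <= err #|K| #|D|.
Proof.
rewrite (_ : shan _ = shan (fun k => (cnt c [::] k)%:R / N)); last first.
  by apply: eq_bigr => k _; rewrite cntE.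
exact: sum_lfact.
Qed.

Let cntD k : (cnt c [::] k <= #|D|)%N.
Proof. by rewrite -sumc (bigD1 k)//= leq_addr. Qed.

(** If some pairing is compatible the color counts are balanced and [card_compat] applies. It gives
    the square of the number of compatible pairings, and the square of the number of all pairings is
    about N!, whence N/2 in front of the entropy. *)
Lemma compat_le : #|compat iota c [::]|%:R <=
  expR (- (N / 2 * shan (fun k => e k)) + err (#|K| + 1) #|D|) * #|I (D := D) [::]|%:R :> R.
Proof.
have [->|] := posnP #|compat iota c [::]|; first by rewrite mulr_ge0// expR_ge0.
move=> c0; have /card_gt0P[s hs] := c0.
have := card_compat iotaK (P := [::]) (fun k => compat_balanced iotaK k hs) isT.
move=> hc; have c0R : 0 < #|compat iota c [::]|%:R :> R by rewrite ltr0n.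
have h : 2 * ln #|compat iota c [::]|%:R <= \sum_k lfact (cnt c [::] k) :> R.
  rewrite mulr_natl -lnXn// -natrX hc -ler_expR sum_lfact_eq lnK; last first.
    by rewrite posrE ltr0n -hc expn_gt0 c0.
  rewrite ler_nat; apply: leq_prod => k _; rewrite /gfac; case: ifP => // _; exact: ndf_le.
have I0 : 0 < #|I (D := D) [::]|%:R :> R by rewrite ltr0n I_gt0.
rewrite -[leLHS]lnK ?posrE// -[X in _ * X]lnK ?posrE// -expRD ler_expR.
move: lnI lfactc; rewrite errD !ler_norml => /andP[a1 a2] /andP[a3 a4].
have a5 : 0 <= err #|K| #|D| :> R by exact: err_ge0.
move: a1 a2 a3 a4 a5 h.
set x := ln _; set y := ln _; set z := \sum_k _; set u := err _ _; set v := err _ _; set w := N * ln N.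
set sh := shan _; rewrite (mulrAC N); set q := N * sh; lra.
Qed.

(** Balance and evenness of the colors fixed by [iota] are exactly what makes all the factors [gfac]
    positive; [ndf_ge] then loses a linear factor per color. *)
Lemma compat_ge : (forall k, #|[set x | c x == k]%SET| = #|[set x | c x == iota k]%SET|) ->
  (forall k, iota k = k -> ~~ odd #|[set x | c x == k]%SET|) ->
  expR (- (N / 2 * shan (fun k => e k)) - err (#|K| + 1) #|D|) * #|I (D := D) [::]|%:R <=
  #|compat iota c [::]|%:R :> R.
Proof.
move=> bal ev.
have hc := card_compat iotaK (c := c) (P := [::]) (fun k => etrans (cntE k) (etrans (bal k) (esym (cntE _)))) isT.
have g0 k : (0 < gfac iota k (cnt c [::] k))%N.
  rewrite /gfac; case: eqP => [/ev|_]; last exact: fact_gt0.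
  rewrite -cntE => /ndf_ge h; rewrite lt0n; apply: contraTneq h => ->.
  by rewrite muln0 -ltnNge fact_gt0.
have c0 : (0 < #|compat iota c [::]|)%N.
  have : (0 < #|compat iota c [::]| ^ 2)%N by rewrite hc prodn_gt0.
  by rewrite expn_gt0 orbF.
have c0R : 0 < #|compat iota c [::]|%:R :> R by rewrite ltr0n.
have h : \sum_k lfact (cnt c [::] k) - #|K|%:R * ln #|D|.+1%:R <= 2 * ln #|compat iota c [::]|%:R :> R.
  rewrite [leRHS]mulr_natl -lnXn// -natrX hc -ler_expR lnK; last first.
    by rewrite posrE ltr0n -hc expn_gt0 c0.
  rewrite mulr_natl -sumr_const -sumrB expR_sum natr_prod; apply: ler_prod => k _.
  rewrite expR_ge0 /= expRB expR_lfact lnK ?posrE ?ltr0n// ler_pdivrMr ?ltr0n// -natrM ler_nat mulnC.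
  rewrite /gfac; case: eqP => [/ev|_].
    by rewrite -cntE => /ndf_ge/leq_trans; apply; rewrite leq_mul2r ltnS cntD orbT.
  by rewrite leq_pmull.
have I0 : 0 < #|I (D := D) [::]|%:R :> R by rewrite ltr0n I_gt0.
rewrite -[leRHS]lnK ?posrE// -[X in _ * X]lnK ?posrE// -expRD ler_expR.
have a6 : err #|K| #|D| = #|K|%:R + #|K|%:R * ln #|D|.+1%:R :> R by rewrite /err mulrDr mulr1.
have a5 : 0 <= #|K|%:R :> R by [].
move: lnI lfactc; rewrite errD !ler_norml => /andP[a1 a2] /andP[a3 a4].
move: a1 a2 a3 a4 a5 a6 h.
set x := ln _; set y := ln _; set z := \sum_k _; set u := err _ _; set v := err _ _; set w := N * ln N.
set kl := #|K|%:R * _.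
set sh := shan _; rewrite (mulrAC N); set q := N * sh; lra.
Qed.
End compat_bound.

(** * Upper bound on the number of colored pairings of a given type *)

Section core_upper.
Context {R : realType} {D V : finType} (vtx : D -> V) (M : finType) (Dl k : nat).
Local Notation dl := (dl vtx).
Local Notation Bk := (B M Dl k).
Local Notation K := (B M Dl k.+1).
Local Notation ty s f := (typ vtx Dl f s k).
Hypothesis dlD : forall v, (size (dl v) <= Dl)%N.
Hypotheses (V0 : (0 < #|V|)%N) (D0 : (0 < #|D|)%N) (eD : ~~ odd #|D|).
Implicit Types (s : {perm D}) (f : {ffun V -> M}).

Definition dg (v : V) : 'I_Dl.+1 := Ordinal (dlD v : (size (dl v) < Dl.+1)%N).

Lemma degB_ty s f v : degB (ty s f v) = dg v.
Proof. by apply: val_inj; rewrite /= size_kids_typ. Qed.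

Definition swp (ab : Bk * Bk) : Bk * Bk := (ab.2, ab.1).
Lemma swpK : involutive swp. Proof. by case. Qed.

(** The color of the half-edge [x] as read in the tree at its vertex: the branch through [x] and the
    truncated rest, found at the position of [x] in [dl]. The default of [nth] is not reached when
    the tree has one branch for each half-edge of the vertex. *)
Definition dcol (T : finType) (h : Bk * Bk -> T) (X : V -> K) (x : D) : T :=
  nth (h (lf k (X (vtx x)).1, lf k (X (vtx x)).1))
    (map h (kaps (X (vtx x)))) (index x (dl (vtx x))).

Lemma dcol_typ s f x : fpi s ->
  dcol (@canon2 _ _ k) (fun v => star (ty s f v)) x = (canon (br vtx Dl f s k x), canon (br vtx Dl f s k (s x))).
Proof.
move=> fs; have xd : x \in dl (vtx x) by rewrite mem_dl.
rewrite /dcol canon2_star (kaps_typ dlD)// -map_comp (nth_map x) ?index_mem//.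
by rewrite /canon2 /= nth_index.
Qed.

Lemma count_dcol (T : finType) (h : Bk * Bk -> T) (X : V -> K) ab :
  (forall v, size (kids (X v)) = size (dl v)) ->
  #|[set x | dcol h X x == ab]%SET| = (\sum_v count_mem ab (map h (kaps (X v))))%N.
Proof.
move=> hX; rewrite -sum1_card (partition_big vtx predT)//=; apply: eq_bigr => v _.
have : size (map h (kaps (X v))) = size (dl v) by rewrite size_map size_kaps hX.
set l := map _ _ => sl.
have -> : l = map (dcol h X) (dl v).
  apply: (@eq_from_nth _ (h (lf k (X v).1, lf k (X v).1))) => [|i]; first by rewrite sl size_map.
  rewrite sl => il.
  have x0 : D by case: (dl v) il.
  rewrite (nth_map x0)//; have : nth x0 (dl v) i \in dl v by rewrite mem_nth.
  rewrite mem_dl /dcol => /eqP ->; rewrite index_uniq// ?dl_uniq//.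
rewrite count_map -sum1_count /dl big_filter_cond big_enum_cond /=.
by apply: eq_bigl => x; rewrite inS andbC.
Qed.

Let C := (2 * #|{: K}| + Dl.+1 + #|{: Bk * Bk}| + 1)%N.

Section one_class.
Variables (s0 : {perm D}) (f0 : {ffun V -> M}) (fs0 : fpi s0).
Let X0 v := star (ty s0 f0 v).
Let L0 : K -> R := emp (ty s0 f0).
Let m (a : K) := #|[set v | X0 v == a]%SET|.

Let Cls := [set X : {ffun V -> K} | [forall v, degB (X v) == dg v] &
      [forall a, #|[set v | X v == a]%SET| == m a]]%SET.

Let degX X v : X \in Cls -> size (kids (X v)) = size (dl v).
Proof. by case/setIdP => /forallP/(_ v)/eqP/(congr1 val). Qed.

Let count_X X ab : X \in Cls ->
  (#|[set x | dcol (@canon2 _ _ k) X x == ab]%SET| = #|[set x | dcol (@canon2 _ _ k) X0 x == ab]%SET|)%N.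
Proof.
move=> hX; rewrite (count_dcol _ _ (fun v => degX v hX)) count_dcol; last first.
  by move=> v; rewrite /X0 kids_star size_map size_kids_typ.
rewrite (partition_big X predT)//= [RHS](partition_big X0 predT)//=.
apply: eq_bigr => a _.
rewrite (eq_bigr (fun=> count_mem ab (map (@canon2 _ _ k) (kaps a)))); last by move=> v /eqP ->.
rewrite [RHS](eq_bigr (fun=> count_mem ab (map (@canon2 _ _ k) (kaps a)))); last by move=> v /eqP ->.
rewrite !sum_nat_const; congr muln.
case/setIdP: hX => _ /forallP/(_ a)/eqP; rewrite /m => h.
rewrite -(@eq_card _ [set v | X v == a]%SET) => [|v]; last by rewrite !inE.
by rewrite h; apply: eq_card => v; rewrite !inE.
Qed.

(** The pair (s, f) is encoded by [s] and the map [X] of types modulo [star], where [f] is the color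
    of the root. [X] has a prescribed empirical law, which leaves exp (n (H(star) - H(degree)))
    choices up to a polynomial factor, and [s] is compatible with the colors read in [X]. The
    resulting exponent is the left-hand side of [Sig_star_le]. *)
Lemma core_class (A : {set {perm D} * {ffun V -> M}}) (c : R) :
  (forall s f, (s, f) \in A -> fpi s) ->
  (forall s f a, (s, f) \in A -> #|[set v | star (ty s f v) == a]%SET| = m a) ->
  Sig (Sym L0) <= c ->
  #|A|%:R <= expR (#|V|%:R * c + err (#|{: K}| + Dl.+1) #|V| + err (#|{: Bk * Bk}| + 1) #|D|) *
     #|I (D := D) [::]|%:R :> R.
Proof.
move=> fA mA Sc.
pose F (sf : {perm D} * {ffun V -> M}) : {perm D} * {ffun V -> K} := (sf.1, [ffun v => star (ty sf.1 sf.2 v)]).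
have Finj : injective F.
  move=> [s f] [t g] [<- /ffunP e]; congr pair; apply/ffunP => v.
  by move: (e v); rewrite !ffunE => /(congr1 fst).
rewrite -(card_imset _ Finj).
pose Tot := (\sum_(X in Cls) #|compat swp (dcol (@canon2 _ _ k) X) [::]|)%N.
have le1 : (#|F @: A|%SET <= Tot)%N.
  apply: leq_trans (_ : #|\bigcup_(X in Cls) [set (s, X) | s in compat swp (dcol (@canon2 _ _ k) X) [::]]|%SET <= _)%N.
    apply: card_incl => _ /imsetP[[s f] sfA ->] /=.
    have fs := fA _ _ sfA; apply/bigcupP; exists [ffun v => star (ty s f v)].
      apply/setIdP; split; apply/forallP => a.
        by rewrite ffunE -(degB_ty s f); apply/eqP/val_inj; rewrite /= kids_star size_map.
      rewrite -(mA _ _ a sfA); apply/eqP; apply: eq_card => v.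
      by rewrite !inS ffunE.
    apply: imset_f; apply/setIdP; split; first by rewrite I_nil.
    apply/forall_inP => x _; apply/eqP.
    have e y : dcol (@canon2 _ _ k) [ffun v => star (ty s f v)] y = dcol (@canon2 _ _ k) (fun v => star (ty s f v)) y.
      by rewrite /dcol ffunE.
    rewrite (e (s x)) (e x) !dcol_typ// /swp /=; congr (_, _).
    by case/fpiP/(_ x): fs => ->.
  apply: (big_ind2 (fun (A : {set _}) m => #|A| <= m)%N); rewrite ?cards0//.
    by move=> A1 m1 A2 m2 h1 h2; apply: leq_trans (leq_add h1 h2); rewrite cardsU leq_subr.
  by move=> X _; exact: leq_imset_card.
apply: le_trans (_ : Tot%:R <= _); first by rewrite ler_nat.
set ec := fun ab => #|[set x | dcol (@canon2 _ _ k) X0 x == ab]%SET|%:R / #|D|%:R : R.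
have le2 : Tot%:R <= #|Cls|%:R * (expR (- (#|D|%:R / 2 * shan ec) + err (#|{: Bk * Bk}| + 1) #|D|) * #|I (D := D) [::]|%:R) :> R.
  rewrite natr_sum mulr_natl -sumr_const; apply: ler_sum => X hX.
  apply: le_trans (compat_le (R := R) swpK (dcol (@canon2 _ _ k) X) D0 eD) _.
  rewrite (_ : shan _ = shan ec)//; apply: eq_bigr => ab _.
  by rewrite count_X.
apply: le_trans le2 _; rewrite mulrA ler_wpM2r//.
have hm l : (\sum_(a | degB a == l) m a = #|[set v | dg v == l]%SET|)%N.
  rewrite -[RHS]sum1_card (partition_big X0 (fun a => degB a == l)) /=; last first.
    by move=> v; rewrite inS -(degB_ty s0 f0) => /eqP <-; apply/eqP/val_inj; rewrite /= kids_star size_map.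
  apply: eq_bigr => a /eqP al; rewrite /m -sum1_card; apply: eq_bigl => v.
  rewrite !inS; case: (X0 v =P a) => [e|]; rewrite ?andbF// andbT.
  by rewrite -al -e -(degB_ty s0 f0); apply/esym/eqP/val_inj; rewrite /= kids_star size_map.
have [C0 hC] := cls_entropy (R := R) hm V0; rewrite -/Cls in C0 hC.
rewrite card_ord in hC.
have mL : mdeg L0 = #|D|%:R / #|V|%:R.
  by apply: mdeg_emp => v; rewrite size_kids_typ.
have V0R : 0 < #|V|%:R :> R by rewrite ltr0n.
have D0R : 0 < #|D|%:R :> R by rewrite ltr0n.
have := @Sig_star_le R M Dl k (Sym L0) L0 (Sym_inv _) (fun x => emp_ge0 _ _) _ (push_canon_Sym _) (edge_symm_typ dlD f0 fs0 (k := k)).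
rewrite {1}mL divr_gt0// => /(_ isT).
rewrite (_ : shan (push (@star _ _ k) L0) = shan (fun a => (m a)%:R / #|V|%:R)); last first.
  by apply: eq_bigr => a _; rewrite push_emp.
rewrite (_ : shan (push (@degB _ _ k) L0) = shan (fun l => #|[set v | dg v == l]%SET|%:R / #|V|%:R)); last first.
  apply: eq_bigr => l _; rewrite push_deg_typ /emp; congr (eta (_%:R / _)).
  by apply: eq_card => v; rewrite !inS degB_ty.
rewrite (_ : shan (fun ab => push (@canon2 _ _ k) (Ek L0) ab / mdeg L0) = shan ec); last first.
  apply: eq_bigr => ab _; congr eta; rewrite mL /ec invf_div mulrA; congr (_ / _).
  rewrite (push2_Ek_typ dlD)// divfK ?gt_eqF// -sum1_card natr_sum [RHS]big_mkcond.
  apply: eq_bigr => x _; rewrite inS dcol_typ//.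
  case: ab => a b; rewrite (@xpair_eqE Bk Bk) /=.
  by case: (_ == a); case: (_ == b); rewrite ?mulr1 ?mulr0.
rewrite mL => hS.
rewrite -[X in X * _]lnK ?posrE ?ltr0n// -expRD ler_expR.
move: hC; rewrite ler_norml => /andP[_ hC].
set sh1 := shan _ in hC; set sh2 := shan _ in hC.
have {}hS : #|V|%:R * (sh1 - sh2) - #|D|%:R / 2 * shan ec <= #|V|%:R * c.
  rewrite (_ : _ - _ = #|V|%:R * (sh1 - #|D|%:R / #|V|%:R / 2 * shan ec - sh2)); last first.
    rewrite -{1}[#|D|%:R](divfK (lt0r_neq0 V0R)); move: (#|D|%:R / _) (shan ec) => x y; lra.
  by rewrite ler_pM2l//; apply: le_trans Sc.
move: hS hC; set t1 := _ * (sh1 - sh2); set t2 := _ * shan ec; set t3 := err _ _; set t4 := err _ _; lra.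
Qed.
End one_class.

(** The empirical counts take at most (n + 1)^#|K| values, and [core_class] is applied to each of
    them. *)
Lemma core_up (A : {set {perm D} * {ffun V -> M}}) (c : R) :
  (forall s f, (s, f) \in A -> fpi s) ->
  (forall s f, (s, f) \in A -> Sig (Sym (@emp R V _ (ty s f))) <= c) ->
  #|A|%:R <= expR (#|V|%:R * c + err C (#|V| + #|D|)) * #|I (D := D) [::]|%:R :> R.
Proof.
move=> fA Sc.
pose cv (sf : {perm D} * {ffun V -> M}) : {ffun K -> 'I_#|V|.+1} :=
  [ffun a => inord #|[set v | star (ty sf.1 sf.2 v) == a]%SET|].
have cvE s f a : cv (s, f) a = #|[set v | star (ty s f v) == a]%SET| :> nat.
  by rewrite ffunE inordK// ltnS max_card.
rewrite -sum1_card (partition_big cv predT)//= natr_sum.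
set E := expR (#|V|%:R * c + err (#|{: K}| + Dl.+1) #|V| + err (#|{: Bk * Bk}| + 1) #|D|) * #|I (D := D) [::]|%:R.
apply: le_trans (_ : \sum_(g : {ffun K -> 'I_#|V|.+1}) E <= _).
  apply: ler_sum => g _; rewrite sum1_card.
  set Ag : {set {perm D} * {ffun V -> M}} := [set sf in A | cv sf == g]%SET.
  rewrite (_ : #|_| = #|Ag|); last by apply: eq_card => x; rewrite inS.
  case: (finset.set_0Vmem Ag) => [->|[[s0 f0] /setIdP[h0 /eqP g0]]].
    by rewrite cards0 mulr_ge0// expR_ge0.
  apply: (@core_class s0 f0 (fA _ _ h0)); last exact: Sc.
    by move=> s f /setIdP[/fA].
  by move=> s f a /setIdP[_ /eqP e]; rewrite -!cvE e g0.
rewrite sumr_const card_ffun card_ord -[leLHS]mulr_natl natrX /E mulrA ler_wpM2r//.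
have V1 : 0 < #|V|.+1%:R :> R by rewrite ltr0n.
rewrite -[X in X ^+ _]lnK ?posrE// -expRM_natl -expRD ler_expR.
have h1 : #|{: K}|%:R * ln #|V|.+1%:R <= err #|{: K}| (#|V| + #|D|) :> R.
  apply: le_trans (err_le (R := R) (leqnn #|{: K}|) (leq_addr #|D| #|V|)).
  by rewrite ler_wpM2l// lerDr.
have h2 := err_le (R := R) (leqnn (#|{: K}| + Dl.+1)) (leq_addr #|D| #|V|).
have h3 := err_le (R := R) (leqnn (#|{: Bk * Bk}| + 1)) (leq_addl #|V| #|D|).
have -> : C = (#|{: K}| + (#|{: K}| + Dl.+1) + (#|{: Bk * Bk}| + 1))%N by rewrite /C; clear; lia.
rewrite (errD _ (#|{: Bk * Bk}| + 1)) (errD #|{: K}| (#|{: K}| + _)); move: h1 h2 h3; lra.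
Qed.
End core_upper.

(** * Rounding of laws and volume of Hamming balls *)

Section rounding.
Context {R : realType}.

(* Round down, and give the remainder of each class to one of its elements. *)
Lemma round_class (T L : finType) (g : T -> L) (x : T -> R) (c : L -> nat) :
  (forall l, exists a, g a = l) -> (forall a, 0 <= x a) ->
  (forall l, \sum_(a | g a == l) x a <= (c l)%:R) ->
  exists m : T -> nat, (forall l, \sum_(a | g a == l) m a = c l)%N /\
    forall a, x a - 1 <= (m a)%:R <= x a + #|T|%:R + ((c (g a))%:R - \sum_(b | g b == g a) x b).
Proof.
move=> gs x0 xc; pose m0 a := Num.truncn (x a).
have m0x a : (m0 a)%:R <= x a by rewrite truncn_le.
have xm0 a : x a < (m0 a)%:R + 1.
  by have := truncnS_gt (x a); rewrite -natr1.
have hl l : (\sum_(a | g a == l) m0 a <= c l)%N.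
  rewrite -(ler_nat R) natr_sum; apply: le_trans (xc l); exact: ler_sum.
have hg l : exists a, g a == l by case: (gs l) => a <-; exists a.
pose ch l := xchoose (hg l).
have chE l : g (ch l) = l by apply/eqP; exact: (xchooseP (hg l)).
pose m a := (m0 a + (if ch (g a) == a then c (g a) - \sum_(b | g b == g a) m0 b else 0))%N.
exists m; split=> [l|a].
  rewrite big_split /= -[X in (_ + X)%N](_ : (c l - \sum_(b | g b == l) m0 b)%N = _) ?subnKC//.
  rewrite [RHS](bigD1 (ch l)) /=; last by rewrite chE.
  rewrite chE eqxx [X in (_ + X)%N]big1 ?addn0// => a /andP[/eqP al]; rewrite al eq_sym => /negbTE -> //.
have lo : x a - 1 <= (m a)%:R.
  by rewrite /m natrD; have := xm0 a; have : 0 <= (if ch (g a) == a then c (g a) - \sum_(b | g b == g a) m0 b else 0)%N%:R :> R; [by []|lra].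
rewrite lo /= /m natrD -addrA lerD ?m0x//.
have d0 : 0 <= (c (g a))%:R - \sum_(b | g b == g a) x b by rewrite subr_ge0.
case: ifP => _; last by rewrite addr_ge0.
rewrite natrB// natr_sum.
have : \sum_(b | g b == g a) x b <= \sum_(b | g b == g a) (m0 b)%:R + #|T|%:R.
  apply: le_trans (_ : \sum_(b | g b == g a) ((m0 b)%:R + 1) <= _).
    by apply: ler_sum => b _; apply/ltW/xm0.
  by rewrite big_split /= lerD2l sumr_const ler_nat max_card.
lra.
Qed.
End rounding.

Section hamming_ball.
Context {R : realType} {V K : finType}.

(** Chernoff's method: in the generating function of the distance to [Z], which factors over [V],
    each element of the ball has weight at least exp (-lam w). *)
Lemma card_ball (Z : V -> K) (w : nat) (lam : R) : 0 <= lam ->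
  #|[set X : {ffun V -> K} | (#|[set v | X v != Z v]%SET| <= w)%N]%SET|%:R <=
  expR (lam * w%:R) * (1 + #|K|%:R * expR (- lam)) ^+ #|V|.
Proof.
move=> lam0.
pose h (v : V) (a : K) : R := if a != Z v then expR (- lam) else 1.
have h0 v a : 0 <= h v a by rewrite /h; case: ifP => _; rewrite ?expR_ge0.
have hX (X : {ffun V -> K}) : \prod_v h v (X v) = expR (- (lam * #|[set v | X v != Z v]%SET|%:R)).
  rewrite -mulNr mulr_natr -sumr_const expR_sum [RHS]big_mkcond /=; apply: eq_bigr => v _.
  by rewrite inS.
apply: le_trans (_ : expR (lam * w%:R) * \sum_(X : {ffun V -> K}) \prod_v h v (X v) <= _).
  rewrite -sum1_card natr_sum mulr_sumr big_mkcond /=; apply: ler_sum => X _.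
  rewrite hX -expRD; case: ifP; last by rewrite expR_ge0.
  rewrite inS => hw; rewrite -[leLHS]expR0 ler_expR subr_ge0.
  by rewrite ler_wpM2l// ler_nat.
rewrite ler_wpM2l ?expR_ge0// -bigA_distr_bigA /= -prodr_const.
apply: ler_prod => v _; rewrite sumr_ge0//= (bigD1 (Z v))//= {1}/h eqxx /= lerD2l.
rewrite -sum1_card natr_sum mulr_suml.
rewrite [leRHS](bigD1 (Z v))//= mul1r -[leLHS]add0r lerD ?expR_ge0//.
by apply: ler_sum => a aZ; rewrite /h aZ.
Qed.
End hamming_ball.

(** * Constructing colorings of a given type *)

Section truncation.
Context {M : finType} {Dl : nat}.
Local Notation B := (B M Dl).

(** Truncation to a depth given in advance, so that a prescribed branch yields a family indexed by
    the depth, as [unf_lip] requires. *)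
Fixpoint tru k : B k -> forall j, B j :=
  match k with
  | 0 => fun x j => lf j x
  | k'.+1 => fun x j =>
      match j with
      | 0 => x.1
      | j'.+1 => nd x.1 (map (fun y => @tru k' y j') (kids x))
      end
  end.

Lemma tru0 k (x : B k) : tru x 0 = root x. Proof. by case: k x. Qed.

Lemma truS k (x : B k.+1) j : tru x j.+1 = nd x.1 (map (fun y => tru y j) (kids x)).
Proof. by []. Qed.

Lemma tru_id k (x : B k) : tru x k = x.
Proof.
elim: k x => // k ih x; rewrite truS (eq_map ih) map_id; exact: nd_kids.
Qed.

Lemma tru_tr k (x : B k.+1) j : (j <= k)%N -> tru (tr x) j = tru x j.
Proof.
elim: k j x => [[]//|k ih [|j] x jk]; first by rewrite tru0 root_tr.
rewrite !truS kids_tr -map_comp; congr nd; apply: eq_map => y /=; exact: ih.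
Qed.
End truncation.

Section core_lower.
Context {R : realType} {D V : finType} (vtx : D -> V) (M : finType) (Dl k : nat).
Local Notation dl := (dl vtx).
Local Notation Bk := (B M Dl k).
Local Notation K := (B M Dl k.+1).
Local Notation ty s f := (typ vtx Dl f s k).
Hypothesis dlD : forall v, (size (dl v) <= Dl)%N.
Hypotheses (V0 : (0 < #|V|)%N) (D0 : (0 < #|D|)%N) (eD : ~~ odd #|D|).
Implicit Types (s : {perm D}) (f : {ffun V -> M}) (X : {ffun V -> K}).

Variable m : K -> nat.
Hypothesis hm : forall l, (\sum_(a | degB a == l) m a = #|[set v | dg dlD v == l]%SET|)%N.

Let Cls := [set X : {ffun V -> K} | [forall v, degB (X v) == dg dlD v] &
      [forall a, #|[set v | X v == a]%SET| == m a]]%SET.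

Definition edges (ab : Bk * Bk) : nat := (\sum_a m a * count_mem ab (kaps a))%N.
Definition sedges (ab : Bk * Bk) : nat := (2 * (minn (edges ab) (edges (swp ab)))./2)%N.
Definition unused : nat := (#|D| - \sum_ab sedges ab)%N.
Definition slaw (o : option (Bk * Bk)) : R :=
  (if o is Some ab then (sedges ab)%:R else unused%:R) / #|D|%:R.

Let iot : option (Bk * Bk) -> option (Bk * Bk) := omap (@swp M Dl k).
Let iotK : involutive iot. Proof. by case=> [[]|]. Qed.

Lemma sedges_le ab : (sedges ab <= edges ab)%N.
Proof.
rewrite /sedges mul2n; apply: leq_trans (geq_minl _ (edges (swp ab))).
by rewrite -[leqRHS]odd_double_half leq_addl.
Qed.

Lemma sedges_swp ab : sedges (swp ab) = sedges ab.
Proof. by rewrite /sedges swpK minnC. Qed.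

Section one_X.
Variables (X : {ffun V -> K}) (hX : X \in Cls).

Let degX v : size (kids (X v)) = size (dl v).
Proof. by case/setIdP: hX => /forallP/(_ v)/eqP/(congr1 val). Qed.

Let c := dcol vtx (fun x => x) X.
Let cls ab := [set x | c x == ab]%SET.

Let card_cls ab : #|cls ab| = edges ab.
Proof.
rewrite /cls count_dcol// (partition_big X predT)//=; apply: eq_bigr => a _.
rewrite (eq_bigr (fun=> count_mem ab (kaps a))); last by move=> v /eqP ->; rewrite map_id.
rewrite sum_nat_const; congr muln; case/setIdP: hX => _ /forallP/(_ a)/eqP <-.
by apply: eq_card => v; rewrite !inE.
Qed.

Let c' x : option (Bk * Bk) := if x \in take (sedges (c x)) (enum (cls (c x))) then Some (c x) else None.

Let card_c' ab : #|[set x | c' x == Some ab]%SET| = sedges ab.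
Proof.
rewrite (_ : finset _ = [set:: take (sedges ab) (enum (cls ab))]%SET); last first.
  apply/setP => x; rewrite !inS /c'; apply/idP/idP.
    by case: ifP => // xt /eqP[<-].
  move=> xt; have /eqP e : c x == ab.
    by move/mem_take: xt; rewrite mem_enum inS.
  by rewrite e xt.
rewrite cardsE (card_uniqP _) ?take_uniq ?enum_uniq// size_takel// -cardE card_cls.
exact: sedges_le.
Qed.

Let sum_c' : (\sum_ab sedges ab + #|[set x | c' x == None]%SET| = #|D|)%N.
Proof.
rewrite -[RHS]sum1_card (partition_big c' predT)//= (bigD1 None)//= addnC; congr addn.
  by rewrite -sum1_card; apply: eq_bigl => x; rewrite inS.
rewrite [RHS](reindex_onto (@Some (Bk * Bk)%type) (odflt (c (enum_val (Ordinal D0))))) /=; last by case.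
apply: eq_big => [ab|ab _]; first by rewrite eqxx.
by rewrite -card_c' -sum1_card; apply: eq_bigl => x; rewrite inS.
Qed.

Let card_None : #|[set x | c' x == None]%SET| = unused.
Proof. by rewrite /unused -sum_c' addKn. Qed.

Let Wit := compat iot c' [::].

Let card_Wit : expR (- (#|D|%:R / 2 * shan slaw) - err (#|{: option (Bk * Bk)}| + 1) #|D|) *
   #|I (D := D) [::]|%:R <= #|Wit|%:R :> R.
Proof.
rewrite (_ : shan slaw = shan (fun o => #|[set x | c' x == o]%SET|%:R / #|D|%:R)); last first.
  by apply: eq_bigr => -[ab|] _; rewrite ?card_c' ?card_None.
apply: compat_ge => //.
- by move=> [ab|]; rewrite // /iot /= !card_c' sedges_swp.
- case=> [ab|] _; first by rewrite card_c' /sedges oddM.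
  rewrite card_None /unused oddB; last by rewrite -sum_c' leq_addr.
  rewrite (negbTE eD) /=; apply: (big_ind (fun i => ~~ odd i)) => // [i j hi hj|ab _].
    by rewrite oddD (negbTE hi) (negbTE hj).
  by rewrite /sedges oddM.
Qed.

Let f : {ffun V -> M} := [ffun v => (X v).1].

(** At a half-edge that keeps its color, the branch prescribed by [X] is the truncated tree
    prescribed at the other end, so that the recursion of [unf_lip] holds. The defects are the
    half-edges of color [None]. *)
Let near_X s : s \in Wit -> (#|[set v | X v != ty s f v]%SET| <= wt Dl k * unused)%N.
Proof.
move=> /setIdP[sI /forall_inP hs]; have fs := I_sub sI.
have hs' x : c' (s x) = iot (c' x) by apply/eqP/hs; rewrite inE.
have kX v : kids (X v) = [seq (c x).1 | x <- dl v].
  have e : map fst (kaps (X v)) = kids (X v).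
    rewrite /kaps -map_comp -[RHS](_ : map fst (picks (kids (X v))) = _) //.
    by elim: (kids _) => //= a l {2}<-; rewrite -map_comp.
  apply: (@eq_from_nth _ (lf k (X v).1)) => [|i]; first by rewrite size_map degX.
  rewrite degX => il; have x0 : D by case: (dl v) il.
  rewrite (nth_map x0)//; have : nth x0 (dl v) i \in dl v by rewrite mem_nth.
  rewrite mem_dl /c /dcol map_id => /eqP ->; rewrite index_uniq ?dl_uniq//.
  by rewrite -e (nth_map (lf k (X v).1, lf k (X v).1))// size_kaps degX.
have c2 x : (c x).2 = tr (nd (X (vtx x)).1 [seq (c z).1 | z <- dl (vtx x) & z != x]).
  have xd : x \in dl (vtx x) by rewrite mem_dl.
  rewrite /c /dcol map_id /kaps kX map_picks picks_uniq ?dl_uniq// -!map_comp (nth_map x) ?index_mem//.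
  by rewrite /= nth_index.
have good x : c' x <> None -> (c (s x)).2 = (c x).1.
  rewrite /c'; case: ifP => // h _; have := hs' x; rewrite /c' h; case: ifP => // _ [->].
  by rewrite /swp.
pose a x := (c x).1.
apply: leq_trans (_ : #|[set x | tru (a x) k != unf (nxd vtx s) (fun x => f (vtx (s x))) k x]%SET| <= _)%N.
  apply: leq_trans (leq_imset_card vtx _); apply: card_incl => v; rewrite inS => h.
  suff /hasP[x xv hx] : has (fun x => a x != br vtx Dl f s k x) (dl v).
    by apply/imsetP; exists x; rewrite ?inS ?tru_id//; apply/esym/eqP; rewrite -mem_dl.
  apply: contraNT h; rewrite -all_predC => /allP hx; apply/eqP.
  rewrite -(nd_kids (X v)) kX /typ ffunE; congr nd.
  by apply/eq_in_map => x /hx /=; rewrite negbK => /eqP.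
rewrite -card_None; apply: (@unf_lip _ _ vtx Dl dlD M s _ (fun j x => tru (a x) j)).
  move=> x; rewrite inS => /eqP/good e; rewrite tru0 /a -e c2 ffunE.
  by rewrite root_tr.
move=> j x jk; rewrite inS => /eqP/good e; rewrite {1}/a -e c2 tru_tr// truS.
rewrite kids_nd; last first.
  by rewrite size_map; apply: leq_trans (dlD (vtx (s x))); rewrite size_filter count_size.
by rewrite -map_comp ffunE.
Qed.

Lemma core_low_X : exists W : {set {perm D}},
  [/\ forall s, s \in W -> fpi s,
     expR (- (#|D|%:R / 2 * shan slaw) - err (#|{: option (Bk * Bk)}| + 1) #|D|) *
       #|I (D := D) [::]|%:R <= #|W|%:R :> R &
     forall s, s \in W -> (#|[set v | X v != ty s [ffun v => (X v).1] v]%SET| <= wt Dl k * unused)%N].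
Proof.
exists Wit; split=> [s /setIdP[/I_sub]//| |]; [exact: card_Wit|exact: near_X].
Qed.
End one_X.

Definition lowset : {set {perm D} * {ffun V -> M}} :=
  [set sf : {perm D} * {ffun V -> M} | fpi sf.1 &
     [exists X : {ffun V -> K}, [forall a, #|[set v | X v == a]%SET| == m a] &&
        (#|[set v | X v != ty sf.1 sf.2 v]%SET| <= wt Dl k * unused)%N]]%SET.

(** Pairs of a prescription [X] and a compatible pairing are counted from below, and mapped to (s,
    f) by keeping the colors of the roots. This map is not injective, but [X] is within Hamming
    distance [w] of the types of (s, f), so that a fiber is no larger than a Hamming ball. *)
Lemma core_low_fixed (lam : R) (w := (wt Dl k * unused)%N) (G := lowset) : 0 <= lam ->
  expR (#|V|%:R * (shan (fun a => (m a)%:R / #|V|%:R) - shan (emp (dg dlD))) -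
        #|D|%:R / 2 * shan slaw - err (#|{: K}| + Dl.+1) #|V| -
        err (#|{: option (Bk * Bk)}| + 1) #|D|) * #|I (D := D) [::]|%:R <=
  #|G|%:R * (expR (lam * w%:R) * (1 + #|{: K}|%:R * expR (- lam)) ^+ #|V|).
Proof.
move=> lam0.
have /choice[W hW] : forall X, exists W : {set {perm D}}, X \in Cls ->
  [/\ forall s, s \in W -> fpi s,
     expR (- (#|D|%:R / 2 * shan slaw) - err (#|{: option (Bk * Bk)}| + 1) #|D|) *
       #|I (D := D) [::]|%:R <= #|W|%:R :> R &
     forall s, s \in W -> (#|[set v | X v != ty s [ffun v => (X v).1] v]%SET| <= w)%N].
  move=> X; case: (boolP (X \in Cls)) => [/core_low_X[W hW]|_]; last by exists finset.set0.
  by exists W.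
pose Q := [set Xs : {ffun V -> K} * {perm D} | Xs.1 \in Cls & Xs.2 \in W Xs.1]%SET.
pose F (Xs : {ffun V -> K} * {perm D}) : {perm D} * {ffun V -> M} := (Xs.2, [ffun v => (Xs.1 v).1]).
have [C0 hC] := cls_entropy (R := R) hm V0; rewrite -/Cls card_ord in C0 hC.
have lo : #|Cls|%:R * (expR (- (#|D|%:R / 2 * shan slaw) - err (#|{: option (Bk * Bk)}| + 1) #|D|) *
       #|I (D := D) [::]|%:R) <= #|Q|%:R :> R.
  rewrite (_ : #|Q| = \sum_(X in Cls) #|W X|)%N.
    by rewrite natr_sum mulr_natl -sumr_const; apply: ler_sum => X /hW[].
  rewrite -sum1_card (partition_big fst (mem Cls)) /=; last by move=> Xs /setIdP[].
  apply: eq_bigr => X hX; rewrite sum1_card -(card_imset (W X) (f := pair X)); last by move=> ? ? [].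
  apply: eq_card => -[Y s]; rewrite unfold_in inS /=; apply/idP/imsetP.
    by move=> /andP[/andP[_ sW] /eqP e]; exists s; rewrite -e.
  by case=> t tW [-> ->]; rewrite hX tW eqxx.
apply: le_trans (_ : #|Q|%:R <= _).
  apply: le_trans lo; rewrite mulrA ler_wpM2r//.
  rewrite -[X in _ <= X * _]lnK ?posrE ?ltr0n// -expRD ler_expR.
  move: hC; rewrite ler_norml => /andP[hC _].
  rewrite (_ : shan (emp _) = shan (fun l => #|[set v | dg dlD v == l]%SET|%:R / #|V|%:R))//.
  move: hC; set t1 := _ * (_ - _); set t2 := _ * shan slaw; set t3 := err _ _; set t4 := err _ _; lra.
rewrite -sum1_card (partition_big F (mem G)) /=; last first.
  move=> [X s] /setIdP[/= hX sW]; have [h1 h2 h3] := hW _ hX.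
  apply/setIdP; split; first exact: h1.
  apply/existsP; exists X; rewrite h3// andbT.
  by case/setIdP: hX.
rewrite natr_sum mulr_natl -sumr_const; apply: ler_sum => -[s f] _.
rewrite sum1_card; apply: le_trans (card_ball (ty s f) w lam0); rewrite ler_nat.
rewrite -(card_imset [set X | _]%SET (f := pair^~ s)); last by move=> ? ? [].
apply: card_incl => -[X t]; rewrite unfold_in /= => /andP[/setIdP[/= hX sW] /eqP[ts e]].
apply/imsetP; exists X; last by rewrite ts.
rewrite inS; have [_ _ h3] := hW _ hX.
by have := h3 _ sW; rewrite e ts.
Qed.
End core_lower.

Lemma near_pos (idx : set nat) : \forall n \near within idx \oo, (0 < n)%N.
Proof. by apply: cvg_within; exact: nbhs_infty_gt. Qed.

Section limits.
Context {R : realType} {F : set_system nat} {FF : Filter F}.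

Lemma cvg_sumf (T : finType) (P : pred T) (f : T -> nat -> R) (l : T -> R) :
  (forall x, P x -> f x n @[n --> F] --> l x) ->
  (\sum_(x | P x) f x n) @[n --> F] --> \sum_(x | P x) l x.
Proof.
move=> h; rewrite -[X in X @ _ --> _]/(fun n => _); elim: (index_enum T) => [|x s ih].
  by rewrite big_nil; under eq_fun do rewrite big_nil; exact: cvg_cst.
rewrite big_cons; under eq_fun do rewrite big_cons.
by case: ifP => Px //; apply: cvgD => //; exact: h.
Qed.

Lemma cvg_shan (T : finType) (w : nat -> T -> R) (w0 : T -> R) :
  (forall x, w n x @[n --> F] --> w0 x) -> shan (w n) @[n --> F] --> shan w0.
Proof.
move=> h; apply: cvg_sumf => x _.
exact: (cvg_comp _ _ (h x) (@continuous_eta R (w0 x))).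
Qed.

Lemma near_forall (T : finType) (P : T -> nat -> Prop) :
  (forall x, \forall n \near F, P x n) -> \forall n \near F, forall x, P x n.
Proof.
move=> h; suff : \forall n \near F, forall x, x \in enum T -> P x n.
  by apply: filterS => n hn x; apply: hn; rewrite mem_enum.
elim: (enum T) => [|x s ih]; first by apply: nearW.
near=> n => y; rewrite inE => /orP[/eqP->|]; first by near: n; exact: h.
by move: y; near: n.
Unshelve. all: end_near. Qed.

End limits.

(** * Asymptotics of the lower bound on colored pairings *)

Section sequences.
Context {R : realType} (Dl : nat) (V D : nat -> finType) (vtx : forall n, D n -> V n)
  (F : set_system nat) {FF : Filter F}.
Hypothesis dlD : forall n v, (size (dl (@vtx n) v) <= Dl)%N.
Hypothesis eD : forall n, ~~ odd #|D n|.
Hypothesis nV : forall k, \forall n \near F, (k <= #|V n|)%N.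
Variable pid : 'I_Dl.+1 -> R.
Hypothesis cdeg : forall l, emp (dg (@dlD n)) l @[n --> F] --> pid l.
Let md := \sum_l pid l * (l%:R : R).
Hypothesis md0 : 0 < md.

Lemma nearV0 : \forall n \near F, (0 < #|V n|)%N.
Proof. exact: nV. Qed.

Lemma cvg_invV : (#|V n|%:R^-1 : R) @[n --> F] --> (0 : R).
Proof.
apply/cvgr0Pnorm_le => e e0; near=> n.
rewrite ger0_norm ?invr_ge0//.
have V0 : (0 < #|V n|)%N by near: n; exact: nearV0.
rewrite -[leRHS]invrK lef_pV2 ?posrE ?invr_gt0 ?ltr0n//.
apply: le_trans (ltW (truncnS_gt _)) _; rewrite ler_nat; near: n; exact: nV.
Unshelve. all: end_near. Qed.

Lemma size_D n : #|D n|%:R = \sum_(v : V n) (dg (@dlD n) v : nat)%:R :> R.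
Proof. by rewrite -natr_sum -(sum_size_dl (@vtx n)). Qed.

Lemma cvg_DV : (#|D n|%:R / #|V n|%:R : R) @[n --> F] --> md.
Proof.
have e n : #|D n|%:R / #|V n|%:R = \sum_l emp (dg (@dlD n)) l * l%:R :> R.
  by rewrite sum_emp size_D.
under eq_fun do rewrite e.
by apply: cvg_sumf => l _; apply: cvgM => //; exact: cvg_cst.
Qed.

Lemma near_DV : \forall n \near F, md / 2 * #|V n|%:R <= #|D n|%:R :> R.
Proof.
near=> n; have V0 : (0 < #|V n|)%N by near: n; exact: nearV0.
rewrite -ler_pdivlMr ?ltr0n//; near: n.
by apply: (cvgr_ge _ cvg_DV); rewrite ltr_pdivrMr// ltr_pMr// ltr1n.
Unshelve. all: end_near. Qed.

Lemma nearD k : \forall n \near F, (k <= #|D n|)%N.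
Proof.
near=> n; rewrite -(ler_nat R); apply: le_trans (_ : md / 2 * #|V n|%:R <= _); last first.
  by near: n; exact: near_DV.
rewrite mulrC -ler_pdivrMr ?divr_gt0//.
apply: le_trans (ltW (truncnS_gt _)) _; rewrite ler_nat; near: n; exact: nV.
Unshelve. all: end_near. Qed.

(** With q the square root of the number of vertices, ln y < y at y = (Dl + 2) q bounds the
    logarithm by a multiple of q, which is negligible against q^2. *)
Lemma err_small C (d : R) : 0 < d -> \forall n \near F, err C (#|V n| + #|D n|) <= d * #|V n|%:R.
Proof.
move=> d0; pose A : R := C%:R * (2 * Dl%:R + 5).
near=> n.
have V1 : (1 <= #|V n|)%N by near: n; exact: nV.
set N := #|V n| in V1 *; have N1 : 1 <= N%:R :> R by rewrite ler1n.
have hD : (#|D n| <= Dl * N)%N.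
  by rewrite -(sum_size_dl (@vtx n)) mulnC -sum_nat_const; apply: leq_sum => v _; exact: dlD.
set q := Num.sqrt (N%:R : R).
have q1 : 1 <= q by rewrite -sqrtr1 ler_sqrt// ltW// ltr01.
have qq : q * q = N%:R by rewrite -expr2 sqr_sqrtr.
have hq : ln (N + #|D n|).+1%:R <= 2 * (Dl%:R + 2) * q.
  have : (N + #|D n|).+1%:R <= ((Dl%:R + 2) * q) ^+ 2.
    rewrite expr2 mulrACA qq -natrD; apply: le_trans (_ : (Dl + 2)%:R * N%:R <= _).
      rewrite -natrM ler_nat; move: hD V1; clear; nia.
    by rewrite ler_pM2r ?(lt_le_trans ltr01)// -natrM ler_nat; clear; nia.
  move=> h; apply: le_trans (_ : ln (((Dl%:R + 2) * q) ^+ 2) <= _).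
    by rewrite ler_ln ?posrE// (lt_le_trans _ h)// ltr0n.
  have p0 : 0 < (Dl%:R + 2) * q :> R by apply: mulr_gt0; [exact: ltr_wpDl|exact: (lt_le_trans ltr01 q1)].
  rewrite lnXn// -[leLHS]mulr_natl -[leRHS]mulrA ler_pM2l//.
  exact/ltW/(ln_sublinear p0).
apply: le_trans (_ : A * q <= _).
  rewrite /err /A -mulrA ler_wpM2l//; apply: le_trans (_ : q + 2 * (Dl%:R + 2) * q <= _).
    by rewrite lerD.
  lra.
rewrite -qq mulrA ler_pM2r ?(lt_le_trans ltr01)//.
rewrite mulrC -ler_pdivrMr// -(@ler_pXn2r _ 2) ?nnegrE//; first last.
- by rewrite (le_trans ler01).
- by rewrite divr_ge0 ?(ltW d0)// mulr_ge0// addr_ge0// mulr_ge0.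
rewrite expr2 expr2 qq; apply: le_trans (ltW (truncnS_gt _)) _; rewrite ler_nat /N.
near: n; exact: nV.
Unshelve. all: end_near. Qed.

Section core_low.
Context (M : finType) (k : nat) (m0 : M).
Local Notation Bk := (B M Dl k).
Local Notation K := (B M Dl k.+1).
Variable P : K -> R.
Hypotheses (P0 : forall a, 0 <= P a) (Pdeg : push (@degB _ _ k) P =1 pid) (Psym : edge_symm (Ek P)).

Let pid_ge0 l : 0 <= pid l.
Proof. by rewrite -Pdeg push_ge0. Qed.

Let P_pid a : pid (degB a) = 0 -> P a = 0.
Proof.
move=> h; apply/eqP; rewrite eq_le P0 andbT -h -Pdeg; exact: push_ge.
Qed.

Let mdP : mdeg P = md.
Proof. by rewrite /mdeg /md -[LHS](sum_push (@degB _ _ k) P (fun l => l%:R)); apply: eq_bigr => l _; rewrite Pdeg. Qed.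

Let cc n (l : 'I_Dl.+1) : nat := #|[set v | dg (@dlD n) v == l]%SET|.
(** Among the vertices of degree l, a proportion P a/pid l is to receive the type [a], so that the
    degrees of the graph are matched at each size. If pid l = 0 the quotient is 0, and the vertices
    of degree l, a vanishing proportion, are left to the rounding. *)
Let xx n (a : K) : R := (cc n (degB a))%:R * (P a / pid (degB a)).

Let sum_xx n l : \sum_(a | degB a == l) xx n a = (cc n l)%:R * (pid l / pid l).
Proof.
rewrite (eq_bigr (fun a => (cc n l)%:R * (P a / pid l))); last by move=> a /eqP <-.
by rewrite -mulr_sumr -mulr_suml -Pdeg.
Qed.

Let ex_m n : exists m : K -> nat, (forall l, \sum_(a | degB a == l) m a = cc n l)%N /\
  forall a, xx n a - 1 <= (m a)%:R <= xx n a + #|{: K}|%:R + ((cc n (degB a))%:R - \sum_(b | degB b == degB a) xx n b).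
Proof.
apply: round_class => [l|a|l].
- exists (nd m0 (nseq l (lf k m0))); apply: val_inj => /=.
  by rewrite kids_nd size_nseq// -ltnS.
- by rewrite mulr_ge0// divr_ge0.
- rewrite sum_xx ler_piMr//; have [->|/divff ->//] := eqVneq (pid l) 0.
  by rewrite mul0r.
Qed.

Let mm n : K -> nat := sval (cid (ex_m n)).

Let mm1 n l : (\sum_(a | degB a == l) mm n a = cc n l)%N.
Proof. by case: (svalP (cid (ex_m n))). Qed.

Let cvg_xx a : (xx n a / #|V n|%:R : R) @[n --> F] --> P a.
Proof.
have -> : P a = pid (degB a) * (P a / pid (degB a)).
  have [e|e] := eqVneq (pid (degB a)) 0; first by rewrite e mul0r P_pid.
  by rewrite mulrC divfK.
under eq_fun do rewrite /xx mulrAC.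
by apply: cvgM; [exact: cdeg|exact: cvg_cst].
Qed.

Let cvg_mm a : ((mm n a)%:R / #|V n|%:R : R) @[n --> F] --> P a.
Proof.
(* The last term is the proportion of vertices of that degree if [pid] vanishes there, and 0
   otherwise; it tends to 0 in both cases. *)
apply: (squeeze_cvgr (f := fun n => xx n a / #|V n|%:R - #|V n|%:R^-1)
  (h := fun n => xx n a / #|V n|%:R + #|{: K}|%:R * #|V n|%:R^-1 +
     (emp (dg (@dlD n)) (degB a) - emp (dg (@dlD n)) (degB a) * (pid (degB a) / pid (degB a))))).
- near=> n; have [_ /(_ a)/andP[h1 h2]] := svalP (cid (ex_m n)).
  rewrite sum_xx in h2; rewrite -[X in _ - X]mul1r -mulrBl ler_wpM2r ?invr_ge0//=.
  apply: le_trans (ler_wpM2r _ h2) _; rewrite ?invr_ge0// !mulrDl mulNr.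
  have -> : emp (dg (@dlD n)) (degB a) = (cc n (degB a))%:R / #|V n|%:R by [].
  by rewrite [(_ / _) * (_ / _)]mulrAC.
- rewrite -[X in _ --> X]subr0; apply: cvgB; [exact: cvg_xx|exact: cvg_invV].
- have -> : P a = P a + #|{: K}|%:R * 0 + (pid (degB a) - pid (degB a) * (pid (degB a) / pid (degB a))).
    have [->|e] := eqVneq (pid (degB a)) 0; first by rewrite !mul0r subrr mulr0 !addr0.
    by rewrite divff// mulr1 subrr mulr0 !addr0.
  apply: cvgD; first by apply: cvgD; [exact: cvg_xx|apply: cvgM; [exact: cvg_cst|exact: cvg_invV]].
  by apply: cvgB; [exact: cdeg|apply: cvgM; [exact: cdeg|exact: cvg_cst]].
Unshelve. all: end_near. Qed.

Let sum_edges n : (\sum_ab edges (mm n) ab = #|D n|)%N.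
Proof.
rewrite -(sum_size_dl (@vtx n)) /edges exchange_big /=.
transitivity (\sum_a mm n a * size (kids a))%N.
  apply: eq_bigr => a _; rewrite -big_distrr /=; congr muln.
  rewrite -size_kaps -sum1_size (eq_bigr (fun ab => \sum_(x <- kaps a | x == ab) 1)%N); last first.
    by move=> ab _; rewrite -sum1_count.
  rewrite (exchange_big_dep predT)//=; apply: eq_bigr => x _.
  by rewrite (bigD1 x)//= big1// => y /andP[/eqP -> /eqP].
rewrite (partition_big (@degB _ _ k) predT)//= [RHS](partition_big (dg (@dlD n)) predT)//=.
apply: eq_bigr => l _; rewrite (eq_bigr (fun a => mm n a * l)%N); last by move=> a /eqP <-.
rewrite -big_distrl /= mm1 -sum_nat_const; apply: eq_big => v; first by rewrite inS.
by rewrite inS => /eqP <-.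
Qed.

Let cvg_edges ab : ((edges (mm n) ab)%:R / #|D n|%:R : R) @[n --> F] --> Ek P ab / md.
Proof.
have h : ((edges (mm n) ab)%:R / #|V n|%:R / (#|D n|%:R / #|V n|%:R) : R) @[n --> F] --> Ek P ab / md.
  apply: cvgM; last by apply: cvgV; [rewrite gt_eqF|exact: cvg_DV].
  have e n : (edges (mm n) ab)%:R / #|V n|%:R = \sum_a (mm n a)%:R / #|V n|%:R * (count_mem ab (kaps a))%:R :> R.
    rewrite /edges natr_sum mulr_suml; apply: eq_bigr => a _; by rewrite natrM mulrAC.
  under eq_fun do rewrite e.
  by apply: cvg_sumf => a _; apply: cvgM; [exact: cvg_mm|exact: cvg_cst].
apply: cvg_trans h; apply: near_eq_cvg; near=> n.
have V0 : (0 < #|V n|)%N by near: n; exact: nearV0.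
by rewrite /= invf_div mulrA divfK// pnatr_eq0 -lt0n.
Unshelve. all: end_near. Qed.

Let cvg_invD : (#|D n|%:R^-1 : R) @[n --> F] --> (0 : R).
Proof.
apply/cvgr0Pnorm_le => e e0; near=> n.
rewrite ger0_norm ?invr_ge0//.
have D0 : (0 < #|D n|)%N by near: n; exact: nearD.
rewrite -[leRHS]invrK lef_pV2 ?posrE ?invr_gt0 ?ltr0n//.
apply: le_trans (ltW (truncnS_gt _)) _; rewrite ler_nat; near: n; exact: nearD.
Unshelve. all: end_near. Qed.

Let cvg_sedges ab : ((sedges (mm n) ab)%:R / #|D n|%:R : R) @[n --> F] --> Ek P ab / md.
Proof.
apply: (squeeze_cvgr (f := fun n => (edges (mm n) ab)%:R / #|D n|%:R -
   `|(edges (mm n) ab)%:R / #|D n|%:R - (edges (mm n) (swp ab))%:R / #|D n|%:R| - #|D n|%:R^-1)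
  (h := fun n => (edges (mm n) ab)%:R / #|D n|%:R)).
- near=> n; apply/andP; split; last by rewrite ler_wpM2r ?invr_ge0// ler_nat sedges_le.
  rewrite -[X in Num.norm X]mulrBl normrM [Num.norm _^-1]ger0_norm ?invr_ge0// -[X in _ - X]mul1r -!mulrBl.
  rewrite ler_wpM2r ?invr_ge0//.
  have h : (minn (edges (mm n) ab) (edges (mm n) (swp ab)) <= (sedges (mm n) ab).+1)%N.
    by rewrite /sedges; move: (minn _ _); clear => x; lia.
  apply: le_trans (_ : (minn (edges (mm n) ab) (edges (mm n) (swp ab)))%:R - 1 <= _); last first.
    by rewrite lerBlDr natr1 ler_nat.
  rewrite lerD2r /minn; case: ltnP => hh; first by rewrite gerBl.
  rewrite ger0_norm ?subr_ge0 ?ler_nat//; lra.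
- have sy : Ek P (swp ab) = Ek P ab by case: ab => a b; exact: Psym.
  have -> : Ek P ab / md = Ek P ab / md - `|Ek P ab / md - Ek P (swp ab) / md| - 0.
    by rewrite sy subrr normr0 !subr0.
  apply: cvgB; last exact: cvg_invD.
  apply: cvgB; first exact: cvg_edges.
  by apply: cvg_norm; apply: cvgB; exact: cvg_edges.
- exact: cvg_edges.
Unshelve. all: end_near. Qed.

Let e0 (o : option (Bk * Bk)) : R := if o is Some ab then Ek P ab / md else 0.

Let cvg_slaw o : slaw (D := D n) (mm n) o @[n --> F] --> e0 o.
Proof.
case: o => [ab|]; first exact: cvg_sedges.
have h : (1 - \sum_ab ((sedges (mm n) ab)%:R / #|D n|%:R) : R) @[n --> F] --> e0 None.
  have -> : e0 None = 1 - \sum_ab Ek P ab / md.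
    by rewrite -mulr_suml sum_Ek1 mdP divff ?gt_eqF// subrr.
  by apply: cvgB; [exact: cvg_cst|apply: cvg_sumf => ab _; exact: cvg_sedges].
apply: cvg_trans h; apply: near_eq_cvg; near=> n; have D0 : (0 < #|D n|)%N by near: n; exact: nearD.
rewrite /slaw /unused natrB; last by rewrite -(sum_edges n); apply: leq_sum => ab _; exact: sedges_le.
by rewrite mulrBl divff ?pnatr_eq0 -?lt0n// natr_sum -mulr_suml.
Unshelve. all: end_near. Qed.

Let shan_e0 : shan e0 = shan (fun ab => Ek P ab / mdeg P).
Proof.
rewrite /shan (bigD1 None)//= eta0 add0r (reindex_onto (@Some (Bk * Bk)%type) (odflt (lf k m0, lf k m0))) /=; last by case.
by apply: eq_big => [ab|ab _]; rewrite ?eqxx ?mdP.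
Qed.

Let expo n : R := shan (fun a => (mm n a)%:R / #|V n|%:R) - shan (emp (dg (@dlD n)))
  - #|D n|%:R / #|V n|%:R / 2 * shan (slaw (D := D n) (mm n)).

Let cvg_expo : expo n @[n --> F] --> Sig P.
Proof.
have -> : Sig P = shan P - shan pid - md / 2 * shan e0.
  rewrite /Sig shan_e0 mdP (_ : shan (push _ _) = shan pid); first by rewrite addrAC.
  by apply: eq_bigr => l _; rewrite Pdeg.
apply: cvgB; first by apply: cvgB; apply: cvg_shan; [exact: cvg_mm|exact: cdeg].
apply: cvgM; last by apply: cvg_shan => o; exact: cvg_slaw.
by apply: cvgM; [exact: cvg_DV|exact: cvg_cst].
Qed.

Let cvg_unused : ((unused (D := D n) (mm n))%:R / #|V n|%:R : R) @[n --> F] --> (0 : R).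
Proof.
have h : (slaw (D := D n) (mm n) None * (#|D n|%:R / #|V n|%:R) : R) @[n --> F] --> (0 * md : R).
  apply: cvgM; last exact: cvg_DV.
  exact: cvg_slaw.
rewrite mul0r in h; apply: cvg_trans h; apply: near_eq_cvg; near=> n.
have D0 : (0 < #|D n|)%N by near: n; exact: nearD.
by rewrite /slaw /= mulrA divfK// pnatr_eq0 -lt0n.
Unshelve. all: end_near. Qed.

Lemma core_low (delta et : R) : 0 < delta -> 0 < et -> \forall n \near F,
  expR (#|V n|%:R * (Sig P - delta)) * #|I (D := D n) [::]|%:R <=
  #|[set sf : {perm D n} * {ffun V n -> M} | fpi sf.1 &
      [forall a, `|emp (typ (@vtx n) Dl sf.2 sf.1 k) a - P a| <= et]]%SET|%:R :> R.
Proof.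
move=> d0 et0; pose d := delta / 8; have dd : 0 < d by rewrite divr_gt0.
(* For this [lam] the Hamming ball of radius [w] has at most exp (lam w + d n) elements. As [lam] is
   fixed and [w] is negligible against n, the ball costs an arbitrarily small rate. *)
have [lam [lam0 hlam]] : exists lam : R, 0 <= lam /\ #|{: K}|%:R * expR (- lam) <= d.
  exists (#|{: K}|%:R / d); rewrite divr_ge0 ?(ltW dd)//; split=> //.
  rewrite expRN -ler_pdivlMr ?invr_gt0 ?expR_gt0// invrK mulrC -ler_pdivrMr//.
  by apply: le_trans (expR_ge1Dx _); rewrite lerDr.
pose w n := (wt Dl k * unused (D := D n) (mm n))%N.
have cw : ((w n)%:R / #|V n|%:R : R) @[n --> F] --> (0 : R).
  rewrite -[X in _ --> X](mulr0 (wt Dl k)%:R); under eq_fun do rewrite /w natrM -mulrA.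
  by apply: cvgM; [exact: cvg_cst|exact: cvg_unused].
have c6 : \forall n \near F, forall a, `|(mm n a)%:R / #|V n|%:R - P a| <= et / 2.
  apply: near_forall => a; have /cvgrPdist_le/(_ (et / 2)) := @cvg_mm a.
  move=> /(_ _)/wrap[]; first by rewrite divr_gt0.
  by apply: filterS => n; rewrite distrC.
near=> n.
have V0 : (0 < #|V n|)%N by near: n; exact: nearV0.
have D0 : (0 < #|D n|)%N by near: n; exact: nearD.
have V0R : 0 < #|V n|%:R :> R by rewrite ltr0n.
have h := core_low_fixed (R := R) V0 D0 (@eD n) (mm1 n) lam0.
set G := lowset _ _ in h; set G' := (X in _ <= #|pred_of_set X|%:R).
have h1 : expo n >= Sig P - d.
  by near: n; apply: (cvgr_ge _ cvg_expo); rewrite ltrBlDr ltrDl.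
have h2 : (w n)%:R / #|V n|%:R <= et / 2.
  by near: n; apply: (cvgr_le _ cw); rewrite divr_gt0.
have h3 : lam * ((w n)%:R / #|V n|%:R) <= d.
  near: n; have c3 : (lam * ((w n)%:R / #|V n|%:R)) @[n --> F] --> (lam * 0).
    by apply: cvgM => //; exact: cvg_cst.
  by apply: (cvgr_le _ c3); rewrite mulr0.
have h4 : err (#|{: K}| + Dl.+1) #|V n| <= d * #|V n|%:R.
  apply: le_trans (err_le (leqnn _) (leq_addr #|D n| _)) _.
  by near: n; exact: err_small.
have h5 : err (#|{: option (Bk * Bk)}| + 1) #|D n| <= d * #|V n|%:R.
  apply: le_trans (err_le (leqnn _) (leq_addl #|V n| _)) _.
  by near: n; exact: err_small.
have h6 : forall a, `|(mm n a)%:R / #|V n|%:R - P a| <= et / 2.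
  by near: n; exact: c6.
have sub : G \subset G'.
  apply/fintype.subsetP => -[s f] /setIdP[/= fs /existsP[X /andP[/forallP hX hw]]].
  apply/setIdP; split=> //; apply/forallP => a.
  have e : emp X a = (mm n a)%:R / #|V n|%:R :> R by rewrite /emp (eqP (hX a)).
  rewrite -(subrKA (emp X a)) [leRHS](splitr et); apply: le_trans (ler_normD _ _) _.
  apply: lerD; last by rewrite e.
  rewrite distrC; apply: le_trans (emp_dist _ _ _) (le_trans _ h2).
  by rewrite ler_wpM2r ?invr_ge0// ler_nat.
apply: le_trans (_ : #|G|%:R <= _); last by rewrite ler_nat subset_leq_card.
have pos : 0 < expR (lam * (w n)%:R) * (1 + #|{: K}|%:R * expR (- lam)) ^+ #|V n|.
  by rewrite mulr_gt0 ?expR_gt0// exprn_gt0// ltr_pwDl// mulr_ge0// expR_ge0.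
rewrite -(ler_pM2r pos); apply: le_trans h; rewrite mulrAC ler_wpM2r//.
apply: le_trans (_ : expR (#|V n|%:R * (Sig P - delta)) * (expR (lam * (w n)%:R) * expR d ^+ #|V n|) <= _).
  rewrite ler_wpM2l ?expR_ge0// ler_wpM2l ?expR_ge0//.
  rewrite lerXn2r ?nnegrE ?expR_ge0 ?addr_ge0 ?mulr_ge0 ?expR_ge0//.
  by apply: le_trans (expR_ge1Dx _); rewrite lerD2l.
rewrite -expRM_natl -!expRD ler_expR.
have -> : lam * (w n)%:R = #|V n|%:R * (lam * ((w n)%:R / #|V n|%:R)).
  by rewrite mulrCA (mulrC _ (_ / _)) divfK ?gt_eqF.
have -> : #|D n|%:R / 2 * shan (slaw (D := D n) (mm n)) = #|V n|%:R * (#|D n|%:R / #|V n|%:R / 2 * shan (slaw (D := D n) (mm n))) :> R.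
  rewrite -{1}[#|D n|%:R](divfK (lt0r_neq0 V0R)).
  move: (#|D n|%:R / _) (shan _) => x y; lra.
have : 0 <= #|V n|%:R * d by rewrite mulr_ge0// ltW.
have : #|V n|%:R * (Sig P - d) <= #|V n|%:R * expo n by rewrite ler_pM2l.
have : #|V n|%:R * (lam * ((w n)%:R / #|V n|%:R)) <= #|V n|%:R * d by rewrite ler_pM2l.
have : #|V n|%:R * delta = #|V n|%:R * d * 8 by rewrite -mulrA divfK.
move: h4 h5; rewrite /expo; set N := #|V n|%:R.
set t1 := err _ _; set t2 := err _ _; set t3 := lam * _; set t4 := _ / 2 * shan _; set t5 := shan _; set t6 := shan _.
rewrite !mulrBr (mulrC d); set Nd := N * d; set NS := N * Sig P; set a1 := N * t3; set a2 := N * t4.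
set a3 := N * t5; set a4 := N * t6; set a5 := N * delta.
lra.
Unshelve. all: end_near. Qed.
End core_low.
End sequences.

(** * Continuity of [Sig] and compactness of the set of laws *)

Section entropy_continuity.
Context {R : realType} {F : set_system nat} {FF : Filter F}.

Lemma cvg_push (T U : finType) (phi : T -> U) (q : nat -> T -> R) (q0 : T -> R) u :
  (forall a, q n a @[n --> F] --> q0 a) -> push phi (q n) u @[n --> F] --> push phi q0 u.
Proof. by move=> h; apply: cvg_sumf => x _; exact: h. Qed.

Lemma cvg_Ek (M : finType) (Dl k : nat) (q : nat -> B M Dl k.+1 -> R) q0 ab :
  (forall a, q n a @[n --> F] --> q0 a) -> Ek (q n) ab @[n --> F] --> Ek q0 ab.
Proof. by move=> h; apply: cvg_sumf => x _; apply: cvgM; [exact: h|exact: cvg_cst]. Qed.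

Lemma cvg_Sig (M : finType) (Dl k : nat) (q : nat -> B M Dl k.+1 -> R) q0 :
  0 < mdeg q0 -> (forall a, q n a @[n --> F] --> q0 a) -> Sig (q n) @[n --> F] --> Sig q0.
Proof.
move=> m0 h.
have cm : mdeg (q n) @[n --> F] --> mdeg q0.
  by apply: cvg_sumf => x _; apply: cvgM; [exact: h|exact: cvg_cst].
apply: cvgB; last by apply: cvg_shan => l; exact: cvg_push.
apply: cvgB; first exact: cvg_shan.
apply: cvgM; first by apply: cvgM => //; exact: cvg_cst.
apply: cvg_shan => ab; apply: cvgM; first exact: cvg_Ek.
by apply: cvgV => //; rewrite gt_eqF.
Qed.
End entropy_continuity.

Lemma ultra_image (T U : Type) (G : set_system T) (u : T -> U) : UltraFilter G -> UltraFilter (u @ G).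
Proof.
move=> GU; have GP : ProperFilter G by exact: ultra_proper.
split=> [|H HP GH]; first exact: fmap_proper_filter.
apply/seteqP; split=> A hA; last exact: GH.
have [//|nA] := in_ultra_setVsetC (u @^-1` A) GU.
have /GH hnA : (u @ G) (~` A) by [].
by have [x []] := filter_ex (filterI hA hnA).
Qed.

Section compactness.
Context {R : realType} {M J : finType} {Dl k : nat} (pid : 'I_Dl.+1 -> R).
Hypothesis md0 : 0 < \sum_l pid l * (l%:R : R).
Variables (h : bool -> B M Dl k.+1 -> J) (pr : J -> R).

(** Otherwise there would be laws that satisfy the constraints up to 1/(n + 1) and violate the
    bound. Along an ultrafilter their finitely many coordinates, which lie in [0, 1], converge to a
    law that satisfies the constraints exactly, and continuity of [Sig] contradicts [hc]. The maps
    [h] are the two marginals of a coupling, or the identity. *)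
Lemma near_optimal (c delta : R) : 0 < delta ->
  (forall q : B M Dl k.+1 -> R, (forall a, 0 <= q a) -> inv q -> edge_symm (Ek q) ->
     push (@degB _ _ k) q =1 pid -> (forall i, push (h i) q =1 pr) -> Sig q <= c) ->
  exists2 et : R, 0 < et &
    forall q : B M Dl k.+1 -> R, (forall a, 0 <= q a) -> \sum_a q a = 1 ->
     inv q -> edge_symm (Ek q) ->
     (forall l, `|push (@degB _ _ k) q l - pid l| <= et) ->
     (forall i j, `|push (h i) q j - pr j| <= et) -> Sig q <= c + delta.
Proof.
move=> d0 hc; apply: contrapT => hn.
have {}hn (n : nat) : exists q : B M Dl k.+1 -> R,
    [/\ (forall a, 0 <= q a) /\ \sum_a q a = 1,
     inv q /\ edge_symm (Ek q),
     (forall l, `|push (@degB _ _ k) q l - pid l| <= n.+1%:R^-1),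
     (forall i j, `|push (h i) q j - pr j| <= n.+1%:R^-1) & c + delta < Sig q].
  apply: contrapT => hq; apply: hn; exists (n.+1%:R^-1); first by rewrite invr_gt0.
  move=> q q0 q1 qi qs qd qh; rewrite leNgt; apply/negP => hS; apply: hq.
  by exists q.
have /choice[q hq] := hn.
have [G [GU GF]] := ultraFilterLemma (@eventually_filter : ProperFilter (\oo : set_system nat)).
have GP : ProperFilter G by exact: ultra_proper.
have /choice[q0 hq0] : forall a, exists x : R, q n a @[n --> G] --> x.
  move=> a; have := @segment_compact R 0 1; rewrite compact_ultra => /(_ ((q^~ a) @ G)).
  move=> /(_ _)/wrap[]; first exact: ultra_image.
  move=> /(_ _)/wrap[]; last by move=> [x [_ hx]]; exists x.
  apply: (@filterE _ G _ _ _) => n /=; rewrite in_itv /=.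
  have [[p0 p1] _ _ _ _] := hq n; rewrite p0 /= -p1 (bigD1 a)//= lerDl.
  by rewrite sumr_ge0.
have lim0 (u : nat -> R) (x y : R) : u n @[n --> G] --> x -> (forall n, `|u n - y| <= n.+1%:R^-1) -> x = y.
  move=> cu hu; apply: (@cvg_unique _ (@Rhausdorff R) (u @ G)) => //.
  apply/cvgrPdist_le => e e0; apply: GF; near=> n; rewrite distrC; apply: le_trans (hu n) _.
  by near: n; apply: (cvgr_le _ cvg_harmonic).
have ul (u : nat -> R) (x y : R) : u n @[n --> G] --> x -> u n @[n --> G] --> y -> x = y.
  exact: (@cvg_unique _ (@Rhausdorff R) (u @ G)).
have n0 a : 0 <= q0 a.
  by apply: (ler_cvg_to (cvg_cst 0) (hq0 a)); apply: nearW => n; have [[]] := hq n.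
have q0deg : push (@degB _ _ k) q0 =1 pid.
  move=> l; apply: (lim0 (fun n => push (@degB _ _ k) (q n) l)); first exact: cvg_push.
  by move=> n; have [] := hq n.
have q0h i : push (h i) q0 =1 pr.
  move=> j; apply: (lim0 (fun n => push (h i) (q n) j)); first exact: cvg_push.
  by move=> n; have [] := hq n.
have q0i : inv q0.
  move=> x y xy; apply: (ul _ _ _ (hq0 x)); rewrite (_ : (fun n => q n x) = (fun n => q n y)); first exact: hq0.
  by apply/funext => n; have [_ [hi _] _ _ _] := hq n; exact: hi.
have q0s : edge_symm (Ek q0).
  move=> a b; apply: (ul (fun n => Ek (q n) (a, b))); first exact: cvg_Ek.
  rewrite (_ : (fun n => Ek (q n) (a, b)) = (fun n => Ek (q n) (b, a))); first exact: cvg_Ek.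
  by apply/funext => n; have [_ [_ hs] _ _ _] := hq n; exact: hs.
have m0 : 0 < mdeg q0.
  rewrite /mdeg -[ltRHS](sum_push (@degB _ _ k) q0 (fun l => l%:R)).
  by rewrite (eq_bigr (fun l => pid l * l%:R))// => l _; rewrite q0deg.
have := hc q0 n0 q0i q0s q0deg q0h; apply/negP; rewrite -ltNge.
apply: lt_le_trans (_ : c + delta <= _); first by rewrite ltrDl.
apply: (ler_cvg_to (cvg_cst _) (cvg_Sig m0 hq0)); apply: nearW => n.
by have [_ _ _ _ /ltW] := hq n.
Unshelve. all: end_near. Qed.
End compactness.

Section canonical_distance.
Context {R : realType} {M : finType} {Dl k : nat}.
Local Notation B := (B M Dl k).

Lemma push_dist (T U : finType) (phi : T -> U) (P Q : T -> R) u :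
  `|push phi P u - push phi Q u| <= \sum_x `|P x - Q x|.
Proof.
rewrite /push -sumrB; apply: le_trans (ler_norm_sum _ _ _) _.
by rewrite big_mkcond; apply: ler_sum => x _; case: ifP.
Qed.

Lemma Sym_dist (P Q : B -> R) x : `|Sym P x - Sym Q x| <= \sum_y `|P y - Q y|.
Proof.
rewrite /Sym -mulrBl normrM [Num.norm _^-1]ger0_norm ?invr_ge0// ler_pdivrMr ?ocl_gt0R//.
apply: le_trans (push_dist _ _ _ _) _; rewrite ler_peMr ?sumr_ge0// ler1n.
exact: ocl_gt0.
Qed.
End canonical_distance.

Section iterated_truncation.
Context {M : finType} {Dl k : nat}.

Fixpoint trs d : B M Dl (d + k).+1 -> B M Dl k.+1 :=
  match d with 0 => fun x => x | d'.+1 => fun x => @trs d' (tr x) end.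

Lemma trs_sw l i d (x : B M Dl (d + k).+1) : trs (sw l i x) = sw l i (trs x).
Proof. by elim: d x => //= d ih x; rewrite tr_sw ih. Qed.

Lemma trs_typ (D V : finType) (vtx : D -> V) (dlD : forall v, (size (dl vtx v) <= Dl)%N) f s d v :
  trs (typ vtx Dl f s (d + k) v) = typ vtx Dl f s k v.
Proof. by elim: d => //= d ih; rewrite tr_typ. Qed.
End iterated_truncation.

Lemma mapB_typ (M M' : finType) (h : M -> M') (Dl k : nat) (D V : finType) (vtx : D -> V)
  (dlD : forall v, (size (dl vtx v) <= Dl)%N) f s v :
  mapB h (typ vtx Dl f s k v) = typ vtx Dl (h \o f) s k v.
Proof.
have hu j x : mapB h (br vtx Dl f s j x) = br vtx Dl (h \o f) s j x.
  elim: j x => [//|j ih] x; rewrite !brS /mapB -/mapB kids_nd ?size_map; last exact: nxdD.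
  by rewrite -map_comp; congr nd; apply: eq_map => y /=; exact: ih.
rewrite /typ /mapB -/mapB kids_nd ?size_map//= -map_comp.
by congr nd; apply: eq_map => y /=; exact: hu.
Qed.

Section second_moment.
Context {R : realType}.

(** Outside the set where [Z] is at least [c], the sum of [Z] is at most a/2; on this set
    Cauchy-Schwarz applies, in the form of the positivity of a variance. *)
Lemma second_moment (T : finType) (A : {set T}) (Z : T -> R) (a b c : R) :
  (forall x, 0 <= Z x) -> 0 <= c -> 0 < b ->
  2 * (c * #|A|%:R) <= a -> a <= \sum_(x in A) Z x -> \sum_(x in A) Z x ^+ 2 <= b ->
  (a / 2) ^+ 2 <= #|[set x in A | c <= Z x]%SET|%:R * b.
Proof.
move=> Z0 c0 b0 ha hZ hb; set A' := finset _.
have h1 : a / 2 <= \sum_(x in A') Z x.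
  have : \sum_(x in A) Z x <= \sum_(x in A') Z x + c * #|A|%:R.
    rewrite mulr_natr -sumr_const [X in _ <= X + _]big_mkcond [X in _ <= _ + X]big_mkcond /= -big_split big_mkcond /=.
    apply: ler_sum => x _; rewrite inS; case: (x \in A) => /=; last by rewrite addr0.
    by case: (leP c (Z x)) => h; [rewrite lerDl|rewrite add0r; exact: ltW].
  lra.
have a0 : 0 <= a / 2 by rewrite divr_ge0// (le_trans _ ha)// !mulr_ge0.
apply: le_trans (_ : (\sum_(x in A') Z x) ^+ 2 <= _); first by rewrite lerXn2r ?nnegrE// (le_trans a0).
apply: le_trans (_ : #|A'|%:R * \sum_(x in A') Z x ^+ 2 <= _); last first.
  rewrite ler_wpM2l//; apply: le_trans hb; rewrite big_mkcond [leRHS]big_mkcond /=.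
  apply: ler_sum => x _; rewrite inS; case: (x \in A); case: (c <= Z x) => //=; exact: sqr_ge0.
have [A0|A0] := posnP #|A'|.
  by rewrite (cards0_eq A0) !big_set0 cards0 mul0r expr0n.
have A0R : 0 < #|A'|%:R :> R by rewrite ltr0n.
set S := \sum_(x in A') Z x; set N := #|A'|%:R.
have : 0 <= \sum_(x in A') (Z x - S / N) ^+ 2 by apply: sumr_ge0 => x _; exact: sqr_ge0.
under eq_bigr do rewrite sqrrB; rewrite big_split sumrB /= sumr_const.
have -> : \sum_(i in A') Z i * (S / N) *+ 2 = 2 * (S ^+ 2 / N).
  by rewrite sumrMnl -mulr_suml -/S -[LHS]mulr_natl; congr (2 * _); rewrite expr2 mulrA.
have -> : (S / N) ^+ 2 *+ #|A'| = S ^+ 2 / N.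
  rewrite -[LHS]mulr_natl -/N exprMn [N^-1 ^+ 2]expr2 mulrCA; congr (_ * _).
  by rewrite mulrA mulfV ?mul1r// gt_eqF.
move=> h; have {}h : S ^+ 2 / N <= \sum_(x in A') Z x ^+ 2 by lra.
by rewrite mulrC -ler_pdivrMr.
Qed.
End second_moment.

Section Sym_types.
Context {R : realType} {D V : finType} (vtx : D -> V) {Dl : nat} {M : finType} {k : nat}.
Hypothesis dlD : forall v, (size (dl vtx v) <= Dl)%N.
Variables (f : V -> M) (s : {perm D}).
Local Notation L := (@emp R V _ (typ vtx Dl f s k)).

Lemma edge_symm_Sym_typ : fpi s -> edge_symm (Ek (Sym L)).
Proof.
move=> fs; apply: edge_symm_inv; first exact: Sym_inv.
move=> a b; rewrite !(push_canon2_Ek (push_canon_Sym L)); exact: edge_symm_typ.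
Qed.

Lemma push_deg_Sym_typ : push (@degB _ _ k) (Sym L) =1 emp (dg dlD).
Proof.
move=> l; transitivity (push (@degB _ _ k) L l); last first.
  by rewrite push_emp /emp; congr (_%:R / _); apply: eq_card => v; rewrite !inS /=;
    congr (_ == _); apply: val_inj; rewrite /= size_kids_typ.
have e (P : B M Dl k.+1 -> R) : push (@degB _ _ k) P l = \sum_x P x * (degB x == l)%:R.
  by rewrite /push big_mkcond; apply: eq_bigr => x _; case: (_ == l); rewrite ?mulr1 ?mulr0.
rewrite !e; apply: sum_class; first exact: push_canon_Sym.
by move=> x y /size_canon h; congr (nat_of_bool (_ == _))%:R; apply: val_inj.
Qed.
End Sym_types.

(** * Exponentially rare events for uniform pairings *)

Section sequences.
Context {R : realType} (Dl : nat) (V D : nat -> finType) (vtx : forall n, D n -> V n)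
  (F : set_system nat) {FF : Filter F}.
Hypothesis dlD : forall n v, (size (dl (@vtx n) v) <= Dl)%N.
Hypothesis eD : forall n, ~~ odd #|D n|.
Hypothesis nV : forall k, \forall n \near F, (k <= #|V n|)%N.
Variable pid : 'I_Dl.+1 -> R.
Hypothesis cdeg : forall l, emp (dg (@dlD n)) l @[n --> F] --> pid l.
Local Notation md := (\sum_l pid l * (l%:R : R)).
Hypothesis md0 : 0 < md.

Local Notation ty f s k := (typ (@vtx _) Dl f s k).
Local Notation nI n := (#|I (D := D n) [::]|%:R : R).
Local Notation nn n := (#|V n|%:R : R).

Let nearV : \forall n \near F, (0 < #|V n|)%N := nV 1.
Let nearD k : \forall n \near F, (k <= #|D n|)%N := nearD nV cdeg md0 k.
Let near_md : \forall n \near F, md / 2 * nn n <= #|D n|%:R := near_DV nV cdeg md0.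

Lemma near_exp (c e : R) : 0 < c -> 0 < e -> \forall n \near F, expR (- (c * nn n)) <= e.
Proof.
move=> c0 e0; near=> n; rewrite expRN -[leRHS]invrK lef_pV2 ?posrE ?expR_gt0 ?invr_gt0//.
apply: le_trans (expR_ge1Dx _); apply: le_trans (_ : c * nn n <= _); last by rewrite lerDr.
rewrite mulrC -ler_pdivrMr//; apply: le_trans (ltW (truncnS_gt _)) _; rewrite ler_nat.
by near: n; exact: nV.
Unshelve. all: end_near. Qed.

(** Proportions are among all pairings. Exponential decay is stable under unions, and it absorbs the
    subexponential cost of conditioning on simple pairings ([rare_simple]). *)
Definition rare (Bad : forall n, {perm D n} -> bool) := exists2 c : R, 0 < c &
  \forall n \near F, #|[set s in I [::] | @Bad n s]%SET|%:R <= expR (- (c * nn n)) * nI n.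

Lemma rare_sub (Bad Bad' : forall n, {perm D n} -> bool) : (\forall n \near F, forall s, fpi s -> @Bad n s -> @Bad' n s) ->
  rare Bad' -> rare Bad.
Proof.
move=> h [c c0 hc]; exists c => //; near=> n.
apply: le_trans (_ : #|[set s in I [::] | @Bad' n s]%SET|%:R <= _); last by near: n.
rewrite ler_nat; apply: card_incl => s /setIdP[sI sB].
apply/setIdP; split=> //; move: (I_sub sI) sB; move: s {sI}; near: n; exact: h.
Unshelve. all: end_near. Qed.

Lemma rareU (Bad Bad' : forall n, {perm D n} -> bool) : rare Bad -> rare Bad' -> rare (fun n s => @Bad n s || @Bad' n s).
Proof.
(* Half of the smaller rate is kept, and the other half absorbs the factor 2 of the union bound. *)
move=> [c c0 hc] [c' c'0 hc']; pose d := Num.min c c' / 2.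
have m0 : 0 < Num.min c c' by rewrite lt_min c0.
have d0 : 0 < d by rewrite divr_gt0.
exists d => //; near=> n.
have h1 : #|[set s in I [::] | @Bad n s]%SET|%:R <= expR (- (c * nn n)) * nI n by near: n.
have h2 : #|[set s in I [::] | @Bad' n s]%SET|%:R <= expR (- (c' * nn n)) * nI n by near: n.
apply: le_trans (_ : #|[set s in I [::] | @Bad n s]|%SET%:R + #|[set s in I [::] | @Bad' n s]|%SET%:R <= _).
  rewrite -natrD ler_nat; apply: leq_trans (_ : #|([set s in I [::] | @Bad n s] :|: [set s in I [::] | @Bad' n s])%SET| <= _)%N.
    apply: card_incl => s /setIdP[sI sB]; rewrite finset.in_setU.
    by apply/orP; case/orP: sB => sB; [left|right]; apply/setIdP.
  by rewrite cardsU leq_subr.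
apply: le_trans (lerD h1 h2) _; rewrite -mulrDl ler_wpM2r//.
have e2 : 2 * expR (- (d * nn n)) <= 1.
  by rewrite mulrC -ler_pdivlMr// mul1r; near: n; apply: near_exp; rewrite ?invr_gt0.
apply: le_trans (_ : 2 * expR (- (Num.min c c' * nn n)) <= _).
  by rewrite mulr_natl lerD// ler_expR lerN2 ler_wpM2r// ge_min lexx ?orbT.
rewrite (_ : - (Num.min c c' * nn n) = - (d * nn n) + - (d * nn n)); last first.
  by rewrite -opprD -mulrDl /d -splitr.
by rewrite expRD mulrA ler_piMl// expR_ge0.
Unshelve. all: end_near. Qed.

Lemma near_simple (c : R) : 0 < c -> \forall n \near F,
  nI n <= expR (c * nn n) * (nsimple (@vtx n))%:R.
Proof.
move=> c0; pose C := (4 * (Dl ^ 2 * Dl.+1))%N.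
near=> n; have hN : (2 * (Dl.+1 * Dl) + C + 4 * Dl < #|D n|)%N by near: n; exact: nearD.
have := simple_many (@dlD n) hN; rewrite -/C -(ler_nat R) => h; apply: le_trans h _.
rewrite mulnA natrM ler_wpM2r// natrM natrX.
have p0 : 0 < (#|D n| ^ 2).+1%:R :> R by rewrite ltr0n.
rewrite -[X in X * _]lnK ?posrE// -[X in _ * X]lnK ?posrE ?exprn_gt0// -expRD ler_expR lnXn//.
have h1 : ln 2 <= 1 :> R by rewrite -ler_expR lnK ?posrE//; apply: le_trans (expR_ge1Dx 1).
have h2 : ln (#|D n| ^ 2).+1%:R <= ln #|D n|.+1%:R *+ 2 :> R.
  rewrite -lnXn// -natrX ler_ln ?posrE ?ltr0n// ler_nat -addn1 -[X in (_ <= X ^ 2)%N]addn1; clear; nia.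
apply: le_trans (_ : err (2 * C + 1) (#|V n| + #|D n|) <= _); last first.
  by near: n; exact: (err_small dlD nV).
apply: le_trans (err_le (leqnn _) (leq_addl #|V n| _)).
rewrite /err natrD natrM -[X in ln 2 + X]mulr_natl; have l0 : 0 <= ln #|D n|.+1%:R :> R by rewrite ln_ge0// ler1n.
have C0 : 0 <= C%:R :> R by [].
have : C%:R * ln (#|D n| ^ 2).+1%:R <= C%:R * (2 * ln #|D n|.+1%:R) :> R by rewrite ler_wpM2l// mulr_natl.
move: (ln 2 : R) h1 => x; set y := ln #|D n|.+1%:R in l0 *; set z := C%:R * ln _.
have := mulr_ge0 C0 l0; set w := C%:R * y; rewrite mulrCA -/w => w0 hx hz.
rewrite [leRHS](_ : _ = 2 * C%:R + 1 + 2 * w + y); [lra|rewrite /w; lra].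
Unshelve. all: end_near. Qed.

Lemma near_nsimple : \forall n \near F, (0 < nsimple (@vtx n))%N.
Proof.
have h := near_simple ltr01.
near=> n; rewrite lt0n; apply/eqP => e.
have : nI n <= expR (1 * nn n) * (nsimple (@vtx n))%:R by near: n; exact: h.
by rewrite e mulr0 lern0 -leqn0 leqNgt I_gt0.
Unshelve. all: end_near. Qed.

Lemma rare_simple (Bad : forall n, {perm D n} -> bool) : rare Bad ->
  (#|[set s | simple (@vtx n) s & @Bad n s]%SET|%:R / (nsimple (@vtx n))%:R : R) @[n --> F] --> (0 : R).
Proof.
move=> [c c0 hc]; apply/cvgr0Pnorm_le => e e0; near=> n.
have s0 : (0 < nsimple (@vtx n))%N by near: n; exact: near_nsimple.
rewrite ger0_norm ?divr_ge0// ler_pdivrMr ?ltr0n//.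
apply: le_trans (_ : #|[set s in I [::] | @Bad n s]%SET|%:R <= _).
  rewrite ler_nat; apply: card_incl => s /setIdP[/andP[fs _] sB].
  by apply/setIdP; rewrite I_nil.
apply: le_trans (_ : expR (- (c * nn n)) * nI n <= _); first by near: n.
apply: le_trans (_ : expR (- (c * nn n)) * (expR (c / 2 * nn n) * (nsimple (@vtx n))%:R) <= _).
  by rewrite ler_wpM2l ?expR_ge0//; near: n; apply: near_simple; rewrite divr_gt0.
rewrite mulrA ler_wpM2r// -expRD (_ : - (c * nn n) + c / 2 * nn n = - (c / 2 * nn n)); last by lra.
by near: n; apply: near_exp; rewrite ?divr_gt0.
Unshelve. all: end_near. Qed.

Lemma leD n : (#|D n| <= Dl * #|V n|)%N.
Proof.
rewrite -(sum_size_dl (@vtx n)) mulnC -sum_nat_const; apply: leq_sum => v _; exact: dlD.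
Qed.

Lemma wt_gt0 k : (0 < wt Dl k)%N. Proof. by case: k. Qed.

(** By [card_ntree] the mean number of vertices near a cycle is bounded. Divided by [wt Dl k] this
    number is 1-Lipschitz ([ntree_lip]), so [conc_tail] applies. *)
Lemma rare_ntree k (beta : R) : 0 < beta ->
  rare (fun n s => beta * nn n <= #|[set v | ntree (@vtx n) s k v]%SET|%:R).
Proof.
move=> b0; pose W : R := (wt Dl k)%:R; have W0 : 0 < W by rewrite ltr0n wt_gt0.
(* Chosen so that 2 b1 #|D| W <= beta n, given that #|D| is at most (Dl + 1) n; the bound 1 is
   required by [conc_tail]. *)
pose b1 : R := Num.min 1 (beta / (2 * W * Dl.+1%:R)).
have b10 : 0 < b1 by rewrite lt_min ltr01 divr_gt0// !mulr_gt0.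
pose m := (Dl * wt Dl k)%N; pose K := (m * (Dl * m.+1))%N.
exists (b1 ^+ 2 / 128 * (md / 2)); first by rewrite mulr_gt0 ?divr_gt0// exprn_gt0.
near=> n.
have V0 : (0 < #|V n|)%N by near: n; exact: nearV.
have D4 : (4 * m <= #|D n|)%N by near: n; exact: nearD.
have D0 : (0 < #|D n|)%N by near: n; exact: nearD.
have mdn : md / 2 * nn n <= #|D n|%:R by near: n; exact: near_md.
have D0R : 0 < #|D n|%:R :> R by rewrite ltr0n.
pose Fn (s : {perm D n}) : R := #|[set v | ntree (@vtx n) s k v]%SET|%:R / W.
have lip s t : fpi s -> fpi t -> `|Fn s - Fn t| <= (hd s t)%:R.
  move=> _ _; rewrite /Fn -mulrBl normrM [Num.norm W^-1]gtr0_norm ?invr_gt0// ler_pdivrMr// -natrM mulnC.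
  have h1 := ntree_lip (@dlD n) s t k; have h2 := ntree_lip (@dlD n) t s k.
  rewrite hd_sym in h2; rewrite ler_norml lerBlDr lerNl opprB lerBlDr -!natrD !ler_nat.
  by rewrite addnC h2 addnC h1.
have I0 := I_gt0 (@eD n).
have := conc_tail b10 _ lip I0; rewrite ge_min lexx /= => /(_ isT) h.
apply: le_trans (_ : #|[set s in I [::] | 2 * b1 * #|D n|%:R <= Fn s]%SET|%:R <= _).
  rewrite ler_nat; apply: card_incl => s /setIdP[sI sB]; apply/setIdP; split=> //.
  rewrite /Fn ler_pdivlMr//; apply: le_trans sB.
  apply: le_trans (_ : 2 * (beta / (2 * W * Dl.+1%:R)) * (Dl.+1%:R * nn n) * W <= _).
    apply: ler_wpM2r; first exact: ltW.
    apply: ler_pM => //; first by rewrite mulr_ge0// ltW.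
      by rewrite ler_pM2l// ge_min lexx orbT.
    by rewrite -natrM ler_nat; apply: leq_trans (leD n) _; rewrite leq_mul2r leqnSn orbT.
  rewrite (_ : 2 * _ * _ * W = beta * nn n * ((2 * W * Dl.+1%:R)^-1 * (2 * W * Dl.+1%:R))); last first.
    move: (_^-1) => x; lra.
  by rewrite mulVf ?mulr1// gt_eqF// !mulr_gt0.
apply: le_trans (h _) _.
  rewrite /Fn -mulr_suml ler_pdivrMr//.
  have e1 : (\sum_(s in I (D := D n) [::]) #|[set v | ntree (@vtx n) s k v]%SET| * (#|D n| - 2 * m) <= #|V n| * (K * #|I (D := D n) [::]|))%N.
    rewrite -big_distrl /=; rewrite -sum_nat_const.
    rewrite (eq_bigr (fun s => \sum_(v | ntree (@vtx n) s k v) 1)%N); last first.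
      by move=> s _; rewrite -sum1_card; apply: eq_bigl => v; rewrite inS.
    rewrite (exchange_big_dep predT)//= big_distrl /=; apply: leq_sum => v _.
    rewrite sum1_card -[X in (X * _ <= _)%N](@eq_card _ [set s in I [::] | ntree (@vtx n) s k v]%SET); last first.
      by move=> s; rewrite inS.
    by apply: (card_ntree (@dlD n)); rewrite subnK//; apply: leq_trans D4; rewrite leq_mul2r orbT.
  have e2 : \sum_(s in I (D := D n) [::]) #|[set v | ntree (@vtx n) s k v]%SET|%:R * (#|D n|%:R / 2) <= nn n * (K%:R * nI n) :> R.
    move: e1; rewrite -(ler_nat R) natrM natrM => e1; apply: le_trans e1.
    rewrite natr_sum; apply: ler_sum => s _; rewrite natrM ler_wpM2l//.
    rewrite natrB; last by apply: leq_trans D4; rewrite leq_mul2r orbT.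
    have : (4 * m)%:R <= #|D n|%:R :> R by rewrite ler_nat.
    rewrite !natrM; lra.
  rewrite -mulr_suml -ler_pdivlMr ?divr_gt0// in e2; apply: le_trans e2 _.
  rewrite ler_pdivrMr ?divr_gt0//.
  have hK : nn n * K%:R <= b1 * #|D n|%:R * W * (#|D n|%:R / 2).
    apply: le_trans (_ : (2 / md * #|D n|%:R) * K%:R <= _).
      rewrite ler_wpM2r//; rewrite -ler_pdivrMl ?divr_gt0// invf_div; exact: mdn.
    rewrite [leLHS](_ : _ = #|D n|%:R * (2 / md * K%:R)); last by lra.
    rewrite [leRHS](_ : _ = #|D n|%:R * (b1 * W / 2 * #|D n|%:R)); last by lra.
    rewrite ler_pM2l// -ler_pdivrMl ?divr_gt0// ?mulr_gt0//.
    apply: le_trans (ltW (truncnS_gt _)) _; rewrite ler_nat.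
    by near: n; exact: nearD.
  move: hK; rewrite -(ler_pM2r (_ : 0 < nI n)) ?ltr0n//; lra.
rewrite ler_wpM2r// ler_expR mulNr lerN2 -mulrA ler_wpM2l//.
by rewrite divr_ge0// exprn_ge0// ltW.
Unshelve. all: end_near. Qed.

Lemma emp_dg_near (et : R) : 0 < et -> \forall n \near F, forall l, `|emp (dg (@dlD n)) l - pid l| <= et.
Proof.
move=> e0; apply: near_forall => l; have /cvgrPdist_le/(_ et e0) := cdeg (l := l).
by apply: filterS => n; rewrite distrC.
Qed.

(** [core_up] bounds the count through the largest [Sig] of a symmetrized empirical law that meets
    the constraints approximately, and [near_optimal] compares it with [c]. *)
Lemma count_up (M J : finType) (k : nat) (h : bool -> B M Dl k.+1 -> J) (pr : J -> R) (c delta : R) :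
  0 < delta ->
  (forall q : B M Dl k.+1 -> R, (forall a, 0 <= q a) -> inv q -> edge_symm (Ek q) ->
     push (@degB _ _ k) q =1 pid -> (forall i, push (h i) q =1 pr) -> Sig q <= c) ->
  exists2 et : R, 0 < et & \forall n \near F,
    #|[set sf : {perm D n} * {ffun V n -> M} | fpi sf.1 &
      [forall i, forall j, `|push (h i) (Sym (@emp R (V n) _ (ty sf.2 sf.1 k))) j - pr j| <= et]]%SET|%:R
    <= expR (nn n * (c + delta)) * nI n.
Proof.
move=> d0 hc; have d2 : 0 < delta / 2 by rewrite divr_gt0.
have [et et0 het] := near_optimal md0 d2 hc; exists et => //; near=> n.
have V0 : (0 < #|V n|)%N by near: n; exact: nearV.
have D0 : (0 < #|D n|)%N by near: n; exact: nearD.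
apply: le_trans (core_up (@dlD n) V0 D0 (@eD n) (c := c + delta / 2) _ _) _.
- by move=> s f /setIdP[].
- move=> s f /setIdP[/= fs /forallP hh]; apply: het.
  + by apply: Sym_ge0 => a; exact: emp_ge0.
  + by rewrite sum_Sym sum_emp1.
  + exact: Sym_inv.
  + exact: edge_symm_Sym_typ.
  + move=> l; rewrite (push_deg_Sym_typ (@dlD n)); move: l; near: n; exact: emp_dg_near.
  + by move=> i j; move: (hh i) => /forallP/(_ j).
rewrite ler_wpM2r// ler_expR.
rewrite (_ : nn n * (c + delta) = nn n * (c + delta / 2) + delta / 2 * nn n); last by lra.
by rewrite lerD2l; near: n; exact: (err_small dlD nV).
Unshelve. all: end_near. Qed.

Section typical.
Context (M : finType) (m0 : M) (k d : nat).
Local Notation tau := (d + k)%N.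
Local Notation K := (B M Dl tau.+1).
Variable pt : K -> R.
Hypotheses (P0 : forall a, 0 <= pt a) (Pi : inv pt) (Pdeg : push (@degB _ _ tau) pt =1 pid)
  (Psym : edge_symm (Ek pt)).
Let pr := push (@trs M Dl k d) pt.
Let S := Sig pr.

Definition typical n (et : R) (s : {perm D n}) : {set {ffun V n -> M}} :=
  [set f : {ffun V n -> M} | [forall a, `|Sym (@emp R (V n) _ (ty f s tau)) a - pt a| <= et]]%SET.

Let cK : R := #|{: K}|%:R.
Let cK0 : 0 < cK.
Proof. by rewrite ltr0n; apply/card_gt0P; exists (lf _ m0). Qed.

Lemma typical_tr n et (s : {perm D n}) (f : {ffun V n -> M}) : f \in typical et s ->
  forall a, `|Sym (@emp R (V n) _ (ty f s k)) a - pr a| <= cK * et.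
Proof.
rewrite inS => /forallP hf a.
have -> : Sym (emp (ty f s k)) a = push (@trs M Dl k d) (Sym (emp (ty f s tau))) a :> R.
  rewrite (Sym_push _ (fun l i x => trs_sw l i x)); apply: eq_Sym => u; apply: eq_bigr => x _.
  by rewrite push_emp; congr (_%:R / _); apply: eq_card => v; rewrite !inS /= trs_typ.
apply: le_trans (push_dist _ _ _ _) _; rewrite /cK mulr_natl -sumr_const.
by apply: ler_sum => x _; exact: hf.
Qed.

(** Markov's inequality. Typical colorings at depth [tau] are counted at depth [k], where they are
    still typical; [h] is the identity, so that the constraint of [count_up] determines the law. *)
Lemma upper_rare (delta : R) : 0 < delta -> exists2 et : R, 0 < et &
  rare (fun n s => expR (nn n * (S + delta)) <= #|typical et s|%:R).
Proof.
move=> d0; have d2 : 0 < delta / 2 by rewrite divr_gt0.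
have [|et et0 het] := @count_up M _ k (fun _ x => x) pr S _ d2.
  move=> q _ _ _ _ /(_ true) hq; rewrite (_ : q = pr)//; apply/funext => a; rewrite -hq.
  by rewrite /push big_pred1_eq.
exists (et / cK); first by rewrite divr_gt0.
exists (delta / 2) => //; near=> n.
set Bd := finset _; set E := expR (nn n * (S + delta)).
have E0 : 0 < E by exact: expR_gt0.
rewrite -(ler_pM2r E0).
apply: le_trans (_ : \sum_(s in I (D := D n) [::]) #|typical (et / cK) s|%:R <= _).
  rewrite mulr_natl -sumr_const big_mkcond [leRHS]big_mkcond /=; apply: ler_sum => s _.
  by rewrite /Bd inS; case: (s \in I _) => //=; case: ifP.
apply: le_trans (_ : expR (nn n * (S + delta / 2)) * nI n <= _); last first.
  rewrite mulrAC -expRD ler_wpM2r// ler_expR; lra.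
have h : #|[set sf : {perm D n} * {ffun V n -> M} | fpi sf.1 &
      [forall i : bool, forall j, `|push (fun x => x) (Sym (@emp R (V n) _ (ty sf.2 sf.1 k))) j - pr j| <= et]]%SET|%:R
    <= expR (nn n * (S + delta / 2)) * nI n by near: n.
apply: le_trans h; rewrite -natr_sum ler_nat -[leqRHS]sum1_card.
rewrite [leqRHS](partition_big fst (fun s => s \in I [::])) /=; last first.
  by move=> sf /setIdP[fs _]; rewrite I_nil.
apply: leq_sum => s sI; rewrite sum1_card -(card_imset (typical _ s) (f := pair s)); last by move=> ? ? [].
apply: card_incl => _ /imsetP[f hf ->]; rewrite unfold_in /= eqxx andbT.
apply/setIdP; split; first exact: I_sub sI.
apply/forallP => _; apply/forallP => j; rewrite [push _ _ _]/push big_pred1_eq.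
by apply: le_trans (typical_tr hf j) _; rewrite mulrC divfK ?gt_eqF.
Unshelve. all: end_near. Qed.

Hypothesis hS : S <= Sig pt.
Hypothesis coupl : forall q : B (M * M)%type Dl k.+1 -> R,
  (forall a, 0 <= q a) -> inv q -> edge_symm (Ek q) -> push (@degB _ _ k) q =1 pid ->
  push (@mapB _ _ Dl (@fst M M) k.+1) q =1 pr ->
  push (@mapB _ _ Dl (@snd M M) k.+1) q =1 pr -> Sig q <= 2 * S.

Let hh (i : bool) : B (M * M)%type Dl k.+1 -> B M Dl k.+1 := if i then @mapB _ _ Dl fst k.+1 else @mapB _ _ Dl snd k.+1.

(** The first moment comes from [core_low] at depth [tau], the second from [count_up] at depth [k]:
    a pair of typical colorings is a coloring by [M * M] with both marginals close to [pr]. The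
    proportion obtained is at least exp (-3 d1 n)/4, which eventually exceeds exp (-delta n). *)
Lemma many_typical (delta : R) : 0 < delta -> exists2 et0 : R, 0 < et0 &
  forall et, 0 < et -> et <= et0 -> \forall n \near F,
  expR (- (delta * nn n)) * nI n <=
    #|[set s in I (D := D n) [::] | expR (nn n * (S - delta)) <= #|typical et s|%:R]%SET|%:R.
Proof.
move=> d0; pose d1 := delta / 8; have d10 : 0 < d1 by rewrite divr_gt0.
have [|et1 et10 het1] := @count_up (M * M)%type _ k hh pr (2 * S) _ d10.
  move=> q q0 qi qs qd qh; apply: coupl => //; [exact: (qh true)|exact: (qh false)].
exists (et1 / cK); first by rewrite divr_gt0.
move=> et et0 ete.
have cl := core_low eD nV cdeg md0 m0 P0 Pdeg Psym d10 (divr_gt0 et0 cK0).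
near=> n; pose Z (s : {perm D n}) : R := #|typical et s|%:R.
have V0 : (0 < #|V n|)%N by near: n; exact: nearV.
have hlow : expR (nn n * (S - d1)) * nI n <= \sum_(s in I (D := D n) [::]) Z s.
  apply: le_trans (_ : expR (nn n * (Sig pt - d1)) * nI n <= _).
    by rewrite ler_wpM2r// ler_expR ler_wpM2l// lerD2r.
  apply: le_trans (_ : #|[set sf : {perm D n} * {ffun V n -> M} | fpi sf.1 &
      [forall a, `|emp (typ (@vtx n) Dl sf.2 sf.1 tau) a - pt a| <= et / cK]]%SET|%:R <= _).
    by near: n; exact: cl.
  rewrite -natr_sum ler_nat -[leqLHS]sum1_card (partition_big fst (fun s => s \in I [::])) /=; last first.
    by move=> sf /setIdP[fs _]; rewrite I_nil.
  apply: leq_sum => s sI; rewrite sum1_card -(card_imset (typical _ s) (f := pair s)); last by move=> ? ? [].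
  apply: card_incl => -[t f]; rewrite unfold_in /= => /andP[/setIdP[/= ft /forallP hf] /eqP e]; subst t.
  apply/imsetP; exists f => //; rewrite inS; apply/forallP => a.
  rewrite -(Sym_id Pi a); apply: le_trans (Sym_dist _ _ _) _.
  apply: le_trans (_ : \sum_(a : K) et / cK <= _); first by apply: ler_sum => x _; exact: hf.
  by rewrite sumr_const -[leLHS]mulr_natl -/cK mulrC divfK ?gt_eqF.
have hup : \sum_(s in I (D := D n) [::]) Z s ^+ 2 <= expR (nn n * (2 * S + d1)) * nI n.
  have h : #|[set sf : {perm D n} * {ffun V n -> (M * M)%type} | fpi sf.1 &
      [forall i, forall j, `|push (hh i) (Sym (@emp R (V n) _ (ty sf.2 sf.1 k))) j - pr j| <= et1]]%SET|%:R
    <= expR (nn n * (2 * S + d1)) * nI n by near: n.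
  apply: le_trans h; rewrite /Z; under eq_bigr do rewrite -natrX; rewrite -natr_sum ler_nat -[leqRHS]sum1_card.
  rewrite [leqRHS](partition_big fst (fun s => s \in I [::])) /=; last first.
    by move=> sf /setIdP[fs _]; rewrite I_nil.
  apply: leq_sum => s sI; rewrite sum1_card -mulnn -cardsX.
  pose G (fg : {ffun V n -> M} * {ffun V n -> M}) : {perm D n} * {ffun V n -> (M * M)%type} :=
    (s, [ffun v => (fg.1 v, fg.2 v)]).
  have Ginj : injective G.
    by move=> [f g] [f' g'] [/ffunP e]; congr pair; apply/ffunP => v; move: (e v); rewrite !ffunE => -[].
  rewrite -(card_imset _ Ginj).
  apply: card_incl => _ /imsetP[[f g] /setXP[hf hg] ->]; rewrite unfold_in /= eqxx andbT.
  apply/setIdP; split; first exact: I_sub sI.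
  apply/forallP => i; apply/forallP => j /=.
  have -> : push (hh i) (Sym (emp (ty [ffun v => (f v, g v)] s k))) j = Sym (emp (ty (if i then f else g) s k)) j :> R.
    case: i => /=; rewrite (Sym_push _ (fun l i x => mapB_sw _ l i x)); apply: eq_Sym => u; apply: eq_bigr => x _;
      rewrite push_emp; congr (_%:R / _); apply: eq_card => v; rewrite !inS /= mapB_typ//;
      by congr (typ _ _ _ _ _ _ == _); apply/funext => w; rewrite /= ffunE.
  have hfg : (if i then f else g) \in typical et s by case: i.
  apply: le_trans (typical_tr hfg j) _; rewrite mulrC -ler_pdivlMr//.
have nI0 : 0 < nI n by rewrite ltr0n; exact: I_gt0.
(* Half of the lower bound for the mean of [Z], as [second_moment] requires. *)
pose c0 : R := expR (nn n * (S - d1)) / 2.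
have b0 : 0 < expR (nn n * (2 * S + d1)) * nI n by rewrite mulr_gt0 ?expR_gt0.
have := @second_moment R _ (I (D := D n) [::]) Z (expR (nn n * (S - d1)) * nI n) _ c0 _ _ b0 _ hlow hup.
move=> /(_ (fun s => ler0n _ _)) /(_ _)/wrap[]; first by rewrite divr_ge0// expR_ge0.
move=> /(_ _)/wrap[]; first by rewrite /c0; lra.
move=> hA.
have e4 : expR (- (d1 * nn n)) <= 4^-1 by near: n; apply: near_exp; rewrite ?invr_gt0.
have N0 : 0 <= nn n by [].
have dN : delta * nn n = 8 * (d1 * nn n) by rewrite /d1; lra.
have dN0 : 0 <= d1 * nn n by rewrite mulr_ge0// ltW.
apply: le_trans (_ : #|[set s in I (D := D n) [::] | c0 <= Z s]%SET|%:R <= _); last first.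
  rewrite ler_nat; apply: card_incl => s /setIdP[sI hs]; apply/setIdP; split=> //.
  apply: le_trans hs; rewrite /c0.
  apply: le_trans (_ : expR (nn n * (S - d1)) * expR (- (d1 * nn n)) <= _).
    rewrite -expRD ler_expR; move: dN dN0; rewrite !mulrBr (mulrC _ d1) (mulrC _ delta); lra.
  by rewrite ler_wpM2l ?expR_ge0//; apply: le_trans e4 _; lra.
rewrite -(ler_pM2r b0); apply: le_trans hA.
rewrite [leRHS](_ : _ = (expR (nn n * (S - d1)) ^+ 2 / 4) * (nI n * nI n)); last first.
  by rewrite !expr2; set x := expR _; set y := nI n; lra.
rewrite mulrACA -expRD ler_wpM2r ?mulr_ge0// -expRM_natl.
apply: le_trans (_ : expR (2 * (nn n * (S - d1))) * expR (- (d1 * nn n)) <= _).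
  rewrite -expRD ler_expR; move: dN dN0; rewrite !mulrBr mulrDr (mulrC _ d1); lra.
by rewrite ler_wpM2l ?expR_ge0.
Unshelve. all: end_near. Qed.

(** [many_typical] yields a set [A], of proportion at least exp (-d1 n), of pairings with many
    colorings that are typical for a smaller tolerance. A pairing at distance less than 2 b1 #|D|
    from [A] inherits these colorings at tolerance [et], and by [blowup] the remaining pairings are
    rare. The rate d1 is taken small enough for [blowup]. *)
Lemma lower_rare (delta et : R) : 0 < delta -> 0 < et ->
  rare (fun n s => #|typical et s|%:R < expR (nn n * (S - delta))).
Proof.
move=> d0 et0; pose W : R := (wt Dl tau)%:R; have W0 : 0 < W by rewrite ltr0n wt_gt0.
(* For b1 <= et/Q, moving to such a nearby pairing changes the symmetrized law by at most 2 cK W b1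
   (Dl + 1) <= et/2. *)
pose Q : R := 4 * cK * W * Dl.+1%:R; have Q0 : 0 < Q by rewrite !mulr_gt0.
pose b1 : R := Num.min 1 (et / Q); have b10 : 0 < b1 by rewrite lt_min ltr01 divr_gt0.
pose g := b1 ^+ 2 / 128; have g0 : 0 < g by rewrite divr_gt0// exprn_gt0.
pose d1 := Num.min delta (g * (md / 2)).
have gm : 0 < g * (md / 2) by rewrite mulr_gt0// divr_gt0.
have d10 : 0 < d1 by rewrite lt_min d0.
have [et1 et10 hmany] := many_typical d10.
pose et2 := Num.min (et / 2) et1; have et20 : 0 < et2 by rewrite lt_min divr_gt0.
have {}hmany : \forall n \near F, expR (- (d1 * nn n)) * nI n <=
    #|[set s in I (D := D n) [::] | expR (nn n * (S - d1)) <= #|typical et2 s|%:R]%SET|%:R.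
  by apply: hmany => //; rewrite ge_min lexx orbT.
exists (g * (md / 2)) => //; near=> n.
have V0 : (0 < #|V n|)%N by near: n; exact: nearV.
have V0R : 0 < nn n by rewrite ltr0n.
have mdn : md / 2 * nn n <= #|D n|%:R by near: n; exact: near_md.
have hA : expR (- (d1 * nn n)) * nI n <= #|[set s in I (D := D n) [::] | expR (nn n * (S - d1)) <= #|typical et2 s|%:R]%SET|%:R by near: n.
set A := [set s in I _ | _]%SET in hA.
have nI0 : 0 < nI n by rewrite ltr0n; exact: I_gt0.
have A0 : (0 < #|A|)%N by rewrite -(ltr0n R); apply: lt_le_trans hA; rewrite mulr_gt0 ?expR_gt0.
have AI : A \subset I [::] by apply/fintype.subsetP => s /setIdP[].
have b11 : b1 <= 1 by rewrite ge_min lexx.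
have hexp : g * (md / 2) * nn n <= g * #|D n|%:R by rewrite -mulrA ler_pM2l.
have := blowup b10 b11 A0 AI; rewrite -/g mulNr => /(_ _)/wrap[].
  apply: le_trans hA; rewrite ler_wpM2r// ler_expR lerN2; apply: le_trans hexp.
  by rewrite ler_wpM2r// ge_min lexx orbT.
move=> h; apply: le_trans (_ : expR (- (g * #|D n|%:R)) * nI n <= _); last first.
  by rewrite ler_wpM2r// ler_expR lerN2.
apply: le_trans h; rewrite ler_nat; apply: card_incl => s /setIdP[sI hs].
apply/setIdP; split=> //; apply/forall_inP => t /setIdP[tI ht]; rewrite leNgt; apply/negP => hst.
move: hs; rewrite ltNge => /negP; apply.
apply: le_trans (_ : expR (nn n * (S - d1)) <= _).
  by rewrite ler_expR ler_wpM2l// lerD2l lerN2 ge_min lexx.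
apply: le_trans ht _; rewrite ler_nat; apply: card_incl => f.
rewrite !inS => /forallP hf; apply/forallP => a.
rewrite -(subrKA (Sym (emp (ty f t tau)) a)) [leRHS](splitr et); apply: le_trans (ler_normD _ _) _.
apply: lerD; last by apply: le_trans (hf a) _; rewrite ge_min lexx.
apply: le_trans (Sym_dist _ _ _) _.
apply: le_trans (_ : \sum_(a : K) (W * (2 * b1 * (Dl.+1%:R * nn n))) / nn n <= _).
  apply: ler_sum => x _; apply: le_trans (emp_dist _ _ _) _; rewrite ler_wpM2r ?invr_ge0//.
  apply: le_trans (_ : (wt Dl tau * hd s t)%:R <= _); first by rewrite ler_nat typ_lip.
  rewrite natrM ler_wpM2l// ltW//; apply: lt_le_trans hst _.
  apply: ler_wpM2l; first by rewrite mulr_ge0// ltW.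
  rewrite -natrM ler_nat; apply: leq_trans (leD n) _.
  by rewrite leq_mul2r leqnSn orbT.
rewrite sumr_const -[leLHS]mulr_natl -/cK.
rewrite (_ : cK * _ = (Q / 2) * b1 * (nn n / nn n)); last by rewrite /Q; move: (_^-1 : R) => x; lra.
rewrite divff ?gt_eqF// mulr1 mulrAC ler_pM2r ?invr_gt0// mulrC -ler_pdivlMr//.
by rewrite ge_min lexx orbT.
Unshelve. all: end_near. Qed.
End typical.
End sequences.

Lemma onth_mem (T : eqType) (s : seq T) j y : onth s j = Some y -> y \in s.
Proof. by elim: s j => [|a s ih] [|j] //=; rewrite inE; [case=> ->; rewrite eqxx|move/ih ->; rewrite orbT]. Qed.

Lemma onth_lt (T : Type) (s : seq T) j y : onth s j = Some y -> (j < size s)%N.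
Proof. by move=> h; rewrite -onthTE h. Qed.

Lemma onth_Some (T : Type) (s : seq T) j : (j < size s)%N -> exists y, onth s j = Some y.
Proof. by rewrite -onthTE; case: (onth s j) => // y _; exists y. Qed.

Lemma mem_onth (T : eqType) (s : seq T) y : y \in s -> exists j, onth s j = Some y.
Proof.
elim: s => //= a s ih; rewrite inE => /orP[/eqP->|/ih[j hj]]; first by exists 0%N.
by exists j.+1.
Qed.

Lemma onth_map (T T' : Type) (f : T -> T') (s : seq T) j : onth (map f s) j = omap f (onth s j).
Proof. by elim: s j => [|a s ih] [|j] //=. Qed.

Lemma uniq_flatten_onth (T : eqType) (ss : seq (seq T)) i j s1 s2 z : uniq (flatten ss) ->
  onth ss i = Some s1 -> onth ss j = Some s2 -> z \in s1 -> z \in s2 -> i = j.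
Proof.
elim: ss i j => [|s ss ih] [|i] [|j] //=; rewrite cat_uniq => /and3P[u1 /hasPn h u2].
- move=> [<-] hj z1 z2; have : z \in flatten ss by apply/flattenP; exists s2; rewrite ?(onth_mem hj).
  by move/h; rewrite z1.
- move=> hi [<-] z1 z2; have : z \in flatten ss by apply/flattenP; exists s1; rewrite ?(onth_mem hi).
  by move/h; rewrite z2.
- by move=> hi hj z1 z2; rewrite (ih i j).
Qed.

(** * Breadth-first labelings *)

Section walks.
Context {W : eqType} (nx : W -> seq W).

(* The vertex reached from [w] along the label [l] in the unfolding by [nx] *)
Fixpoint walk (w : W) (l : label) : option W :=
  if l is j :: l' then obind (fun w' => walk w' l') (onth (nx w) j) else Some w.

Lemma walk_rcons w l j : walk w (rcons l j) = obind (fun w' => onth (nx w') j) (walk w l).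
Proof. by elim: l w => [|i l ih] w /=; case: (onth _ _) => //= w'; rewrite ih. Qed.

Lemma walk_flat (T : eqType) (c : W -> T) k w l a : (size l <= k)%N -> walk w l = Some a ->
  c a \in flat nx c k w.
Proof.
elim: k w l => [|k ih] w [|j l] //= sl; rewrite ?inE; [by case=> ->; rewrite eqxx..|].
case e : (onth (nx w) j) => [w'|//] /= h; apply/orP; right; apply/flatten_mapP.
by exists w'; [exact: onth_mem e|exact: ih h].
Qed.

(** In a tree a vertex is reached along a single label: two walks to it that separate would produce
    a repetition in [flat]. *)
Lemma walk_inj (T : eqType) (c : W -> T) k w l l' a b : uniq (flat nx c k w) ->
  (size l <= k)%N -> (size l' <= k)%N -> walk w l = Some a -> walk w l' = Some b -> c a = c b -> l = l'.
Proof.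
elim: k w l l' => [|k ih] w [|j l] [|j' l'] //= /andP[wn uf] sl sl'.
- move=> [<-]; case e : (onth (nx w) j') => [w'|//] /= h eab; case/negP: wn; rewrite eab.
  by apply/flatten_mapP; exists w'; [exact: onth_mem e|exact: walk_flat h].
- case e : (onth (nx w) j) => [w'|//] /= h [<-] eab; case/negP: wn; rewrite -eab.
  by apply/flatten_mapP; exists w'; [exact: onth_mem e|exact: walk_flat h].
- case e : (onth (nx w) j) => [w1|//] /= h; case e' : (onth (nx w) j') => [w2|//] /= h' eab.
  have jj : j = j'.
    apply: (uniq_flatten_onth (z := c a) (s1 := flat nx c k w1) (s2 := flat nx c k w2) uf).
    + by rewrite onth_map e.
    + by rewrite onth_map e'.
    + exact: walk_flat h.
    + by rewrite eab; exact: walk_flat h'.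
  subst j'; move: e'; rewrite e => -[?]; subst w2; congr (_ :: _); apply: (ih w1) => //.
  move: uf; elim: (nx w) j e => [|x s ihs] [|j] //=; rewrite cat_uniq => + /and3P[h1 h2 h3].
    by case=> <-.
  by move=> /ihs; apply.
Qed.
End walks.

Lemma perm_flat (W W' T : eqType) (nx : W -> seq W) (nx' : W' -> seq W') (c : W -> T) (c' : W' -> T)
    (h : W' -> W) k x :
  (forall x, perm_eq (nx (h x)) (map h (nx' x))) -> (forall x, c (h x) = c' x) ->
  perm_eq (flat nx c k (h x)) (flat nx' c' k x).
Proof.
move=> hp hc; elim: k x => [|k ih] x /=; first by rewrite hc.
rewrite hc perm_cons; apply: perm_trans (_ : perm_eq (flatten (map (flat nx c k) (map h (nx' x)))) _).
  exact/perm_flatten/perm_map/hp.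
elim: (nx' x) => //= y s ihs; exact: perm_cat.
Qed.

(** States correspond through [h], with successors in a possibly different order, so that the
    unfoldings differ by a reordering of siblings at each vertex. *)
Lemma canon_unf (M : finType) Dl (W W' : eqType) (nx : W -> seq W) (nx' : W' -> seq W') (c : W -> M) (c' : W' -> M)
    (h : W' -> W) k x :
  (forall w, size (nx w) <= Dl)%N -> (forall w, size (nx' w) <= Dl)%N ->
  (forall x, perm_eq (nx (h x)) (map h (nx' x))) -> (forall x, c (h x) = c' x) ->
  canon (unf nx c k (h x) : B M Dl k) = canon (unf nx' c' k x).
Proof.
move=> hD hD' hp hc; elim: k x => [|k ih] x; first by rewrite /unf hc.
apply/canonP; split; first exact: hc.
rewrite !kids_unf// -!map_comp.
apply: perm_trans (perm_map _ (hp x)) _; rewrite -map_comp.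
by rewrite (eq_map (g := @canon _ _ k \o unf nx' c' k)) => // y /=.
Qed.

Section search.
Context {T : eqType} {M : Type} (g : cgraph T M) (s : seq T).
Hypotheses (us : uniq s) (gs : forall x y, adj g x y -> y \in s).

(* Walks remember the vertex they come from, to exclude backtracking. *)
Definition nbr (w : option T * T) : seq (option T * T) :=
  [seq (Some w.2, y) | y <- [seq y <- s | adj g w.2 y & Some y != w.1]].

Lemma nbrP w p y : (p, y) \in nbr w <-> [/\ p = Some w.2, adj g w.2 y & Some y != w.1].
Proof.
split=> [/mapP[z]|[-> a1 a2]].
  by rewrite mem_filter => /andP[/andP[a1 a2] _] [-> ->].
by apply/mapP; exists y => //; rewrite mem_filter a1 a2 (gs a1).
Qed.

Variables (v : T) (vs : v \in s) (t : nat).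
Local Notation wk := (walk nbr (None, v)).
Hypothesis TL : uniq (flat nbr snd t.+1 (None, v)).

Let wk_inj l l' p p' x : (size l <= t.+1)%N -> (size l' <= t.+1)%N ->
  wk l = Some (p, x) -> wk l' = Some (p', x) -> l = l'.
Proof. by move=> sl sl' h h'; exact: (walk_inj TL sl sl' h h'). Qed.

Let wk_pre l p x : wk l = Some (p, x) -> p = None /\ l = [::] \/
  exists l' j q y, [/\ l = rcons l' j, p = Some y, wk l' = Some (q, y) & adj g y x].
Proof.
case/lastP: l => [[-> _]|l j]; first by left.
rewrite walk_rcons; case e : (wk l) => [[q y]|//] /= h; right.
have /nbrP[/= -> yx _] := onth_mem h.
by exists l, j, q, y.
Qed.

Let BI don queue : Prop :=
  let d := don ++ queue in
  [/\ uniq (map fst d) /\ uniq (map snd d),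
      {subset map snd d <= s},
      forall l x, (l, x) \in d -> (size l <= t)%N -> exists p, wk l = Some (p, x),
      (forall l x, (l, x) \in don -> (size l < t)%N -> forall j w, wk (rcons l j) = Some w -> (rcons l j, w.2) \in d) /\
      (forall l x j, (rcons l j, x) \in d -> exists y, (l, y) \in don) &
      ([::], v) \in d /\ (forall z lx q, queue = lx :: q -> z \in d -> size z.1 <= (size lx.1).+1)%N /\
      pairwise (fun z z' : label * T => size z.1 <= size z'.1)%N d].

Let BI_step don lx q : BI don (lx :: q) ->
  BI (rcons don lx) (q ++ labeled_offspring g s (map snd (don ++ lx :: q)) lx).
Proof.
case: lx => li xi; set d := don ++ _; set new := labeled_offspring _ _ _ _.
have d'E : rcons don (li, xi) ++ q ++ new = d ++ new by rewrite cat_rcons /d -catA.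
rewrite /BI d'E -/d; case=> -[d1 d1'] d2 d3 [d4 d4'] [d5 [d6 d7]].
set ys := offspring g s (map snd d) xi.
have newE : new = zip [seq rcons li j | j <- iota 0 (size ys)] ys by [].
have new1 : map fst new = [seq rcons li j | j <- iota 0 (size ys)].
  by rewrite newE -/unzip1 unzip1_zip// size_map size_iota.
have new2 : map snd new = ys.
  by rewrite newE -/unzip2 unzip2_zip// size_map size_iota.
have newP l x : (l, x) \in new -> exists j, l = rcons li j /\ onth ys j = Some x.
  rewrite newE => /(nthP ([::], xi))[j]; rewrite size_zip size_map size_iota minnn => jy.
  rewrite nth_zip ?size_map ?size_iota// => -[<- <-]; exists j.
  rewrite (nth_map 0%N) ?size_iota// nth_iota//; split=> //.
  by have [y hy] := onth_Some jy; rewrite hy (@onth_nth _ xi _ _ _ hy).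
have newI j x : onth ys j = Some x -> (rcons li j, x) \in new.
  move=> h; have jy := onth_lt h; rewrite newE; apply/(nthP ([::], xi)); exists j.
    by rewrite size_zip size_map size_iota minnn.
  rewrite nth_zip ?size_map ?size_iota//; congr pair; last exact: (@onth_nth _ xi _ _ _ h).
  by rewrite (nth_map 0%N) ?size_iota// nth_iota.
have lid : (li, xi) \in d by rewrite mem_cat mem_head orbT.
have lin x : (li, x) \notin don.
  apply/negP => h; move: d1; rewrite /d map_cat cat_uniq => /and3P[_ /hasPn/(_ li) + _].
  by rewrite /= inE eqxx => /(_ isT)/negP; apply; exact: (map_f fst h).
(* The search excludes all vertices already seen, the walk only the previous one. In a tree this is
   the same: a seen neighbor other than the parent would carry the label of an offspring of [li],
   although [li] is not treated yet. *)
have ysE : (size li < t)%N -> exists p, wk li = Some (p, xi) /\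
    ys = [seq y <- s | adj g xi y & Some y != p].
  move=> lt; have [p hp] := d3 _ _ lid (ltnW lt); exists p; split=> //.
  rewrite /ys /offspring undup_id ?filter_uniq//; apply: eq_in_filter => y ys'.
  case xy : (adj g xi y) => //=; congr negb; apply/idP/eqP.
    case/mapP => -[l' y'] l'd /= ey; subst y'; apply: contrapT => py.
    have sl' : (size l' <= t)%N.
      by apply: leq_trans lt; exact: (d6 (l', y) (li, xi) q).
    have [p' hp'] := d3 _ _ l'd sl'.
    have : (Some xi, y) \in nbr (p, xi) by apply/nbrP; split=> //; exact/eqP.
    move=> /mem_onth[j hj]; have hc : wk (rcons li j) = Some (Some xi, y) by rewrite walk_rcons hp.
    have e : l' = rcons li j.
      by apply: wk_inj hp' hc; [exact: leqW|rewrite size_rcons ltnS ltnW].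
    by move: l'd; rewrite e => /d4'[y' hy']; move: (lin y'); rewrite hy'.
  move=> ep; case: (wk_pre hp) => [[pN _]|[l' [j [q' [y' [el py wy _]]]]]]; first by rewrite pN in ep.
  move: py; rewrite -ep => -[ey]; subst y'.
  have := lid; rewrite el => /d4'[y' hy'].
  have hy'd : (l', y') \in d by rewrite mem_cat hy'.
  have [|p' hp'] := d3 _ _ hy'd; first by move: lt; rewrite el size_rcons; clear; lia.
  move: hp'; rewrite wy => -[_ ->]; exact: (map_f snd hy'd).
have snew z : z \in new -> size z.1 = (size li).+1.
  by case: z => l x /newP[j [-> _]]; rewrite size_rcons.
split.
- rewrite (map_cat fst d) (map_cat snd d) (cat_uniq (map fst d)) (cat_uniq (map snd d)) d1 d1' new1 new2 /=; split; apply/andP; split.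
  + apply/hasPn => _ /mapP[j _ ->]; apply/negP => /mapP[[l x] lx /= el]; subst l.
    by move: lx => /d4'[y hy]; move: (lin y); rewrite hy.
  + by rewrite map_inj_uniq ?iota_uniq// => i j /rcons_inj[].
  + apply/hasPn => y; rewrite mem_undup mem_filter => /andP[/andP[_ hy] _] //.
  + by rewrite undup_uniq.
- move=> y; rewrite map_cat mem_cat new2 => /orP[/d2//|].
  by rewrite mem_undup mem_filter => /andP[].
- move=> l x; rewrite mem_cat => /orP[/d3//|/newP[j [-> hj]]]; rewrite size_rcons => lt.
  have [p [hp eys]] := ysE lt; exists (Some xi).
  by rewrite walk_rcons hp /= /nbr onth_map /= -eys hj.
- split=> [l x|l x j].
    rewrite mem_rcons inE => /orP[/eqP[-> _]|lx] lt j w.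
      have [p [hp eys]] := ysE lt.
      rewrite walk_rcons hp /= /nbr onth_map /= -eys; case hj : (onth ys j) => [y|//] [<-] /=.
      by rewrite mem_cat newI ?orbT.
    by move=> /(d4 _ _ lx lt) h; rewrite mem_cat h.
  rewrite mem_cat => /orP[/d4'[y hy]|/newP[j' [/rcons_inj[-> _] _]]].
    by exists y; rewrite mem_rcons inE hy orbT.
  by exists xi; rewrite mem_rcons inE eqxx.
- split; first by rewrite mem_cat d5.
  have dli z : z \in d -> (size z.1 <= (size li).+1)%N by move=> zd; exact: (d6 z (li, xi) q).
  have qli z : z \in q -> (size li <= size z.1)%N.
    move=> zq; move: d7; rewrite /d pairwise_cat /= => /and4P[_ _ /allP h _]; exact: h.
  split.
    move=> z lx q' eq; rewrite mem_cat => hz.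
    have hlx : (size li <= size lx.1)%N.
      have : lx \in q ++ new by rewrite eq mem_head.
      by rewrite mem_cat => /orP[/qli//|/snew ->].
    by case/orP: hz => [/dli|/snew ->]; [move/leq_trans; apply|]; rewrite ltnS.
  rewrite pairwise_cat d7 /=; apply/andP; split.
    by apply/allrelP => z z' /dli h /snew ->.
  elim: new snew {newE new1 new2 newP newI d'E} => //= z l ih h; apply/andP; split.
    by apply/allP => z' z'l; rewrite !h ?mem_head// inE z'l orbT.
  by apply: ih => z' z'l; apply: h; rewrite inE z'l orbT.
Qed.

Let BI_run k don queue : BI don queue -> exists don' queue',
  [/\ bfs_run g s k don queue = don' ++ queue', BI don' queue' &
      queue' = [::] \/ size don' = (k + size don)%N].
Proof.
elim: k don queue => [|k ih] don [|lx q] //= h.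
- by exists don, [::]; split=> //; left.
- by exists don, (lx :: q); split=> //; right.
- by exists don, [::]; split=> //; left.
have [don' [q' [e1 e2 e3]]] := ih _ _ (BI_step h); exists don', q'; split=> //.
by case: e3 => [|->]; [left|right]; rewrite // size_rcons addnS.
Qed.

Lemma lookup_bfs l : (size l <= t)%N -> lookup (bfs_trace g s v) l = omap snd (wk l).
Proof.
have h0 : BI [::] [:: ([::], v)].
  split=> //=.
  - by move=> x; rewrite inE => /eqP ->.
  - by move=> l' x; rewrite inE => /eqP[-> ->] _; exists None.
  - split=> [//|l' x j]; rewrite inE => /eqP[].
    by case: l'.
  - split; first by rewrite mem_head.
    by split=> // z lx q [<- _]; rewrite inE => /eqP -> /=.
have [don [q [e [[d1 d1'] d2 d3 [d4 d4'] [d5 _]] hq]]] := BI_run (size s).+1 h0.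
(* The fuel suffices: if it ran out, the treated vertices would be more than [size s] distinct
   elements of [s]. *)
have q0 : q = [::].
  case: hq => // e'; exfalso.
  have : (size (map snd (don ++ q)) <= size s)%N by exact: uniq_leq_size.
  by rewrite size_map size_cat e' addn0 => /leq_trans/(_ (leqnn _)); rewrite -ltn_subRL subnn; clear; lia.
move: d1 d1' d2 d3 d4 d4' d5; rewrite /bfs_trace e q0 cats0 => d1 d1' d2 d3 d4 d4' d5.
have lk x l' : (l', x) \in don -> lookup don l' = Some x.
  move: d1; rewrite /lookup; elim: (don) => [//|[l1 x1] d ih] /= /andP[n1 ud].
  rewrite inE => /orP[/eqP[-> ->]|h]; first by rewrite eqxx.
  by case: (l1 =P l') => [el|_]; [case/negP: n1; rewrite el (map_f fst h)|exact: ih].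
have lk' x l' : lookup don l' = Some x -> (l', x) \in don.
  rewrite /lookup; elim: (don) => [//|[l1 x1] d ih] /=.
  case: (l1 =P l') => [-> [->]|_ /ih h]; by rewrite inE ?eqxx ?h ?orbT.
move=> sl; case el : (lookup don l) => [x|].
  by have [p ->] := d3 _ _ (lk' _ _ el) sl.
suff : forall w, wk l = Some w -> (l, w.2) \in don.
  by case: (wk l) => [w|//] /(_ w erefl)/lk; rewrite el.
elim/last_ind: l sl {el} => [|l j ih] sl w; first by case=> <-.
move=> hw; move: (hw); rewrite walk_rcons; case hl : (wk l) => [w'|//] _.
rewrite size_rcons in sl.
by apply: d4 hw => //; apply: ih; [exact: ltnW|exact: hl].
Qed.

Lemma col_bfs l : (size l <= t)%N ->
  pull_col g (bfs_trace g s v) l = obind (fun w => Defs.col g w.2) (wk l).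
Proof. by move=> sl; rewrite /pull_col lookup_bfs//; case: (wk l). Qed.

(** The hypothesis [TL] goes one level beyond [t]: an extra edge between two vertices at depth [t]
    would show up as a repetition at depth t + 1. *)
Lemma adj_bfs l l' : (size l <= t)%N -> (size l' <= t)%N ->
  pull_adj g (bfs_trace g s v) l l' = [&& wk l != None, wk l' != None & child l l' || child l' l].
Proof.
move=> sl sl'; rewrite /pull_adj !lookup_bfs//.
case hl : (wk l) => [[p x]|] //; case hl' : (wk l') => [[p' y]|] //=.
have one a b pa pb xa xb : (size a <= t)%N -> (size b <= t.+1)%N -> wk a = Some (pa, xa) -> wk b = Some (pb, xb) ->
    adj g xa xb -> child a b || child b a.
  move=> sa sb ha hb ab; case: (Some xb =P pa) => [ep|np].
    case: (wk_pre ha) => [[pN _]|[a' [j [q [z [ea pz wz _]]]]]]; first by rewrite pN in ep.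
    move: pz; rewrite -ep => -[ez]; subst z.
    have sa' : (size a' <= t.+1)%N by move: sa; rewrite ea size_rcons; clear; lia.
    rewrite -(wk_inj sa' _ wz hb); last exact: sb.
    by apply/orP; right; rewrite ea /child parent_rcons eqxx andbT; case: (a').
  have : (Some xa, xb) \in nbr (pa, xa) by apply/nbrP; split=> //; exact/eqP.
  move=> /mem_onth[j hj]; have hc : wk (rcons a j) = Some (Some xa, xb) by rewrite walk_rcons ha.
  rewrite -(wk_inj _ _ hc hb); [|by rewrite size_rcons ltnS|exact: sb].
  by apply/orP; left; rewrite /child parent_rcons eqxx andbT; case: (a).
have two a b pa pb xa xb : wk a = Some (pa, xa) -> wk b = Some (pb, xb) -> child a b -> adj g xa xb.
  move=> ha hb /andP[bn /eqP eb]; move: hb bn eb; case/lastP: b => // b j hb _; rewrite parent_rcons => eb.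
  by move: hb; rewrite eb walk_rcons ha /= => /onth_mem/nbrP[].
apply/idP/orP => [h|[h|h]]; first by apply/orP; by apply: (one l l' p p' x y) => //; exact: leqW.
  exact: two hl hl' h.
by rewrite adj_sym; exact: two hl' hl h.
Qed.
End search.

(** * Finite trees as labeled graphs *)

Section tree_graphs.
Context {R : realType} {M : pFinType} {Dl : nat}.
Local Notation B := (B M Dl).

Fixpoint colB k : B k -> label -> option M :=
  match k with
  | 0 => fun x l => if l is [::] then Some x else None
  | k'.+1 => fun x l => if l is j :: l' then obind (fun y => @colB k' y l') (onth (kids x) j) else Some x.1
  end.

Lemma colBS k (x : B k.+1) j l : colB x (j :: l) = obind (fun y => colB y l) (onth (kids x) j).
Proof. by []. Qed.

Lemma colB0 k (x : B k) : colB x [::] = Some (root x). Proof. by case: k x. Qed.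

Lemma colB_size k (x : B k) l : colB x l -> (size l <= k)%N.
Proof.
elim: k x l => [|k ih] x [|j l] //; rewrite colBS.
by case: (onth _ _) => [y|//] /= /ih.
Qed.

Lemma colB_rcons k (x : B k) l j : colB x (rcons l j) ->
  [/\ colB x l, (j < Dl)%N & forall i, (i < j)%N -> colB x (rcons l i)].
Proof.
elim: k x l => [|k ih] x [|a l]; rewrite ?rcons_cons //.
  rewrite /= -/(colB x [:: j]) colBS; case e : (onth _ _) => [y|//] _; have lj := onth_lt e.
  split=> //; first exact: leq_trans lj (size_kids x).
  move=> i ij; have [z hz] := onth_Some (ltn_trans ij lj).
  by rewrite /= -/(colB x [:: i]) colBS hz /= colB0.
rewrite !colBS; case e : (onth _ _) => [y|//] /= /ih[h1 h2 h3]; split=> // i ij.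
by rewrite e /=; exact: h3.
Qed.

Definition adjB k (x : B k) (u v : label) : bool := [&& colB x u, colB x v & child u v || child v u].

Fact adjB_sym k (x : B k) : symmetric (adjB x).
Proof. by move=> u v; rewrite /adjB andbCA orbC. Qed.

Lemma childxx u : child u u = false.
Proof.
apply/negP => /andP[]; case/lastP: u => // u j _; rewrite parent_rcons => /eqP/(congr1 size).
by rewrite size_rcons => /n_Sn.
Qed.

Fact adjB_irr k (x : B k) : irreflexive (adjB x).
Proof. by move=> u; rewrite /adjB childxx !andbF. Qed.

Fact adjB_col k (x : B k) u v : adjB x u v -> colB x u.
Proof. by case/and3P. Qed.

Definition clg k (x : B k) : cgraph label M := CGraph (adjB_sym x) (adjB_irr x) (@adjB_col k x).

Lemma child_rcons u v j : child u (rcons v j) = (v == u).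
Proof. by rewrite /child parent_rcons; case: v. Qed.

Fact clg_bfs k (x : B k) : bfs_labeled (clg x).
Proof.
split.
- by rewrite /verts /= colB0.
- move=> v j; rewrite /verts /= => vj; have [h1 h2 h3] := colB_rcons vj; split=> //.
  by rewrite /adjB h1 vj child_rcons eqxx.
- move=> v j u /and3P[_ _]; rewrite child_rcons => /orP[/eqP ->|/andP[]].
    by rewrite /shortlex eqxx lexx orbT.
  case/lastP: u => // u i _; rewrite parent_rcons => /eqP ->.
  by rewrite /shortlex !size_rcons ltnS leqnSn.
- move=> v; apply: (@sub_finite_set _ _ [set` parent v :: [seq rcons v j | j <- iota 0 Dl]]); last exact: finite_seq.
  move=> u /= /and3P[_ xu]; rewrite inE => /orP[|/andP[_ /eqP ->]]; last by rewrite eqxx.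
  move: xu; case/lastP: u => // u j /colB_rcons[_ jD _]; rewrite child_rcons => /eqP ->.
  by rewrite map_f ?orbT// mem_iota.
Qed.

(** The embedding through which laws on [B] and laws on [lgraph] are compared. It is injective, and
    its truncations are restrictions to balls ([lg_inj], [restr_lg]). *)
Definition lg k (x : B k) : lgraph R M := RGraph R (clg_bfs x).

Lemma colB_inj k (x y : B k) : colB x =1 colB y -> x = y.
Proof.
elim: k x y => [|k ih] x y h; first by have := h [::] => -[].
apply: B_eq; first by have := h [::] => -[].
apply: eq_from_onth => j.
have hj l : obind (fun y => colB y l) (onth (kids x) j) = obind (fun y => colB y l) (onth (kids y) j).
  exact: (h (j :: l)).
case: (onth (kids x) j) (onth (kids y) j) hj => [a|] [b|] hj //.
- by congr Some; apply: ih => l; exact: hj.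
- by have := hj [::]; rewrite /= colB0.
- by have := hj [::]; rewrite /= colB0.
Qed.

Lemma lg_inj k : injective (@lg k).
Proof. by move=> x y /(congr1 (fun g : lgraph R M => Defs.col g)) /= h; apply: colB_inj => l; rewrite h. Qed.

Lemma colB_tr k (x : B k.+1) l : colB (tr x) l = if (size l <= k)%N then colB x l else None.
Proof.
elim: k x l => [|k ih] x [|j l] //; rewrite colBS kids_tr onth_map colBS.
by case: (onth _ _) => [y|] /=; rewrite ?ih ?ltnS//; case: ifP.
Qed.

Lemma restr_eq k (g : lgraph R M) (x : B k) :
  (forall l, (size l <= k)%N -> Defs.col g l = colB x l) ->
  (forall u v, (size u <= k)%N -> (size v <= k)%N -> adj g u v = adjB x u v) ->
  restr k g = lg x.
Proof.
move=> hc ha; apply/lgraph_eq/cgraph_eq => [l|u v].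
  rewrite restr_col /=; case: ifPn => [/hc//|h]; case e : (colB x l) => [a|//].
  by case/negP: h; apply: (@colB_size _ x); rewrite e.
rewrite restr_adj; case: (leqP (size u) k) => su; case: (leqP (size v) k) => sv; rewrite ?andbF ?andbT; first exact: ha.
- by apply/esym/negP => /and3P[_ /colB_size]; rewrite leqNgt sv.
- by apply/esym/negP => /and3P[/colB_size]; rewrite leqNgt su.
- by apply/esym/negP => /and3P[/colB_size]; rewrite leqNgt su.
Qed.

Lemma restr_lg k (x : B k.+1) : restr k (lg x) = lg (tr x).
Proof.
by apply: restr_eq => [l sl|u v su sv] /=; rewrite /adjB !colB_tr ?sl ?su ?sv.
Qed.

Lemma restr_lg_id k (x : B k) : restr k (lg x) = lg x.
Proof. exact: restr_eq. Qed.

Lemma colB_unf (W : eqType) (nx : W -> seq W) (c : W -> M) k w l :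
  (forall w, size (nx w) <= Dl)%N ->
  colB (unf nx c k w : B k) l = if (size l <= k)%N then omap c (walk nx w l) else None.
Proof.
move=> h; elim: k w l => [|k ih] w [|j l] //; rewrite colBS kids_unf// onth_map /=.
by case: (onth _ _) => [y|] /=; rewrite ?ih ?ltnS//; case: ifP.
Qed.

Section search.
Context {T : eqType} (g : cgraph T M) (s : seq T) (cc : T -> M).
Hypotheses (us : uniq s) (gs : forall x y, adj g x y -> y \in s)
  (hcc : forall x, x \in s -> Defs.col g x = Some (cc x))
  (hD : forall x, (size [seq y <- s | adj g x y] <= Dl)%N).

Lemma size_nbr w : (size (nbr g s w) <= Dl)%N.
Proof.
rewrite size_map; apply: leq_trans (hD w.2); rewrite !size_filter.
by apply: sub_count => y /andP[].
Qed.

Lemma walk_in v l w : v \in s -> walk (nbr g s) (None, v) l = Some w -> w.2 \in s.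
Proof.
move=> vs; case/lastP: l => [[<-]//|l j]; rewrite walk_rcons; case: (walk _ _ _) => [w'|//] /= /onth_mem.
by case: w => p y /(nbrP gs)[_ /gs].
Qed.

Definition btree k v : B k := unf (nbr g s) (fun w => cc w.2) k (None, v).

Lemma restr_bfs t v (gv : verts g v) : v \in s -> uniq (flat (nbr g s) snd t.+1 (None, v)) ->
  restr t (bfs R s gv) = lg (btree t v).
Proof.
move=> vs TL; apply: restr_eq => [l sl|u w su sw] /=.
  rewrite (col_bfs us gs vs TL)// colB_unf; last exact: size_nbr.
  rewrite sl; case e : (walk _ _ _) => [w|//] /=; exact/hcc/(walk_in vs e).
rewrite (adj_bfs us gs vs TL)// /adjB !colB_unf ?su ?sw; try exact: size_nbr.
by case: (walk _ _ u) => [?|]; case: (walk _ _ w) => [?|].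
Qed.
End search.
End tree_graphs.

Section recolor_tree_graphs.
Context {R : realType} {M M' : pFinType} (h : M -> M') {Dl : nat}.

Lemma colB_mapB k (x : B M Dl k) l : colB (mapB h x) l = omap h (colB x l).
Proof.
elim: k x l => [|k ih] x [|j l] //; rewrite !colBS kids_mapB onth_map.
by case: (onth _ _) => [y|] //=.
Qed.

Lemma recolor_lg k (x : B M Dl k) : recolor h (lg x) = lg (mapB h x) :> lgraph R M'.
Proof.
apply/lgraph_eq/cgraph_eq => [l|u v] /=; first by rewrite colB_mapB.
by rewrite /adjB !colB_mapB; case: (colB x u); case: (colB x v).
Qed.
End recolor_tree_graphs.

Lemma onth_split (T : Type) (s : seq T) j y : onth s j = Some y ->
  exists s1 s2, s = s1 ++ y :: s2 /\ size s1 = j.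
Proof.
elim: s j => [|a s ih] [|j] //=; first by case=> <-; exists [::], s.
by move=> /ih[s1 [s2 [-> <-]]]; exists (a :: s1), s2.
Qed.

Lemma upd_default (T : eqType) j f (s : seq T) : (size s <= j)%N -> upd j f s = s.
Proof. by elim: s j => [|a s ih] [|j] //= h; rewrite ih. Qed.

Lemma swl_default (T : eqType) i (s : seq T) : (size s <= i.+1)%N -> swl i s = s.
Proof. by elim: i s => [|i ih] [|a [|b s]] //= h; rewrite ih. Qed.

Lemma uniq_flatten_in (T T' : eqType) (f : T -> seq T') (s : seq T) x :
  uniq (flatten (map f s)) -> x \in s -> uniq (f x).
Proof.
elim: s => //= a s ih; rewrite cat_uniq inE => /and3P[u1 _ u2] /orP[/eqP->//|].
exact: ih.
Qed.

(** * Uniform search orders produce uniform orders of siblings *)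

Section exchange.
Context {T : eqType}.
Variables a b : T.

Definition sw2 (x : T) : T := if x == a then b else if x == b then a else x.

Lemma sw2K : involutive sw2.
Proof.
move=> x; rewrite /sw2; case: (x =P a) => [->|xa]; first by case: (b =P a) => [->|]; rewrite ?eqxx.
case: (x =P b) => [->|xb]; first by rewrite eqxx.
by case: eqP => // ; case: eqP.
Qed.

Lemma filter_sw2_no (P : pred T) s : ~~ P a -> ~~ P b -> seq.filter P (map sw2 s) = seq.filter P s.
Proof.
move=> /negbTE na /negbTE nb; elim: s => //= x s ->; rewrite /sw2.
by case: (x =P a) => [->|_]; rewrite ?na ?nb//; case: (x =P b) => [->|_]; rewrite ?na ?nb.
Qed.

Lemma filter_sw2 (P : pred T) s : P a -> P b -> seq.filter P (map sw2 s) = map sw2 (seq.filter P s).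
Proof.
move=> pa pb; have e x : P (sw2 x) = P x.
  by rewrite /sw2; case: (x =P a) => [->|_]; rewrite ?pa ?pb//; case: (x =P b) => [->|_]; rewrite ?pa ?pb.
by elim: s => //= x s ->; rewrite e; case: (P x).
Qed.

Lemma map_sw2_cat s1 s2 : uniq (s1 ++ a :: b :: s2) ->
  map sw2 (s1 ++ a :: b :: s2) = s1 ++ b :: a :: s2.
Proof.
move=> u; have fx (s : seq T) : a \notin s -> b \notin s -> map sw2 s = s.
  move=> na nb; rewrite -[RHS]map_id; apply/eq_in_map => x xs; rewrite /sw2.
  by rewrite ifN ?ifN//; [apply: contraNneq nb => <-|apply: contraNneq na => <-].
move: u; rewrite cat_uniq /= inE !negb_or => /and3P[_ /and3P[a1 b1 _] /and3P[/andP[ab a2] b2 _]].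
rewrite map_cat /= !fx//; congr (_ ++ _).
by rewrite /sw2 eqxx eq_sym (negbTE ab) eqxx.
Qed.
Lemma perm_sw2 s : uniq s -> a \in s -> b \in s -> perm_eq (map sw2 s) s.
Proof.
move=> us as_ bs; apply: uniq_perm; rewrite ?(map_inj_uniq (inv_inj sw2K))//.
have sub x : x \in s -> sw2 x \in s.
  by rewrite /sw2; case: (x =P a) => // _; case: (x =P b).
move=> x; apply/mapP/idP => [[y ys ->]|xs]; first exact: sub.
by exists (sw2 x); rewrite ?sw2K//; exact: sub.
Qed.
End exchange.

Lemma sw2C (T : eqType) (a b x : T) : sw2 a b x = sw2 b a x.
Proof. by rewrite /sw2; case: (x =P a) => [->|]; case: (_ =P b) => // ->. Qed.

Section uniform_labels.
Context {T : eqType} {M : finType} (g : cgraph T M) (Dl : nat) (cc : T -> M).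
Implicit Types (s : seq T) (w : option T * T).

Local Notation nb s := (nbr g s).
Local Notation un s := (unf (nb s) (fun w => cc w.2)).

Let hdx w (x : T) : bool := adj g w.2 x && (Some x != w.1).

Let nbE s w : nb s w = [seq (Some w.2, y) | y <- seq.filter (hdx w) s].
Proof. by []. Qed.

Let D s := forall w, (size (nb s w) <= Dl)%N.

Let nb_no s w a b : (Some w.2, a) \notin nb s w -> (Some w.2, b) \notin nb s w -> a \in s -> b \in s ->
  nb (map (sw2 a b) s) w = nb s w.
Proof.
rewrite !nbE => na nb_ as_ bs; congr map; apply: filter_sw2_no.
  by apply: contra na => h; apply: map_f; rewrite mem_filter h.
by apply: contra nb_ => h; apply: map_f; rewrite mem_filter h.
Qed.

Let unaffected s a b k w : D s -> D (map (sw2 a b) s) -> a \in s -> b \in s ->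
  a \notin behead (flat (nb s) snd k w) -> b \notin behead (flat (nb s) snd k w) ->
  un (map (sw2 a b) s) k w = un s k w :> B M Dl k.
Proof.
move=> Ds Ds' as_ bs; elim: k w => // k ih w /= na nb_.
have root_in (z : T) w' : (Some w.2, z) = w' -> w' \in nb s w -> z \in flatten [seq flat (nb s) snd k i | i <- nb s w].
  by move=> <- h; apply/flatten_mapP; exists (Some w.2, z) => //; case: (k) => [|?] /=; rewrite inE eqxx.
have e : nb (map (sw2 a b) s) w = nb s w.
  apply: nb_no => //; first by apply: contra na => h; exact: root_in h.
  by apply: contra nb_ => h; exact: root_in h.
apply: B_eq => //; rewrite !kids_unf// e; apply/eq_in_map => w' hw'; apply: ih.
  by apply: contra na => /mem_behead h; apply/flatten_mapP; exists w'.
by apply: contra nb_ => /mem_behead h; apply/flatten_mapP; exists w'.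
Qed.

(** Exchanging in the order [s] two consecutive offspring of one vertex exchanges their subtrees
    there and changes nothing else: in the absence of repetitions, neither of them is an offspring
    of another vertex of the unfolding. *)
Let swap_at s a b k w0 w l i l1 l2 : D s -> D (map (sw2 a b) s) -> uniq s ->
  uniq (flat (nb s) snd k w0) -> (size l < k)%N ->
  walk (nb s) w0 l = Some w -> nb s w = l1 ++ (Some w.2, a) :: (Some w.2, b) :: l2 -> size l1 = i ->
  un (map (sw2 a b) s) k w0 = sw l i (un s k w0) :> B M Dl k /\
  walk (nb (map (sw2 a b) s)) w0 l = Some w /\
  nb (map (sw2 a b) s) w = l1 ++ (Some w.2, b) :: (Some w.2, a) :: l2.
Proof.
move=> Ds Ds' us + + + ew <-.
have [y1 [y2 [ey1 ey2 eys]]] : exists y1 y2, [/\ l1 = map (pair (Some w.2)) y1, l2 = map (pair (Some w.2)) y2 &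
    seq.filter (hdx w) s = y1 ++ a :: b :: y2].
  have pinj : injective (pair (Some w.2) : T -> _) by move=> ? ? [].
  exists (take (size l1) (seq.filter (hdx w) s)), (drop (size l1).+2 (seq.filter (hdx w) s)).
  have h1 : map (pair (Some w.2)) (take (size l1) (seq.filter (hdx w) s)) = l1.
    by rewrite map_take -nbE ew take_size_cat.
  have h2 : map (pair (Some w.2)) (drop (size l1).+2 (seq.filter (hdx w) s)) = l2.
    by rewrite map_drop -nbE ew -cat_rcons -cat_rcons drop_size_cat// !size_rcons.
  by split=> //; apply: (inj_map pinj); rewrite -nbE ew map_cat /= h1 h2.
have nw : nb (map (sw2 a b) s) w = l1 ++ (Some w.2, b) :: (Some w.2, a) :: l2.
  have pa : hdx w a by have : a \in seq.filter (hdx w) s; [rewrite eys mem_cat mem_head orbT|rewrite mem_filter => /andP[]].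
  have pb : hdx w b by have : b \in seq.filter (hdx w) s; [rewrite eys mem_cat !inE eqxx !orbT|rewrite mem_filter => /andP[]].
  rewrite nbE [seq.filter _ _](filter_sw2 s pa pb) eys map_sw2_cat; last by rewrite -eys filter_uniq.
  by rewrite map_cat /= ey1 ey2.
have as_ : a \in s by have : a \in seq.filter (hdx w) s; [rewrite eys mem_cat mem_head orbT|rewrite mem_filter => /andP[]].
have bs : b \in s by have : b \in seq.filter (hdx w) s; [rewrite eys mem_cat !inE eqxx !orbT|rewrite mem_filter => /andP[]].
have aw : (Some w.2, a) \in nb s w by rewrite ew mem_cat mem_head orbT.
have bw : (Some w.2, b) \in nb s w by rewrite ew mem_cat !inE eqxx !orbT.
elim: l k w0 => [|j l ih] [|k] w0 //= /andP[w0n uf] sl.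
  case=> ?; subst w0; split; last by split.
  apply: B_eq; first by rewrite sw1.
  rewrite kids_sw !kids_unf// nw ew -map_swl swl_cat; apply/eq_in_map => c hc.
  have hc' : c \in nb s w by move: hc; rewrite ew !mem_cat !inE => /or3P[->|->|/orP[->|->]]; rewrite ?orbT.
  have no z : (Some w.2, z) \in nb s w -> z \notin behead (flat (nb s) snd k c).
    move=> hz; have [jz hjz] := mem_onth hz; have [jc hjc] := mem_onth hc'; apply/negP => zc.
    have ej : jz = jc.
      apply: (uniq_flatten_onth (z := z) (s1 := flat (nb s) snd k (Some w.2, z)) (s2 := flat (nb s) snd k c) uf).
      - by rewrite onth_map hjz.
      - by rewrite onth_map hjc.
      - by case: (k) => [|?] /=; rewrite inE eqxx.
      - exact: mem_behead zc.
    move: hjz; rewrite ej hjc => -[ec]; move: zc; rewrite ec.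
    have := uniq_flatten_in uf hz.
    by case: (k) => [|?] //= /andP[/negbTE ->].
  by apply: unaffected => //; exact: no.
case e : (onth (nb s w0) j) => [c|//] /= hw.
have [c1 [c2 [ec sc1]]] := onth_split e.
have ufc : uniq (flat (nb s) snd k c).
  by move: uf; rewrite ec map_cat flatten_cat /= !cat_uniq => /and3P[_ _ /and3P[]].
have [ih1 [ih2 _]] := ih k c ufc sl hw.
have inc z : (Some w.2, z) \in nb s w -> z \in behead (flat (nb s) snd k c).
  move=> hz; have [jz hjz] := mem_onth hz.
  have hwz : walk (nb s) c (rcons l jz) = Some (Some w.2, z) by rewrite walk_rcons hw.
  have := @walk_flat _ (nb s) _ snd k c (rcons l jz) _ _ hwz; rewrite size_rcons => /(_ sl) /=.
  have nr : z <> c.2.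
    move=> ez; have := @walk_inj _ (nb s) _ snd k c (rcons l jz) [::] _ c ufc _ isT hwz erefl ez.
    by rewrite size_rcons => /(_ sl); case: (l).
  by case: (k) sl => // k' _ /=; rewrite inE => /orP[/eqP/nr|].
have noc z : z \in behead (flat (nb s) snd k c) -> (Some w0.2, z) \notin nb s w0.
  move=> zc; apply/negP => hz; have [jz hjz] := mem_onth hz.
  have ej : jz = j.
    apply: (uniq_flatten_onth (z := z) (s1 := flat (nb s) snd k (Some w0.2, z)) (s2 := flat (nb s) snd k c) uf).
    - by rewrite onth_map hjz.
    - by rewrite onth_map e.
    - by case: (k) => [|?] /=; rewrite inE eqxx.
    - exact: mem_behead zc.
  move: hjz; rewrite ej e => -[ecz]; move: zc ufc; rewrite ecz.
  by case: (k) => [|?] //= zc /andP[]; rewrite zc.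
have e' : nb (map (sw2 a b) s) w0 = nb s w0 by apply: nb_no => //; apply: noc; exact: inc.
split; last by rewrite e' e.
apply: B_eq; first by rewrite sw1.
have sz : size (map (fun w' => un s k w' : B M Dl k) c1) = j by rewrite size_map.
rewrite kids_sw !kids_unf// e' ec !map_cat /= -sz upd_cat ih1.
have [ac bc] : a \in flat (nb s) snd k c /\ b \in flat (nb s) snd k c.
  by split; apply: mem_behead; exact: inc.
move: uf; rewrite ec map_cat flatten_cat /= !cat_uniq => /and3P[_ /hasPn u1 /and3P[_ /hasPn u2 _]].
congr (_ ++ _ :: _); apply/eq_in_map => c' hc'; apply: unaffected => //; apply/negP => /mem_behead h.
- have := u1 a; rewrite mem_cat ac => /(_ isT)/negP; apply; apply/flatten_mapP; by exists c'.
- have := u1 b; rewrite mem_cat bc => /(_ isT)/negP; apply; apply/flatten_mapP; by exists c'.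
- have : a \in flatten [seq flat (nb s) snd k i | i <- c2] by apply/flatten_mapP; exists c'.
  by move/u2; rewrite /= ac.
- have : b \in flatten [seq flat (nb s) snd k i | i <- c2] by apply/flatten_mapP; exists c'.
  by move/u2; rewrite /= bc.
Qed.

Let unswapped s k w0 l i : D s ->
  (walk (nb s) w0 l = None \/ (k <= size l)%N \/
     exists2 w, walk (nb s) w0 l = Some w & (size (nb s w) <= i.+1)%N) ->
  sw l i (un s k w0) = un s k w0 :> B M Dl k.
Proof.
move=> Ds; elim: l k w0 => [|j l ih] [|k] w0 //= h; apply: B_eq; rewrite ?sw1// kids_sw kids_unf//.
  case: h => [//|[//|[w [<-] sw_]]]; rewrite swl_default// size_map//.
have [hj|hj] := leqP (size (nb s w0)) j; first by rewrite upd_default// size_map.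
have [c e] := onth_Some hj; have [c1 [c2 [ec sc1]]] := onth_split e.
have sz : size (map (fun w' => un s k w' : B M Dl k) c1) = j by rewrite size_map.
rewrite ec map_cat /= -{1}sz upd_cat ih//.
by move: h; rewrite e /= ltnS.
Qed.

Variables (S : seq T) (v : T).
Hypotheses (vS : v \in S) (uS : uniq S).
Hypothesis gS : forall x y, adj g x y -> y \in S.
Hypothesis DS : forall x, (size [seq y <- S | adj g x y] <= Dl)%N.
Variable t : nat.
Hypothesis TL : uniq (flat (nb S) snd t (None, v)).

Let perm_nb s w : perm_eq s S -> perm_eq (nb s w) (nb S w).
Proof. by move=> h; apply/perm_map/perm_filter. Qed.

Let DSs s : perm_eq s S -> D s.
Proof.
move=> h w; rewrite (perm_size (perm_nb w h)) size_map; apply: leq_trans (DS w.2).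
by rewrite !size_filter; apply: sub_count => y /andP[].
Qed.

Let TLs s : perm_eq s S -> uniq (flat (nb s) snd t (None, v)).
Proof.
move=> h; have := @perm_flat _ _ _ (nb s) (nb S) snd snd id t (None, v).
by move=> /(_ _ (fun=> erefl))/wrap[w|/perm_uniq ->//]; rewrite map_id perm_nb.
Qed.

Definition bt s : B M Dl t := un s t (None, v).

Lemma canon_bt s : perm_eq s S -> canon (bt s) = canon (bt S).
Proof.
move=> h; apply: (canon_unf (h := id)) => //; [exact: DSs|exact: (DSs (perm_refl _))|].
by move=> w; rewrite map_id perm_nb.
Qed.

(** The change of search order that performs [sw l i] on the unfolding. It is the identity when
    there is no such pair of siblings within depth [t], where [sw l i] is the identity too. *)
Let fl l i s : seq T :=
  if (size l < t)%N then
    if walk (nb s) (None, v) l is Some w then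
      if (onth (nb s w) i, onth (nb s w) i.+1) is (Some a, Some b) then map (sw2 a.2 b.2) s else s
    else s
  else s.

Let nb_in s w i p a : perm_eq s S -> onth (nb s w) i = Some (p, a) -> p = Some w.2 /\ a \in s.
Proof.
move=> h /onth_mem ha; have gs x y : adj g x y -> y \in s by move=> /gS; rewrite (perm_mem h).
by move/(nbrP gs): ha => [-> /gs].
Qed.

Let flP l i s : perm_eq s S -> bt (fl l i s) = sw l i (bt s) /\ fl l i (fl l i s) = s.
Proof.
move=> h; rewrite /fl; case: ltnP => [lt|ge]; last first.
  by split=> //; rewrite /bt unswapped//; [exact: DSs|right; left].
case ew : (walk _ _ _) => [w|]; last first.
  by rewrite ew; split=> //; rewrite /bt unswapped//; [exact: DSs|left].
case ea : (onth (nb s w) i) => [[pa a]|]; last first.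
  rewrite ew ea; split=> //; rewrite /bt unswapped//; [exact: DSs|right; right; exists w => //].
  by rewrite leqW// -onthNE ea.
case eb : (onth (nb s w) i.+1) => [[pb b]|]; last first.
  rewrite ew ea eb; split=> //; rewrite /bt unswapped//; [exact: DSs|right; right; exists w => //].
  by rewrite -onthNE eb.
have [l1 [l3 [e1 s1]]] := onth_split ea.
have [l2 e2] : exists l2, l3 = (pb, b) :: l2.
  move: eb; rewrite e1 onth_cat -s1 ltnNge leqnSn /= subSnn /=.
  by case: (l3) => [//|x l2] [->]; exists l2.
have [epa as_] := nb_in h ea; have [epb bs_] := nb_in h eb.
subst pa pb; rewrite e2 in e1.
have us : uniq s by rewrite (perm_uniq h).
have h' : perm_eq (map (sw2 a b) s) S by apply: perm_trans h; exact: perm_sw2.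
have [h1 [h2 h3]] := swap_at (DSs h) (DSs h') us (TLs h) lt ew e1 s1.
split; first exact: h1.
have o1 : onth (nb (map (sw2 a b) s) w) i = Some (Some w.2, b).
  by rewrite h3 onth_cat s1 ltnn subnn.
have o2 : onth (nb (map (sw2 a b) s) w) i.+1 = Some (Some w.2, a).
  by rewrite h3 onth_cat s1 ltnNge leqnSn /= subSnn.
rewrite h2; cbv iota beta; rewrite o1; cbv iota beta; rewrite o2 [LHS]/=.
rewrite -map_comp -[RHS]map_id; apply: eq_map => x /=.
by rewrite (sw2C b) sw2K.
Qed.

Let cnt_bt (x : B M Dl t) := count (fun s => bt s == x) (permutations S).

Let cnt_bt_sw l i x : cnt_bt (sw l i x) = cnt_bt x.
Proof.
have pm s : s \in permutations S -> fl l i s \in permutations S.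
  rewrite !mem_permutations => h; rewrite /fl; case: ifP => // lt.
  case ew : (walk _ _ _) => [w|//].
  case ea : (onth (nb s w) i) => [[pa a]|//]; case eb : (onth (nb s w) i.+1) => [[pb b]|//] /=.
  have [_ as_] := nb_in h ea; have [_ bs_] := nb_in h eb.
  by apply: (perm_trans _ h); apply: perm_sw2 => //; rewrite (perm_uniq h).
have pe : perm_eq (map (fl l i) (permutations S)) (permutations S).
  apply: uniq_perm; rewrite ?permutations_uniq//.
    rewrite map_inj_in_uniq ?permutations_uniq// => s s'; rewrite !mem_permutations => hs hs' e.
    by have [_ <-] := flP l i hs; have [_ <-] := flP l i hs'; rewrite e.
  move=> s; apply/mapP/idP => [[s' hs' ->]|hs]; first exact: pm.
  exists (fl l i s); first exact: pm.
  by have [_ ->] := flP l i (etrans (esym (mem_permutations _ _)) hs).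
rewrite /cnt_bt -(seq.permP pe) count_map; apply: eq_in_count => s.
rewrite mem_permutations => hs /=; have [-> _] := flP l i hs.
by rewrite (inj_eq (inv_inj (@swK _ _ l i _))).
Qed.

(** The involutions [fl] preserve the set of orders, so the number of orders that produce [x] is
    invariant under the exchanges, hence constant on the class of [x]. All orders lead to the class
    of [bt S], and each of its members gets the proportion 1/ocl. *)
Lemma uniform_labels (x : B M Dl t) :
  (count (fun s => bt s == x) (permutations S) * ocl x =
   (canon x == canon (bt S)) * size (permutations S))%N.
Proof.
have [e|ne] := eqVneq (canon x) (canon (bt S)); last first.
  rewrite mul0n (_ : count _ _ = 0)%N//; apply/eqP; rewrite -leqn0 leqNgt -has_count.
  apply/hasPn => s; rewrite mem_permutations => hs; apply: contraNneq ne => <-; apply/eqP; exact: canon_bt.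
rewrite mul1n; have hinv := sw_inv (F := cnt_bt) cnt_bt_sw.
transitivity (\sum_(y | canon y == canon x) cnt_bt y)%N.
  rewrite (eq_bigr (fun=> cnt_bt x)); last by move=> y /eqP; exact: hinv.
  by rewrite sum_nat_const mulnC /ocl; congr muln; apply: eq_card => y; rewrite !inE.
rewrite -sum1_size /cnt_bt (eq_bigr (fun y => \sum_(s <- permutations S | bt s == y) 1)%N); last first.
  by move=> y _; rewrite sum1_count.
rewrite (exchange_big_dep predT)//= big_seq [RHS]big_seq; apply: eq_bigr => s.
rewrite mem_permutations => hs; rewrite (bigD1 (bt s)) /=; last by rewrite e eqxx andbT; apply/eqP; exact: canon_bt.
by rewrite big1// => y /andP[/andP[_ /eqP ->]]; rewrite eqxx.
Qed.
End uniform_labels.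

Lemma empiricalE (R : realType) d (X : measurableType d) (xs : seq X) (A : set X) :
  (0 < size xs)%N ->
  empirical R xs A = ((count (fun x => x \in A) xs)%:R / (size xs)%:R)%:E.
Proof.
move=> s0.
pose m : {measure set X -> \bar R} := msum (fun k => \d_(nth point xs k) : {measure set X -> \bar R}) (size xs).
have E B : m B = (count (fun x => x \in B) xs)%:R%:E.
  rewrite /m /= /msum -sum1_count natr_sum -sumEFin (big_nth point) big_mkord [RHS]big_mkcond /=.
  by apply: eq_bigr => i _; rewrite diracE; case: (_ \in _).
rewrite -[LHS]/(mnormalize m \d_point A) /mnormalize !E (eq_count (a2 := predT)); last by move=> x; rewrite in_setT.
rewrite count_predT !eqe /= orbF pnatr_eq0 -[_ == 0%N]negbK -lt0n s0 /=.
by rewrite -[LHS]/((m A * ((size xs)%:R^-1)%:E)%E) E -EFinM.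
Qed.

Lemma count_allpairs (S T U : Type) (F : S -> T -> U) (P : pred U) (s : seq S) (t : seq T) :
  count P (allpairs F s t) = (\sum_(x <- s) count (fun y => P (F x y)) t)%N.
Proof. by rewrite count_flatten sumnE !big_map; apply: eq_bigr => x _; rewrite count_map. Qed.

Lemma subseq_flat (W : Type) (T : eqType) (nx : W -> seq W) (c : W -> T) k w :
  subseq (flat nx c k w) (flat nx c k.+1 w).
Proof.
elim: k w => [|k ih] w; first by rewrite /= eqxx sub0seq.
have h l : subseq (flatten (map (flat nx c k) l)) (flatten (map (flat nx c k.+1) l)).
  by elim: l => // x l ihl; exact: cat_subseq (ih x) ihl.
by rewrite /= eqxx; exact: h.
Qed.

(** * The neighborhood law of a colored graph against its law of types *)

Section graph_law.
Context {R : realType} {M : pFinType} {n Dl : nat} {D : finType} (vtx : D -> 'I_n).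
Hypothesis dlD : forall v, (size (dl vtx v) <= Dl)%N.
Variables (f : 'I_n -> M) (s : {perm D}).
Hypothesis ss : simple vtx s.
Local Notation g := (cfinite (Gr vtx s) f).

(** Walks in the graph of [s] read on half-edges, with [None] for the start at [v]; [perm_nbr]
    identifies them with the walks of the search. *)
Let nxo (v : 'I_n) (x : option D) : seq (option D) :=
  map Some (if x is Some x then nxd vtx s x else dl vtx v).
Let ho v (x : option D) : option 'I_n * 'I_n := if x is Some x then (Some (vtx x), vtx (s x)) else (None, v).
Let co v (x : option D) : M := f (ho v x).2.

Let fs : forall x, s (s x) = x /\ s x <> x.
Proof. by case/andP: ss => /fpiP. Qed.

Let perm_nbr S v x : perm_eq S (enum 'I_n) -> perm_eq (nbr g S (ho v x)) (map (ho v) (nxo v x)).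
Proof.
move=> hS; have uS : uniq S by rewrite (perm_uniq hS) enum_uniq.
have gS u w : adj g u w -> w \in S by rewrite (perm_mem hS) mem_enum.
apply: uniq_perm.
- by rewrite map_inj_uniq ?filter_uniq// => ? ? [].
- rewrite /nxo -map_comp map_inj_in_uniq; first by case: x => [x|]; rewrite ?dl_uniq// filter_uniq// dl_uniq.
  move=> y z hy hz /= [e1 e2]; exact: simple_inj ss e1 e2.
case=> p y; apply/idP/idP.
  move/(nbrP gS) => [-> /= e ne]; move: e; rewrite edge_Gr// => /mapP[z]; rewrite mem_dl => /eqP vz ey.
  rewrite /nxo -map_comp; apply/mapP; exists z; last by rewrite /= vz ey.
  case: x ne vz => [x|] /= ne vz; last by rewrite mem_dl vz.
  rewrite mem_filter mem_dl vz eqxx andbT; apply: contra_neqN ne => /eqP ez.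
  by rewrite ey ez (fs x).1.
rewrite /nxo -map_comp => /mapP[z hz [-> ->]]; apply/(nbrP gS).
case: x hz => [x|] /=.
  rewrite mem_filter mem_dl => /andP[zx /eqP vz]; split=> //; first by rewrite vz.
    by rewrite edge_Gr//; apply/mapP; exists z => //; rewrite mem_dl vz.
  apply: contra zx => /eqP[e]; apply/eqP/(simple_inj ss) => //.
  by rewrite (fs x).1.
rewrite mem_dl => /eqP vz; split=> //; first by rewrite vz.
by rewrite edge_Gr//; apply/mapP; exists z => //; rewrite mem_dl vz.
Qed.

Let nxoD v x : (size (nxo v x) <= Dl)%N.
Proof. by rewrite size_map; case: x => [x|//]; exact: nxdD. Qed.

Lemma size_adj_Gr S v : perm_eq S (enum 'I_n) -> (size [seq y <- S | adj g v y] <= Dl)%N.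
Proof.
move=> hS; have := perm_size (perm_nbr v None hS); rewrite !size_map /= => e.
rewrite (_ : size _ = size [seq y <- S | adj g v y & Some y != None]) ?e //.
by rewrite -e !size_filter; apply: eq_count => y /=; rewrite andbT.
Qed.

Let unf_nxo k v : unf (nxo v) (co v) k.+1 None = typ vtx Dl f s k v.
Proof.
rewrite /unf /typ -/unf; congr nd; rewrite -map_comp; apply: eq_map => x /=.
by elim: k x => // k ih x; rewrite /unf -/unf brS; congr nd; rewrite -map_comp; apply: eq_map => y /=; rewrite ih.
Qed.

Let flat_nxo k v : flat (nxo v) (fun x => (ho v x).2) k.+1 None = v :: flatten [seq fld vtx s k x | x <- dl vtx v].
Proof.
rewrite /= -map_comp; congr (_ :: flatten _); apply: eq_map => x /=.
elim: k x => // k ih x /=; rewrite /fld /= -map_comp; congr (_ :: flatten _); apply: eq_map => y /=.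
by rewrite ih.
Qed.

Lemma bt_typ S k v : perm_eq S (enum 'I_n) ->
  canon (bt g Dl f v k.+1 S) = canon (typ vtx Dl f s k v).
Proof.
move=> hS; rewrite -unf_nxo.
apply: (@canon_unf M Dl _ _ (nbr g S) (nxo v) (fun w => f w.2) (co v) (ho v) k.+1 None) => //.
- move=> w; rewrite size_map; apply: leq_trans (size_adj_Gr w.2 hS).
  by rewrite !size_filter; apply: sub_count => y /andP[].
- by move=> x; exact: perm_nbr.
Qed.

Lemma uniq_flat_nbr S k v : perm_eq S (enum 'I_n) -> ~~ ntree vtx s k v ->
  uniq (flat (nbr g S) snd k.+1 (None, v)).
Proof.
move=> hS; rewrite /ntree negbK -flat_nxo; congr (is_true _); apply/esym/perm_uniq.
by apply: (@perm_flat _ _ _ (nbr g S) (nxo v) snd (fun x => (ho v x).2) (ho v) k.+1 None) => // x; exact: perm_nbr.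
Qed.

Let frac v (A : set (lgraph R M)) : R :=
  (count (fun S => bfs R S (isT : verts g v) \in A) (permutations (enum 'I_n)))%:R /
  (size (permutations (enum 'I_n)))%:R.

Let psize0 : (0 < size (permutations (enum 'I_n)))%N.
Proof.
have : enum 'I_n \in permutations (enum 'I_n) by rewrite mem_permutations.
by case: (permutations _).
Qed.

Let frac_le1 v A : 0 <= frac v A <= 1.
Proof.
by rewrite divr_ge0//= ler_pdivrMr ?ltr0n// mul1r ler_nat count_size.
Qed.

Let distrE (A : set (lgraph R M)) : (0 < n)%N ->
  distr R (Gr vtx s) f A = ((\sum_v frac v A) / n%:R)%:E.
Proof.
move=> n0; have sz : size [seq bfs R S0 (isT : verts g v) | v <- enum 'I_n, S0 <- permutations (enum 'I_n)] =
    (n * size (permutations (enum 'I_n)))%N by rewrite size_allpairs size_enum_ord.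
rewrite /distr empiricalE; last by rewrite sz muln_gt0 n0.
rewrite sz count_allpairs natrM natr_sum invfM big_enum /=.
congr EFin; rewrite (_ : \sum_v frac v A = (\sum_v (count (fun S0 => bfs R S0 (isT : verts g v) \in A) (permutations (enum 'I_n)))%:R) / (size (permutations (enum 'I_n)))%:R).
  by rewrite -mulrA; congr (_ * _); exact: mulrC.
by rewrite mulr_suml.
Qed.

Let fracE v k (x : B M Dl k.+1) : ~~ ntree vtx s k.+1 v ->
  frac v [set h | restr k.+1 h = lg x] =
  (canon (typ vtx Dl f s k v) == canon x)%:R / (ocl x)%:R.
Proof.
move=> nt; have hS := perm_refl (enum 'I_n).
have us := enum_uniq 'I_n.
have TL : uniq (flat (nbr g (enum 'I_n)) snd k.+1 (None, v)).
  rewrite uniq_flat_nbr//; apply: contra nt; rewrite /ntree; apply: contra.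
  rewrite -(flat_nxo k) -(flat_nxo k.+1).
  exact/subseq_uniq/subseq_flat.
have := @uniform_labels _ M g Dl f (enum 'I_n) v us
  (fun _ y _ => mem_enum _ y) (fun u => size_adj_Gr u hS) k.+1 TL x.
rewrite bt_typ// [canon x == _]eq_sym => /(congr1 (fun m => m%:R : R)).
rewrite !natrM => e.
rewrite /frac (eq_in_count (a2 := fun S => bt g Dl f v k.+1 S == x)); last first.
  move=> S; rewrite mem_permutations => hSp.
  have uS : uniq S by rewrite (perm_uniq hSp).
  have TLS := uniq_flat_nbr hSp nt.
  have vS : v \in S by rewrite (perm_mem hSp) mem_enum.
  have := @restr_bfs R M Dl _ g S f uS (fun _ y _ => _) (fun _ _ => erefl) (fun u => size_adj_Gr u hSp) k.+1 v isT vS TLS.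
  move=> /(_ (fun y => etrans (perm_mem hSp y) (mem_enum _ _))) eb.
  apply/idP/eqP => [/set_mem/=|h]; first by rewrite eb => /lg_inj.
  by apply/mem_set; rewrite /= eb -h.
have p0 : (size (permutations (enum 'I_n)))%:R != 0 :> R by rewrite pnatr_eq0 -lt0n.
by apply: (mulIf p0); rewrite divfK// mulrAC -e mulfK// pnatr_eq0 -lt0n ocl_gt0.
Qed.

(** Away from short cycles the random search orders the unfolding uniformly, so that the vertex
    contributes to both sides equally ([fracE]). At the other vertices both contributions lie in
    [0, 1]. *)
Lemma distr_typ k (x : B M Dl k.+1) : (0 < n)%N ->
  `|fine (distr R (Gr vtx s) f [set h | restr k.+1 h = lg x]) -
    Sym (emp (typ vtx Dl f s k)) x| <= #|[set v | ntree vtx s k.+1 v]%SET|%:R / n%:R.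
Proof.
move=> n0; rewrite distrE//=.
have -> : Sym (emp (typ vtx Dl f s k)) x =
    (\sum_v (canon (typ vtx Dl f s k v) == canon x)%:R / (ocl x)%:R) / n%:R :> R.
  by rewrite /Sym push_emp empE card_ord mulrAC -mulr_suml.
rewrite -mulrBl -sumrB normrM [X in _ * X]ger0_norm ?invr_ge0//.
rewrite ler_wpM2r ?invr_ge0//; apply: le_trans (ler_norm_sum _ _ _) _.
rewrite -sum1_card natr_sum big_mkcond [leRHS]big_mkcond /=; apply: ler_sum => v _.
rewrite inS; case: ifPn => [_|nt]; last by rewrite fracE// subrr normr0.
have := frac_le1 v [set h | restr k.+1 h = lg x].
have : 0 <= ((canon (typ vtx Dl f s k v) == canon x)%:R / (ocl x)%:R : R) <= 1.
  rewrite divr_ge0//= ler_pdivrMr ?ocl_gt0R// mul1r ler_nat.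
  by case: (_ == _) => //; exact: ocl_gt0.
move: (_ / (ocl x)%:R) (frac _ _) => a b /andP[a0 a1] /andP[b0 b1].
by rewrite ler_norml; apply/andP; split; lra.
Qed.
End graph_law.

(* A non-root vertex has its parent as a further neighbor. *)
Definition ktree (R : realType) (M : pFinType) (Dl : nat) (g : lgraph R M) : Prop :=
  (forall u v, adj g u v -> child u v || child v u) /\
  (forall v j, verts g (rcons v j) -> (j + (v != [::]) < Dl)%N).

(** * Labeled trees and their random relabelings *)

Section tree_truncation.
Context {R : realType} {M : pFinType} (Dl : nat).
Implicit Types (g : lgraph R M).

Lemma ktree_restr t g : ktree Dl g -> ktree Dl (restr t g).
Proof.
case=> h1 h2; split=> [u v|v j]; first by rewrite restr_adj => /and3P[/h1].
by rewrite /verts/mkset restr_col; case: ifP => // _ /h2.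
Qed.

(** Offspring are numbered without gaps, so the first missing number counts them. *)
Definition nkids g v := find (fun j => ~~ Defs.col g (rcons v j) : bool) (iota 0 Dl).

Definition gkids g v : seq label := [seq rcons v j | j <- iota 0 (nkids g v)].

Definition gcol g v : M := odflt point (Defs.col g v).

Section fixed.
Variables (g : lgraph R M) (hT : ktree Dl g).
Local Notation kd := (gkids g).
Local Notation nk := (nkids g).

Lemma ltn_nkids v j : (j < nk v)%N = Defs.col g (rcons v j) :> bool.
Proof.
apply/idP/idP => [lt|gv].
  have := before_find 0%N lt; rewrite nth_iota ?add0n; first by move/negbFE.
  by apply: leq_trans lt _; have := find_size (fun j => ~~ Defs.col g (rcons v j) : bool) (iota 0 Dl); rewrite size_iota.
have jD : (j < Dl)%N by apply: leq_trans (hT.2 _ _ gv); rewrite ltnS leq_addr.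
rewrite ltnNge; apply/negP => le.
have lt : (nk v < Dl)%N by exact: leq_ltn_trans le jD.
have : has (fun j => ~~ Defs.col g (rcons v j) : bool) (iota 0 Dl) by rewrite has_find size_iota.
move/(nth_find 0%N); rewrite nth_iota// add0n -/(nk v) => /negP; apply.
move: le; rewrite leq_eqVlt => /orP[/eqP -> //|lt'].
by case: (lgraphP g) => _ h _ _; have [_] := h _ _ gv; apply.
Qed.

Lemma size_gkids v : (size (kd v) <= Dl)%N.
Proof.
rewrite size_map size_iota.
by have := find_size (fun j => ~~ Defs.col g (rcons v j) : bool) (iota 0 Dl); rewrite size_iota.
Qed.

Lemma mem_gkids v u : (u \in kd v) = Defs.col g u && child v u :> bool.
Proof.
apply/mapP/andP => [[j]|[gu vu]].
  by rewrite mem_iota add0n ltn_nkids => gv ->; split=> //; rewrite child_rcons.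
case/lastP: u gu vu => // u j gu; rewrite child_rcons => /eqP e; subst u; exists j => //.
by rewrite mem_iota add0n ltn_nkids.
Qed.

Lemma walk_gkids v l : Defs.col g v -> walk kd v l = if Defs.col g (v ++ l) then Some (v ++ l) else None.
Proof.
elim: l v => [|j l ih] v gv /=; first by rewrite cats0 gv.
have -> : onth (kd v) j = if Defs.col g (rcons v j) then Some (rcons v j) else None.
  rewrite /gkids onth_map -ltn_nkids; case: ltnP => lt.
    by rewrite (_ : onth _ _ = Some j)// (onthE) (nth_map 0%N) ?size_iota// nth_iota.
  by rewrite onthE nth_default// size_map size_iota.
case: ifPn => [gj|ngj] /=; first by rewrite ih// cat_rcons.
rewrite ifN//; apply: contra ngj; rewrite -cat_rcons; elim/last_ind: l {ih} => [|l i ih]; first by rewrite cats0.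
by rewrite -rcons_cat => /parent_vert/ih.
Qed.

Definition btr t : B M Dl t := unf kd (gcol g) t [::].

Lemma restr_btr t : restr t g = lg (btr t).
Proof.
have c l : (size l <= t)%N -> Defs.col g l = colB (btr t) l.
  move=> sl; rewrite colB_unf; last exact: size_gkids.
  rewrite sl walk_gkids ?vert_root// /gcol cat0s.
  by case e : (Defs.col g l) => [a|]//=; rewrite e.
apply: restr_eq => [//|u v su sv]; rewrite /adjB -!c//.
apply/idP/and3P => [uv|[gu gv]].
  by split; [exact: adj_col uv|apply: (@adj_col _ _ g v u); rewrite adj_sym|exact: hT.1].
have h u' v' : Defs.col g v' -> child u' v' -> adj g u' v'.
  by case/lastP: v' => // v' j; rewrite child_rcons => gv' /eqP <-; exact: parent_adj.
by case/orP => [/h|/h]; [exact|rewrite adj_sym; exact].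
Qed.

Lemma prefix_flat t v u : u \in flat kd id t v -> prefix v u.
Proof.
elim: t v => [|t ih] v /=; first by rewrite inE => /eqP ->; exact: prefix_refl.
rewrite inE => /orP[/eqP ->|/flatten_mapP[w /mapP[j _ ->] /ih]]; first exact: prefix_refl.
exact/prefix_trans/prefix_rcons.
Qed.

Lemma uniq_flat_gkids t v : uniq (flat kd id t v).
Proof.
elim: t v => //= t ih v; apply/andP; split.
  apply/negP => /flatten_mapP[w /mapP[j _ ->] /prefix_flat].
  by move/size_prefix; rewrite size_rcons ltnn.
rewrite /gkids -map_comp; elim: (iota _ _) (iota_uniq 0 (nk v)) => //= j l ihl /andP[jl ul].
rewrite cat_uniq ih ihl// andbT; apply/hasPn => u /flatten_mapP[i il /prefix_flat ui] /=.
apply/negP => /prefix_flat uj; case/negP: jl.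
move: ui uj; rewrite !prefixE !size_rcons => /eqP e /eqP; by rewrite e => /rcons_inj[<-].
Qed.

Section orders.
Variable s : seq label.
Hypotheses (us : uniq s) (sg : forall x, (x \in s) = Defs.col g x :> bool).

Let hw (x : label) : option label * label := (if x is [::] then None else Some (parent x), x).

Let gs x y : adj g x y -> y \in s.
Proof. by rewrite sg adj_sym => /adj_col. Qed.

Lemma perm_nbr_gkids x : perm_eq (nbr g s (hw x)) (map hw (gkids g x)).
Proof.
have hi : injective hw by move=> ? ? [].
apply: uniq_perm.
- by rewrite map_inj_uniq ?filter_uniq// => ? ? [].
- by rewrite map_inj_uniq// map_inj_uniq ?iota_uniq// => i j /rcons_inj[].
case=> p y; apply/idP/mapP => [/(nbrP gs)[-> /= xy ne]|[z]].
  exists y.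
    rewrite mem_gkids -sg (gs xy); case/orP: (hT.1 _ _ xy) => // /andP[x0 /eqP px].
    by move: ne; case: (x) x0 px => // a b _ /= ->; rewrite eqxx.
  rewrite /hw; congr pair; case/orP: (hT.1 _ _ xy) => /andP[y0 /eqP px].
    by case: (y) y0 px => // a b _ ->.
  by move: ne; case: (x) y0 px => // a b _ /= ->; rewrite eqxx.
rewrite mem_gkids => /andP[gz xz] [-> ->]; move: gz xz; case/lastP: z => // z j gz.
rewrite child_rcons => /eqP ez; subst z.
have -> : (if rcons x j is [::] then None else Some (parent (rcons x j))) = Some x.
  by rewrite parent_rcons; case: (x).
apply/(nbrP gs); split=> //; first exact: parent_adj.
case: (x) => //= a b; apply/eqP => -[] /(congr1 size).
by rewrite /parent size_take /= size_rcons; case: ltnP; clear; lia.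
Qed.

Lemma size_adj_ktree x : (size [seq y <- s | adj g x y] <= Dl)%N.
Proof.
have [gx|ngx] := boolP (Defs.col g x : bool); last first.
  rewrite (_ : [seq _ <- _ | _] = [::])//; apply/eqP; rewrite -[_ == _]negbK -has_filter.
  by apply/hasPn => y _; apply: contra ngx => /adj_col.
apply: leq_trans (_ : nk x + (x != [::]) <= _)%N; last first.
  case e : (nk x) => [|k].
    case: (x) gx => [//|a b]; rewrite lastI => /(hT.2) h.
    by rewrite add0n; apply: leq_trans (leq_b1 _) _; exact: leq_ltn_trans (leq0n _) h.
  by have := hT.2 x k; rewrite addSn; apply; rewrite /verts/= -ltn_nkids e.
have -> : nk x = size (gkids g x) by rewrite size_map size_iota.
apply: leq_trans (_ : size (gkids g x ++ if x is [::] then [::] else [:: parent x]) <= _)%N; last first.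
  by rewrite size_cat; case: (x).
apply: uniq_leq_size; first exact: filter_uniq.
move=> y; rewrite mem_filter => /andP[xy _]; rewrite mem_cat mem_gkids -sg (gs xy).
case/orP: (hT.1 _ _ xy) => [->//|/andP[x0 /eqP px]].
by case: (x) x0 px => // a b _ <-; rewrite inE eqxx orbT.
Qed.

Lemma uniq_flat_ktree t : uniq (flat (nbr g s) snd t (None, [::])).
Proof.
rewrite (@perm_uniq _ _ (flat (gkids g) id t [::])) ?uniq_flat_gkids//.
by apply: (@perm_flat _ _ _ (nbr g s) (gkids g) snd id hw t [::]) => // x; exact: perm_nbr_gkids.
Qed.

Lemma canon_bt_btr t : canon (bt g Dl (gcol g) [::] t s) = canon (btr t).
Proof.
apply: (@canon_unf M Dl _ _ (nbr g s) (gkids g) (fun w => gcol g w.2) (gcol g) hw t [::]) => //.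
- move=> w; rewrite size_map; apply: leq_trans (size_adj_ktree w.2).
  by rewrite !size_filter; apply: sub_count => y /andP[].
- exact: size_gkids.
- exact: perm_nbr_gkids.
Qed.

Lemma bfs_ktree t (gv : verts g [::]) : restr t g = g ->
  bfs R s gv = lg (bt g Dl (gcol g) [::] t s).
Proof.
move=> gt; have rs := sg [::]; rewrite vert_root in rs.
have cE x : x \in s -> Defs.col g x = Some (gcol g x) by rewrite sg /gcol; case: (Defs.col g x).
have h k : restr k (bfs R s gv) = lg (btree g s (gcol g) k [::] : B M Dl k).
  by apply: (restr_bfs us gs cE size_adj_ktree) => //; exact: uniq_flat_ktree.
(* A walk along [l] ends at a vertex whose own label has the length of [l], and [g] has no vertex
   beyond depth [t]. *)
have deep l : Defs.col (bfs R s gv) l -> (size l <= t)%N.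
  move=> hl; rewrite leqNgt; apply/negP => lt.
  have : Defs.col (restr (size l) (bfs R s gv)) l by rewrite restr_col leqnn.
  rewrite h /= colB_unf; last by apply: size_nbr; exact: size_adj_ktree.
  rewrite leqnn; case e : (walk _ _ _) => [w|//] _.
  suff : (size w.2 = size l)%N.
    move: (walk_in gs rs e); rewrite sg -gt restr_col.
    by case: leqP => // + _ ew; rewrite ew leqNgt lt.
  have : walk (nbr g s) (hw [::]) l = Some w by [].
  move: w {e}; elim/last_ind: l {hl lt} => [w [<-]//|l j ih] w.
  rewrite walk_rcons; case e : (walk _ _ _) => [w'|//] /= hj.
  have [x ex] : exists x, w' = hw x.
    clear ih hj; elim/last_ind: l w' e => [w' [<-]|l i ih w']; first by exists [::].
    rewrite walk_rcons; case e : (walk _ _ _) => [w2|//] /=; have [x ->] := ih _ e.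
    by move/onth_mem; rewrite (perm_mem (perm_nbr_gkids x)) => /mapP[y _ ->]; exists y.
  move: hj => /onth_mem; rewrite ex (perm_mem (perm_nbr_gkids x)) => /mapP[y + ->] /=.
  by case/mapP => i _ ->; rewrite !size_rcons; have := ih _ e; rewrite ex => <-.
rewrite -[RHS](h t); apply/lgraph_eq/cgraph_eq => [l|u v].
  rewrite restr_col; case: ifPn => // /negP; case e : (Defs.col _ l) => [a|//] [].
  by apply: deep; rewrite e.
rewrite restr_adj; case e : (adj _ u v) => //=; rewrite !deep//.
  by apply: (@adj_col _ _ (bfs R s gv) v u); exact: etrans (pull_sym _ _ _ _) e.
exact: (@adj_col _ _ (bfs R s gv) u v e).
Qed.
End orders.

Lemma finite_ktree t : restr t g = g -> verts g = [set` flat kd id t [::]].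
Proof.
move=> gt; apply/seteqP; split=> [l|l /= ] gl.
  have sl : (size l <= t)%N by move: gl; rewrite /verts/= -gt restr_col; case: ifP.
  rewrite /=; apply: (@walk_flat _ kd _ id t [::] l l sl).
  by rewrite walk_gkids ?vert_root// cat0s; rewrite (_ : (Defs.col g l : bool) = true).
suff : forall t v, Defs.col g v -> l \in flat kd id t v -> Defs.col g l.
  by move=> /(_ t [::]); apply => //; exact: vert_root.
elim=> [|k ih] v gv /=; first by rewrite inE => /eqP ->.
rewrite inE => /orP[/eqP ->//|/flatten_mapP[w]]; rewrite mem_gkids => /andP[gw _]; exact: ih.
Qed.
End fixed.

Lemma restr_restr t g : restr t (restr t g) = restr t g.
Proof.
apply/lgraph_eq/cgraph_eq => [l|u v]; first by rewrite !restr_col; case: (_ <= _)%N.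
by rewrite !restr_adj; case: (adj g u v); case: (_ <= _)%N; case: (_ <= _)%N.
Qed.

(** [uniform_labels] for a tree that is already labeled: relabeling draws uniformly from the class
    of [btr g t]. *)
Lemma relabeledE t g (A : set (lgraph R M)) : ktree Dl g ->
  relabeled g t A =
  (\sum_(x : B M Dl t) (lg x \in A)%:R * ((canon x == canon (btr g t))%:R / (ocl x)%:R))%:E.
Proof.
move=> hT; have hT' := ktree_restr t hT; have gt := restr_restr t g.
rewrite /relabeled; set g' := restr t g in hT' gt *.
have -> : btr g t = btr g' t :> B M Dl t.
  by apply: (@lg_inj R); rewrite -!restr_btr.
have vE := finite_ktree hT' gt.
have fv : finite_set (verts g') by rewrite vE; exact: finite_seq.
have us : uniq (fset_set (verts g')) by [].
have sg x' : (x' \in fset_set (verts g')) = Defs.col g' x' :> bool.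
  by rewrite in_fset_set// ; apply/idP/idP => [/set_mem|h]; last exact/mem_set.
set S := enum_fset _ in us sg.
have ps s : s \in permutations S -> uniq s /\ forall x', (x' \in s) = Defs.col g' x' :> bool.
  by rewrite mem_permutations => h; split=> [|x']; rewrite ?(perm_uniq h)// (perm_mem h).
have gS x' y : adj g' x' y -> y \in S by rewrite sg adj_sym => /adj_col.
have e x := congr1 (fun m => m%:R : R) (@uniform_labels _ M g' Dl (gcol g') S [::] us gS
  (size_adj_ktree hT' us sg) t (uniq_flat_ktree hT' us sg t) x).
have p0 : (0 < size (permutations S))%N.
  have : S \in permutations S by rewrite mem_permutations.
  by case: (permutations S).
have p0' : (size (permutations S))%:R != 0 :> R by rewrite pnatr_eq0 -lt0n.
rewrite empiricalE size_map// count_map (eq_in_count (a2 := fun s => lg (bt g' Dl (gcol g') [::] t s) \in A)); last first.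
  by move=> s /ps[us' sg'] /=; rewrite (bfs_ktree hT' us' sg' _ gt).
congr EFin; apply: (mulIf p0'); rewrite divfK// mulr_suml.
rewrite (eq_bigr (fun x => \sum_(s <- permutations S) (lg x \in A)%:R * (bt g' Dl (gcol g') [::] t s == x)%:R)); last first.
  move=> x _; rewrite -mulr_sumr -mulrA; congr (_ * _); move: (e x); rewrite (canon_bt_btr hT' us sg) !natrM => ex.
  rewrite mulrAC -ex mulfK ?pnatr_eq0 -?lt0n ?ocl_gt0// -sum1_count natr_sum big_mkcond.
  by apply: eq_bigr => s _; case: eqP.
rewrite exchange_big /= -sum1_count natr_sum big_mkcond; apply: eq_bigr => s _.
rewrite (bigD1 (bt g' Dl (gcol g') [::] t s))//= eqxx mulr1 big1 ?addr0; first by case: (_ \in _).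
by move=> x; rewrite eq_sym => /negbTE ->; rewrite mulr0.
Qed.

Lemma relabeled_ktree t g (x : B M Dl t) : ktree Dl g ->
  relabeled g t [set lg x] = ((canon x == canon (btr g t))%:R / (ocl x)%:R)%:E.
Proof.
move=> hT; rewrite relabeledE// (bigD1 x)//= mem_set// mul1r big1 ?addr0// => y yx.
by rewrite memNset ?mul0r// => /lg_inj e; rewrite e eqxx in yx.
Qed.

Lemma relabeled_out t g h : ktree Dl g -> (forall x : B M Dl t, h <> lg x) -> relabeled g t [set h] = 0%E.
Proof.
by move=> hT hh; rewrite relabeledE// big1// => y _; rewrite memNset ?mul0r//= => /esym/hh.
Qed.
End tree_truncation.

(** * Laws on rooted graphs *)

Section atoms.
Context {R : realType} d (T : measurableType d) (P : {measure set T -> \bar R}) (I : finType)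
  (E : I -> set T) (f : T -> \bar R) (c : I -> \bar R).
Hypotheses (mE : forall i, measurable (E i)) (dE : forall i j x, E i x -> E j x -> i = j)
  (mf : measurable_fun setT f) (f0 : forall x, (0 <= f x)%E) (fc : forall i x, E i x -> f x = c i).

Let UE : \big[setU/set0]_(i <- enum I) E i = [set x | exists i, E i x].
Proof.
rewrite -bigcup_seq; apply/seteqP; split=> x [i] //= ; first by move=> _ h; exists i.
by move=> h; exists i => //=; rewrite mem_enum.
Qed.

Lemma measurable_atoms : measurable [set x | exists i, E i x].
Proof. by rewrite -UE; apply: bigsetU_measurable. Qed.

Lemma integral_bigatoms : (\int[P]_(x in [set x | exists i, E i x]) f x = \sum_i c i * P (E i))%E.
Proof.
rewrite -UE ge0_integral_bigsetU ?enum_uniq//; last first.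
- by apply: measurable_funS mf.
- by move=> i j _ _ [x [hi hj]]; exact: dE hi hj.
rewrite big_enum; apply: eq_bigr => i _.
rewrite (eq_integral (cst (c i))); first by rewrite integral_cst.
by move=> x /set_mem/fc.
Qed.

Lemma integral_atoms_ge : (\sum_i c i * P (E i) <= \int[P]_x f x)%E.
Proof. by rewrite -integral_bigatoms; apply: ge0_subset_integral => //; exact: measurable_atoms. Qed.

Lemma integral_atoms : P (~` [set x | exists i, E i x]) = 0%E -> (\int[P]_x f x = \sum_i c i * P (E i))%E.
Proof.
move=> P0; rewrite (@ge0_negligible_integral _ _ _ _ _ (~` [set x | exists i, E i x]))//; last first.
  by apply: measurableC; exact: measurable_atoms.
by rewrite setDE setCK setTI integral_bigatoms.
Qed.
End atoms.

Section local_events.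
Context {R : realType} {M : pFinType}.
Implicit Types (g : lgraph R M) (A : set (lgraph R M)).

(** Dependence on the ball of radius [N] alone. Local events are open, hence measurable, and for
    laws on trees of bounded degree their probabilities are finite sums over [B]. *)
Definition local (X : Type) (N : nat) (f : lgraph R M -> X) := forall g g', restr N g = restr N g' -> f g = f g'.

Lemma restr_le N N' g g' : (N <= N')%N -> restr N' g = restr N' g' -> restr N g = restr N g'.
Proof.
move=> le h; apply/lgraph_eq/cgraph_eq => [l|u v].
  rewrite !restr_col; case: leqP => // sl; have := restr_col N' g l.
  by rewrite h restr_col (leq_trans sl le) => ->.
rewrite !restr_adj; have := restr_adj N' g u v; rewrite h restr_adj.
case: (leqP (size u) N) => su; rewrite ?andbF//; case: (leqP (size v) N) => sv; rewrite ?andbF// !andbT.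
by rewrite (leq_trans su le) (leq_trans sv le) !andbT => ->.
Qed.

Lemma local_le (X : Type) N N' (f : lgraph R M -> X) : (N <= N')%N -> local N f -> local N' f.
Proof. by move=> le h g g' /(restr_le le)/h. Qed.

Lemma local_open N A : local N A -> open A.
Proof.
move=> lA; rewrite openE => g Ag; rewrite /interior -!nbhs_ballE.
exists (2 ^+ N)^-1 => /=; first by rewrite invr_gt0 exprn_gt0.
by move=> g'; rewrite ballEmdist /= => /gdist_lt_restr/lA <-.
Qed.

Lemma local_measurable N A : local N A -> measurable A.
Proof. by move=> lA; apply: sub_sigma_algebra; exact: local_open lA. Qed.

Lemma local_measurable_fun N d (T : measurableType d) (f : lgraph R M -> T) : local N f -> measurable_fun setT f.
Proof.
move=> lf _ Y mY; rewrite setTI; apply: (@local_measurable N) => g g' /lf h.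
by rewrite /preimage /mkset h.
Qed.

Lemma measurable_atom N h : measurable [set g : lgraph R M | restr N g = h].
Proof. by apply: (@local_measurable N) => g g' e; rewrite /mkset e. Qed.

Lemma set1_lgraph h : [set h] = \bigcap_N [set g : lgraph R M | restr N g = restr N h].
Proof.
by apply/seteqP; split=> [g -> //|g hg]; apply: restr_inj => N; exact: hg.
Qed.

Lemma measurable_set1_lgraph h : measurable [set h : lgraph R M].
Proof. by rewrite set1_lgraph; apply: bigcapT_measurable => N; exact: measurable_atom. Qed.

Lemma measurable_ktree Dl : measurable [set g : lgraph R M | ktree Dl g].
Proof.
have -> : [set g : lgraph R M | ktree Dl g] = \bigcap_N [set g | ktree Dl (restr N g)].
  apply/seteqP; split=> [g hg N _|g hg]; first exact: ktree_restr.
  split=> [u v uv|v j gv].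
    have [h _] := hg (maxn (size u) (size v)) Logic.I; apply: h.
    by rewrite restr_adj uv leq_maxl leq_maxr.
  have [_ h] := hg (size (rcons v j)) Logic.I; apply: h.
  by rewrite /verts/mkset restr_col leqnn.
by apply: bigcapT_measurable => N; apply: (@local_measurable N) => g g' e; rewrite /mkset e.
Qed.
End local_events.

Definition treelike (R : realType) (M : pFinType) (Dl : nat) (P : probability (lgraph R M) R) :=
  P (~` [set g | ktree Dl g]) = 0%E.

Section tree_laws.
Context {R : realType} {M : pFinType} {Dl : nat} (P : probability (lgraph R M) R).
Local Notation B := (B M Dl).

Definition law t (x : B t) : R := fine (P [set g | restr t g = lg x]).

Lemma lawE t (x : B t) : P [set g | restr t g = lg x] = (law x)%:E.
Proof. by rewrite /law fineK// fin_num_measure//; exact: measurable_atom. Qed.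

Lemma law_ge0 t (x : B t) : 0 <= law x.
Proof. by rewrite -lee_fin -lawE. Qed.

Hypothesis tP : treelike Dl P.

Lemma null_ktree A : measurable A -> (A `<=` ~` [set g | ktree Dl g]) -> P A = 0%E.
Proof.
move=> mA sA; apply: subset_measure0 sA tP => //.
by apply: measurableC; exact: measurable_ktree.
Qed.

Lemma law_ktree t (x : B t) : law x != 0 -> ktree Dl (lg x : lgraph R M).
Proof.
move=> h; apply: contrapT => nx; case/eqP: h; rewrite /law null_ktree//; first exact: measurable_atom.
by move=> g /= e hg; apply: nx; rewrite -e; exact: ktree_restr.
Qed.

Lemma integral_local N (f : lgraph R M -> \bar R) : local N f -> (forall g, 0 <= f g)%E ->
  (\int[P]_g f g = \sum_(x : B N) f (lg x) * (law x)%:E)%E.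
Proof.
move=> lf f0; rewrite (@integral_atoms _ _ _ P _ (fun x : B N => [set g | restr N g = lg x]) f (fun x => f (lg x))) //.
- by apply: eq_bigr => x _; congr (_ * _)%E; exact: lawE.
- by move=> x; exact: measurable_atom.
- by move=> x y g /= ->; exact: lg_inj.
- exact: local_measurable_fun lf.
- by move=> x g /= e; apply: lf; rewrite e restr_lg_id.
- apply: null_ktree.
    apply: (@local_measurable _ _ N) => g g' e; rewrite /setC /mkset e //.
  by move=> g /= hg hT; apply: hg; exists (btr Dl g N); exact: restr_btr.
Qed.

Lemma measure_local N (A : set (lgraph R M)) : local N A -> P A = (\sum_(x : B N) (lg x \in A)%:R * law x)%:E.
Proof.
move=> lA; transitivity (\int[P]_g (\1_A g)%:E)%E.
  by rewrite integral_indic ?setIT//; exact: local_measurable lA.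
rewrite (@integral_local N); last by move=> g; rewrite lee_fin.
  by rewrite -sumEFin; apply: eq_bigr => x _; rewrite indicE EFinM.
by move=> g g' /lA e; rewrite !indicE (_ : (g \in A) = (g' \in A))//; apply/idP/idP => /set_mem h; apply/mem_set; [rewrite -e|rewrite e].
Qed.

Lemma sum_law t : \sum_(x : B t) law x = 1.
Proof.
have := @measure_local t setT (fun _ _ _ => erefl); rewrite probability_setT => -[->].
by apply: eq_bigr => x _; rewrite in_setT mul1r.
Qed.

Lemma law_tr t : push (@tr M Dl t) (@law t.+1) =1 @law t.
Proof.
move=> x; apply: EFin_inj; rewrite -lawE (@measure_local t.+1).
  rewrite /push big_mkcond; congr EFin; apply: eq_bigr => y _.
  case: eqP => [e|ne]; first by rewrite mem_set ?mul1r//= restr_lg e.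
  by rewrite memNset ?mul0r//= restr_lg => /lg_inj.
by apply: local_le (leqnSn t) _ => g g' e; rewrite /mkset e.
Qed.

(** By [relabeled_ktree] the law of the relabeled ball is the symmetrization of [law], so [law]
    equals its own symmetrization. *)
Lemma randomly_labeled_inv t : randomly_labeled P -> inv (@law t).
Proof.
move=> rP; have e : @law t =1 Sym (@law t).
  move=> x; apply: EFin_inj; rewrite -lawE rP (@integral_local t) //; last first.
    by move=> g g' e; rewrite /relabeled e.
  rewrite /Sym /push mulr_suml [in RHS]big_mkcond -sumEFin; apply: eq_bigr => y _.
  have [l0|/law_ktree hy] := eqVneq (law y) 0; first by rewrite l0 mule0 mul0r if_same.
  rewrite (relabeled_ktree x hy) (_ : btr Dl (lg y) t = y) 1?eq_sym.
    by case: eqP; rewrite ?mul1r ?mul0r ?mul0e// -EFinM mulrC.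
  by apply: (@lg_inj R); rewrite -restr_btr// restr_lg_id.
by move=> x y h; rewrite !e; exact: Sym_inv.
Qed.

Lemma btr_lg t (x : B t) : ktree Dl (lg x : lgraph R M) -> btr Dl (lg x : lgraph R M) t = x.
Proof. by move=> h; apply: (@lg_inj R); rewrite -restr_btr// restr_lg_id. Qed.
End tree_laws.

Lemma ktree_recolor (R : realType) (M M' : pFinType) (h : M -> M') Dl (g : lgraph R M) :
  ktree Dl (recolor h g) <-> ktree Dl g.
Proof.
have vE v : verts (recolor h g) v = verts g v by rewrite /verts/=; case: (Defs.col g v).
by split=> -[h1 h2]; split=> // v j; have := h2 v j; rewrite vE.
Qed.

Section galton_watson.
Context {R : realType} (pi : probability nat R) (Dl : nat).
Hypothesis pi_Dl : forall k, (Dl < k)%N -> pmass pi k = 0.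
Variable nu : probability (lgraph R unit) R.
Hypothesis nuU : UGW pi nu.

(** An excess of offspring is a countable union, over labels and numbers, of null events. The bound
    is one less away from the root, because [hat_pmass] is a shift of [pmass]; this leaves room for
    the parent. *)
Lemma UGW_treelike : treelike Dl nu.
Proof.
case: nuU => d [Om [P [N [mN lN eN]]]].
have mass v k : P (N v @^-1` [set k]) = (if v is [::] then pmass pi k else hat_pmass pi k)%:E.
  have := lN [:: v] (fun=> k) isT; rewrite big_seq1 => <-; congr (P _).
  apply/seteqP; split=> w /= h; first by move=> v'; rewrite inE => /eqP ->.
  by apply: h; rewrite inE.
have mlt v j : measurable [set w | (j < N v w)%N].
  rewrite (_ : mkset _ = \bigcup_(k in [set k | (j < k)%N]) N v @^-1` [set k]); last first.
    by apply/seteqP; split=> [w /= h|w [k /= h e]]; [exists (N v w)|rewrite e].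
  by apply: bigcup_measurable => k _; exact: mN.
have null v j : (Dl <= j + (v != [::]))%N -> P [set w | (j < N v w)%N] = 0%E.
  move=> hj; apply: measure_negligible => //.
  rewrite (_ : mkset _ = \bigcup_k (if (j < k)%N then N v @^-1` [set k] else set0)); last first.
    apply/seteqP; split=> [w /= h|w [k _]]; first by exists (N v w); rewrite ?h.
    by case: ifP => // h /= ->.
  apply: negligible_bigcup => k; case: ifPn => [jk|_]; last exact: negligible_set0.
  apply/negligibleP; first exact: mN.
  apply: etrans (mass v k) _; case: v hj => [|a b] /=; rewrite ?addn0 ?addn1 => hj.
    by rewrite pi_Dl//; exact: leq_ltn_trans hj jk.
  by rewrite /hat_pmass pi_Dl ?mulr0 ?mul0r//; exact: leq_ltn_trans hj _.
have mv v : measurable [set w | gw_vert (N ^~ w) v].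
  elim/last_ind: v => [|v j ih].
    by rewrite (_ : mkset _ = setT)//; apply/seteqP.
  rewrite (_ : mkset _ = [set w | gw_vert (N ^~ w) v] `&` [set w | (j < N v w)%N]); first exact: measurableI.
  by apply/seteqP; split=> w /=; rewrite gw_vert_rcons => /andP.
pose F n : set Om := if (choice.unpickle n : option (seq nat * nat)) is Some (v, j) then
  if (Dl <= j + (v != [::]))%N then [set w | gw_vert (N ^~ w) (rcons v j)] else set0 else set0.
rewrite /treelike eN; last by apply: measurableC; exact: measurable_ktree.
apply: measure_negligible; last first.
  apply: (@negligibleS _ _ _ _ (\bigcup_n F n)).
    move=> w /= nk; apply: contrapT => h; apply: nk; split=> [u v /and3P[]//|v j].
    rewrite /verts/=; case gv : (gw_vert _ _) => // _; rewrite ltnNge; apply/negP => le; apply: h.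
    by exists (choice.pickle (v, j)) => //; rewrite /F choice.pickleK le.
  apply: negligible_bigcup => n; rewrite /F; case: (choice.unpickle n) => [[v j]|]; last exact: negligible_set0.
  case: ifP => h; last exact: negligible_set0.
  apply: (@negligibleS _ _ _ _ [set w | (j < N v w)%N]); first by move=> w /=; rewrite gw_vert_rcons => /andP[].
  by apply/negligibleP => //; exact: null.
rewrite (_ : mkset _ = \bigcup_n F n); first apply: bigcupT_measurable => n.
  by rewrite /F; case: (choice.unpickle n) => [[v j]|]//; case: ifP.
apply/seteqP; split=> [w /= nk|w [n _]].
  apply: contrapT => h; apply: nk; split=> [u v /and3P[]//|v j].
  rewrite /verts/=; case gv : (gw_vert _ _) => // _; rewrite ltnNge; apply/negP => le; apply: h.
  by exists (choice.pickle (v, j)) => //; rewrite /F choice.pickleK le.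
rewrite /F; case: (choice.unpickle n) => [[v j]|]//; case: ifP => //= le gv [_ h].
by have := h v j; rewrite /verts/= gv ltnNge le => /(_ isT).
Qed.

Lemma UGW_degree k : nu [set g | (forall j, (j < k)%N -> verts g [:: j]) /\ ~ verts g [:: k]] = (pmass pi k)%:E.
Proof.
case: nuU => d [Om [P [N [mN lN eN]]]]; rewrite eN; last first.
  apply: (@local_measurable _ _ 1) => g g' e; rewrite /mkset.
  have v j : verts g [:: j] <-> verts g' [:: j].
    by rewrite /verts/mkset; have := restr_col 1 g [:: j]; rewrite e restr_col /= => ->.
  by apply/propext; split=> -[h1 h2]; split=> [j jk|/v//]; apply/v; exact: h1.
have := lN [:: [::]] (fun=> k) isT; rewrite big_seq1 => <-; congr (P _).
have v w j : verts (gw_tree R (N ^~ w)) [:: j] = (j < N [::] w)%N.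
  by rewrite /verts/= -[[:: j]]/(rcons [::] j) gw_vert_rcons /=; case: (_ < _)%N.
apply/seteqP; split=> w /= h.
  move=> v'; rewrite inE => /eqP ->; case: h => h1 h2; apply/eqP; rewrite eqn_leq leqNgt; apply/andP; split.
    by apply/negP; rewrite -v.
  by case: (k) h1 => // k' /(_ k' (ltnSn _)); rewrite v.
rewrite v h ?inE// ltnn; split=> // j jk; by rewrite v h ?inE.
Qed.
End galton_watson.

Arguments law {R M Dl} P {t} x.

Section degree_laws.
Context {R : realType} {M : pFinType} {Dl : nat}.
Local Notation B := (B M Dl).

Definition root_kids k (g : lgraph R M) : Prop := (forall j, (j < k)%N -> verts g [:: j]) /\ ~ verts g [:: k].

Lemma local_root_kids k : local 1 (root_kids k).
Proof.
move=> g g' e.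
have v j : verts g [:: j] <-> verts g' [:: j].
  by rewrite /verts/mkset; have := restr_col 1 g [:: j]; rewrite e restr_col /= => ->.
by apply/propext; split=> -[h1 h2]; split=> [j jk|/v//]; apply/v; exact: h1.
Qed.

Lemma verts_lg1 t (x : B t.+1) j : verts (lg x : lgraph R M) [:: j] <-> (j < size (kids x))%N.
Proof.
rewrite /verts/= -onthTE; case: (onth _ _) => [y|] /=; last by split.
by rewrite colB0.
Qed.

Lemma root_kids_lg t (x : B t.+1) k : root_kids k (lg x) <-> size (kids x) = k.
Proof.
split=> [[h1 /verts_lg1 h2]|<-].
  apply/eqP; rewrite eqn_leq leqNgt; apply/andP; split; first exact/negP.
  by case: k h1 {h2} => // k /(_ k (ltnSn k)) /verts_lg1.
by split=> [j|] /=; [move=> h; exact/verts_lg1|move/verts_lg1; rewrite ltnn].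
Qed.

Lemma push_degB_law (P : probability (lgraph R M) R) (pi : probability nat R) t : treelike Dl P ->
  (forall k, P [set g | root_kids k g] = (pmass pi k)%:E) ->
  forall l, push (@degB M Dl t) (law P) l = pmass pi l.
Proof.
move=> tP h l; apply: EFin_inj; rewrite -h (@measure_local _ _ Dl _ tP t.+1); last first.
  exact: local_le (@local_root_kids l).
rewrite /push big_mkcond; congr EFin; apply: eq_bigr => x _.
case: eqP => [e|ne]; first by rewrite mem_set ?mul1r//; apply/root_kids_lg; rewrite -e.
by rewrite memNset ?mul0r//= => /root_kids_lg e; apply: ne; apply: val_inj.
Qed.

Lemma root_deg_lg t (x : B t.+1) : root_deg (lg x : lgraph R M) = size (kids x).
Proof.
rewrite /root_deg.
have e : [set u | adj (lg x : lgraph R M) [::] u] = [set` [seq [:: j] | j <- iota 0 (size (kids x))]].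
  apply/seteqP; split=> [u /=|u /= /mapP[j]].
    case/and3P => _ xu; case/lastP: u xu => // u j xu; rewrite child_rcons => /orP[/eqP e|/andP[]//].
    rewrite e /= in xu *; apply: map_f; rewrite mem_iota add0n /=.
    by apply/(@verts_lg1 _ x).
  rewrite mem_iota add0n /= => /(verts_lg1 x) h ->.
  by rewrite /adjB h colB0 -[[:: j]]/(rcons [::] j) child_rcons eqxx.
rewrite e; transitivity (size [seq [:: j] | j <- iota 0 (size (kids x))]); last by rewrite size_map size_iota.
apply: perm_size; apply: uniq_perm.
- exact: fset_uniq.
- by rewrite map_inj_uniq ?iota_uniq// => ? ? [].
- move=> u; rewrite in_fset_set; last exact: finite_seq.
  by apply/idP/idP => [/set_mem//|h]; exact/mem_set.
Qed.
End degree_laws.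

(** * Edge balls and the edge-biased law *)

Section edge_balls.
Context {R : realType} {M : pFinType}.
Implicit Types (g : lgraph R M) (l u v : label).

(* Distance to the edge between the root and the vertex [:: 0] *)
Definition rho l := if l is 0%N :: l' then size l' else size l.

Lemma rho_rcons l j : (rho l <= rho (rcons l j) <= (rho l).+1)%N.
Proof. by case: l => [|[|i] l] /=; rewrite ?size_rcons ?leqnn ?leqnSn//; case: j. Qed.

Lemma rho_child u v : child u v || child v u -> (rho v <= (rho u).+1)%N.
Proof.
case/orP; first by case/lastP: v => // v j; rewrite child_rcons => /eqP ->; have /andP[] := rho_rcons u j.
case/lastP: u => // u j; rewrite child_rcons => /eqP ->; have /andP[h _] := rho_rcons v j.
exact: leqW.
Qed.

Lemma gball_rho k g w : (forall u v, adj g u v -> child u v || child v u) -> verts g w ->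
  gball g k [set [::]; [:: 0%N]] w <-> (rho w <= k)%N.
Proof.
move=> hT gw; split.
  case=> u [p [u0 up <- pk]]; apply: leq_trans pk; rewrite -[leqRHS]add0n; have <- : (rho u = 0)%N by case: u0 => ->.
  elim: p u {gw u0} up => [|y p ih] u /=; first by rewrite addn0.
  by move=> /andP[/hT/rho_child uy /ih yp]; apply: leq_trans yp _; rewrite addnS -addSn leq_add2r.
elim/last_ind: w k gw => [|w j ih] k gw wk; first by exists [::], [::]; split=> //; left.
have [r0|r0] := posnP (rho (rcons w j)).
  case: w gw {ih wk} r0 => [|i w] gw /=; last by rewrite size_rcons; case: i {gw}.
  by case: j gw => // gw _; exists [:: 0%N], [::]; split=> //; right.
have e : (rho w).+1 = rho (rcons w j).
  by move: r0; case: (w) => [|[|i] w'] /=; rewrite ?size_rcons//; case: j {gw wk}.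
case: k wk => [|k]; first by rewrite -e.
rewrite -e ltnS => wk; have [u [p [u0 up lp sp]]] := ih k (parent_vert gw) wk.
exists u, (rcons p (rcons w j)); split=> //.
- by rewrite rcons_path up lp parent_adj.
- by rewrite last_rcons.
- by rewrite size_rcons.
Qed.

Lemma edge_ballE k g : (forall u v, adj g u v -> child u v || child v u) ->
  edge_ball k.+1 g = Defs.restrict g [set w | (rho w <= k)%N].
Proof.
move=> hT; have m w : verts g w -> (w \in gball g k [set [::]; [:: 0%N]]) = (rho w <= k)%N :> bool.
  by move=> gw; apply/idP/idP => [/set_mem/gball_rho|h]; [exact|apply/mem_set/gball_rho].
have m' w : (w \in [set w | (rho w <= k)%N]) = (rho w <= k)%N :> bool.
  by apply/idP/idP => [/set_mem//|h]; exact/mem_set.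
apply: cgraph_eq => [w|u v] /=; rewrite !m'.
  case e : (Defs.col g w) => [c|]; last by do 2 case: ifP.
  by rewrite m// /verts/mkset e.
case uv : (adj g u v) => //=; rewrite !m//; last exact: adj_col uv.
by apply: (@adj_col _ _ g v u); rewrite adj_sym.
Qed.

(** A path of length at most [k] from the edge stays within distance k + 1 of the root, so it
    survives in the restriction. *)
Lemma local_edge_ball k : local k.+1 (@edge_ball R M k.+1).
Proof.
have sub g g' u p : restr k.+1 g = restr k.+1 g' -> (size u + size p <= k.+1)%N -> path (adj g) u p -> path (adj g') u p.
  move=> e; elim: p u => //= y p ih u; rewrite addnS ltnS => le /andP[uy yp].
  have sy := adj_size uy.
  have uy' : adj g' u y.
    have := restr_adj k.+1 g' u y; rewrite -e restr_adj uy /=.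
    have -> : (size u <= k.+1)%N by move: le; clear; lia.
    have -> : (size y <= k.+1)%N by apply: leq_trans sy _; rewrite ltnS; exact: leq_trans (leq_addr _ _) le.
    by rewrite !andbT => <-.
  by rewrite uy'; apply: ih => //; apply: leq_trans (leq_add sy (leqnn _)) _; rewrite addSn ltnS.
have gb g g' w : restr k.+1 g = restr k.+1 g' -> gball g k [set [::]; [:: 0%N]] w -> gball g' k [set [::]; [:: 0%N]] w /\ (size w <= k.+1)%N.
  move=> e [u [p [u0 up lp sp]]]; have su : (size u <= 1)%N by case: u0 => ->.
  have sup : (size u + size p <= k.+1)%N by move: su sp; clear; lia.
  split; first by exists u, p; split=> //; exact: sub up.
  rewrite -lp; move: up sup; elim: p u {u0 su lp sp} => [|y p ih] u /=; first by rewrite addn0.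
  move=> /andP[/adj_size uy /ih h] le; apply: h; apply: leq_trans (leq_add uy (leqnn _)) _.
  by rewrite addSn -addnS.
move=> g g' e; rewrite /edge_ball.
have mE w : (w \in gball g k [set [::]; [:: 0%N]]) = (w \in gball g' k [set [::]; [:: 0%N]]) :> bool.
  by apply/idP/idP => /set_mem h; apply/mem_set; [have [] := gb _ _ _ e h|have [] := gb _ _ _ (esym e) h].
apply: cgraph_eq => [w|u v] /=; rewrite !mE.
  case: ifP => // /set_mem h; have [_ sw_] := gb _ _ _ (esym e) h.
  by have := restr_col k.+1 g w; rewrite e restr_col sw_.
case hu : (u \in _); rewrite ?andbF//; case hv : (v \in _); rewrite ?andbF//.
have [_ su] := gb _ _ _ (esym e) (set_mem hu); have [_ sv] := gb _ _ _ (esym e) (set_mem hv).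
by have := restr_adj k.+1 g u v; rewrite e restr_adj su sv !andbT => ->.
Qed.
End edge_balls.

Section edge_graphs.
Context {R : realType} {M : pFinType} {Dl : nat}.
Local Notation B := (B M Dl).

(* The tree rooted at a directed edge, [ab.2] and [ab.1] being the branches at its
   origin and at its end *)
Definition egcol k (ab : B k * B k) (l : label) : option M :=
  match l with
  | [::] => colB ab.2 [::]
  | 0%N :: l' => colB ab.1 l'
  | j.+1 :: l' => colB ab.2 (j :: l')
  end.

Definition egadj k (ab : B k * B k) (u v : label) := [&& egcol ab u, egcol ab v & child u v || child v u].

Fact egadj_sym k (ab : B k * B k) : symmetric (egadj ab).
Proof. by move=> u v; rewrite /egadj andbCA orbC. Qed.

Fact egadj_irr k (ab : B k * B k) : irreflexive (egadj ab).
Proof. by move=> u; rewrite /egadj childxx !andbF. Qed.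

Fact egadj_col k (ab : B k * B k) u v : egadj ab u v -> egcol ab u.
Proof. by case/and3P. Qed.

Definition eg k (ab : B k * B k) : cgraph label M := CGraph (egadj_sym ab) (egadj_irr ab) (@egadj_col k ab).

Lemma eg_inj k : injective (@eg k).
Proof.
move=> [a b] [a' b'] /(congr1 (fun h : cgraph label M => Defs.col h)) /= e.
have h l : egcol (a, b) l = egcol (a', b') l by rewrite e.
congr pair; apply: colB_inj => l; first exact: (h (0%N :: l)).
by case: l => [|j l]; [exact: (h [::])|exact: (h (j.+1 :: l))].
Qed.

Lemma cadj_switch u v : child (switch u) (switch v) || child (switch v) (switch u) = child u v || child v u.
Proof.
have c u' v' : child u' v' -> child (switch u') (switch v') || child (switch v') (switch u').
  case/lastP: v' => // v' j; rewrite child_rcons => /eqP ->.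
  case: u' => [|[|i] [|a l]] /=; rewrite /child /parent /= ?size_rcons /= ?eqxx ?orbT//.
  - by case: j => [|j] /=; rewrite ?eqxx ?orbT.
  - by rewrite -[rcons l j]cats1 -[size l]/(size l) -cat_cons take_size_cat ?eqxx.
  - by rewrite -cats1 take_size_cat ?eqxx.
have c2 u' v' : child u' v' || child v' u' -> child (switch u') (switch v') || child (switch v') (switch u').
  by case/orP => /c //; rewrite orbC.
by apply/idP/idP => /c2 //; rewrite !switchK.
Qed.

Lemma cswitch_eg k (ab : B k * B k) : cswitch (eg ab) = eg (ab.2, ab.1).
Proof.
have h l : egcol ab (switch l) = egcol (ab.2, ab.1) l by case: l => [|[|i] [|a l]].
by apply: cgraph_eq => [l|u v] /=; rewrite ?h// /egadj !h cadj_switch.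
Qed.

Lemma edge_ball_lg k (x : B k.+1) : (0 < size (kids x))%N ->
  edge_ball k.+1 (lg x : lgraph R M) = eg (kapj x 0).
Proof.
move=> x0; rewrite edge_ballE; last by move=> u v /and3P[].
have sk := size_kids x; move: (sk) x0; rewrite /kapj; case ek : (kids x) => [//|c s] sD _.
have sD' : (size s <= Dl)%N by exact: ltnW.
have kE : Defs.col (lg x : lgraph R M) =1 (fun l => if l is j :: l' then obind (fun y => colB y l') (onth (c :: s) j) else Some x.1).
  by case=> [|j l]//=; rewrite ek.
have cE l : (if (rho l <= k)%N then Defs.col (lg x : lgraph R M) l else None) = egcol (c, tr (nd x.1 s)) l.
  rewrite kE; case: l => [|[|j] l].
  - by rewrite /= colB0 root_tr.
  - rewrite [rho _]/=; case: leqP => //= h; case e : (colB c l) => [a|//].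
    by have := @colB_size _ _ _ c l; rewrite e leqNgt h => /(_ isT).
  - rewrite [rho _]/= [egcol _ _]colB_tr colBS kids_nd//.
have m' w : (w \in [set w | (rho w <= k)%N]) = (rho w <= k)%N :> bool.
  by apply/idP/idP => [/set_mem//|h]; exact/mem_set.
have rs : rem_at 0 (c :: s) = s by rewrite /rem_at /= drop0.
rewrite rs; apply: cgraph_eq => [l|u v]; first by rewrite -[RHS]/(egcol (c, tr (nd x.1 s)) l) -cE /= m'.
rewrite -[RHS]/([&& egcol (c, tr (nd x.1 s)) u, egcol (c, tr (nd x.1 s)) v & child u v || child v u]).
rewrite -!cE /= !m' /adjB.
by case: (rho u <= k)%N; rewrite ?andbF//; case: (rho v <= k)%N; rewrite ?andbF ?andbT.
Qed.

Section mass.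
Variables (k : nat) (P : B k.+1 -> R).
Hypothesis iP : inv P.

Let fr j (x : B k.+1) : B k.+1 :=
  if (j < size (kids x))%N then nd x.1 (nth (lf k x.1) (kids x) j :: rem_at j (kids x)) else x.
Let bk j (x : B k.+1) : B k.+1 :=
  if (j < size (kids x))%N then nd x.1 (ins_at j (head (lf k x.1) (kids x)) (behead (kids x))) else x.

Let size_fr j (x : B k.+1) : (j < size (kids x))%N -> size (nth (lf k x.1) (kids x) j :: rem_at j (kids x)) = size (kids x).
Proof. by move=> h; rewrite /= size_remS. Qed.

Let kids_fr j (x : B k.+1) : (j < size (kids x))%N -> kids (fr j x) = nth (lf k x.1) (kids x) j :: rem_at j (kids x).
Proof. by move=> h; rewrite /fr h kids_nd// size_fr// size_kids. Qed.

Let frK j : cancel (fr j) (bk j).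
Proof.
move=> x; case h : (j < size (kids x))%N; last by rewrite /fr h /bk h.
rewrite /bk kids_fr// size_fr// h /= ins_rem//.
by rewrite (_ : (fr j x).1 = x.1) ?nd_kids// /fr h.
Qed.

Let P_fr j x : P (fr j x) = P x.
Proof.
apply: iP; rewrite /fr; case: ifP => // h; apply/canonP; split=> //.
rewrite kids_nd ?size_fr ?size_kids// perm_sym -[in X in perm_eq X](ins_rem (lf k x.1) h).
exact: (perm_map _ (perm_ins _ _ _)).
Qed.

(** The edge-biased law distinguishes the first offspring and weighs by the degree, while [Ek] sums
    over all offspring. Moving the branch [j] to the front preserves an invariant law, so the
    existing positions contribute equally. *)
Lemma Ek_first ab : Ek P ab = \sum_(x | (0 < size (kids x))%N && (kapj x 0 == ab)) (size (kids x))%:R * P x.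
Proof.
rewrite EkE (eq_bigr (fun j : 'I_Dl => \sum_(x | (j < size (kids x))%N && (kapj x 0 == ab)) P x)); last first.
  move=> j _; rewrite [RHS](reindex_inj (can_inj (frK j))); apply: eq_big => [x|x _]; last by rewrite P_fr.
  case h : (j < size (kids x))%N; last by rewrite /fr h h.
  rewrite kids_fr// size_fr// h /=; congr (_ == _).
  have fx : (fr j x).1 = x.1 by rewrite /fr h.
  by rewrite /kapj kids_fr// fx /rem_at /= drop0.
rewrite (eq_bigr (fun j : 'I_Dl => \sum_(x | (0 < size (kids x))%N && (kapj x 0 == ab)) (j < size (kids x))%N%:R * P x)); last first.
  move=> j _; rewrite [LHS]big_mkcond [RHS]big_mkcond; apply: eq_bigr => x _.
  case h : (j < size (kids x))%N; last by rewrite mul0r if_same.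
  by rewrite (leq_ltn_trans _ h) ?mul1r.
rewrite exchange_big /=; apply: eq_bigr => x _; rewrite -mulr_suml; congr (_ * _).
rewrite -natr_sum (eq_bigr (fun j : 'I_Dl => if (j < size (kids x))%N then 1 else 0)%N); last by move=> j _; case: ifP.
by rewrite -big_mkcond -(big_ord_widen _ (fun=> 1%N) (size_kids x)) sum1_card card_ord.
Qed.
End mass.
End edge_graphs.

(** The sum in [shannon] runs over an infinite type; [phi] parametrizes a finite set that carries
    the law. *)
Lemma shannon_fin (R : realType) (T : finType) (U : choiceType) (phi : T -> U) (m : U -> R) (q : T -> R) :
  injective phi -> (forall x, m (phi x) = q x) -> (forall u, (forall x, u <> phi x) -> m u = 0) ->
  (forall x, 0 <= q x <= 1) -> shannon m = (shan q)%:E.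
Proof.
move=> iphi mq m0 q01; rewrite /shannon.
have -> : (fun u => (- (m u * ln (m u)))%:E) = (fun u => if u \in range phi then (- (m u * ln (m u)))%:E else 0%E).
  apply/funext => u; case: ifPn => // /negP h; rewrite m0 ?mul0r ?oppr0// => x e.
  by apply: h; apply/mem_set; exists x.
rewrite -esum_mkcond (@reindex_esum _ _ _ setT _ phi); last first.
  by split; [move=> x _; exists x|move=> x y _ _ /iphi|move=> u [x _ <-]; exists x].
have h x : (0 <= (- (m (phi x) * ln (m (phi x))))%:E)%E.
  by rewrite mq lee_fin; apply: eta_ge0; have /andP[] := q01 x.
rewrite esum_fset//; last exact: finite_finset.
rewrite fsbig_finite; last exact: finite_finset.
rewrite sumEFin; congr EFin; rewrite /shan.
rewrite (perm_big (index_enum T)); first by apply: eq_bigr => x _; rewrite mq.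
apply: uniq_perm; [exact: fset_uniq|exact: index_enum_uniq|move=> x].
by rewrite mem_index_enum in_fset_set; [exact/mem_set|exact: finite_finset].
Qed.

(** * [Sigma] and the switch condition on finite trees *)

Section entropy_formula.
Context {R : realType} {M : pFinType} {Dl : nat}.
Local Notation B := (B M Dl).

Lemma local_root_deg : local 1 (@root_deg R M).
Proof.
move=> g g' e; rewrite /root_deg (_ : [set u | adj g [::] u] = [set u | adj g' [::] u])//.
have h (g1 g2 : lgraph R M) u : restr 1 g1 = restr 1 g2 -> adj g1 [::] u -> adj g2 [::] u.
  move=> e' gu; have := restr_adj 1 g1 [::] u; rewrite e' restr_adj gu.
  by rewrite (adj_size gu) /= !andbT => ->.
by apply/seteqP; split=> u; exact: h.
Qed.

Variables (k : nat) (P : probability (lgraph R M) R).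
Hypothesis tP : treelike Dl P.
Local Notation q := (law P : B k.+1 -> R).

Lemma edge_biased_lg (d : R) h :
  edge_biased d P [set g | edge_ball k.+1 g = h] =
  (d^-1 * \sum_(x : B k.+1 | edge_ball k.+1 (lg x : lgraph R M) == h) (size (kids x))%:R * q x)%:E.
Proof.
rewrite /edge_biased EFinM integral_mkcond; congr (_ * _)%E.
rewrite (@integral_local _ _ Dl _ tP k.+1).
- rewrite -sumEFin [RHS]big_mkcond; apply: eq_bigr => x _; rewrite /patch.
  case: eqP => [e|ne]; first by rewrite mem_set// root_deg_lg EFinM.
  by rewrite memNset// mul0e.
- move=> g g' e; have eb := local_edge_ball e; rewrite /patch.
  have -> : (g \in [set g0 | edge_ball k.+1 g0 = h]) = (g' \in [set g0 | edge_ball k.+1 g0 = h]).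
    by apply/idP/idP => /set_mem/= h'; apply/mem_set; rewrite /= ?eb// -eb.
  by rewrite (local_le (ltn0Sn k) local_root_deg e).
- by move=> g; rewrite /patch; case: ifP => // _; rewrite lee_fin.
Qed.

Hypothesis iq : inv q.

Lemma edge_mass_eg (d : R) ab : edge_mass d k.+1 P (eg ab) = Ek q ab / d.
Proof.
rewrite /edge_mass edge_biased_lg /= mulrC (Ek_first iq); congr (_ / _).
rewrite [LHS]big_mkcond [RHS]big_mkcond; apply: eq_bigr => x _.
have [x0|x0] := posnP (size (kids x)); first by rewrite x0 mul0r if_same.
by rewrite /= (edge_ball_lg x0) (inj_eq (@eg_inj _ _ _)).
Qed.

Lemma edge_mass_out (d : R) h : (forall ab : B k * B k, h <> eg ab) -> edge_mass d k.+1 P h = 0.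
Proof.
move=> hh; rewrite /edge_mass edge_biased_lg /= big1 ?mulr0// => x /eqP e.
have [x0|x0] := posnP (size (kids x)); first by rewrite x0 mul0r.
by case: (hh (kapj x 0)); rewrite -e edge_ball_lg.
Qed.

(** [cswitch] exchanges the two components of [eg], and graphs that are not of this form have mass
    0, as have their switched versions. *)
Lemma switch_edge_symm (d : R) : d != 0 ->
  (forall h, edge_mass d k.+1 P (cswitch h) = edge_mass d k.+1 P h) <-> edge_symm (Ek q).
Proof.
move=> d0; have di : d^-1 != 0 by rewrite invr_eq0.
split=> [h a b|h g].
  by have := h (eg (a, b)); rewrite cswitch_eg !edge_mass_eg => /(mulIf di) ->.
have [[ab ->]|ng] := pselect (exists ab : B k * B k, g = eg ab).
  by rewrite cswitch_eg !edge_mass_eg; case: ab => a b; rewrite h.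
rewrite !edge_mass_out//; first by move=> ab e; apply: ng; exists ab.
move=> ab e; apply: ng; exists (ab.2, ab.1).
by rewrite -cswitch_eg -e; apply: cgraph_eq => [l|u v] /=; rewrite !switchK.
Qed.

Variable pi : probability nat R.
Hypothesis pi_Dl : forall l, (Dl < l)%N -> pmass pi l = 0.
Hypothesis degP : forall l, push (@degB M Dl k) q l = pmass pi l.
Hypothesis meanP : fine (mean pi) = mdeg q.
Hypothesis mean0 : 0 < mdeg q.
Hypothesis P1 : forall g, (forall x : B k.+1, g <> lg x) -> P [set g] = 0%E.
Hypothesis P1' : forall x : B k.+1, P [set lg x] = (q x)%:E.

Let q1 (T : finType) (w : T -> R) : (forall x, 0 <= w x) -> \sum_x w x = 1 -> forall x, 0 <= w x <= 1.
Proof. by move=> w0 w1 x; rewrite w0 -w1 (bigD1 x)//= lerDl sumr_ge0. Qed.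

Lemma Sigma_Sig : Sigma pi k.+1 P = (Sig q)%:E.
Proof.
have q0 := law_ge0 P (t := k.+1) (Dl := Dl).
have s1 := sum_law tP k.+1.
rewrite /Sigma meanP (shannon_fin (phi := @lg R M Dl k.+1) (q := q)); last exact: q1.
- rewrite (shannon_fin (phi := @eg M Dl k) (q := fun ab => Ek q ab / mdeg q)).
  + rewrite (shannon_fin (phi := fun l : 'I_Dl.+1 => val l) (q := push (@degB M Dl k) q)) //.
    * move=> l hl; apply: pi_Dl; rewrite ltnNge; apply/negP => le.
      by apply: (hl (Ordinal (le : (l < Dl.+1)%N))).
    * by apply: q1; [exact: push_ge0|rewrite push_sum1].
  + exact: eg_inj.
  + by move=> ab; rewrite edge_mass_eg.
  + by move=> h; exact: edge_mass_out.
  + apply: q1 => [ab|]; first by rewrite divr_ge0 ?Ek_ge0// ltW.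
    by rewrite -mulr_suml sum_Ek1 mulfV// gt_eqF.
- exact: lg_inj.
- by move=> x; rewrite P1'.
- by move=> g /P1 ->.
Qed.
End entropy_formula.

Lemma canon_unf_in (M : finType) Dl (W W' : eqType) (nx : W -> seq W) (nx' : W' -> seq W') (c : W -> M) (c' : W' -> M)
    (h : W' -> W) (Q : W' -> Prop) k x :
  (forall w, size (nx w) <= Dl)%N -> (forall w, size (nx' w) <= Dl)%N ->
  (forall x y, Q x -> y \in nx' x -> Q y) ->
  (forall x, Q x -> perm_eq (nx (h x)) (map h (nx' x))) -> (forall x, Q x -> c (h x) = c' x) -> Q x ->
  canon (unf nx c k (h x) : B M Dl k) = canon (unf nx' c' k x).
Proof.
move=> hD hD' hQ hp hc; elim: k x => [|k ih] x Qx; first by rewrite /unf hc.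
apply/canonP; split; first exact: hc.
rewrite !kids_unf// -!map_comp.
apply: perm_trans (perm_map _ (hp x Qx)) _; rewrite -map_comp.
rewrite (_ : map _ (nx' x) = map (@canon _ _ k \o unf nx' c' k) (nx' x)) //.
by apply/eq_in_map => y yx /=; apply: ih; exact: hQ yx.
Qed.

(** * Unimodularity gives edge symmetry *)

Section edge_counts.
Context {R : realType} {M : pFinType} (Dl k : nat).
Implicit Types (g : lgraph R M) (w : label * label) (u v x : label).
Local Notation B := (B M Dl).

Definition gnbs g x : seq label := enum_fset (fset_set [set u | adj g x u]).

Lemma mem_gnbs g x u : (u \in gnbs g x) = adj g x u.
Proof.
have f : finite_set [set u | adj g x u] by case: (lgraphP g).
by rewrite in_fset_set//; apply/idP/idP => [/set_mem|h]; last exact/mem_set.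
Qed.

Lemma uniq_gnbs g x : uniq (gnbs g x). Proof. exact: fset_uniq. Qed.

(* Junk when there are more than [Dl] neighbors, but invariant under isomorphisms *)
Definition gnx g w : seq (label * label) :=
  let s := [seq (w.2, z) | z <- gnbs g w.2 & z != w.1] in if (size s <= Dl)%N then s else [::].

Lemma size_gnx g w : (size (gnx g w) <= Dl)%N.
Proof. by rewrite /gnx; case: ifP. Qed.

Definition gbr t g u v : B t := unf (gnx g) (fun w => gcol g w.2) t (u, v).

Lemma perm_gnx g w (s : seq (label * label)) : (size s <= Dl)%N ->
  perm_eq [seq (w.2, z) | z <- gnbs g w.2 & z != w.1] s -> perm_eq (gnx g w) s.
Proof. by move=> h p; rewrite /gnx (perm_size p) h. Qed.

Lemma gbr_iso t g g' phi u v : cgiso g g' phi -> verts g u -> verts g v ->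
  canon (gbr t g' (phi u) (phi v)) = canon (gbr t g u v).
Proof.
case=> [[hf hi hs] hc ha] gu gv.
apply: (@canon_unf_in M Dl _ _ (gnx g') (gnx g) (fun w => gcol g' w.2) (fun w => gcol g w.2)
  (fun w => (phi w.1, phi w.2)) (fun w => verts g w.1 /\ verts g w.2) t (u, v)) => //.
- exact: size_gnx.
- exact: size_gnx.
- move=> [a b] y [/= ga gb]; rewrite /gnx; case: ifP => // _ /mapP[z]; rewrite mem_filter mem_gnbs => /andP[_ bz] ->.
  by split=> //=; apply: (@adj_col _ _ g z b); rewrite adj_sym.
- move=> [a b] [/= ga gb].
  have p : perm_eq [seq (phi b, z) | z <- gnbs g' (phi b) & z != phi a]
      [seq (phi w.1, phi w.2) | w <- [seq (b, z) | z <- gnbs g b & z != a]].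
    rewrite -map_comp; apply: uniq_perm.
    + by rewrite map_inj_uniq ?filter_uniq ?uniq_gnbs// => ? ? [].
    + rewrite map_inj_in_uniq ?filter_uniq ?uniq_gnbs// => z z'.
      rewrite !mem_filter !mem_gnbs => /andP[_ bz] /andP[_ bz'] /= [e].
      by apply: hi => //; apply/mem_set; apply: (@adj_col _ _ g _ b); rewrite adj_sym.
    + move=> [x y]; apply/mapP/mapP => -[z]; rewrite mem_filter mem_gnbs => /andP[za bz] [-> ->].
      * have gz : verts g' z by apply: (@adj_col _ _ g' z (phi b)); rewrite adj_sym.
        have [z' gz' ez] := hs _ gz; exists z'; last by rewrite /= ez.
        rewrite mem_filter mem_gnbs -ha// ez bz andbT.
        by apply: contraNneq za => e; rewrite -ez e.
      * have gz : verts g z by apply: (@adj_col _ _ g z b); rewrite adj_sym.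
        exists (phi z) => //; rewrite mem_filter mem_gnbs ha// bz andbT.
        by apply: contraNneq za => e; apply/eqP; apply: hi => //; exact/mem_set.
  have ps := perm_size p; rewrite [X in _ = X]size_map in ps.
  by rewrite /gnx /= ps; case: (_ <= Dl)%N.
- by move=> [a b] [/= ga gb]; rewrite /gcol hc.
Qed.

Lemma gbr_local t N g g' u v : restr N g = restr N g' -> (size v + t < N)%N -> gbr t g u v = gbr t g' u v.
Proof.
move=> e; have a x y : (size x < N)%N -> adj g x y = adj g' x y.
  move=> sx; have h (g1 g2 : lgraph R M) : restr N g1 = restr N g2 -> adj g1 x y -> adj g2 x y.
    move=> e' xy; have := restr_adj N g1 x y; rewrite e' restr_adj xy (ltnW sx).
    by rewrite (leq_trans (adj_size xy) sx) !andbT => ->.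
  by apply/idP/idP; exact: h.
have c x : (size x < N)%N -> gcol g x = gcol g' x.
  by move=> sx; rewrite /gcol; have := restr_col N g x; rewrite e restr_col (ltnW sx) => ->.
have n w : (size w.2 < N)%N -> gnx g w = gnx g' w.
  move=> sw_; rewrite /gnx /gnbs (_ : [set u | adj g w.2 u] = [set u | adj g' w.2 u])//.
  by apply/seteqP; split=> z /=; rewrite a.
suff h w : (size w.2 + t < N)%N -> unf (gnx g) (fun w => gcol g w.2) t w =
    unf (gnx g') (fun w => gcol g' w.2) t w :> B t by exact: (h (u, v)).
elim: t w => [|t ih] w sw_; first by rewrite /unf c//; move: sw_; rewrite addn0.
have sw' : (size w.2 < N)%N by apply: leq_trans sw_; rewrite ltnS leq_addr.
rewrite /unf -/unf c// n//; congr nd; apply/eq_in_map => z; rewrite /gnx; case: ifP => // _.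
case/mapP => y; rewrite mem_filter mem_gnbs => /andP[_ /adj_size sy] -> /=; apply: ih => /=.
by apply: leq_ltn_trans (leq_add sy (leqnn t)) _; rewrite addSn -addnS.
Qed.

(** The test function for unimodularity. It has to be defined on all graphs and invariant under
    isomorphisms, hence branches built from neighbor sets and compared through [canon2]. *)
Definition gedge (ab : B k * B k) g u v : \bar R :=
  ((adj g u v && (canon2 (gbr k g u v, gbr k g v u) == ab))%:R : R)%:E.

Lemma gedge_ge0 ab g u v : (0 <= gedge ab g u v)%E. Proof. by rewrite lee_fin. Qed.

Lemma gedge_sym ab g u v : gedge ab g v u = gedge (ab.2, ab.1) g u v.
Proof.
rewrite /gedge adj_sym; congr ((_ && _)%:R%:E); case: ab => a b.
by rewrite /canon2 /= !(@xpair_eqE (B k) (B k)) andbC.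
Qed.

Lemma gedge_local ab N g g' u v : restr N g = restr N g' -> (size u + k < N)%N -> (size v + k < N)%N ->
  gedge ab g u v = gedge ab g' u v.
Proof.
move=> e su sv; rewrite /gedge (gbr_local u e sv) (gbr_local v e su); congr ((_ && _)%:R%:E).
have := restr_adj N g u v; rewrite e restr_adj.
have -> : (size u <= N)%N by apply: ltnW; exact: leq_ltn_trans (leq_addr _ _) su.
have -> : (size v <= N)%N by apply: ltnW; exact: leq_ltn_trans (leq_addr _ _) sv.
by rewrite !andbT => ->.
Qed.

Lemma esum_gedge ab g : (\esum_(v in verts g) gedge ab g [::] v = \esum_(v in [set: label]) gedge ab g [::] v)%E.
Proof.
rewrite esum_mkcond; apply: eq_esum => v _; case: ifPn => // /negP h.
rewrite /gedge; case uv : (adj g [::] v) => //; case: h; apply/mem_set.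
by apply: (@adj_col _ _ g v [::]); rewrite adj_sym.
Qed.

Lemma local_esum_gedge ab : local k.+2 (fun g => \esum_(v in [set: label]) gedge ab g [::] v)%E.
Proof.
move=> g g' e; apply: eq_esum => v _; have [sv|sv] := leqP (size v) 1.
  by apply: gedge_local e _ _ => //=; rewrite ltnS -[k.+1]add1n leq_add2r.
by rewrite /gedge; case: (boolP (adj g _ _)) => [/adj_size|_]; [rewrite leqNgt sv|];
   case: (boolP (adj g' _ _)) => [/adj_size|_] //; rewrite leqNgt sv.
Qed.

Lemma kaps_btr g : ktree Dl g -> kaps (btr Dl g k.+1) =
  [seq (unf (gkids Dl g) (gcol g) k v,
        tr (nd (gcol g [::]) (map (unf (gkids Dl g) (gcol g) k) [seq z <- gkids Dl g [::] | z != v]))) | v <- gkids Dl g [::]].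
Proof.
move=> hT; have ug : uniq (gkids Dl g [::]).
  by rewrite map_inj_uniq ?iota_uniq// => i j /rcons_inj[].
rewrite /kaps /btr kids_unf; last exact: size_gkids.
by rewrite map_picks picks_uniq// -!map_comp.
Qed.

Let gnx_child g x : ktree Dl g -> x != [::] ->
  perm_eq (gnx g (parent x, x)) (map (fun z => (parent z, z)) (gkids Dl g x)).
Proof.
move=> hT x0; apply: perm_gnx; first by rewrite size_map; exact: size_gkids.
apply: uniq_perm.
- by rewrite map_inj_uniq ?filter_uniq ?uniq_gnbs// => ? ? [].
- by rewrite map_inj_uniq; [rewrite map_inj_uniq ?iota_uniq// => i j /rcons_inj[]|move=> ? ? []].
move=> [a b]; apply/mapP/mapP => -[z].
  rewrite mem_filter mem_gnbs => /andP[zx xz] [-> ->]; exists z => /=.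
    rewrite mem_gkids//; have gz : verts g z by apply: (@adj_col _ _ g z x); rewrite adj_sym.
    rewrite (_ : (Defs.col g z : bool) = true) //=; case/orP: (hT.1 _ _ xz) => // /andP[_ /eqP e].
    by rewrite /= e eqxx in zx.
  case/orP: (hT.1 _ _ xz) => /andP[_ /eqP e]; first by rewrite e.
  by rewrite /= e eqxx in zx.
rewrite mem_gkids// => /andP[gz xz] [-> ->]; exists z => /=.
  move: gz xz; case/lastP: z => // z j gz; rewrite child_rcons => /eqP e; subst z.
  rewrite mem_filter mem_gnbs (parent_adj gz) andbT; apply/eqP => /(congr1 size) /= e.
  have : (size (parent x) <= size x)%N by rewrite size_take_min geq_minr.
  by rewrite -e size_rcons ltnn.
by case/andP: xz => _ /eqP ->.
Qed.

Lemma gbr_child t g x : ktree Dl g -> x != [::] ->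
  canon (gbr t g (parent x) x) = canon (unf (gkids Dl g) (gcol g) t x).
Proof.
move=> hT x0.
apply: (@canon_unf_in M Dl _ _ (gnx g) (gkids Dl g) (fun w => gcol g w.2) (gcol g)
  (fun z => (parent z, z)) (fun z => z != [::])) => //.
- exact: size_gnx.
- exact: size_gkids.
- by move=> z y _ /mapP[j _ ->]; case: (z).
- by move=> z z0; exact: gnx_child.
Qed.

Lemma gbr_root g x : ktree Dl g -> x \in gkids Dl g [::] ->
  canon (gbr k g x [::]) =
  canon (tr (nd (gcol g [::]) (map (unf (gkids Dl g) (gcol g) k) [seq z <- gkids Dl g [::] | z != x]))).
Proof.
move=> hT hx; have sk := @size_gkids R M Dl g [::].
have sf : (size [seq z <- gkids Dl g [::] | z != x] <= Dl)%N by apply: leq_trans sk; rewrite size_filter count_size.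
case: k => [|t]; first by [].
apply/canonP; split; first by [].
rewrite /gbr kids_unf; last exact: size_gnx.
rewrite kids_tr kids_nd ?size_map// -!map_comp.
have p : perm_eq (gnx g (x, [::])) [seq (parent z, z) | z <- [seq z <- gkids Dl g [::] | z != x]].
  apply: perm_gnx; first by rewrite size_map.
  apply: uniq_perm.
  - by rewrite map_inj_uniq ?filter_uniq ?uniq_gnbs// => ? ? [].
  - by rewrite map_inj_uniq ?filter_uniq//; [rewrite map_inj_uniq ?iota_uniq// => i j /rcons_inj[]|move=> ? ? []].
  move=> [a b]; apply/mapP/mapP => -[z]; rewrite mem_filter => /andP[zx].
    rewrite mem_gnbs => gz [-> ->]; exists z.
      rewrite mem_filter zx mem_gkids//; have gz' : verts g z by apply: (@adj_col _ _ g z [::]); rewrite adj_sym.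
      by rewrite (_ : (Defs.col g z : bool) = true) //=; case/orP: (hT.1 _ _ gz).
    by case/orP: (hT.1 _ _ gz) => // /andP[_ /eqP ->].
  rewrite mem_gkids// => /andP[gz cz] [-> ->]; exists z.
    rewrite mem_filter zx mem_gnbs; move: gz cz; case/lastP: (z) => // z' j gz.
    by rewrite child_rcons => /eqP e; subst z'; exact: (parent_adj gz).
  by case/andP: cz => _ /eqP ->.
apply: perm_trans (perm_map _ p) _; rewrite -map_comp.
match goal with |- is_true (perm_eq ?a ?b) => suff -> : a = b by exact: perm_refl end.
apply/eq_in_map => z; rewrite mem_filter => /andP[_ hz] /=; rewrite tr_unf; last exact: size_gkids.
apply: gbr_child => //; move: hz; rewrite mem_gkids// => /andP[_].
by case: (z).
Qed.

(** On a tree the neighbors of the root are its offspring, and the branches on the two sides of such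
    an edge are, up to order, the components of an entry of [kaps]. *)
Lemma esum_gedge_ktree ab g : ktree Dl g ->
  (\esum_(v in [set: label]) gedge ab g [::] v = (count_mem ab (map (@canon2 M Dl k) (kaps (btr Dl g k.+1))))%:R%:E)%E.
Proof.
move=> hT; have ug : uniq (gkids Dl g [::]).
  by rewrite map_inj_uniq ?iota_uniq// => i j /rcons_inj[].
have off v : v \notin gkids Dl g [::] -> gedge ab g [::] v = 0%E.
  rewrite /gedge; case gv : (adj g [::] v) => //; rewrite mem_gkids//.
  have gv' : verts g v by apply: (@adj_col _ _ g v [::]); rewrite adj_sym.
  rewrite (_ : (Defs.col g v : bool) = true) //=; case/orP: (hT.1 _ _ gv) => [->//|/andP[]//].
transitivity (\esum_(v in [set` gkids Dl g [::]]) gedge ab g [::] v)%E.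
  rewrite [RHS]esum_mkcond; apply: eq_esum => v _; case: ifPn => // /negP h.
  by apply: off; apply/negP => h'; apply: h; exact/mem_set.
rewrite esum_fset; [|exact: finite_seq|by move=> *; exact: gedge_ge0].
rewrite -fsbig_seq// kaps_btr// -map_comp count_map -sum1_count natr_sum -sumEFin [RHS]big_mkcond.
rewrite big_seq [RHS]big_seq; apply: eq_bigr => v hv; rewrite /gedge.
have v0 : v != [::] by move: (hv); rewrite mem_gkids// => /andP[_]; case: (v).
have pv : parent v = [::] by move: (hv); rewrite mem_gkids// => /andP[_ /andP[_ /eqP]].
have -> : adj g [::] v.
  move: (hv); rewrite mem_gkids// => /andP[]; case/lastP: (v) => // z j gz.
  by rewrite child_rcons => /eqP e; subst z; exact: (parent_adj gz).
by rewrite /canon2 /= -(gbr_child k hT v0) pv -gbr_root//; case: eqP.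
Qed.

Variable mu : probability (lgraph R M) R.
Hypotheses (tmu : treelike Dl mu) (umu : unimodular mu).

Lemma integral_gedge ab : (\int[mu]_g (\esum_(v in [set: label]) gedge ab g [::] v) =
  (push (@canon2 M Dl k) (Ek (law mu)) ab)%:E)%E.
Proof.
rewrite (@integral_local _ _ Dl _ tmu k.+2); [|exact: local_esum_gedge|by move=> g; apply: esum_ge0 => v _; exact: gedge_ge0].
transitivity (\sum_(x : B k.+2) law mu x * (count_mem ab (map (@canon2 M Dl k) (kaps (tr x))))%:R)%:E.
  rewrite -sumEFin; apply: eq_bigr => x _.
  have [->|/(law_ktree tmu) hx] := eqVneq (law mu x) 0; first by rewrite mule0 mul0r.
  rewrite esum_gedge_ktree// -EFinM mulrC.
  by rewrite (_ : btr Dl (lg x) k.+1 = tr x)//; apply: (@lg_inj R); rewrite -restr_btr// restr_lg.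
congr EFin; rewrite -(sum_push (@tr M Dl k.+1) (law mu) (fun y => (count_mem ab (map (@canon2 M Dl k) (kaps y)))%:R)).
transitivity (\sum_cd Ek (law mu) cd * (canon2 cd == ab)%:R); last first.
  by rewrite /push [RHS]big_mkcond; apply: eq_bigr => cd _; case: eqP; rewrite ?mulr1 ?mulr0.
rewrite sum_Ek; apply: eq_bigr => y _; rewrite law_tr//; congr (_ * _).
by rewrite count_map -sum1_count natr_sum [RHS]big_mkcond [LHS]big_mkcond; apply: eq_bigr => cd _ /=; case: eqP.
Qed.

(** Mass transport for [gedge (a, b)]: exchanging the two vertices exchanges [a] and [b]. *)
Lemma unimodular_edge_symm : inv (law mu : B k.+1 -> R) -> edge_symm (Ek (law mu : B k.+1 -> R)).
Proof.
move=> iP; apply: edge_symm_inv iP _ => a b.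
have meas (f : label -> lgraph R M -> \bar R) v N : local N (f v) -> measurable_fun [set g : lgraph R M | verts g v] (f v).
  by move=> lf; apply: measurable_funS (local_measurable_fun lf).
have H2 g g' phi u v : cgiso g g' phi -> verts g u -> verts g v ->
    gedge (a, b) g' (phi u) (phi v) = gedge (a, b) g u v.
  by move=> h gu gv; rewrite /gedge /canon2 /= !(gbr_iso k h)//; case: h => _ _ ->.
have H3 v : measurable_fun [set g : lgraph R M | verts g v] (fun g => gedge (a, b) g [::] v).
  apply: (meas (fun v g => gedge (a, b) g [::] v) v (size v + k).+1) => g g' e.
  by apply: gedge_local e _ _ => //=; rewrite add0n ltnS leq_addl.
have H4 v : measurable_fun [set g : lgraph R M | verts g v] (fun g => gedge (a, b) g v [::]).
  apply: (meas (fun v g => gedge (a, b) g v [::]) v (size v + k).+1) => g g' e.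
  by apply: gedge_local e _ _ => //=; rewrite add0n ltnS leq_addl.
have := @umu (gedge (a, b)) (@gedge_ge0 (a, b)) H2 H3 H4.
have e1 : (fun g : lgraph R M => \esum_(v in verts g) gedge (a, b) g [::] v)%E =
    (fun g => \esum_(v in [set: label]) gedge (a, b) g [::] v)%E.
  by apply/funext => g; exact: esum_gedge.
have e2 : (fun g : lgraph R M => \esum_(v in verts g) gedge (a, b) g v [::])%E =
    (fun g => \esum_(v in [set: label]) gedge (b, a) g [::] v)%E.
  by apply/funext => g; rewrite -esum_gedge; apply: eq_esum => v _; exact: gedge_sym.
by rewrite e1 e2 !integral_gedge => -[].
Qed.
End edge_counts.

(** * The Markov property as an exchange identity *)

Section markov_law.
Context {R : realType} {M : pFinType} {Dl : nat} (k : nat) (mu : probability (lgraph R M) R).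
Hypotheses (tmu : treelike Dl mu) (mk : r_markov k.+1 mu).
Local Notation B := (B M Dl).

Section depth.
Variable K : nat.
Hypothesis kK : (k <= K)%N.

(** An event on colors alone is sufficient: in a labeled tree, the set of labels that are vertices
    determines the adjacency. *)
Let Lf (y : B K.+2) : set (cgraph label M) :=
  [set h | forall l, (size l <= K.+2)%N -> ~~ prefix [:: 0%N] l -> Defs.col h l = colB y l].
Let Rf (y : B K.+2) : set (cgraph label M) :=
  [set h | forall l, (size l <= K.+2)%N -> prefix [:: 0%N] l -> Defs.col h l = colB y l].
Let lft (g : lgraph R M) := Defs.restrict g [set w | ~~ prefix [:: 0%N] w].
Let rgt (g : lgraph R M) := Defs.restrict g [set w | prefix [:: 0%N] w].
Let LA y : set (lgraph R M) := lft @^-1` (Lf y).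
Let RA y : set (lgraph R M) := rgt @^-1` (Rf y).
Let C c : set (lgraph R M) := [set g | edge_ball k.+1 g = c].

Let LAE y g : LA y g <-> forall l, (size l <= K.+2)%N -> ~~ prefix [:: 0%N] l -> Defs.col g l = colB y l.
Proof.
have m l : ~~ prefix [:: 0%N] l -> (l \in [set w | ~~ prefix [:: 0%N] w]) = true by move=> h; apply/mem_set.
by split=> h l sl pl; have := h l sl pl; rewrite /= m.
Qed.

Let RAE y g : RA y g <-> forall l, (size l <= K.+2)%N -> prefix [:: 0%N] l -> Defs.col g l = colB y l.
Proof.
have m l : prefix [:: 0%N] l -> (l \in [set w | prefix [:: 0%N] w]) = true by move=> h; apply/mem_set.
by split=> h l sl pl; have := h l sl pl; rewrite /= m.
Qed.

Let colloc (g g' : lgraph R M) l : restr K.+2 g = restr K.+2 g' -> (size l <= K.+2)%N -> Defs.col g l = Defs.col g' l.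
Proof. by move=> e sl; have := restr_col K.+2 g l; rewrite e restr_col sl. Qed.

Let lLA y : local K.+2 (LA y).
Proof.
have h (g g' : lgraph R M) : restr K.+2 g = restr K.+2 g' -> LA y g -> LA y g'.
  by move=> e /LAE h; apply/LAE => l sl pl; rewrite -(colloc e)// h.
by move=> g g' e; apply/propext; split; exact: h.
Qed.

Let lRA y : local K.+2 (RA y).
Proof.
have h (g g' : lgraph R M) : restr K.+2 g = restr K.+2 g' -> RA y g -> RA y g'.
  by move=> e /RAE h; apply/RAE => l sl pl; rewrite -(colloc e)// h.
by move=> g g' e; apply/propext; split; exact: h.
Qed.

Let lC c : local K.+2 (C c).
Proof.
have le : (k.+1 <= K.+2)%N by rewrite ltnS leqW.
by move=> g g' /(local_le le (@local_edge_ball R M k)) e; rewrite /C /mkset e.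
Qed.

Let P_E (y : B K.+2) c : edge_ball k.+1 (lg y : lgraph R M) = c ->
  mu (C c `&` (LA y `&` RA y)) = (law mu y)%:E.
Proof.
move=> ey; rewrite (@measure_local _ _ Dl _ tmu K.+2); last first.
  move=> g g' e; rewrite /setI /mkset; congr (_ /\ (_ /\ _)).
  - exact: lC e.
  - exact: lLA e.
  - exact: lRA e.
congr EFin; rewrite (bigD1 y)//= big1 ?addr0 ?mem_set ?mul1r//.
  by split=> //; split; [apply/LAE|apply/RAE].
move=> x xy; rewrite memNset ?mul0r// => -[_ [/LAE h1 /RAE h2]]; case/eqP: xy; apply: colB_inj => l.
have [sl|sl] := leqP (size l) K.+2; first by case: (boolP (prefix [:: 0%N] l)) => pl; [exact: h2|exact: h1].
have n (z : B K.+2) : colB z l = None.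
  by case e : (colB z l) => [a|//]; have := @colB_size _ _ _ z l; rewrite e leqNgt sl => /(_ isT).
by rewrite !n.
Qed.

Lemma edge_ball_le (g : lgraph R M) : (forall u v, adj g u v -> child u v || child v u) ->
  edge_ball k.+1 g = Defs.restrict (edge_ball K.+1 g) [set w | (rho w <= k)%N].
Proof.
move=> hT; rewrite !edge_ballE//.
have m' j w : (w \in [set w | (rho w <= j)%N]) = (rho w <= j)%N :> bool.
  by apply/idP/idP => [/set_mem//|h]; exact/mem_set.
apply: cgraph_eq => [w|u v] /=; rewrite !m'.
  by case: leqP => // h; rewrite (leq_trans h kK).
case hu : (rho u <= k)%N; rewrite ?andbF//; case hv : (rho v <= k)%N; rewrite ?andbF//.
by rewrite (leq_trans hu kK) (leq_trans hv kK) !andbT.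
Qed.

Let eb m (b : B K.+1) s : (size s < Dl)%N ->
  edge_ball k.+1 (lg (nd m (b :: s) : B K.+2) : lgraph R M) =
  Defs.restrict (eg (tr b, tr (tr (nd m s : B K.+2)))) [set w | (rho w <= k)%N].
Proof.
move=> sD; rewrite edge_ball_le; last by move=> u v /and3P[].
congr Defs.restrict; set y := nd m (b :: s) : B K.+2.
have ky : kids (tr y) = tr b :: map (@tr M Dl K) s by rewrite kids_tr kids_nd.
rewrite (@local_edge_ball R M K (lg y) (lg (tr y))); last by rewrite restr_lg restr_lg_id.
rewrite edge_ball_lg ?ky//; congr eg; rewrite /kapj ky /rem_at /= drop0; congr pair.
by rewrite trS kids_nd// ltnW.
Qed.

(** The Markov property at the edge between the root and its first offspring. The four trees have
    the same edge ball [c], since the branches and the rests agree after truncation at depth [K],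
    which is at least [k]. Given [c], the mass of a tree is the product of a factor for the root
    color and the other branches and a factor for the first branch, and exchanging [b] and [b']
    permutes these factors. *)
Lemma markov_exchange m m' (b b' : B K.+1) (s s' : seq (B K.+1)) :
  (size s < Dl)%N -> (size s' < Dl)%N ->
  tr b = tr b' -> tr (tr (nd m s : B K.+2)) = tr (tr (nd m' s' : B K.+2)) ->
  law mu (nd m (b :: s) : B K.+2) * law mu (nd m' (b' :: s') : B K.+2) =
  law mu (nd m (b' :: s) : B K.+2) * law mu (nd m' (b :: s') : B K.+2).
Proof.
move=> sD sD' tb ts; set x := nd m (b :: s); set x' := nd m' (b' :: s').
set z := nd m (b' :: s); set z' := nd m' (b :: s').
pose c := edge_ball k.+1 (lg (x : B K.+2) : lgraph R M).
have ex' : edge_ball k.+1 (lg (x' : B K.+2) : lgraph R M) = c by rewrite /c !eb// tb ts.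
have ez : edge_ball k.+1 (lg (z : B K.+2) : lgraph R M) = c by rewrite /c !eb// tb.
have ez' : edge_ball k.+1 (lg (z' : B K.+2) : lgraph R M) = c by rewrite /c !eb// ts.
have vc : verts c [:: 0%N] by rewrite /verts /mkset /c eb// [Defs.col _ _]/= mem_set// colB0.
have colE n (a : B K.+1) t l : (size t < Dl)%N ->
    colB (nd n (a :: t) : B K.+2) l = if l is j :: l' then obind (fun y => colB y l') (onth (a :: t) j) else Some n.
  by move=> tD; case: l => [|j l] //; rewrite colBS kids_nd.
have p0 (l : label) : prefix [:: 0%N] l = (if l is 0%N :: _ then true else false).
  by case: l => [|[|j] l] //; exact: prefix0s.
have LE n a a' t : (size t < Dl)%N -> LA (nd n (a :: t)) = LA (nd n (a' :: t)).
  move=> tD; have h a1 a2 g : LA (nd n (a1 :: t)) g -> LA (nd n (a2 :: t)) g.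
    move=> /LAE h; apply/LAE => l sl pl; rewrite (h l sl pl) !colE//.
    by move: pl; rewrite p0; case: (l) => [|[|j] l'].
  by apply/seteqP; split=> g; exact: h.
have RE a n n' t t' : (size t < Dl)%N -> (size t' < Dl)%N -> RA (nd n (a :: t)) = RA (nd n' (a :: t')).
  move=> tD tD'; have h n1 n2 t1 t2 g : (size t1 < Dl)%N -> (size t2 < Dl)%N -> RA (nd n1 (a :: t1)) g -> RA (nd n2 (a :: t2)) g.
    move=> h1 h2 /RAE h; apply/RAE => l sl pl; rewrite (h l sl pl) !colE//.
    by move: pl; rewrite p0; case: (l) => [|[|j] l'].
  by apply/seteqP; split=> g; exact: h.
have mC : measurable (C c) by exact: local_measurable (@lC c).
have mL y : measurable (LA y) by exact: local_measurable (@lLA y).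
have mR y : measurable (RA y) by exact: local_measurable (@lRA y).
have mCL y : measurable (C c `&` LA y) by exact: measurableI.
have mCR y : measurable (C c `&` RA y) by exact: measurableI.
pose al := fine (mu (C c)); pose ll y := fine (mu (C c `&` LA y)); pose rr y := fine (mu (C c `&` RA y)).
have key y : edge_ball k.+1 (lg y : lgraph R M) = c -> al * law mu y = ll y * rr y.
  move=> ey; apply: EFin_inj; rewrite !EFinM /al /ll /rr !fineK ?fin_num_measure//; last exact: measurable_atom.
  have := P_E ey; rewrite -lawE => <-.
  exact: (mk (A := Lf y) (B := Rf y) (v := [:: 0%N]) (c := c) isT vc (mL y) (mR y)).
have le0 (y : B K.+2) : edge_ball k.+1 (lg y : lgraph R M) = c -> law mu y <= al.
  move=> ey; rewrite -lee_fin -(P_E ey) /al fineK ?fin_num_measure//.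
  by apply: le_measure; rewrite ?inE//; apply: measurableI => //; exact: measurableI.
have kx := key x erefl; have kx' := key x' ex'; have kz := key z ez; have kz' := key z' ez'.
have eL : ll z = ll x by rewrite /ll /z (LE m b' b s sD).
have eL' : ll z' = ll x' by rewrite /ll /z' (LE m' b b' s' sD').
have eR : rr z = rr x' by rewrite /rr /z (RE b' m m' s s').
have eR' : rr z' = rr x by rewrite /rr /z' (RE b m' m s' s).
have [a0|a0] := eqVneq al 0.
  have z0 (y : B K.+2) : edge_ball k.+1 (lg y : lgraph R M) = c -> law mu y = 0.
    by move=> ey; apply/eqP; rewrite eq_le -{1}a0 le0// law_ge0.
  by rewrite (z0 x)// (z0 z)// !mul0r.
apply: (mulfI a0); apply: (mulfI a0).
have -> : al * (al * (law mu x * law mu x')) = (al * law mu x) * (al * law mu x') by lra.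
have -> : al * (al * (law mu z * law mu z')) = (al * law mu z) * (al * law mu z') by lra.
by rewrite kx kx' kz kz' eL eL' eR eR'; lra.
Qed.
End depth.

Hypotheses (rl : randomly_labeled mu) (um : unimodular mu)
  (d0 : forall t, 0 < mdeg (law mu : B t.+1 -> R)).

Lemma Sig_markov d : Sig (law mu : B k.+1 -> R) <= Sig (law mu : B (d + k).+1 -> R).
Proof.
elim: d => // d ih; apply: le_trans ih _.
have e : (law mu : B (d + k).+1 -> R) = push (@tr M Dl (d + k).+1) (law mu : B (d + k).+2 -> R).
  by apply/funext => x; rewrite law_tr.
rewrite e; apply: markov_Sig.
- exact: law_ge0.
- exact: randomly_labeled_inv.
- by move=> *; apply: markov_exchange => //; exact: leq_addl.
- exact: d0.
- by apply: unimodular_edge_symm => //; exact: randomly_labeled_inv.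
Qed.
End markov_law.

(** * Laws carried by finite trees, and couplings *)

Section resizing.
Context {R : realType} {M : pFinType} {Dl : nat}.
Local Notation B := (B M Dl).

Fixpoint pad k : B k -> B k.+1 :=
  match k with
  | 0 => fun x => nd x [::]
  | k'.+1 => fun x => nd x.1 (map (@pad k') (kids x))
  end.

Lemma kids_pad k (x : B k.+1) : kids (pad x) = map (@pad k) (kids x).
Proof. by rewrite /= kids_nd// size_map size_kids. Qed.

Arguments pad : simpl never.

Lemma pad_sw l i k (x : B k) : pad (sw l i x) = sw l i (pad x).
Proof.
elim: k l x => [|k ih] l x.
  have e0 : sw l i x = x by case: l.
  rewrite e0; apply: B_eq; first by rewrite [RHS]sw1.
  by rewrite kids_sw !kids_nd//; case: l {e0} => [|j l]; [case: i|case: j].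
apply: B_eq; first exact: etrans (sw1 l i x) (esym (sw1 l i (pad x))).
rewrite kids_pad !kids_sw kids_pad; case: l => [|j l]; first by rewrite map_swl.
by rewrite (map_upd (g' := @sw M Dl l i k.+1)).
Qed.

Lemma colB_pad k (x : B k) l : colB (pad x) l = colB x l.
Proof.
elim: k x l => [|k ih] x [|j l] //; rewrite !colBS ?kids_pad ?onth_map.
  by rewrite kids_nd//; case: j.
by case: (onth _ _) => [y|] //=; exact: ih.
Qed.

Lemma lg_pad k (x : B k) : lg (pad x) = lg x :> lgraph R M.
Proof.
apply/lgraph_eq/cgraph_eq => [l|u v]; first exact: colB_pad.
by rewrite -[LHS]/(adjB (pad x) u v) -[RHS]/(adjB x u v) /adjB !colB_pad.
Qed.

(** The tree is padded to depth t + k and then truncated down to [t], which treats [t] below and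
    above [k] together. *)
Lemma resize k t : exists beta : B k -> B t,
  (forall l i x, beta (sw l i x) = sw l i (beta x)) /\
  (forall x, restr t (lg x) = lg (beta x) :> lgraph R M).
Proof.
have up d : exists beta : B k -> B (d + k),
    (forall l i x, beta (sw l i x) = sw l i (beta x)) /\ (forall x, lg x = lg (beta x) :> lgraph R M).
  elim: d => [|d [beta [h1 h2]]]; first by exists id.
  exists (fun x => pad (beta x)); split=> [l i x|x]; first by rewrite h1 pad_sw.
  by rewrite lg_pad.
have down d : (exists beta : B k -> B (d + t),
    (forall l i x, beta (sw l i x) = sw l i (beta x)) /\
    (forall x, restr (d + t) (lg x) = lg (beta x) :> lgraph R M)) -> exists beta : B k -> B t,
    (forall l i x, beta (sw l i x) = sw l i (beta x)) /\ (forall x, restr t (lg x) = lg (beta x) :> lgraph R M).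
  elim: d => [//|d ih] [beta [h1 h2]]; apply: ih.
  exists (fun x => tr (beta x)); split=> [l i x|x]; first by rewrite h1 tr_sw.
  by rewrite -restr_lg -h2; apply: (restr_le (leqnSn _)); rewrite restr_restr.
apply: (down k); rewrite addnC; have [beta [h1 h2]] := up t; exists beta; split=> // x.
by rewrite h2 restr_lg_id.
Qed.
End resizing.

Section carried.
Context {R : realType} {M : pFinType} {Dl k : nat}.
Local Notation B := (B M Dl).
Variables (P : probability (lgraph R M) R) (q : B k.+1 -> R).
Hypotheses (PE : forall A, measurable A -> P A = (\sum_x (lg x \in A)%:R * q x)%:E)
  (qT : forall x, q x != 0 -> ktree Dl (lg x : lgraph R M)).

Lemma carried_treelike : treelike Dl P.
Proof.
rewrite /treelike PE; last by apply: measurableC; exact: measurable_ktree.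
congr EFin; apply: big1 => x _; have [->|/qT hx] := eqVneq (q x) 0; first by rewrite mulr0.
by rewrite memNset ?mul0r// => /(_ hx).
Qed.

Lemma carried_law t (y : B t) (beta : B k.+1 -> B t) :
  (forall x, restr t (lg x) = lg (beta x) :> lgraph R M) -> law P y = push beta q y.
Proof.
move=> hb; apply: EFin_inj; rewrite -lawE PE; last exact: measurable_atom.
congr EFin; rewrite /push [RHS]big_mkcond; apply: eq_bigr => x _; case: eqP => [e|ne].
  by rewrite mem_set ?mul1r//= hb e.
by rewrite memNset ?mul0r//= hb => /lg_inj.
Qed.

Lemma carried_law_id : law P =1 q.
Proof.
move=> x; rewrite (@carried_law k.+1 x id); first by rewrite /push big_pred1_eq.
by move=> y; exact: restr_lg_id.
Qed.

Lemma carried_set1 (x : B k.+1) : P [set lg x] = (law P x)%:E.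
Proof.
rewrite PE; last exact: measurable_set1_lgraph.
rewrite carried_law_id (bigD1 x)//= mem_set// mul1r big1 ?addr0// => y yx.
by rewrite memNset ?mul0r// => /lg_inj e; rewrite e eqxx in yx.
Qed.

Lemma carried_out g : (forall x : B k.+1, g <> lg x) -> P [set g] = 0%E.
Proof.
move=> h; rewrite PE; last exact: measurable_set1_lgraph.
by congr EFin; apply: big1 => x _; rewrite memNset ?mul0r//= => /esym/h.
Qed.

(** Random labeling has to be checked at every depth [t], below or above k + 1; [resize] transports
    the invariance of [q] to all depths. *)
Lemma carried_labeled : inv q -> randomly_labeled P.
Proof.
move=> iq t h; have tP := carried_treelike.
have [beta [b1 b2]] := @resize R M Dl k.+1 t.
have il : inv (law P : B t -> R).
  have -> : law P = push beta q by apply/funext => y; exact: carried_law.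
  exact: inv_push.
rewrite (@integral_local _ _ Dl _ tP t); last 2 first.
- by move=> g g' e; rewrite /relabeled e.
- by move=> g; exact: measure_ge0.
have [[y ->]|ny] := pselect (exists y : B t, h = lg y).
  rewrite lawE -(Sym_id il) /Sym /push mulr_suml big_mkcond -sumEFin; apply: eq_bigr => x _.
  have [->|/(law_ktree tP) hx] := eqVneq (law P x) 0; first by rewrite mule0 mul0r if_same.
  rewrite (relabeled_ktree y hx) btr_lg// eq_sym.
  by case: eqP; rewrite ?mul1r ?mul0r ?mul0e// -EFinM mulrC.
rewrite (null_ktree tP); last 2 first.
- exact: measurable_atom.
- by move=> g /= e hg; apply: ny; exists (btr Dl g t); rewrite -e; exact: restr_btr.
rewrite big1// => x _; have [->|/(law_ktree tP) hx] := eqVneq (law P x) 0; first by rewrite mule0.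
by rewrite (relabeled_out hx) ?mul0e// => y e; apply: ny; exists y.
Qed.
End carried.

Section finite_laws.
Context {R : realType} {M : pFinType} {Dl k : nat}.
Local Notation B := (B M Dl).

(** A combination of Dirac masses. The norm and the normalization make it a probability for every
    [q]; for a law [q] the weights are those of [q] ([finlawE]). *)
Definition finlaw (q : B k.+1 -> R) : probability (lgraph R M) R :=
  mnormalize (msum (fun i => mscale (NngNum (normr_ge0 (q (nth (lf k.+1 point) (enum (B k.+1)) i))))
     (\d_(lg (nth (lf k.+1 point) (enum (B k.+1)) i)) : {measure set (lgraph R M) -> \bar R}))
     (size (enum (B k.+1)))) (\d_point).

Lemma finlawE (q : B k.+1 -> R) A : (forall x, 0 <= q x) -> \sum_x q x = 1 ->
  finlaw q A = (\sum_x (lg x \in A)%:R * q x)%:E.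
Proof.
move=> q0 q1.
pose m : {measure set (lgraph R M) -> \bar R} := msum (fun i => mscale (NngNum (normr_ge0 (q (nth (lf k.+1 point) (enum (B k.+1)) i))))
     (\d_(lg (nth (lf k.+1 point) (enum (B k.+1)) i)) : {measure set (lgraph R M) -> \bar R}))
     (size (enum (B k.+1))).
have E (C : set (lgraph R M)) : m C = (\sum_x (lg x \in C)%:R * q x)%:E.
  rewrite /m /= /msum -sumEFin -[RHS]big_enum [RHS](big_nth (lf k.+1 point)) [RHS]big_mkord.
  apply: eq_bigr => i _; set y := nth _ _ _.
  by rewrite -[LHS]/((`|q y|)%:E * \d_(lg y) C)%E diracE -EFinM ger0_norm// mulrC.
rewrite -[LHS]/(mnormalize m \d_point A) /mnormalize !E.
have -> : \sum_x (lg x \in [set: lgraph R M])%:R * q x = 1.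
  by rewrite -[RHS]q1; apply: eq_bigr => x _; rewrite in_setT mul1r.
by rewrite !eqe oner_eq0 /= -[LHS]/((m A * (1^-1)%:E)%E) E invr1 mule1.
Qed.
End finite_laws.

Section coupling_law.
Context {R : realType} {M : pFinType} {Dl k : nat} (pi : probability nat R).
Variables (p : probability (lgraph R M) R) (pr : B M Dl k.+1 -> R).
Hypotheses (p_local : local_process pi k.+1 p)
  (pE : forall A, measurable A -> p A = (\sum_x (lg x \in A)%:R * pr x)%:E)
  (prT : forall x, pr x != 0 -> ktree Dl (lg x : lgraph R M)).
Hypotheses (pi_Dl : forall l, (Dl < l)%N -> pmass pi l = 0)
  (degP : forall l, push (@degB M Dl k) pr l = pmass pi l)
  (meanP : fine (mean pi) = \sum_(l < Dl.+1) pmass pi l * l%:R) (mean0 : 0 < fine (mean pi)).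

Lemma mdeg_push (M' : finType) (q : B M' Dl k.+1 -> R) : push (@degB M' Dl k) q =1 (fun l => pmass pi l) ->
  fine (mean pi) = mdeg q.
Proof.
move=> h; rewrite meanP /mdeg -(sum_push (@degB M' Dl k) q (fun l => (l%:R : R))).
by apply: eq_bigr => l _; rewrite h.
Qed.

Lemma Sigma_carried (M' : pFinType) (P : probability (lgraph R M') R) (q : B M' Dl k.+1 -> R) :
  (forall A, measurable A -> P A = (\sum_x (lg x \in A)%:R * q x)%:E) ->
  (forall x, q x != 0 -> ktree Dl (lg x : lgraph R M')) -> inv q ->
  push (@degB M' Dl k) q =1 (fun l => pmass pi l) -> Sigma pi k.+1 P = (Sig q)%:E.
Proof.
move=> PE qT iq dq; have lq : law P = q by apply/funext; exact: carried_law_id.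
rewrite (@Sigma_Sig _ _ Dl) ?lq//.
- exact: carried_treelike PE qT.
- exact: mdeg_push.
- by rewrite -mdeg_push.
- by move=> g; exact: (carried_out PE).
- by move=> x; rewrite (carried_set1 PE) lq.
Qed.

Lemma sum_pr : \sum_x pr x = 1.
Proof.
apply: EFin_inj; rewrite -(@probability_setT _ _ _ p) pE//; congr EFin.
by apply: eq_bigr => x _; rewrite in_setT mul1r.
Qed.

(** Through [finlaw], a law on finite trees with the right marginals becomes a coupling of [p] with
    itself, to which the hypothesis on couplings applies. *)
Lemma coupling_Sig (q : B (M * M)%type Dl k.+1 -> R) :
  (forall Q : probability (lgraph R (M * M)%type) R,
     self_coupling pi k.+1 p Q -> (Sigma pi k.+1 Q <= 2%:E * Sigma pi k.+1 p)%E) -> inv pr ->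
  (forall a, 0 <= q a) -> inv q -> edge_symm (Ek q) ->
  push (@degB _ Dl k) q =1 (fun l => pmass pi l) ->
  push (@mapB _ _ Dl (@fst M M) k.+1) q =1 pr -> push (@mapB _ _ Dl (@snd M M) k.+1) q =1 pr ->
  Sig q <= 2 * Sig pr.
Proof.
move=> hQ ipr q0 iq eq dq q1 q2.
have sq : \sum_x q x = 1.
  by rewrite -(push_sum1 (@mapB _ _ Dl (@fst M M) k.+1)) -sum_pr; apply: eq_bigr => x _; exact: q1.
pose Q : probability (lgraph R (M * M)%type) R := finlaw q.
have QE A : measurable A -> Q A = (\sum_x (lg x \in A)%:R * q x)%:E by move=> _; exact: finlawE.
have qT x : q x != 0 -> ktree Dl (lg x : lgraph R (M * M)%type).
  move=> qx; apply/(ktree_recolor fst); rewrite recolor_lg; apply: prT; rewrite -q1 gt_eqF//.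
  apply: (@lt_le_trans _ _ (q x)); last exact: push_ge.
  by rewrite lt_neqAle eq_sym qx q0.
have lq : law Q = q by apply/funext; exact: carried_law_id.
have marg (h : M * M -> M) : push (@mapB _ _ Dl h k.+1) q =1 pr -> measure_eq (distribution Q (recolor h)) p.
  move=> qh A mA; have mA' : measurable ((recolor h : lgraph R (M * M)%type -> lgraph R M) @^-1` A).
    by rewrite -[X in measurable X]setTI; exact: measurable_recolor.
  apply: etrans (QE _ mA') _; apply: etrans _ (esym (pE mA)); congr EFin.
  transitivity (\sum_y push (@mapB _ _ Dl h k.+1) q y * (lg y \in A)%:R); last first.
    by apply: eq_bigr => y _; rewrite qh mulrC.
  rewrite sum_push; apply: eq_bigr => x _; rewrite mulrC; congr (_ * _%:R).
  by rewrite -(@recolor_lg R).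
have cQ : self_coupling pi k.+1 p Q.
  split; [split|exact: marg|exact: marg].
  - exact: carried_labeled QE qT iq.
  - case: p_local => _ [nu nuU hnu] _; exists nu => // A mA; rewrite -hnu//.
    have mA' : measurable ((recolor (fun=> tt) : lgraph R M -> lgraph R unit) @^-1` A).
      by rewrite -[X in measurable X]setTI; exact: measurable_recolor.
    apply: etrans _ (marg fst q1 _ mA'); rewrite /distribution /=.
    by congr (Q _); apply/seteqP; split=> g /=;
      rewrite (_ : recolor (fun=> tt) (recolor fst g) = recolor (fun=> tt) g)//;
      apply/lgraph_eq/cgraph_eq => [l|u v] //=; case: (Defs.col g l).
  - apply/(switch_edge_symm (carried_treelike QE qT)); rewrite ?lq//.
    by rewrite gt_eqF.
have := hQ Q cQ; rewrite (Sigma_carried QE)// (Sigma_carried pE)//.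
Qed.
End coupling_law.

(** * From masses of balls to the weak topology *)

Section bounds.
Context {R : realFieldType}.
Implicit Types a b c d e u v K z : R.

Lemma shift_bounds u K : `|u| <= K -> 0 <= u + K <= 2 * K.
Proof. by rewrite ler_norml => /andP[h1 h2]; apply/andP; split; lra. Qed.

Lemma calm_up u v e K : `|u - v| <= e -> u + K <= v + (K + e).
Proof. by rewrite ler_norml => /andP[_ h]; lra. Qed.

Lemma calm_lo u v e K : `|u - v| <= e -> v + K <= u + K + (e + 0).
Proof. by rewrite ler_norml => /andP[h _]; lra. Qed.

Lemma wild_up u e K : 0 < e -> `|u| <= K -> 0 <= u + (K + e).
Proof. by move=> e0; rewrite ler_norml => /andP[h _]; lra. Qed.

Lemma wild_lo u e K : 0 < e -> `|u| <= K -> u + K <= 0 + (e + 2 * K).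
Proof. by move=> e0; rewrite ler_norml => /andP[_ h]; lra. Qed.

Lemma close_combine a b c d e K : 0 < e -> c <= d + (K + e / 8) -> a + K <= b + (e / 8 + e / 4) -> b - e / 4 <= c -> a - e <= d.
Proof. by move=> e0 h1 h2 h3; lra. Qed.

Lemma two_sided a b e : 0 < e -> a - e / 2 <= b -> - a - e / 2 <= - b -> `|b - a| < e.
Proof. by move=> e0 h1 h2; rewrite ltr_norml; apply/andP; split; lra. Qed.

End bounds.

Section oscillation.
Context {R : realType} {M : pFinType}.
Local Notation lg_ := (lgraph R M).

Lemma continuous_measurable_lgraph (phi : lg_ -> R) : continuous phi -> measurable_fun setT phi.
Proof.
move=> /continuousP cf; apply: (measurability _ (RGenOpens.measurableE R)).
move=> _ [_ [a [b ->] <-]]; rewrite setTI; apply: sub_sigma_algebra.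
exact/cf/interval_open.
Qed.

Lemma local_continuous N (phi : lg_ -> R) : local N phi -> continuous phi.
Proof.
move=> lp; apply/continuousP => A _; apply: (@local_open _ _ N) => g g' /lp e.
by rewrite /preimage /mkset e.
Qed.

Lemma bounded_integrable (nu : probability lg_ R) (f : lg_ -> R) C : measurable_fun setT f ->
  (forall g, `|f g| <= C) -> nu.-integrable setT (EFin \o f).
Proof.
move=> mf fC; apply: measurable_bounded_integrable => //.
  apply: le_lt_trans (probability_le1 nu measurableT) _; exact: ltry.
by exists C; split; rewrite ?num_real// => x Cx g _ /=; exact: le_trans (fC g) (ltW Cx).
Qed.

Section fixed.
Variables (phi : lg_ -> R) (e : R).
Hypotheses (cphi : continuous phi) (e0 : 0 < e).

(** The space is not compact and [phi] need not be uniformly continuous. By continuity the sets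
    [calm t] exhaust the space, so one of them carries almost all the mass of a given law
    ([calm_mass]). *)
Definition calm t : set lg_ := [set g | forall g' g'', restr t g' = restr t g -> restr t g'' = restr t g ->
  `|phi g' - phi g''| <= e].

Lemma local_calm t : local t (calm t).
Proof. by move=> g g' h; rewrite /calm /mkset h. Qed.

Lemma calm_le t t' : (t <= t')%N -> calm t `<=` calm t'.
Proof. by move=> tt g h g1 g2 h1 h2; apply: h; exact: restr_le tt _. Qed.

Lemma bigcup_calm : \bigcup_t calm t = setT.
Proof.
apply/seteqP; split=> // g _.
have /cvgrPdist_le/(_ (e / 2) (divr_gt0 e0 (ltr0Sn _ 1))) := @cphi g.
move=> /nbhs_ballP[d /= d0 hd].
have [t ht] : exists t, (2 ^+ t)^-1 < d :> R.
  exists (Num.truncn d^-1).+1; rewrite invf_plt ?posrE ?exprn_gt0//.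
  apply: lt_le_trans (truncnS_gt _) _; rewrite -natrX ler_nat; apply: ltnW; exact: ltn_expl.
exists t.+2 => // g' g'' h' h''.
have close g1 : restr t.+2 g1 = restr t.+2 g -> `|phi g - phi g1| <= e / 2.
  move=> h1; apply: hd; rewrite ballEmdist /=; apply: le_lt_trans ht.
  have gz n : (n <= t.+2)%N -> gterm g g1 n = 0.
    by move=> le; rewrite /gterm (restr_le le h1) eqxx mul0r.
  have half n : (t < n)%N -> gterm g g1 n <= (2 ^+ n)^-1.
    by move=> _; rewrite /gterm ler_piMl ?invr_ge0 ?exprn_ge0//; case: (_ != _).
  rewrite /gdist; apply: limr_le; first exact: is_cvg_gdist.
  near=> m; rewrite /series /=.
  have hm j : \sum_(0 <= n < t.+1 + j) gterm g g1 n <= (2 ^+ t)^-1 - (2 ^+ (t + j))^-1.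
    elim: j => [|j ih].
      rewrite addn0 addn0 subrr big_nat big1 // => n /andP[_ hn]; apply: gz; exact: ltnW (leqW hn).
    rewrite addnS big_nat_recr //=; apply: le_trans (lerD ih (half _ _)) _; first by rewrite addSn ltnS leq_addr.
    by rewrite addSn addnS exprS invfM; lra.
  apply: le_trans (_ : \sum_(0 <= n < t.+1 + m) gterm g g1 n <= _).
    rewrite [leRHS](big_cat_nat _ (n := m)) ?leq_addl//= lerDl; apply: sumr_ge0 => n _; exact: gterm_ge0.
  by apply: le_trans (hm m) _; rewrite gerBl invr_ge0 exprn_ge0.
rewrite (_ : phi g' - phi g'' = (phi g - phi g'') - (phi g - phi g')); last by move: (phi g) (phi g') (phi g'') => x y z; lra.
apply: le_trans (ler_normB _ _) _; rewrite [leRHS](splitr e); exact: lerD (close _ h'') (close _ h').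
Unshelve. all: end_near. Qed.

Lemma calm_mass (mu0 : probability lg_ R) (d : R) : 0 < d -> exists T, forall t, (T <= t)%N ->
  fine (mu0 (~` calm t)) <= d.
Proof.
move=> d0; have mc t : measurable (calm t) by exact: local_measurable (@local_calm t).
have : mu0 \o calm @ \oo --> mu0 (\bigcup_t calm t).
  apply: nondecreasing_cvg_mu => //; first by apply: bigcupT_measurable.
  by move=> t t' tt; apply/subsetPset; exact: calm_le.
rewrite bigcup_calm probability_setT => /fine_cvgP[_] /cvgrPdist_le/(_ d d0)[T _ hT].
exists T => t Tt; have := hT t Tt; rewrite /= => h.
rewrite probability_setC// fineB ?fin_num_measure//=.
by apply: le_trans h; exact: ler_norm.
Qed.
End fixed.

Section lower.
Context (Dl : nat).
Local Notation B := (B M Dl).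

Lemma local_ge (nu : probability lg_ R) t (psi : lg_ -> R) C : local t psi -> (forall g, 0 <= psi g <= C) ->
  \sum_(y : B t) psi (lg y) * law nu y <= (\int[nu]_g psi g : R).
Proof.
move=> lp p0; have mp : measurable_fun setT psi by exact: local_measurable_fun lp.
have ip : nu.-integrable setT (EFin \o psi).
  by apply: (@bounded_integrable _ _ C) => // g; have /andP[h1 h2] := p0 g; rewrite ger0_norm.
rewrite /Rintegral -lee_fin fineK; last exact: integrable_fin_num.
apply: le_trans (@integral_atoms_ge _ _ _ nu _ (fun y : B t => [set g | restr t g = lg y])
  (fun g => (psi g)%:E) (fun y => (psi (lg y))%:E) _ _ _ _ _).
- by rewrite -sumEFin; apply: lee_sum => y _; rewrite EFinM -lawE.
- by move=> y; exact: measurable_atom.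
- by move=> x y g /= ->; exact: lg_inj.
- exact/measurable_EFinP.
- by move=> g; rewrite lee_fin; have /andP[] := p0 g.
- by move=> y g /= e; congr EFin; apply: lp; rewrite e restr_lg_id.
Qed.

Variable mu0 : probability lg_ R.
Hypothesis t0 : treelike Dl mu0.

Lemma local_eq t (psi : lg_ -> R) : local t psi -> (forall g, 0 <= psi g) ->
  (\int[mu0]_g psi g : R) = \sum_(y : B t) psi (lg y) * law mu0 y.
Proof.
move=> lp p0; rewrite /Rintegral (@integral_local _ _ Dl _ t0 t).
- by under eq_bigr do rewrite -EFinM; rewrite sumEFin.
- by move=> g g' /lp ->.
- by move=> g; rewrite lee_fin.
Qed.

Lemma close_lower (phi : lg_ -> R) (K e : R) : continuous phi -> (forall g, `|phi g| <= K) -> 0 < e ->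
  exists T, forall t, (T <= t)%N -> exists2 eta : R, 0 < eta & forall nu : probability lg_ R,
    (forall y : B t, law mu0 y - eta <= law nu y) ->
    (\int[mu0]_g phi g : R) - e <= (\int[nu]_g phi g : R).
Proof.
move=> cphi pK e0; pose K' := `|K| + 1.
have K0 : 0 < K' by rewrite ltr_wpDl.
have {}pK g : `|phi g| <= K' by apply: le_trans (pK g) _; rewrite /K'; have := ler_norm K; lra.
pose e' := e / 8; have e'0 : 0 < e' by rewrite divr_gt0.
have mphi := continuous_measurable_lgraph cphi.
pose d := e / (8 * K'); have d0 : 0 < d by rewrite divr_gt0// mulr_gt0.
have [T hT] := @calm_mass phi e' cphi e'0 mu0 d d0.
exists T => t Tt; pose nB : R := #|{: B t}|%:R + 1.
have nB0 : 0 < nB by rewrite ltr_wpDl.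
exists (e / (8 * K' * nB)); first by rewrite divr_gt0// !mulr_gt0.
move=> nu hnu; set eta := e / _ in hnu.
have eta0 : 0 <= eta by rewrite ltW// divr_gt0// !mulr_gt0.
have mcalm : measurable (calm phi e' t) by exact: local_measurable (@local_calm phi e' t).
pose psi g := if g \in calm phi e' t then phi (restr t g) + K' else 0.
have lpsi : local t psi.
  move=> g g' h; have hc : calm phi e' t g = calm phi e' t g' by exact: local_calm h.
  rewrite /psi h (_ : (g \in calm phi e' t) = (g' \in calm phi e' t))//.
  by apply/idP/idP => /set_mem c; apply/mem_set; [rewrite -hc|rewrite hc].
have psi0 g : 0 <= psi g <= 2 * K'.
  rewrite /psi; case: ifP => _; last by rewrite lexx mulr_ge0// ltW.
  exact/shift_bounds/pK.
have psi00 g : 0 <= psi g by have /andP[] := psi0 g.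
have mpsi : measurable_fun setT psi by exact: local_measurable_fun lpsi.
have ipsi (la : probability lg_ R) : la.-integrable setT (EFin \o psi).
  by apply: (@bounded_integrable _ _ (2 * K')) => // g; have /andP[h1 h2] := psi0 g; rewrite ger0_norm.
have iphi (la : probability lg_ R) : la.-integrable setT (EFin \o phi) by exact: bounded_integrable pK.
have icst (la : probability lg_ R) c : la.-integrable setT (EFin \o (fun=> c : R)).
  by apply: (@bounded_integrable _ _ `|c|).
have iind (la : probability lg_ R) : la.-integrable setT (EFin \o (\1_(~` calm phi e' t) : lg_ -> R)).
  apply: (@bounded_integrable _ _ 1) => [|g]; first by apply: measurable_indic; exact: measurableC.
  by rewrite indicE; case: (_ \in _); rewrite ?normr1 ?normr0.
have Icst (la : probability lg_ R) (c : R) : (\int[la]_g c : R) = c.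
  have -> : (\int[la]_g c : R) = c * fine (la setT) by exact: Rintegral_cst.
  by rewrite (_ : la setT = 1%E) ?mulr1//; exact: probability_setT.
have ID (la : probability lg_ R) (f : lg_ -> R) (c : R) : la.-integrable setT (EFin \o f) ->
    (\int[la]_g (f g + c) : R) = (\int[la]_g f g : R) + c.
  move=> jf; transitivity ((\int[la]_g f g : R) + (\int[la]_g c : R)); last by rewrite Icst.
  exact: (RintegralD measurableT jf (icst la c)).
have calm1 g : calm phi e' t g -> `|phi (restr t g) - phi g| <= e'.
  by apply => //; rewrite restr_restr.
have A1 : (\int[nu]_g psi g : R) <= (\int[nu]_g phi g : R) + (K' + e').
  have -> : (\int[nu]_g phi g : R) + (K' + e') = \int[nu]_g (phi g + (K' + e')).
    by rewrite ID.
  apply: le_Rintegral => //; first exact: ipsi.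
    apply: (@bounded_integrable _ _ (K' + (K' + e'))) => [|g]; first exact: measurable_funD.
    by apply: le_trans (ler_normD _ _) _; rewrite lerD// ger0_norm//; move: K0 e'0; clear; lra.
  move=> g _; rewrite /psi; case: ifP => [/set_mem c|_].
    exact/calm_up/calm1.
  exact: wild_up (pK g).
have A2 : (\int[mu0]_g phi g : R) + K' <= (\int[mu0]_g psi g : R) + (e' + 2 * K' * d).
  have h : (\int[mu0]_g (phi g + K') : R) <= \int[mu0]_g (psi g + (e' + 2 * K' * \1_(~` calm phi e' t) g)).
    have ib : mu0.-integrable setT (EFin \o (fun g => e' + 2 * K' * \1_(~` calm phi e' t) g)).
      apply: (@bounded_integrable _ _ (e' + 2 * K')) => [|g].
        by apply: measurable_funD => //; apply: measurable_funM => //; apply: measurable_indic; exact: measurableC.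
      by rewrite indicE ger0_norm; case: (_ \in _); rewrite ?mulr1 ?mulr0; move: K0 e'0; clear; lra.
    apply: le_Rintegral => //.
    - exact: (integrableD measurableT (iphi mu0) (icst mu0 K')).
    - exact: (integrableD measurableT (ipsi mu0) ib).
    move=> g _; rewrite /psi indicE; case: ifPn => [/set_mem c|/negP c].
      by rewrite memNset ?mulr0; [exact/calm_lo/calm1|move=> nc; exact: nc c].
    rewrite mem_set ?mulr1; last by move=> c'; apply: c; exact/mem_set.
    exact: wild_lo (pK g).
  rewrite ID// in h; apply: le_trans h _.
  have ii : mu0.-integrable setT (EFin \o (fun g => 2 * K' * \1_(~` calm phi e' t) g)).
    exact: (integrableZl measurableT (2 * K') (iind mu0)).
  have -> : (\int[mu0]_g (psi g + (e' + 2 * K' * \1_(~` calm phi e' t) g)) : R) =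
      (\int[mu0]_g psi g : R) + (e' + 2 * K' * fine (mu0 (~` calm phi e' t))).
    rewrite RintegralD//; [|exact: ipsi|exact: (integrableD measurableT (icst mu0 e') ii)].
    congr (_ + _); under eq_Rintegral do rewrite addrC.
    have I1 : (\int[mu0]_g (2 * K' * \1_(~` calm phi e' t) g) : R) = 2 * K' * fine (mu0 (~` calm phi e' t)).
      rewrite [LHS](RintegralZl (2 * K') measurableT (iind mu0)); congr (2 * K' * _).
      by rewrite /Rintegral integral_indic ?setIT//; exact: measurableC.
    by rewrite (ID _ _ _ ii) I1 addrC.
  by rewrite !lerD2l; apply: ler_wpM2l; [rewrite mulr_ge0// ltW|exact: hT].
have A3 : (\int[mu0]_g psi g : R) - 2 * K' * nB * eta <= (\int[nu]_g psi g : R).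
  apply: le_trans (local_ge nu lpsi psi0); rewrite (local_eq lpsi psi00).
  rewrite lerBlDr -lerBlDl -sumrB; apply: le_trans (_ : \sum_(y : B t) 2 * K' * eta <= _).
    apply: ler_sum => y _; rewrite -mulrBr; have /andP[h1 h2] := psi0 (lg y).
    apply: le_trans (_ : psi (lg y) * eta <= _); last by apply: ler_wpM2r.
    by apply: ler_wpM2l => //; rewrite lerBlDl addrC -lerBlDl; exact: hnu.
  rewrite sumr_const -[leLHS]mulr_natr mulrAC; apply: ler_wpM2r => //.
  by apply: ler_wpM2l; [rewrite mulr_ge0// ltW|rewrite /nB lerDl].
have E1 : 2 * K' * nB * eta = e / 4.
  have z0 : K' * nB != 0 by rewrite mulf_neq0// gt_eqF.
  rewrite /eta; move: (K' * nB) z0 (mulrA 2 K' nB) (mulrA 8 K' nB) => z z0 <- <-; rewrite invfM.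
  transitivity (e / 4 * (z / z)); first by lra.
  by rewrite divff// mulr1.
have E2 : 2 * K' * d = e / 4.
  have k1 : K' != 0 by rewrite gt_eqF.
  rewrite /d invfM (_ : 2 * K' * (e * (8^-1 * K'^-1)) = e / 4 * (K' / K')); last by lra.
  by rewrite divff// mulr1.
by rewrite E2 in A2; rewrite E1 in A3; exact: close_combine e0 A1 A2 A3.
Qed.

(** [close_lower] for [phi] and for its opposite. *)
Lemma close_integral (phi : lg_ -> R) (K e : R) : continuous phi -> (forall g, `|phi g| <= K) -> 0 < e ->
  exists T, forall t, (T <= t)%N -> exists2 eta : R, 0 < eta & forall nu : probability lg_ R,
    (forall y : B t, law mu0 y - eta <= law nu y) ->
    `|(\int[nu]_g phi g : R) - \int[mu0]_g phi g| < e.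
Proof.
move=> cphi pK e0; have e2 : 0 < e / 2 by rewrite divr_gt0.
have cphi' : continuous (fun g => - phi g) by move=> g; apply: (@continuous_comp _ _ _ phi -%R); [exact: cphi|exact: opp_continuous].
have pK' g : `|- phi g| <= K by rewrite normrN.
have [T1 h1] := close_lower cphi pK e2; have [T2 h2] := close_lower cphi' pK' e2.
exists (maxn T1 T2) => t; rewrite geq_max => /andP[/h1[eta1 p1 {}h1] /h2[eta2 p2 {}h2]].
exists (Num.min eta1 eta2); first by rewrite lt_min p1.
move=> nu hnu.
have {}h1 : (\int[mu0]_g phi g : R) - e / 2 <= \int[nu]_g phi g.
  by apply: h1 => y; apply: le_trans (hnu y); rewrite lerB// ge_min lexx.
have {}h2 : (\int[mu0]_g (- phi g) : R) - e / 2 <= \int[nu]_g (- phi g).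
  by apply: h2 => y; apply: le_trans (hnu y); rewrite lerB// ge_min lexx orbT.
have N (la : probability lg_ R) : (\int[la]_g (- phi g) : R) = - \int[la]_g phi g.
  have ip : la.-integrable setT (EFin \o phi) by apply: bounded_integrable pK; exact: continuous_measurable_lgraph.
  transitivity (\int[la]_g (-1 * phi g) : R); first by apply: eq_Rintegral => g _; rewrite mulN1r.
  by rewrite [LHS](RintegralZl (-1) measurableT ip) mulN1r.
by rewrite !N in h2; exact: two_sided.
Qed.

Variable dist : probability lg_ R -> probability lg_ R -> R.
Hypothesis dist_weak : generates_weak_topology dist.

(** A weak neighborhood involves finitely many test functions; as [close_integral] holds at all
    large depths, they share a common one. *)
Lemma weak_close (eps : R) : 0 < eps -> exists T, forall t, (T <= t)%N -> exists2 eta : R, 0 < eta &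
  forall nu : probability lg_ R, (forall y : B t, law mu0 y - eta <= law nu y) -> dist mu0 nu < eps.
Proof.
move=> eps0; have [|k [phi [e [cphi bphi e0 hU]]]] := (dist_weak mu0 [set nu | dist mu0 nu < eps]).1.
  by exists eps.
have h i : exists T, forall t, (T <= t)%N -> exists2 eta : R, 0 < eta & forall nu : probability lg_ R,
    (forall y : B t, law mu0 y - eta <= law nu y) ->
    `|(\int[nu]_g phi i g : R) - \int[mu0]_g phi i g| < e.
  by have [K pK] := bphi i; exact: close_integral (cphi i) pK e0.
have [T hT] := boolp.choice h; exists (\max_i T i)%N => t tT.
have h' i : exists eta : R, 0 < eta /\ forall nu : probability lg_ R,
    (forall y : B t, law mu0 y - eta <= law nu y) ->
    `|(\int[nu]_g phi i g : R) - \int[mu0]_g phi i g| < e.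
  by have [eta eta0 he] := hT i t (leq_trans (leq_bigmax i) tT); exists eta.
have [eta heta] := boolp.choice h'.
have min_le i : \big[Num.min/1]_j eta j <= eta i by rewrite (bigD1 i)//= ge_min lexx.
exists (\big[Num.min/1]_i eta i).
  by elim/big_ind: _ => // [x y x0 y0|i _]; [rewrite lt_min x0|have [] := heta i].
move=> nu hnu; apply: hU => i; have [_] := heta i; apply => y.
by apply: le_trans (hnu y); rewrite lerB.
Qed.

End lower.

Section restrictions.
Context (Dl : nat) (mu0 : probability lg_ R) (dist : probability lg_ R -> probability lg_ R -> R).
Local Notation B := (B M Dl).
Hypotheses (t0 : treelike Dl mu0) (dist_metric : distance_on_laws dist) (dist_weak : generates_weak_topology dist).

Lemma treelike_restr t : treelike Dl (distribution mu0 (@restr R M t)).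
Proof.
apply: (null_ktree t0); last by move=> g /= h /(ktree_restr t)/h.
have m := @measurable_restr R M t; rewrite -[X in measurable X]setTI; apply: m => //.
by apply: measurableC; exact: measurable_ktree.
Qed.

(** Here the depth is imposed, while [weak_close] works at some depth [T]. The masses at depth [T]
    of a law restricted to depth k + 1 are sums of its masses at depth k + 1, through the map of
    [resize]. *)
Lemma restr_close k (eps : R) : 0 < eps -> exists2 eta : R, 0 < eta & forall nu : probability lg_ R,
  (forall y : B k.+1, law mu0 y - eta <= law nu y) ->
  dist (distribution nu (@restr R M k.+1)) (distribution mu0 (@restr R M k.+1)) <= eps.
Proof.
move=> eps0; set m0 := distribution mu0 _.
have [T /(_ T (leqnn T))[eta eta0 h]] := weak_close (treelike_restr k.+1) dist_weak eps0.
have [beta [_ bE]] := @resize R M Dl k.+1 T.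
pose nB : R := #|{: B k.+1}|%:R + 1; have nB0 : 0 < nB by rewrite ltr_wpDl.
exists (eta / nB); first by rewrite divr_gt0.
move=> nu hnu; case: dist_metric => _ ds _; rewrite ds; apply/ltW/h => y.
have -> : law m0 y = push beta (law mu0 : B k.+1 -> R) y.
  apply: carried_law bE => A mA.
  rewrite -[LHS]/(mu0 (restr k.+1 @^-1` A)) (@measure_local _ _ Dl _ t0 k.+1); last first.
    by move=> g g' e; rewrite /preimage /mkset e.
  congr (_%:E); apply: eq_bigr => x _; congr (_ * _); congr (nat_of_bool _)%:R.
  by apply/idP/idP => /set_mem hx; apply/mem_set; move: hx; rewrite /preimage /mkset restr_lg_id.
pose psi (g : lg_) : R := if restr T (restr k.+1 g) == lg y then 1 else 0.
have lpsi : local k.+1 psi by move=> g g' e; rewrite /psi e.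
have psi01 g : 0 <= psi g <= 1 by rewrite /psi; case: ifP; rewrite ?ler01 ?lexx.
have -> : law (distribution nu (@restr R M k.+1)) y = (\int[nu]_g psi g : R).
  rewrite /Rintegral (eq_integral (fun g => (\1_[set g | restr T (restr k.+1 g) = lg y] g)%:E)); last first.
    move=> g _; rewrite indicE /psi; case: eqP => e; first by rewrite mem_set.
    by rewrite memNset.
  rewrite integral_indic ?setIT//.
  by apply: (@local_measurable _ _ k.+1) => g g' e; rewrite /mkset e.
have hl : \sum_(x : B k.+1) psi (lg x) * law nu x <= (\int[nu]_g psi g : R) by exact: local_ge lpsi psi01.
apply: le_trans _ hl.
have pE (x : B k.+1) : psi (lg x) = (beta x == y)%:R.
  by rewrite /psi restr_lg_id bE (inj_eq (@lg_inj R M Dl T)); case: (beta x == y).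
rewrite lerBlDr -lerBlDl /push [X in X - _]big_mkcond -sumrB.
apply: le_trans (_ : \sum_(x : B k.+1) eta / nB <= _).
  apply: ler_sum => x _; rewrite pE; case: (beta x == y); rewrite ?mul1r ?mul0r ?subrr ?divr_ge0 ?(ltW eta0) ?(ltW nB0)//.
  by have := hnu x; rewrite lerBlDr -lerBlDl.
rewrite sumr_const -mulr_natr mulrAC ler_pdivrMr//; apply: ler_wpM2l; first exact: ltW.
by rewrite /nB lerDl.
Qed.

(** Indicators of balls are local, hence continuous: they define a weak neighborhood, which contains
    a ball for [dist]. *)
Lemma close_atoms k (et : R) : 0 < et -> exists2 eps : R, 0 < eps & forall nu : probability lg_ R,
  dist (distribution nu (@restr R M k)) (distribution mu0 (@restr R M k)) <= eps ->
  forall y : B k, `|law nu y - law mu0 y| <= et.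
Proof.
move=> et0; set m0 := distribution mu0 _.
pose phi (i : 'I_#|{: B k}|) (g : lg_) : R := \1_[set g | restr k g = lg (enum_val i)] g.
pose U : set (probability lg_ R) := [set nu | forall i, `|(\int[nu]_g phi i g : R) - \int[m0]_g phi i g| < et].
have [|e e0 hU] := (dist_weak m0 U).2.
  exists #|{: B k}|, phi, et; split=> // i.
    apply: (@local_continuous k) => g g' e; rewrite /phi !indicE.
    have -> // : (g \in [set g0 | restr k g0 = lg (enum_val i)]) = (g' \in [set g0 | restr k g0 = lg (enum_val i)]).
    by apply/idP/idP => /set_mem h; apply/mem_set; rewrite /mkset -h e.
  by exists 1 => g; rewrite /phi indicE; case: (_ \in _); rewrite ?normr1 ?normr0.
exists (e / 2); first by rewrite divr_gt0.
move=> nu hnu y; have : U (distribution nu (@restr R M k)).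
  apply: hU => /=; case: dist_metric => _ ds _; rewrite ds.
  by apply: le_lt_trans hnu _; rewrite ltr_pdivrMr// mulr_natr mulr2n ltrDl.
move=> /(_ (enum_rank y)); rewrite /phi enum_rankK.
have I1 (la : probability lg_ R) : (\int[distribution la (@restr R M k)]_g \1_[set g | restr k g = lg y] g : R) = law la y.
  rewrite /Rintegral integral_indic ?setIT//; last exact: measurable_atom.
  rewrite /law; congr fine; rewrite /distribution /= /pushforward; congr (la _).
  by apply/seteqP; split=> g /=; rewrite restr_restr.
by rewrite !I1 => /ltW.
Qed.
End restrictions.
End oscillation.

(** * Sofic entropies *)

Section degrees.
Context {R : realType} (pi : probability nat R) (idx : set nat) (deg : forall n, 'I_n -> nat).
Hypothesis dgp : degree_sequence idx deg pi.

Lemma within_infinite : ProperFilter (within idx \oo).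
Proof.
have [inf _ _ _] := dgp; split; last exact: within_filter.
move=> [N _ h]; apply: inf; apply: (@sub_finite_set _ _ `I_N); last exact: finite_II.
by move=> n /= nI; rewrite ltnNge; apply/negP => /h /= /(_ nI).
Qed.

(** The assumptions on degrees hold along [idx]. Degree 0 elsewhere makes the bound and the parity
    hold at every size, as the finite estimates require. *)
Definition deg0 n : 'I_n -> nat := if `[< idx n >] then @deg n else fun=> 0%N.

Lemma deg0E n : idx n -> @deg0 n = @deg n.
Proof. by move=> h; rewrite /deg0 asboolT. Qed.

Lemma degree_bound : exists Dl : nat, forall n (v : 'I_n), (deg0 v <= Dl)%N.
Proof.
have [_ _ _ [Delta h]] := dgp; exists (Num.truncn Delta) => n v.
rewrite /deg0; case: asboolP => // nI.
by rewrite -ltnS -(ltr_nat R); exact: le_lt_trans (h n v nI) (truncnS_gt _).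
Qed.

Lemma even_deg0 n : ~~ odd (\sum_(v < n) deg0 v).
Proof.
have [_ h _ _] := dgp; rewrite /deg0; case: asboolP => [/h//|_].
by rewrite big1.
Qed.

Lemma integral_pmass l : (\int[pi]_k ((k == l)%:R : R) : R) = pmass pi l.
Proof.
rewrite /pmass /Rintegral; congr fine.
rewrite (eq_integral (fun k => (\1_[set l] k)%:E)) ?integral_indic ?setIT//.
move=> k _; rewrite indicE; congr (nat_of_bool _)%:R%:E.
by apply/eqP/idP => [->|/set_mem//]; exact/mem_set.
Qed.

Lemma pmass_cvg l : (n%:R^-1 * #|[set v : 'I_n | deg0 v == l]%SET|%:R : R) @[n --> within idx \oo] --> pmass pi l.
Proof.
have [_ _ h _] := dgp; have {}h := h (fun k => (k == l)%:R).
rewrite integral_pmass in h; apply: cvg_trans (h _); last by exists 1 => k; case: (_ == l); rewrite ?normr1 ?normr0.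
apply: near_eq_cvg; near=> n.
have nI : idx n by near: n; exact: withinT.
congr (_ * _); rewrite -sum1_card natr_sum [RHS]big_mkcond; apply: eq_bigr => v _.
by rewrite inS (deg0E nI); case: (_ == l).
Unshelve. all: end_near. Qed.

(** The frequency of a degree beyond the bound is 0 at every size, and so is its limit. *)
Lemma pmass_big Dl : (forall n (v : 'I_n), (deg0 v <= Dl)%N) -> forall l, (Dl < l)%N -> pmass pi l = 0.
Proof.
move=> hD l hl; have PF := within_infinite; have h := @pmass_cvg l.
suff e : (fun n => n%:R^-1 * #|[set v : 'I_n | deg0 v == l]%SET|%:R) = cst (0 : R).
  by rewrite e in h; exact: (cvg_unique _ h (@cvg_cst _ _ _ _ _)).
apply/funext => n; rewrite eq_card0 ?mulr0// => v; rewrite inS.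
by apply/negP => /eqP e; move: hl; rewrite -e ltnNge hD.
Qed.

Lemma pi_out Dl : (forall l, (Dl < l)%N -> pmass pi l = 0) -> pi (~` [set x | exists i : 'I_Dl.+1, x = i :> nat]) = 0%E.
Proof.
move=> h.
have -> : ~` [set x | exists i : 'I_Dl.+1, x = i :> nat] = \bigcup_i [set (i + Dl.+1)%N].
  apply/seteqP; split=> [x nx|_ [i _ ->] [j e]]; last by have := ltn_ord j; rewrite -e; lia.
  exists (x - Dl.+1)%N => //; rewrite /= subnK// leqNgt; apply/negP => hx.
  by apply: nx; exists (Ordinal hx).
apply/eqP; rewrite eq_le measure_ge0 andbT.
apply: le_trans (measure_sigma_subadditive _ _ _ (@subset_refl _ _)) _ => //.
rewrite eseries0// => i _ _; rewrite -[LHS]fineK ?fin_num_measure// -/(pmass pi (i + Dl.+1)) h//.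
by rewrite addnS ltnS leq_addl.
Qed.

Lemma mean_sum Dl : (forall l, (Dl < l)%N -> pmass pi l = 0) ->
  mean pi = (\sum_(l < Dl.+1) pmass pi l * l%:R)%:E.
Proof.
move=> h; rewrite /mean (@integral_atoms _ _ _ pi 'I_Dl.+1 (fun l => [set (l : nat)]) _ (fun l => (l%:R : R)%:E))//.
- rewrite -sumEFin; apply: eq_bigr => l _.
  by rewrite /pmass EFinM fineK ?fin_num_measure// muleC.
- by move=> i j x /= -> e; exact: val_inj.
- by move=> i x /= ->.
- exact: pi_out.
Qed.
End degrees.

Section invariant_laws.
Context {R : realType} {M : pFinType} (pi : probability nat R) (Dl : nat).
Hypotheses (mean_pi : (0 < mean pi < +oo)%E) (pi_Dl : forall l, (Dl < l)%N -> pmass pi l = 0).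
Variable mu : probability (lgraph R M) R.
Hypothesis mu_invariant : invariant_process pi mu.

Lemma mean_fine : fine (mean pi) = \sum_(l < Dl.+1) pmass pi l * l%:R.
Proof. by rewrite (mean_sum pi_Dl). Qed.

Lemma mean_gt0 : 0 < fine (mean pi).
Proof. by move: mean_pi; rewrite (mean_sum pi_Dl) lte_fin => /andP[]. Qed.

Lemma invariant_treelike : treelike Dl mu.
Proof.
have [_ [nu nuU hnu] _] := mu_invariant.
have mK : measurable (~` [set g : lgraph R unit | ktree Dl g]) by apply: measurableC; exact: measurable_ktree.
rewrite /treelike -[RHS](UGW_treelike pi_Dl nuU) -(hnu _ mK) /distribution /= /pushforward.
by congr (mu _); apply/seteqP; split=> g /= h /(ktree_recolor (fun=> tt))/h.
Qed.

Lemma invariant_root_kids j : mu [set g | root_kids j g] = (pmass pi j)%:E.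
Proof.
have [_ [nu nuU hnu] _] := mu_invariant.
rewrite -(UGW_degree nuU) -hnu; last exact: local_measurable (@local_root_kids R unit j).
rewrite /distribution /= /pushforward; congr (mu _).
by apply/seteqP; split=> g /=; rewrite /root_kids /verts /=; case=> h1 h2; split=> [i /h1|h];
  by [case: (Defs.col g [:: i])|apply: h2; move: h; case: (Defs.col g [:: j])].
Qed.

Lemma invariant_degree t : push (@degB M Dl t) (law mu) =1 (fun l => pmass pi l).
Proof. exact: push_degB_law invariant_treelike invariant_root_kids. Qed.

Lemma invariant_mdeg t : mdeg (law mu : B M Dl t.+1 -> R) = fine (mean pi).
Proof. by rewrite (mdeg_push mean_fine (@invariant_degree t)). Qed.

Lemma invariant_inv t : inv (law mu : B M Dl t -> R).
Proof. by have [rl _ _] := mu_invariant; exact: randomly_labeled_inv invariant_treelike _ rl. Qed.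

Lemma invariant_symm t : edge_symm (Ek (law mu : B M Dl t.+1 -> R)).
Proof.
have [_ _ un] := mu_invariant; apply: unimodular_edge_symm un _; first exact: invariant_treelike.
exact: invariant_inv.
Qed.

Lemma law_trs k d : push (@trs M Dl k d) (law mu) =1 (law mu : B M Dl k.+1 -> R).
Proof.
elim: d => [|d ih] y; first by rewrite /push big_pred1_eq.
transitivity (push (@trs M Dl k d) (push (@tr M Dl (d + k).+1) (law mu)) y); first by rewrite push_comp.
by rewrite -ih; apply: eq_bigr => x _; exact: (law_tr invariant_treelike).
Qed.

Lemma local_law k (p : probability (lgraph R M) R) : measure_eq (distribution mu (restr k)) p ->
  forall A, measurable A -> p A = (\sum_(x : B M Dl k) (lg x \in A)%:R * law mu x)%:E.
Proof.
move=> e A mA; rewrite -e// -[LHS]/(mu (restr k @^-1` A)) (@measure_local _ _ Dl _ invariant_treelike k); last first.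
  by move=> g g' h; rewrite /preimage /mkset h.
congr (_%:E); apply: eq_bigr => x _; congr (_ * _); congr (nat_of_bool _)%:R.
by apply/idP/idP => /set_mem hx; apply/mem_set; move: hx; rewrite /preimage /mkset restr_lg_id.
Qed.
End invariant_laws.

Section limits.
Context {R : realType} {F : set_system nat} {PF : ProperFilter F}.

Lemma limf_einf_ge (f : nat -> \bar R) (c : \bar R) : (\forall n \near F, c <= f n)%E -> (c <= limf_einf f F)%E.
Proof.
move=> h; rewrite limf_einfE; apply: ereal_sup_ge; exists (ereal_inf (f @` [set n | (c <= f n)%E])).
  by exists [set n | (c <= f n)%E].
by apply: le_ereal_inf_tmp => _ [n hn <-].
Qed.

Lemma limf_esup_le (f : nat -> \bar R) (c : \bar R) : (\forall n \near F, f n <= c)%E -> (limf_esup f F <= c)%E.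
Proof.
move=> h; rewrite limf_esupE; apply: ereal_inf_le; exists (ereal_sup (f @` [set n | (f n <= c)%E])).
  by exists [set n | (f n <= c)%E].
by apply: ub_ereal_sup => _ [n hn <-].
Qed.

Lemma limf_einf_le_esup (f : nat -> \bar R) : (limf_einf f F <= limf_esup f F)%E.
Proof.
rewrite limf_einfE limf_esupE; apply: ub_ereal_sup => _ [U FU <-]; apply: le_ereal_inf_tmp => _ [V FV <-].
have [n [nU nV]] := filter_ex (filterI FU FV).
by apply: (@le_trans _ _ (f n)); [apply: ereal_inf_lbound; exists n|apply: ereal_sup_ubound; exists n].
Qed.

(** [f] and [g] stand for the inferior and superior limits in n as functions of the tolerance: the
    lower bound holds at every tolerance, the upper one at small tolerances. *)
Lemma cvg_ereal_squeeze (f g : R -> \bar R) (S : R) : (forall e : R, 0 < e -> (S%:E <= f e)%E /\ (f e <= g e)%E) ->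
  (forall d, 0 < d -> exists2 e0, 0 < e0 & forall e, 0 < e -> e <= e0 -> (g e <= (S + d)%:E)%E) ->
  lim (f e @[e --> 0^'+]) = S%:E /\ lim (g e @[e --> 0^'+]) = S%:E.
Proof.
move=> hf hg.
have key (h : R -> \bar R) : (forall e : R, 0 < e -> (S%:E <= h e)%E /\ (h e <= g e)%E) -> lim (h e @[e --> 0^'+]) = S%:E.
  move=> hh; apply/cvg_lim => //; apply/fine_cvgP; split.
    have [e0 e00 he0] := hg _ ltr01; near=> e.
    have e1 : 0 < e by near: e; exact: nbhs_right_gt.
    have [h1 h2] := hh e e1; rewrite fin_numE; apply/andP; split.
      by rewrite gt_eqF//; apply: lt_le_trans h1; rewrite ltNyr.
    rewrite lt_eqF//; apply: le_lt_trans h2 _; apply: le_lt_trans (he0 e e1 _) _; last by rewrite ltry.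
    by near: e; exact: nbhs_right_le.
  apply/cvgrPdist_le => d d0; have [e0 e00 he0] := hg _ d0; near=> e.
  have e1 : 0 < e by near: e; exact: nbhs_right_gt.
  have e2 : e <= e0 by near: e; exact: nbhs_right_le.
  have [h1 h2] := hh e e1; have := le_trans h2 (he0 e e1 e2); move: h1 => /=.
  case: (h e) => [x| |]//=; rewrite !lee_fin => h1 h3.
  by rewrite ler0_norm ?subr_le0// opprB lerBlDl.
split; apply: key => //; move=> e e0; have [h1 h2] := hf e e0; split=> //; exact: le_trans h1 h2.
Unshelve. all: end_near. Qed.

Lemma lim_eventually (u : nat -> \bar R) (t0 : nat) (c : \bar R) : (forall t, (t0 <= t)%N -> u t = c) ->
  lim (u t @[t --> \oo]) = c.
Proof.
move=> h; apply/cvg_lim => //; apply: cvg_trans (@cvg_cst _ c _ \oo _).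
apply: near_eq_cvg; near=> t; rewrite h//; near: t; exact: nbhs_infty_ge.
Unshelve. all: end_near. Qed.
End limits.

(** * Transfer to the uniform random graph *)

Section random_graphs.
Context {R : realType} (pi : probability nat R) (idx : set nat) (deg : forall n, 'I_n -> nat) (Dl : nat).
Hypotheses (dgp : degree_sequence idx deg pi) (degD : forall n v, (@deg0 idx deg n v <= Dl)%N)
  (mean_pi : (0 < mean pi < +oo)%E).
Local Notation F := (within idx \oo).
Local Notation Dn := (fun n => {v : 'I_n & 'I_(@deg0 idx deg n v)} : finType).
Local Notation Vn := (fun n => 'I_n : finType).
Local Notation vx := (fun n => @tag 'I_n (fun v => 'I_(@deg0 idx deg n v))).

Let PF : ProperFilter F := within_infinite dgp.

Lemma size_half_edges n v : size (dl (vx n) v) = @deg0 idx deg n v.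
Proof.
rewrite /dl size_filter -sum1_count big_enum_cond /=.
rewrite -[LHS]/(\sum_(x : {v : 'I_n & 'I_(@deg0 idx deg n v)} | tag x == v) 1)%N.
transitivity (\sum_(i : 'I_n | i == v) \sum_(j < @deg0 idx deg n i) 1)%N.
  by rewrite sig_big_dep /=; apply: eq_bigl => x; rewrite andbT.
by rewrite big_pred1_eq sum1_card card_ord.
Qed.

Lemma half_edges_le n v : (size (dl (vx n) v) <= Dl)%N.
Proof. by rewrite size_half_edges. Qed.

Lemma half_edges_even n : ~~ odd #|{: Dn n}|.
Proof.
rewrite -(sum_size_dl (vx n)); under eq_bigr do rewrite size_half_edges; exact: (even_deg0 dgp).
Qed.

Lemma vertices_many k : \forall n \near F, (k <= #|{: Vn n}|)%N.
Proof. by near=> n; rewrite card_ord; near: n; apply: cvg_within; exact: nbhs_infty_ge.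
Unshelve. all: end_near. Qed.

Lemma pi_Dl l : (Dl < l)%N -> pmass pi l = 0.
Proof. exact: (pmass_big dgp degD). Qed.

Lemma half_edges_cvg (l : 'I_Dl.+1) : emp (dg (@half_edges_le n)) l @[n --> F] --> pmass pi l.
Proof.
rewrite (_ : (fun n => _) = fun n => n%:R^-1 * #|[set v : 'I_n | @deg0 idx deg n v == l]%SET|%:R); last first.
  apply/funext => n; rewrite /emp card_ord mulrC; congr (_ * _%:R); apply: eq_card => v.
  by rewrite !inS -val_eqE /= size_half_edges.
exact: pmass_cvg dgp _.
Qed.

Lemma half_edges_mean : 0 < \sum_(l < Dl.+1) pmass pi l * l%:R.
Proof. by rewrite -(mean_fine pi_Dl); exact: (mean_gt0 mean_pi pi_Dl). Qed.

Lemma near_prob (A : forall n, {set {set 'I_n}} -> bool) : \forall n \near F, (0 < nsimple (vx n))%N /\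
   @prob R deg n (@A n) = #|[set s | simple (vx n) s & @A n (Gr (vx n) s)]%SET|%:R / (nsimple (vx n))%:R.
Proof.
near=> n; have nI : idx n by near: n; exact: withinT.
have s0 : (0 < nsimple (vx n))%N.
  by near: n; exact: (near_nsimple half_edges_even vertices_many half_edges_cvg half_edges_mean).
split=> //; rewrite -(card_graphs (deg := @deg n))// => v; rewrite size_half_edges; congr (_ v).
by rewrite /deg0 asboolT.
Unshelve. all: end_near. Qed.

(** [card_graphs] turns the probability into a proportion of simple pairings, to which [rare_simple]
    applies. *)
Lemma prob_rare (A : forall n, {set {set 'I_n}} -> bool) (Bad : forall n, {perm (Dn n)} -> bool) :
  @rare R Vn _ F Bad -> (\forall n \near F, forall s, simple (vx n) s -> @A n (Gr (vx n) s) -> @Bad n s) ->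
  @prob R deg n (@A n) @[n --> F] --> (0 : R).
Proof.
move=> hB hA; have hs := rare_simple half_edges_even vertices_many half_edges_cvg half_edges_mean hB.
apply: (squeeze_cvgr _ (@cvg_cst _ (0 : R) _ F _) (hs _)); near=> n.
have [s0 ->] : (0 < nsimple (vx n))%N /\ @prob R deg n (@A n) =
    #|[set s | simple (vx n) s & @A n (Gr (vx n) s)]%SET|%:R / (nsimple (vx n))%:R by near: n; exact: near_prob.
rewrite divr_ge0//= ler_wpM2r ?invr_ge0// ler_nat; apply: card_incl => s /setIdP[s1 s2].
apply/setIdP; split=> //; move: s s1 s2; near: n; exact: hA.
Unshelve. all: end_near. Qed.

Lemma prob_likely (A : forall n, {set {set 'I_n}} -> bool) (Bad : forall n, {perm (Dn n)} -> bool) :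
  @rare R Vn _ F Bad -> (\forall n \near F, forall s, simple (vx n) s -> ~~ @A n (Gr (vx n) s) -> @Bad n s) ->
  @prob R deg n (@A n) @[n --> F] --> (1 : R).
Proof.
move=> hB hA; have h := @prob_rare (fun n E => ~~ @A n E) Bad hB hA.
have h1 : (1 - @prob R deg n (fun E => ~~ @A n E)) @[n --> F] --> (1 : R).
  by rewrite -[X in _ --> X]subr0; apply: cvgB => //; exact: cvg_cst.
apply: cvg_trans h1; apply: near_eq_cvg; near=> n.
have [s0 hT] : (0 < nsimple (vx n))%N /\
   @prob R deg n predT = #|[set s | simple (vx n) s & true]%SET|%:R / (nsimple (vx n))%:R.
  by near: n; exact: (near_prob (fun n => predT)).
have e : @prob R deg n predT = 1.
  rewrite hT (_ : [set s | simple (vx n) s & true]%SET = [set s | simple (vx n) s]%SET); last first.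
    by apply/setP => s; rewrite !inS andbT.
  by rewrite divff// pnatr_eq0 -lt0n.
rewrite -e /prob -mulrBl; congr (_ / _); apply/eqP; rewrite subr_eq -natrD; apply/eqP; congr _%:R.
rewrite -(cardsID [set E | @A n E]%SET); congr (_ + _)%N; apply: eq_card => E.
  by rewrite !inS andbT.
by rewrite !inS andbT andbC.
Unshelve. all: end_near. Qed.
End random_graphs.

Section typicality.
Context {R : realType} {M : pFinType} (dist : probability (lgraph R M) R -> probability (lgraph R M) R -> R)
  (pi : probability nat R) (idx : set nat) (deg : forall n, 'I_n -> nat) (k Dl : nat)
  (p mu : probability (lgraph R M) R).
Hypotheses (dist_metric : distance_on_laws dist) (dist_weak : generates_weak_topology dist)
  (mean_pi : (0 < mean pi < +oo)%E) (dgp : degree_sequence idx deg pi)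
  (p_local : local_process pi k.+1 p) (mu_invariant : invariant_process pi mu)
  (mu_markov : r_markov k.+1 mu) (mu_p : measure_eq (distribution mu (restr k.+1)) p)
  (entropy_couplings : forall q : probability (lgraph R (M * M)%type) R,
     self_coupling pi k.+1 p q -> (Sigma pi k.+1 q <= 2%:E * Sigma pi k.+1 p)%E)
  (degD : forall n v, (@deg0 idx deg n v <= Dl)%N).
Local Notation F := (within idx \oo).
Local Notation Dn := (fun n => {v : 'I_n & 'I_(@deg0 idx deg n v)} : finType).
Local Notation Vn := (fun n => 'I_n : finType).
Local Notation vx := (fun n => @tag 'I_n (fun v => 'I_(@deg0 idx deg n v))).
Local Notation B := (B M Dl).
Local Notation ML d := (law mu : B (d + k).+1 -> R).
Local Notation typ_ d et s := (typical vx (ML d) et s).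
Local Notation S := (Sig (law mu : B k.+1 -> R)).

Let PF : ProperFilter F := within_infinite dgp.
Let piD : forall l, (Dl < l)%N -> pmass pi l = 0 := pi_Dl dgp degD.
Let meanD := mean_fine piD.
Let mean0 := mean_gt0 mean_pi piD.
Let tl : treelike Dl mu := invariant_treelike piD mu_invariant.
Let pE := local_law piD mu_invariant mu_p.
Let prT (x : B k.+1) : law mu x != 0 -> ktree Dl (lg x : lgraph R M) := law_ktree tl (x := x).
Let pd t := @invariant_degree _ _ _ _ piD _ mu_invariant t.
Let lawI t : inv (law mu : B t -> R) := @invariant_inv _ _ _ _ piD _ mu_invariant t.

Lemma Sigma_local_law : Sigma pi k.+1 p = S%:E.
Proof. exact: (Sigma_carried piD meanD mean0 pE prT (@lawI k.+1) (@pd k)). Qed.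

Lemma Sig_trs d : Sig (push (@trs M Dl k d) (ML d)) = S.
Proof. by congr Sig; apply/funext; exact: (law_trs piD mu_invariant). Qed.

Lemma typical_upper d (delta : R) : 0 < delta -> exists2 et : R, 0 < et &
  @rare R Vn _ F (fun n (s : {perm (Dn n)}) => expR (n%:R * (S + delta)) <= #|typ_ d et s|%:R).
Proof.
move=> d0; have [et et0 h] := upper_rare (half_edges_even dgp) (@vertices_many idx)
  (half_edges_cvg dgp degD) (half_edges_mean dgp degD mean_pi) (point : M) (ML d) d0.
exists et => //; apply: rare_sub h; near=> n; move=> s _.
by rewrite Sig_trs card_ord.
Unshelve. all: end_near. Qed.

Lemma typical_lower d (delta et : R) : 0 < delta -> 0 < et ->
  @rare R Vn _ F (fun n (s : {perm (Dn n)}) => #|typ_ d et s|%:R < expR (n%:R * (S - delta))).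
Proof.
move=> d0 et0; have h := lower_rare (half_edges_even dgp) (@vertices_many idx)
  (half_edges_cvg dgp degD) (half_edges_mean dgp degD mean_pi) (point : M)
  (fun a => law_ge0 mu a) (@lawI (d + k).+1) (@pd (d + k))
  (@invariant_symm _ _ _ _ piD _ mu_invariant (d + k)) _ _ d0 et0.
apply: rare_sub (h _ _ _); first by near=> n; move=> s _; rewrite Sig_trs card_ord.
  rewrite Sig_trs; apply: Sig_markov => //; [by case: mu_invariant|by case: mu_invariant|].
  by move=> t; rewrite (invariant_mdeg piD mu_invariant) mean0.
move=> q q0 iq eq dq q1 q2; rewrite Sig_trs.
have e : push (@trs M Dl k d) (ML d) = law mu by apply/funext; exact: (law_trs piD mu_invariant).
rewrite !e in q1 q2.
exact: (coupling_Sig p_local pE prT piD (@pd k) meanD mean0 entropy_couplings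
  (@lawI k.+1) q0 iq eq dq q1 q2).
Unshelve. all: end_near. Qed.

(** The margin eta - et absorbs the proportion of vertices near a cycle in [distr_typ]. *)
Lemma typical_law d (et eta : R) : et < eta -> exists2 beta : R, 0 < beta &
  \forall n \near F, forall (s : {perm (Dn n)}) (f : {ffun 'I_n -> M}), simple (vx n) s ->
    #|[set v | ntree (vx n) s (d + k).+1 v]%SET|%:R < beta * n%:R ->
    f \in typ_ d et s -> forall y : B (d + k).+1, `|law (distr R (Gr (vx n) s) f) y - law mu y| <= eta.
Proof.
move=> h; exists (eta - et); first by rewrite subr_gt0.
near=> n; move=> s f ss ns; rewrite inS => /forallP hf y.
have n0 : (0 < n)%N by near: n; exact: near_pos.
have h1 : `|law (distr R (Gr (vx n) s) f) y - Sym (emp (typ (vx n) Dl f s (d + k))) y| <=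
    #|[set v | ntree (vx n) s (d + k).+1 v]%SET|%:R / n%:R := distr_typ (half_edges_le degD (n := n)) f ss y n0.
have h2 : #|[set v | ntree (vx n) s (d + k).+1 v]%SET|%:R / n%:R <= eta - et :> R.
  by rewrite ler_pdivrMr ?ltr0n//; exact: ltW.
rewrite -(subrKA (Sym (emp (typ (vx n) Dl f s (d + k))) y)) -[leRHS](subrK et).
apply: le_trans (ler_normD _ _) _; apply: lerD; [exact: le_trans h1 h2|exact: hf].
Unshelve. all: end_near. Qed.

Lemma law_typical d (eta et : R) : eta < et -> exists2 beta : R, 0 < beta &
  \forall n \near F, forall (s : {perm (Dn n)}) (f : {ffun 'I_n -> M}), simple (vx n) s ->
    #|[set v | ntree (vx n) s (d + k).+1 v]%SET|%:R < beta * n%:R ->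
    (forall y : B (d + k).+1, `|law (distr R (Gr (vx n) s) f) y - law mu y| <= eta) -> f \in typ_ d et s.
Proof.
move=> h; exists (et - eta); first by rewrite subr_gt0.
near=> n; move=> s f ss ns hf; rewrite inS; apply/forallP => y.
have n0 : (0 < n)%N by near: n; exact: near_pos.
have := distr_typ (half_edges_le degD (n := n)) f ss y n0 : `|law (distr R (Gr (vx n) s) f) y - Sym (emp (typ (vx n) Dl f s (d + k))) y| <=
    #|[set v | ntree (vx n) s (d + k).+1 v]%SET|%:R / n%:R.
rewrite distrC => h1.
have h2 : #|[set v | ntree (vx n) s (d + k).+1 v]%SET|%:R / n%:R <= et - eta :> R.
  by rewrite ler_pdivrMr ?ltr0n//; exact: ltW.
rewrite -(subrKA (law (distr R (Gr (vx n) s) f) y)) -[leRHS](subrK eta).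
apply: le_trans (ler_normD _ _) _; apply: lerD; [exact: le_trans h1 h2|exact: hf].
Unshelve. all: end_near. Qed.

Lemma near_rare_ntree d (beta : R) : 0 < beta ->
  @rare R Vn _ F (fun n (s : {perm (Dn n)}) => beta * n%:R <= #|[set v | ntree (vx n) s (d + k).+1 v]%SET|%:R).
Proof.
move=> b0; have h := rare_ntree (half_edges_even dgp) (@vertices_many idx)
  (half_edges_cvg dgp degD) (half_edges_mean dgp degD mean_pi) (d + k).+1 b0.
by apply: rare_sub (h _); near=> n; move=> s _; rewrite card_ord.
Unshelve. all: end_near. Qed.

(** Two rare events are excluded, a lack of typical colorings and an excess of vertices near cycles;
    off them every typical coloring has the property [P]. *)
Lemma many_colorings d (P : forall n, {set {set 'I_n}} -> {ffun 'I_n -> M} -> bool) (eta delta : R) :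
  0 < eta -> 0 < delta ->
  (forall n E (f : {ffun 'I_n -> M}), (forall y : B (d + k).+1, `|law (distr R E f) y - law mu y| <= eta) -> @P n E f) ->
  @prob R deg n (fun E => expR (n%:R * (S - delta)) <= #|[set f | @P n E f]%SET|%:R) @[n --> F] --> (1 : R).
Proof.
move=> e0 d0 hP; have h : eta / 2 < eta by rewrite ltr_pdivrMr// mulr_natr mulr2n ltrDl.
have e2 : 0 < eta / 2 by rewrite divr_gt0.
have [beta b0 hb] := typical_law d h.
have hB := @rareU R Vn Dn F _ (@vertices_many idx) _ _ (typical_lower d d0 e2) (near_rare_ntree d b0).
apply: (prob_likely dgp degD mean_pi (A := fun n E => expR (n%:R * (S - delta)) <= #|[set f | @P n E f]%SET|%:R) (hB _)).
near=> n; move=> s ss; rewrite -ltNge => hs; rewrite orbC -implyNb -ltNge; apply/implyP => ns.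
apply: le_lt_trans hs; rewrite ler_nat; apply: card_incl => f hf.
rewrite inS; apply: hP => y; move: s f ss ns hf y; near: n; exact: hb.
Unshelve. all: end_near. Qed.

Lemma few_colorings d (delta : R) : 0 < delta -> exists2 eta : R, 0 < eta &
  forall P : (forall n, {set {set 'I_n}} -> {ffun 'I_n -> M} -> bool),
  (forall n E (f : {ffun 'I_n -> M}), @P n E f -> forall y : B (d + k).+1, `|law (distr R E f) y - law mu y| <= eta) ->
  @prob R deg n (fun E => expR (n%:R * (S + delta)) <= #|[set f | @P n E f]%SET|%:R) @[n --> F] --> (0 : R).
Proof.
move=> d0; have [et et0 hr] := typical_upper d d0.
have h : et / 2 < et by rewrite ltr_pdivrMr// mulr_natr mulr2n ltrDl.
have [beta b0 hb] := law_typical d h.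
exists (et / 2) => [|P hP]; first by rewrite divr_gt0.
have hB := @rareU R Vn Dn F _ (@vertices_many idx) _ _ hr (near_rare_ntree d b0).
apply: (prob_rare dgp degD mean_pi (A := fun n E => expR (n%:R * (S + delta)) <= #|[set f | @P n E f]%SET|%:R) (hB _)).
near=> n; move=> s ss hs; rewrite orbC -implyNb -ltNge; apply/implyP => ns.
apply: le_trans hs _; rewrite ler_nat; apply: card_incl => f; rewrite inS => /hP.
by move: s f ss ns; near: n; exact: hb.
Unshelve. all: end_near. Qed.
End typicality.

(** * Sofic entropies and strong typicality *)

Section conclusion.
Context {R : realType} {M : pFinType} (dist : probability (lgraph R M) R -> probability (lgraph R M) R -> R)
  (idx : set nat) (deg : forall n, 'I_n -> nat) (mu : probability (lgraph R M) R) (S : R) (Dl k : nat).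
Hypotheses (dist_metric : distance_on_laws dist) (dist_weak : generates_weak_topology dist)
  (PF : ProperFilter (within idx \oo)) (tl : treelike Dl mu).
Local Notation F := (within idx \oo).
Hypothesis many : forall d (P : forall n, {set {set 'I_n}} -> {ffun 'I_n -> M} -> bool) (eta delta : R),
  0 < eta -> 0 < delta ->
  (forall n E (f : {ffun 'I_n -> M}),
    (forall y : B M Dl (d + k).+1, `|law (distr R E f) y - law mu y| <= eta) -> @P n E f) ->
  @prob R deg n (fun E => expR (n%:R * (S - delta)) <= #|[set f | @P n E f]%SET|%:R) @[n --> F] --> (1 : R).
Hypothesis few : forall d (delta : R), 0 < delta -> exists2 eta : R, 0 < eta &
  forall P : (forall n, {set {set 'I_n}} -> {ffun 'I_n -> M} -> bool),
  (forall n E (f : {ffun 'I_n -> M}), @P n E f ->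
    forall y : B M Dl (d + k).+1, `|law (distr R E f) y - law mu y| <= eta) ->
  @prob R deg n (fun E => expR (n%:R * (S + delta)) <= #|[set f | @P n E f]%SET|%:R) @[n --> F] --> (0 : R).

Lemma prob_mono n (A A' : {set {set 'I_n}} -> bool) : (forall E, A E -> A' E) ->
  @prob R deg n A <= @prob R deg n A'.
Proof.
move=> h; rewrite ler_wpM2r ?invr_ge0// ler_nat; apply: card_incl => E /setIdP[E1 /h E2].
exact/setIdP.
Qed.

Lemma prob_le1 n (A : {set {set 'I_n}} -> bool) : @prob R deg n A <= 1.
Proof.
rewrite /prob; have [->|g0] := eqVneq #|graphs_of_degrees (@deg n)| 0%N; first by rewrite invr0 mulr0.
rewrite ler_pdivrMr ?ltr0n ?lt0n// mul1r ler_nat; apply: card_incl => E.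
by case/setIdP.
Qed.

Lemma h_n_ge d (eps delta alpha : R) : 0 < eps -> 0 < delta -> alpha < 1 ->
  \forall n \near F, ((S - delta)%:E <= h_n dist deg mu (d + k).+1 eps alpha n)%E.
Proof.
move=> e0 d0 a1; have [eta eta0 he] := restr_close tl dist_metric dist_weak (d + k) e0.
have hP n E (f : {ffun 'I_n -> M}) : (forall y : B M Dl (d + k).+1, `|law (distr R E f) y - law mu y| <= eta) ->
    dist (distribution (distr R E f) (restr (d + k).+1)) (distribution mu (restr (d + k).+1)) <= eps.
  by move=> hf; apply: he => y; have := hf y; rewrite ler_norml lerBrDl => /andP[].
have a1' : 0 < 1 - alpha by rewrite subr_gt0.
have /cvgrPdist_lt/(_ _ a1') h := many eta0 d0 hP.
have {}h : \forall n \near F, alpha < @prob R deg n (fun E =>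
    expR (n%:R * (S - delta)) <= #|typical_colorings dist E mu (d + k).+1 eps|%:R).
  apply: filterS h => n; rewrite ger0_norm ?subr_ge0 ?prob_le1//.
  by rewrite ltrD2l ltrN2.
near=> n; have n0 : (0 < n)%N by near: n; exact: near_pos.
have n0R : 0 < n%:R :> R by rewrite ltr0n.
(* [h_n] is a supremum over -oo and the nonnegative values. The maximum with 0 is admissible, since
   a nonempty set of colorings has nonnegative entropy. *)
apply: (@le_trans _ _ (Num.max 0 (S - delta))%:E); first by rewrite lee_fin le_max lexx orbT.
apply: ereal_sup_ubound; split; first by right; rewrite lee_fin le_max lexx /= ltry.
apply: le_trans (_ : @prob R deg n (fun E =>
    expR (n%:R * (S - delta)) <= #|typical_colorings dist E mu (d + k).+1 eps|%:R) <= _).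
  by apply: ltW; near: n.
apply: prob_mono => E hE; rewrite /entropy_of.
have c0 : (0 < #|typical_colorings dist E mu (d + k).+1 eps|)%N.
  by rewrite -(ltr0n R); apply: lt_le_trans hE; exact: expR_gt0.
have c0R : 0 < #|typical_colorings dist E mu (d + k).+1 eps|%:R :> R by rewrite ltr0n.
rewrite ifN; last by rewrite -cards_eq0 -lt0n.
rewrite lee_fin ge_max; apply/andP; split; first by rewrite mulr_ge0 ?invr_ge0// ln_ge0// ler1n.
by rewrite mulrC ler_pdivlMr// mulrC -ler_expR lnK.
Unshelve. all: end_near. Qed.

Lemma h_n_le d (delta alpha : R) : 0 < delta -> 0 < alpha -> exists2 e0 : R, 0 < e0 &
  forall eps, 0 < eps -> eps <= e0 ->
  \forall n \near F, (h_n dist deg mu (d + k).+1 eps alpha n <= (S + delta)%:E)%E.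
Proof.
move=> d0 a0; have [eta eta0 he] := few d d0.
have [e0 e00 hc] := @close_atoms _ _ Dl mu dist dist_metric dist_weak (d + k).+1 _ eta0.
exists e0 => // eps eps0 epse.
have /cvgrPdist_lt/(_ alpha a0) h := he (fun n E f =>
  dist (distribution (distr R E f) (restr (d + k).+1)) (distribution mu (restr (d + k).+1)) <= eps)
  (fun n E f hf => hc _ (le_trans hf epse)).
near=> n; have n0 : (0 < n)%N by near: n; exact: near_pos.
have n0R : 0 < n%:R :> R by rewrite ltr0n.
(* A value above S + delta that is reached with probability at least alpha would contradict the
   bound alpha on the probability of too many close colorings. *)
apply: ub_ereal_sup => x [_ hx]; rewrite leNgt; apply/negP => xS.
have : `|0 - @prob R deg n (fun E => expR (n%:R * (S + delta)) <= #|typical_colorings dist E mu (d + k).+1 eps|%:R)| < alpha.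
  by near: n.
rewrite sub0r normrN; apply/negP; rewrite -leNgt; apply: le_trans (ler_norm _); apply: le_trans hx _.
apply: prob_mono => E; rewrite /entropy_of; case: ifPn => [_|ne].
  by rewrite leeNy_eq => /eqP xN; move: xS; rewrite xN.
move=> /(lt_le_trans xS); rewrite lte_fin => /ltW; rewrite mulrC ler_pdivlMr// mulrC => hS.
by rewrite -[leRHS]lnK ?ler_expR// posrE ltr0n lt0n cards_eq0.
Unshelve. all: end_near. Qed.

Lemma h_at d (alpha : R) : 0 < alpha < 1 ->
  h_lower_at dist idx deg mu (d + k).+1 alpha = S%:E /\ h_upper_at dist idx deg mu (d + k).+1 alpha = S%:E.
Proof.
move=> /andP[a0 a1]; apply: cvg_ereal_squeeze => [e e0|delta d0].
  split; last exact: limf_einf_le_esup.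
  by apply/lee_subgt0Pr => delta d0; rewrite -EFinB; apply: limf_einf_ge; exact: h_n_ge.
have [e0 e00 h] := h_n_le d d0 a0; exists e0 => // e e1 e2; apply: limf_esup_le; exact: h.
Qed.

(** The entropies equal [S] already at every depth beyond [k], so the sequence in [t] is eventually
    constant. *)
Lemma h_lower_upper (alpha : R) : 0 < alpha < 1 ->
  h_lower dist idx deg mu alpha = S%:E /\ h_upper dist idx deg mu alpha = S%:E.
Proof.
move=> a01; split; apply: (@lim_eventually _ _ k.+1) => t kt.
  by rewrite -(subnK kt) addnS; exact: (h_at _ a01).1.
by rewrite -(subnK kt) addnS; exact: (h_at _ a01).2.
Qed.

Lemma strongly_typical_law : strongly_typical dist idx deg mu.
Proof.
(* At each tolerance the limit in n is already 1: with probability tending to 1, the number of close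
   colorings is at least an exponential, hence positive. *)
exists (cst 1); last exact: cvg_cst.
move=> eps e0; have [T /(_ (T + k).+1)[|eta eta0 he]] := weak_close tl dist_weak e0.
  by apply: leq_trans (leq_addr k T) _.
have hm := many (P := fun n E f => dist (distr R E f) mu <= eps) eta0 ltr01.
have {}hm := hm T _.
apply: (squeeze_cvgr _ (hm _) (@cvg_cst _ (1 : R) _ F _)).
  near=> n; rewrite prob_le1 andbT; apply: prob_mono => E hE.
  have : (0 < #|[set f : {ffun 'I_n -> M} | (dist (distr R E f) mu <= eps)%R]%SET|)%N.
    by rewrite -(ltr0n R); apply: lt_le_trans hE; exact: expR_gt0.
  by case/card_gt0P => f; rewrite inS => hf; apply/existsP; exists f.
move=> n E f hf; case: dist_metric => _ ds _; rewrite ds; apply/ltW/he => y.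
by have := hf y; rewrite ler_norml lerBrDl => /andP[].
Unshelve. all: end_near. Qed.
End conclusion.

Theorem theorem4p8 (R : realType) (M : pFinType)
    (dist : probability (lgraph R M) R -> probability (lgraph R M) R -> R)
    (pi : probability nat R) (idx : set nat) (deg : forall n, 'I_n -> nat)
    (r : nat) (p mu : probability (lgraph R M) R)
    (dist_metric : distance_on_laws dist)
    (dist_weak : generates_weak_topology dist)
    (mean_pi : (0 < mean pi < +oo)%E)
    (deg_pi : degree_sequence idx deg pi)
    (r_ge1 : (1 <= r)%N)
    (p_local : local_process pi r p)
    (mu_invariant : invariant_process pi mu)
    (mu_markov : r_markov r mu)
    (mu_p : measure_eq (distribution mu (restr r)) p)
    (entropy_couplings : forall q : probability (lgraph R (M * M)%type) R,
       self_coupling pi r p q -> (Sigma pi r q <= 2%:E * Sigma pi r p)%E) :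
  (forall alpha : R, 0 < alpha < 1 ->
     h_lower dist idx deg mu alpha = Sigma pi r p /\
     h_upper dist idx deg mu alpha = Sigma pi r p) /\
  strongly_typical dist idx deg mu.
Proof.
(* With r = k + 1, the balls of radius r are elements of [B M Dl k.+1] and the edge balls are pairs
   of branches of depth [k]. *)
case: r r_ge1 p_local mu_markov mu_p entropy_couplings => // k _ pl mm mp ec.
have [Dl degD] := degree_bound deg_pi.
have tl := invariant_treelike (pi_Dl deg_pi degD) mu_invariant.
have PF := within_infinite deg_pi.
have many := @many_colorings _ _ pi idx deg k Dl p mu mean_pi deg_pi pl mu_invariant mm mp ec degD.
have few := @few_colorings _ _ pi idx deg k Dl mu mean_pi deg_pi mu_invariant degD.
rewrite (Sigma_local_law mean_pi deg_pi mu_invariant mp degD).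
split; first by move=> alpha; exact: (h_lower_upper dist_metric dist_weak PF tl many few).
have st := strongly_typical_law dist_metric dist_weak tl many.
exact: st.
Qed.
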